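(* Let $(M^{2n},\omega)$ be a closed symplectic manifold with a regular $\omega$-compatible almost complex structure $J$, and let $g_J(\cdot,\cdot)=\omega(\cdot,J\cdot)$. Let $V\subset M$ be an open subset with smooth boundary, let $N\subset M\setminus V$ be a tubular neighborhood of $\partial V$ in $M\setminus V$, and let $\hat V:=\overline V\cup N$. Let $h:N\to\mathbb{R}$ be a smooth function without critical points such that $h|_{\partial V}=0$ and $h|_{\partial\hat V}=1$. Then there exist $\varepsilon_0>0$ and a constant $C(N,g_J,h)>0$ such that for any $\varepsilon\in(0,\varepsilon_0)$ and for any homotopy of Hamiltonians $H:M\times S^1\times\mathbb{R}\to\mathbb{R}$ satisfying $H|_N(x,t,s)=\varepsilon\, h(x)+\beta(s,t)$ for some $\beta:\mathbb{R}\times S^1\to\mathbb{R}$, the following holds. Any Floer trajectory $u$ with respect to $(H,J)$ that intersects both $V$ and $M\setminus\hat V$ satisfies one of the following: (i) $x_-\subset M\setminus\hat V$ and $x_+\subset V$, where $x_\pm:=\lim_{s\to\pm\infty}u(s,\cdot)$; or (ii) $E(u)\ge C(N,g_J,h)$.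
   Context: Tubular neighborhood: $N\subset M\setminus V$ is the image of a diffeomorphism $[0,1]\times\partial V\to N$ sending $\{0\}\times\partial V$ to $\partial V$; thus $\{1\}\times\partial V$ is sent to $\partial\hat V$. Almost complex structures: an $\omega$-compatible almost complex structure $J$ is regular ($J\in\mathcal{J}_{\rm reg}$) if the linearized Cauchy–Riemann operator is surjective at every simple $J$-holomorphic sphere $S^2\to M$; this is a residual set. All almost complex structures are assumed regular. Homotopies: a homotopy of Hamiltonians is a smooth map $H:M\times S^1\times\mathbb{R}\to\mathbb{R}$, $(x,t,s)\mapsto H(x,t,s)$, which is constant in $s$ outside a compact set, i.e. $\partial_sH=0$ for $|s|>R$, for some fixed $R>0$. Its ends are $H_\pm=\lim_{s\to\pm\infty}H(\cdot,\cdot,s)$. The Hamiltonian vector field is defined by $\omega(X_H,\cdot)=-dH$ (with $d$ in the $M$-directions). Floer trajectories: a Floer trajectory with respect to $(H,J)$ is a solution $u:\mathbb{R}\times S^1\to M$ of $\partial_su+J(u)\big(\partial_tu-X_{H_s}(u)\big)=0$, $H_s=H(\cdot,\cdot,s)$, of finite energy $E(u)=\int_{\mathbb{R}\times S^1}\|\partial_su\|_{g_J}^2\,ds\,dt$, converging as $s\to\pm\infty$ to 1-periodic orbits $x_\pm$ of $H_\pm$. The constant $C(N,g_J,h)$ depends only on $N$, $g_J$ and $h$, and not on $\varepsilon$ or $H$. *)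

(* Defs.v *)
From HB Require Import structures.
From mathcomp Require Import all_boot all_order all_algebra.
From mathcomp Require Import all_classical all_reals all_analysis.
From mathcomp Require Import complex.

Set Implicit Arguments.
Unset Strict Implicit.
Unset Printing Implicit Defensive.
Import Order.TTheory GRing.Theory Num.Theory.
Import numFieldNormedType.Exports.

Local Open Scope classical_set_scope.
Local Open Scope ring_scope.

(* Tangent vectors are row vectors in the coordinates
   of a chart, and matrices act on them from the right. *)

Section Smooth.
Context {R : realType} {V W : normedModType R}.

(* Only meaningful when U is open. *)
Fixpoint Ck (k : nat) (U : set V) (f : V -> W) : Prop :=
  (forall x, U x -> {for x, continuous f}) /\
  if k is k'.+1 then
    (forall x, U x -> differentiable f x) /\
    (forall v, Ck k' U (fun x => 'D_v f x))
  else True.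

Definition smooth (U : set V) (f : V -> W) : Prop := forall k, Ck k U f.

End Smooth.

(* psi i is the inverse of the chart phi i; it is junk outside phi i @` dom i,
   and phi i is junk outside dom i. *)
Record smooth_atlas (R : realType) (m : nat) (M : topologicalType) := SmoothAtlas {
  chart : Type ;
  dom : chart -> set M ;
  phi : chart -> M -> 'rV[R]_m ;
  psi : chart -> 'rV[R]_m -> M ;
  dom_cover : forall p, exists i, dom i p ;
  dom_open : forall i, open (dom i) ;
  rng_open : forall i, open (phi i @` dom i) ;
  phiK : forall i p, dom i p -> psi i (phi i p) = p ;
  phi_continuous : forall i p, dom i p -> {for p, continuous (phi i)} ;
  psi_continuous : forall i y, (phi i @` dom i) y -> {for y, continuous (psi i)} ;
  transition_smooth : forall i j,
    smooth (phi i @` (dom i `&` dom j)) (phi j \o psi i)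
}.

Section Manifold.
Context {R : realType} {m : nat} {M : topologicalType} (A : smooth_atlas R m M).

Notation chart := (chart A).
Notation dom := (@dom R m M A).
Notation phi := (@phi R m M A).
Notation psi := (@psi R m M A).

Definition rng (i : chart) : set 'rV[R]_m := phi i @` dom i.

(* Differential at p of the coordinate change from chart i to chart j. *)
Definition dtrans (i j : chart) (p : M) (v : 'rV[R]_m) : 'rV[R]_m :=
  'D_v (phi j \o psi i) (phi i p).

Definition smooth_map {V : normedModType R} (O : set V) (u : V -> M) : Prop :=
  (forall x, O x -> {for x, continuous u}) /\
  forall i, smooth (O `&` u @^-1` dom i) (phi i \o u).

Definition smooth_fun (W : set M) (f : M -> R) : Prop :=
  forall i, smooth (phi i @` (dom i `&` W)) (f \o psi i).

Definition smooth_self (W : set M) (f : M -> M) : Prop :=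
  forall i, smooth_map (phi i @` (dom i `&` W)) (f \o psi i).

Definition smooth_prod (W : set (R * M)) (f : R * M -> M) : Prop :=
  forall i, smooth_map [set z : R * 'rV[R]_m | rng i z.2 /\ W (z.1, psi i z.2)]
                       (fun z => f (z.1, psi i z.2)).

(* A map on an arbitrary subset X is smooth when near each point of X it is the
   restriction of a smooth map S defined on an open set; S stands for one of
   smooth_fun, smooth_self, smooth_prod. *)
Definition smooth_on_subset {P : topologicalType} {T : Type}
    (S : set P -> (P -> T) -> Prop) (X : set P) (f : P -> T) : Prop :=
  forall p, X p -> exists W F,
    [/\ open W, W p, S W F & forall q, W q -> X q -> F q = f q].

Definition critical_point (f : M -> R) (p : M) : Prop :=
  forall i, dom i p -> forall v, 'D_v (f \o psi i) (phi i p) = 0.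

(* For N of codimension 0 (possibly with boundary), the differential at p of a
   local extension F of h does not depend on F. *)
Definition no_critical_points_on (N : set M) (h : M -> R) : Prop :=
  forall p W F, N p -> open W -> W p -> smooth_fun W F ->
    (forall q, W q -> N q -> F q = h q) -> ~ critical_point F p.

Definition bdry (V : set M) : set M := closure V `\` interior V.

Definition smooth_boundary (V : set M) : Prop :=
  forall p, bdry V p -> exists W f,
    [/\ open W, W p, smooth_fun W f, ~ critical_point f p &
        forall q, W q -> (V q <-> f q < 0)].

(* Phi : [0,1] x bdry V -> N is a diffeomorphism with inverse (rho, pr). *)
Definition tubular_neighborhood (V N : set M) : Prop :=
  exists (Phi : R * M -> M) (rho : M -> R) (pr : M -> M),
  let X := `[0, 1] `*` bdry V in
  [/\ N `<=` ~` V,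
      Phi @` X = N,
      (forall z, X z -> (rho (Phi z), pr (Phi z)) = z),
      [/\ smooth_on_subset smooth_prod X Phi,
          smooth_on_subset smooth_fun N rho &
          smooth_on_subset smooth_self N pr] &
      Phi @` ([set 0] `*` bdry V) = bdry V].

(* A tensor field with two indices, given by its matrices in the charts; the
   value at chart i and y is only meaningful for y in rng i. *)
Definition tensor : Type := chart -> 'rV[R]_m -> 'M[R]_m.

Definition bil (B : 'M[R]_m) (v w : 'rV[R]_m) : R := (v *m B *m w^T) 0 0.

Definition symplectic_form (omega : tensor) : Prop :=
  [/\ (forall i j p v w, dom i p -> dom j p ->
         bil (omega i (phi i p)) v w
         = bil (omega j (phi j p)) (dtrans i j p v) (dtrans i j p w)),
      (forall i, smooth (rng i) (omega i)),
      (forall i y v, rng i y -> bil (omega i y) v v = 0),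
      (forall i y, rng i y -> omega i y \in unitmx) &
      (forall i y v1 v2 v3, rng i y ->
         'D_v1 (fun x => bil (omega i x) v2 v3) y
         + 'D_v2 (fun x => bil (omega i x) v3 v1) y
         + 'D_v3 (fun x => bil (omega i x) v1 v2) y = 0)].

Definition almost_complex (J : tensor) : Prop :=
  [/\ (forall i j p v, dom i p -> dom j p ->
         dtrans i j p (v *m J i (phi i p)) = dtrans i j p v *m J j (phi j p)),
      (forall i, smooth (rng i) (J i)) &
      (forall i y, rng i y -> J i y *m J i y = - 1%:M)].

(* bil (gJ omega J i y) v w = omega(v, J w) *)
Definition gJ (omega J : tensor) : tensor := fun i y => omega i y *m (J i y)^T.

Definition compatible (omega J : tensor) : Prop :=
  forall i y, rng i y ->
    (forall v w, bil (gJ omega J i y) v w = bil (gJ omega J i y) w v) /\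
    (forall v, v != 0 -> 0 < bil (gJ omega J i y) v v).

(* The Riemann sphere is option R[i] with None as the point at infinity; its two
   holomorphic charts z (b = false) and 1/z (b = true) are inverse to sph b. *)

Definition toC (z : R * R) : R[i] := Complex z.1 z.2.
Definition ofC (z : R[i]) : R * R := (complex.Re z, complex.Im z).
Definition imC : R[i] := Complex 0 1.
Definition invC (z : R * R) : R * R := ofC (toC z)^-1.

Definition sph (b : bool) (z : R * R) : option R[i] :=
  if b then (if z == 0 then None else Some (toC z)^-1) else Some (toC z).

Definition holomorphic_sphere (J : tensor) (u : option R[i] -> M) : Prop :=
  forall b, smooth_map setT (u \o sph b) /\
    forall i z, dom i (u (sph b z)) ->
      'D_((1, 0) : R * R) (phi i \o u \o sph b) z
      + 'D_((0, 1) : R * R) (phi i \o u \o sph b) z *m J i (phi i (u (sph b z)))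
      = 0.

(* The map p/q of the sphere to itself.  The holomorphic branched coverings of
   the sphere by itself are the non-constant maps p/q with p, q coprime, and the
   degree is max (deg p) (deg q) = (maxn (size p) (size q)).-1. *)
Definition ratmap (p q : {poly R[i]}) (w : option R[i]) : option R[i] :=
  match w with
  | Some z => if q.[z] == 0 then None else Some (p.[z] / q.[z])
  | None => if (size q < size p)%N then None
            else Some (p`_(size q).-1 / lead_coef q)
  end.

Definition multiply_covered (J : tensor) (u : option R[i] -> M) : Prop :=
  exists (p q : {poly R[i]}) (v : option R[i] -> M),
    [/\ coprimep p q, (1 < (maxn (size p) (size q)).-1)%N,
        holomorphic_sphere J v & forall w, u w = v (ratmap p q w)].

Definition simple_sphere (J : tensor) (u : option R[i] -> M) : Prop :=
  holomorphic_sphere J u /\ ~ multiply_covered J u.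

(* Smooth sections of the pullback of TM by u: xi i w is the component in chart
   i, meaningful when dom i (u w). *)
Definition section_along (u : option R[i] -> M)
    (xi : chart -> option R[i] -> 'rV[R]_m) : Prop :=
  (forall i j w, dom i (u w) -> dom j (u w) ->
     xi j w = dtrans i j (u w) (xi i w)) /\
  (forall b i, smooth [set z | dom i (u (sph b z))] (fun z => xi i (sph b z))).

(* Smooth (0,1)-forms on the sphere with values in the pullback of TM: eta b i z
   zeta is the value at the point sph b z, expressed in chart i, on the tangent
   vector with coordinate zeta in the chart b of the sphere. *)
Definition form01_along (J : tensor) (u : option R[i] -> M)
    (eta : bool -> chart -> R * R -> R[i] -> 'rV[R]_m) : Prop :=
  [/\ (forall b i z a zeta zeta', dom i (u (sph b z)) ->
         eta b i z (a%:C * zeta + zeta')%C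
         = a *: eta b i z zeta + eta b i z zeta'),
      (forall b i z zeta, dom i (u (sph b z)) ->
         eta b i z (imC * zeta)
         = - (eta b i z zeta *m J i (phi i (u (sph b z))))),
      (forall b i j z zeta, dom i (u (sph b z)) -> dom j (u (sph b z)) ->
         eta b j z zeta = dtrans i j (u (sph b z)) (eta b i z zeta)),
      (* the differential of z |-> 1/z at z maps zeta to - zeta / z^2 *)
      (forall b i z zeta, z != 0 -> dom i (u (sph b z)) ->
         eta b i z zeta = eta (~~ b) i (invC z) (- zeta / toC z ^+ 2)) &
      (forall b i zeta, smooth [set z | dom i (u (sph b z))]
                               (fun z => eta b i z zeta))].

(* In coordinates, D_u xi = ((d xi) + J(u) (d xi) o j + (d_xi J)(u) du o j) / 2;
   at a J-holomorphic u this does not depend on the coordinates. *)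
Definition linearized_CR (J : tensor) (u : option R[i] -> M)
    (xi : chart -> option R[i] -> 'rV[R]_m)
    (b : bool) (i : chart) (z : R * R) (zeta : R[i]) : 'rV[R]_m :=
  let f := phi i \o u \o sph b in
  let x := fun z => xi i (sph b z) in
  2^-1 *: ('D_(ofC zeta) x z
           + 'D_(ofC (imC * zeta)) x z *m J i (f z)
           + 'D_(ofC (imC * zeta)) f z *m 'D_(x z) (J i) (f z)).

Definition regular (J : tensor) : Prop :=
  forall u, simple_sphere J u ->
  forall eta, form01_along J u eta ->
  exists2 xi, section_along u xi &
    forall b i z zeta, dom i (u (sph b z)) ->
      linearized_CR J u xi b i z zeta = eta b i z zeta.

(* The circle is R/Z: functions on it are 1-periodic functions of t. *)

Definition homotopy (H : M -> R -> R -> R) : Prop :=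
  [/\ (forall x t s, H x (t + 1) s = H x t s),
      (forall i, smooth [set z : 'rV[R]_m * (R * R) | rng i z.1]
                        (fun z => H (psi i z.1) z.2.1 z.2.2)) &
      exists2 R0 : R, 0 < R0 &
        forall x t s, R0 < `|s| -> derive1 (H x t) s = 0].

Definition Hminus (H : M -> R -> R -> R) (x : M) (t : R) : R :=
  lim (H x t s @[s --> -oo]).
Definition Hplus (H : M -> R -> R -> R) (x : M) (t : R) : R :=
  lim (H x t s @[s --> +oo]).

(* The Hamiltonian vector field of f at p, in chart i. *)
Definition ham_vec (omega : tensor) (f : M -> R) (i : chart) (p : M) : 'rV[R]_m :=
  xget 0 [set X | forall w, bil (omega i (phi i p)) X w
                            = - 'D_w (f \o psi i) (phi i p)].

Definition periodic_orbit (omega : tensor) (F : M -> R -> R) (x : R -> M) : Prop :=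
  [/\ smooth_map setT x,
      (forall t, x (t + 1) = x t) &
      (forall t i, dom i (x t) ->
         'D_1 (phi i \o x) t = ham_vec omega (fun p => F p t) i (x t))].

Definition cylinder_map (u : R * R -> M) : Prop :=
  smooth_map setT u /\ forall s t, u (s, t + 1) = u (s, t).

Definition floer_equation (omega J : tensor) (H : M -> R -> R -> R)
    (u : R * R -> M) : Prop :=
  forall s t i, dom i (u (s, t)) ->
    'D_((1, 0) : R * R) (phi i \o u) (s, t)
    + ('D_((0, 1) : R * R) (phi i \o u) (s, t)
       - ham_vec omega (fun p => H p t s) i (u (s, t)))
      *m J i (phi i (u (s, t)))
    = 0.

(* The common value in all charts of the squared gJ-norm of d_s u. *)
Definition energy_density (omega J : tensor) (u : R * R -> M) (z : R * R) : R :=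
  xget 0 [set e | forall i, dom i (u z) ->
    let w := 'D_((1, 0) : R * R) (phi i \o u) z in
    e = bil (gJ omega J i (phi i (u z))) w w].

Definition energy (omega J : tensor) (u : R * R -> M) : \bar R :=
  (\int[lebesgue_measure \x lebesgue_measure]_(z in [set: R] `*` `[0%R, 1%R])
     (energy_density omega J u z)%:E)%E.

(* u(s, .) converges to x- and x+ uniformly. *)
Definition floer_trajectory (omega J : tensor) (H : M -> R -> R -> R)
    (u : R * R -> M) (xm xp : R -> M) : Prop :=
  [/\ cylinder_map u,
      floer_equation omega J H u,
      (energy omega J u < +oo)%E,
      periodic_orbit omega (Hminus H) xm /\ periodic_orbit omega (Hplus H) xp &
      {compact-open, (fun s t => u (s, t)) @ -oo --> xm} /\
      {compact-open, (fun s t => u (s, t)) @ +oo --> xp}].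

End Manifold.

(* Main.v *)
(* The cut-off chi, equal to 0 on V, to 1 outside the closed set V-hat and to a smooth step of h
   in N, turns a trajectory u into a family of functions chi(u(s, .)) on the circle.  For small
   eps there are constants depending only on g_J, N and h such that:
   - the mean of chi(u(s, .)) increases by at most C E(u) along the trajectory.  In N the
     derivative of the mean is, up to a term of the favourable sign - eps |grad h|^2, the
     integral over the loop u(s, .) of the 1-form - d chi o J.  A loop on which the energy density
     is small lies in one chart, where the integral is quadratic in the length of the loop; the
     length is O(eps) plus the mean of |d_s u|, and eps itself is controlled by that mean, since
     otherwise the loop, which follows eps X_h, could not close up;
   - when E(u) is small, chi(u(s, .)) cannot take both a value <= 1/4 and a value >= 3/4.
     Otherwise u would cross the middle of N on a slice lying between two slices of small energy,
     and a mean value inequality centred at the crossing bounds the energy from below;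
   - the 1-periodic orbits of H_- and H_+ do not meet N.  An orbit which meets N stays in N, by a
     Gronwall argument at the boundary, where d(H - eps h) vanishes; in N it follows eps X_h,
     so that it is not closed in time 1.
   Hence x_- and x_+ lie in V or outside V-hat.  If (i) fails, then x_- lies in V or x_+ outside
   V-hat; the mean of chi is close to 0, respectively to 1, on every slice, although some slice
   reaches chi = 1, respectively chi = 0, and the second estimate excludes small energies.

   The constants must depend on J only through g_J.  The derivatives of omega at a point are
   bounded in terms of the 2-jet of g_J by a Bochner identity: omega is closed and
   (g^-1 omega)^2 = -1, so that applying sum g^ab d_a d_b to the trace of (g^-1 omega)^2 leaves
   |d omega|^2 and terms at most linear in d omega. *)

Require Import Defs.
From HB Require Import structures.
From mathcomp Require Import all_boot all_order all_algebra.
From mathcomp Require Import all_classical all_reals all_analysis.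
From mathcomp Require Import measurable_realfun ring lra.

Set Implicit Arguments.
Unset Strict Implicit.
Unset Printing Implicit Defensive.
Import Order.TTheory GRing.Theory Num.Theory.
Import numFieldNormedType.Exports.

Local Open Scope classical_set_scope.
Local Open Scope ring_scope.

(** * Integrals over intervals *)

(** The cylinder is infinite in s, so a bound on the drift of the mean that is linear in d_s u would
    be useless: over a time span T it only gives the square root of T E(u). Every slice has to be
    estimated by its energy. The lower bound for the energy is a monotonicity formula. The curve is
    replaced by its graph, with r s and r t as additional coordinates, in a chart where metric and
    almost complex structure are frozen at the crossing. The graph is immersed even where d_s u = 0,
    and it leaves the ball of radius r by itself once |t - t0| >= 1. Several pairs (omega, J) can
    induce the same g_J. The chart constants are therefore proved for all data with the same metric
    bounds at once, which makes the final constant a function of N, g_J and h; eps0 may depend on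
    omega, J and V. *)

Section Integral.
Context {R : realType}.
Notation mu := (@lebesgue_measure R).
Implicit Types (f g : R -> R) (a b c : R).

Definition I1 a b f : R := (\int[mu]_(x in `[a, b]) f x)%R.

Lemma cont_integrable a b f : continuous f ->
  mu.-integrable `[a, b] (EFin \o f).
Proof.
move=> cf; apply: continuous_compact_integrable; first exact: segment_compact.
exact: continuous_subspaceT.
Qed.

Lemma I1D a b f g : continuous f -> continuous g ->
  I1 a b (fun x => f x + g x) = I1 a b f + I1 a b g.
Proof. by move=> cf cg; apply: RintegralD => //; exact: cont_integrable. Qed.

Lemma I1B a b f g : continuous f -> continuous g ->
  I1 a b (fun x => f x - g x) = I1 a b f - I1 a b g.
Proof. by move=> cf cg; apply: RintegralB => //; exact: cont_integrable. Qed.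

Lemma I1Z a b f k : continuous f -> I1 a b (fun x => k * f x) = k * I1 a b f.
Proof. by move=> cf; apply: RintegralZl => //; exact: cont_integrable. Qed.

Lemma I1_cst a b k : a <= b -> I1 a b (fun=> k) = k * (b - a).
Proof.
move=> ab; rewrite /I1 Rintegral_cst//= lebesgue_measure_itv/= lte_fin.
by move: ab; rewrite le_eqVlt => /predU1P[->|->]; rewrite ?ltxx ?subrr.
Qed.

Lemma I1_le a b f g : continuous f -> continuous g ->
  (forall x, a <= x <= b -> f x <= g x) -> I1 a b f <= I1 a b g.
Proof.
move=> cf cg fg; have cif := cont_integrable a b cf.
have cig := cont_integrable a b cg; apply: le_Rintegral => // x /=; rewrite in_itv; exact: fg.
Qed.

Lemma I1_ge0 a b f : (forall x, a <= x <= b -> 0 <= f x) -> 0 <= I1 a b f.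
Proof.
by move=> f0; apply: Rintegral_ge0 => x /=; rewrite in_itv/=; exact: f0.
Qed.

Lemma I1_norm a b f : continuous f -> `|I1 a b f| <= I1 a b (fun x => `|f x|).
Proof. by move=> cf; apply: le_normr_Rintegral => //; exact: cont_integrable. Qed.

Lemma I1_cat a b c f : continuous f -> a <= b <= c ->
  I1 a c f = I1 a b f + I1 b c f.
Proof.
move=> cf /andP[ab bc].
have := @Rintegral_itvB R f (BLeft a) (BRight c) b (cont_integrable _ _ cf).
rewrite !bnd_simp => /(_ ab bc) E.
suff -> : I1 b c f = (\int[mu]_(x in `]b, c]) f x)%R by rewrite -E /I1; lra.
apply/esym/Rintegral_itv_obnd_cbnd.
apply: (@integrableS _ _ _ mu `[b, c]) => //; first exact: subset_itv_oc_cc.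
exact: cont_integrable.
Qed.

Lemma I1_pt a f : I1 a a f = 0.
Proof. by rewrite /I1 set_itv1 Rintegral_set1. Qed.

Lemma I1_FTC a b f F : a <= b -> continuous f ->
  (forall x, a <= x <= b -> is_derive x 1 F (f x)) -> I1 a b f = F b - F a.
Proof.
rewrite le_eqVlt => /predU1P[-> _ _|ab cf dF]; first by rewrite I1_pt subrr.
have cF x : a <= x <= b -> {for x, continuous F}.
  move=> /dF dFx; apply/differentiable_continuous/derivable1_diffP.
  exact: ex_derive.
rewrite /I1 /Rintegral (@continuous_FTC2 _ f F)//.
- exact: continuous_subspaceT.
- split.
  + move=> x /[!in_itv]/= /andP[/ltW ax /ltW xb].
    by have := dF x; rewrite ax xb => /(_ isT) dFx; exact: ex_derive.
  + by apply/cvg_at_right_filter/cF; rewrite lexx ltW.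
  + by apply/cvg_at_left_filter/cF; rewrite lexx ltW.
- move=> x /[!in_itv]/= /andP[/ltW ax /ltW xb]; rewrite derive1E.
  by have := dF x; rewrite ax xb => /(_ isT) dFx; rewrite derive_val.
Qed.

(** The primitive starts at [a - 1], to the left of the segment, so that it has a two-sided
    derivative also at [a]. *)
Lemma I1_primitive a b f : continuous f -> exists F : R -> R,
  forall x, a <= x <= b -> is_derive x 1 F (f x).
Proof.
move=> cf; exists (fun x => I1 (a - 1) x f) => x /andP[ax xb].
have xx : x < x + 1 by rewrite ltrDl.
have a1x : a - 1 < x by rewrite (lt_le_trans _ ax)// gtrBl.
have [] := @continuous_FTC1_closed R f (a - 1) x (x + 1) xx
  (cont_integrable _ _ cf) a1x (cf x).
by rewrite derive1E => ? <-; apply: derivableP.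
Qed.

Lemma I1_ext a b f g : (forall x, a <= x <= b -> f x = g x) -> I1 a b f = I1 a b g.
Proof.
by move=> fg; apply: eq_Rintegral => x /[!inE]/=; rewrite in_itv/=; exact: fg.
Qed.

Lemma slice1_continuous (F : R * R -> R) s :
  continuous F -> continuous (fun t => F (s, t)).
Proof.
move=> cF t; apply: (@continuous_comp _ _ _ (fun t => (s, t)) F); last exact: cF.
by apply: (@cvg_pair _ _ _ (nbhs t) (nbhs s) (nbhs t)); [exact: cvg_cst|exact: cvg_id].
Qed.

Lemma slice2_continuous (F : R * R -> R) t :
  continuous F -> continuous (fun s => F (s, t)).
Proof.
move=> cF s; apply: (@continuous_comp _ _ _ (fun s => (s, t)) F); last exact: cF.
by apply: (@cvg_pair _ _ _ (nbhs s) (nbhs s) (nbhs t)); [exact: cvg_id|exact: cvg_cst].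
Qed.

Lemma I1_continuous a b (F : R * R -> R) : continuous F ->
  continuous (fun s => I1 a b (fun t => F (s, t))).
Proof.
move=> cF s0.
have [ba|ab] := ltP b a.
  rewrite (_ : (fun s => _) = cst 0); first exact: cvg_cst.
  by apply/funext => s; rewrite /I1 set_itv_ge ?bnd_simp -?ltNge// Rintegral_set0.
apply/cvgrPdist_le => /= e e0.
pose d := e / (b - a + 1).
have ba1 : 0 < b - a + 1 by rewrite ltr_wpDl// subr_ge0.
have d0 : 0 < d by rewrite divr_gt0.
(* Compactness of the segment makes the continuity at the points [(s0, t)] uniform in [t]. *)
have /compact_near_coveringP cov := @segment_compact R a b.
have : \forall s \near s0, `[a, b]%classic `<=` (fun t => `|F (s0, t) - F (s, t)| <= d).
  apply: (cov _ (nbhs s0) (fun s t => `|F (s0, t) - F (s, t)| <= d)) => t _.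
  have /cvgrPdist_lt/(_ (d/2)) := cF (s0, t).
  rewrite divr_gt0// => /(_ isT)[/= [U V] /= [nU nV] UV].
  exists (V, U) => //= -[t' s'] /= [Vt' Us'].
  have h1 := UV (s', t') (conj Us' Vt').
  have h2 := UV (s0, t') (conj (nbhs_singleton nU) Vt').
  rewrite /= in h1 h2.
  rewrite (_ : _ - _ = (F (s0, t) - F (s', t')) - (F (s0, t) - F (s0, t'))); last by lra.
  apply: (le_trans (ler_normB _ _)); lra.
apply: filterS => s hs.
rewrite -I1B; [|exact: slice1_continuous..].
apply: (le_trans (I1_norm _ _ _)).
  by move=> x; apply: cvgB; exact: slice1_continuous.
apply: (@le_trans _ _ (I1 a b (fun=> d))).
  apply: I1_le.
  - by move=> x; apply: cvg_norm; apply: cvgB; exact: slice1_continuous.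
  - by move=> x; exact: cvg_cst.
  - by move=> x xab; apply: hs; rewrite /= in_itv.
rewrite I1_cst// /d mulrAC ler_pdivrMr// ler_wpM2l ?ltW//; lra.
Qed.

(** The product carries the product sigma-algebra, so openness does not give measurability at once:
    an open set is written as a countable union of squares with rational centre and radius. *)
Lemma open_prod_measurable (U : set (R * R)) : open U ->
  measurable (U : set (measurableTypeR R * measurableTypeR R)).
Proof.
move=> oU.
pose box (q : (rat * rat) * rat) : set (R * R) :=
  ball (ratr q.1.1 : R) (ratr q.2) `*` ball (ratr q.1.2 : R) (ratr q.2).
have -> : U = \bigcup_(q in [set q | box q `<=` U]) box q.
  apply/seteqP; split; last by move=> z [q /= qU]; exact: qU.
  move=> [x y] Uxy.
  have /nbhs_ballP[e /= e0 eU] : nbhs (x, y) U by exact: open_nbhs_nbhs.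
  (* A radius below [e / 2] keeps every such square that contains the point inside the ball of
     radius [e]. *)
  have [r /[!inE]/= /[!in_itv]/= /andP[r0 re]] : exists r : rat, (ratr r : R) \in `](e/4), (e/2)[%classic.
    have /(@dense_rat R) : `](e/4), (e/2)[%classic !=set0.
      by exists (e/3); rewrite /= in_itv/=; lra.
    move=> /(_ (@interval_open R (BRight (e/4)) (BLeft (e/2)) isT isT))[x0 [/= h [r _ rE]]].
    by exists r; rewrite inE/= rE.
  have r0' : 0 < ratr r :> R by lra.
  have near_rat z : exists q : rat, ball (ratr q : R) (ratr r) z.
    have /(@dense_rat R) : ball z (ratr r) !=set0.
      by exists z; apply: ballxx; lra.
    move=> /(_ (ball_open _ _))[x0 [/= h [q _ qE]]].
    by exists q; rewrite qE; exact: ball_sym.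
  have [p px] := near_rat x; have [q qy] := near_rat y.
  exists ((p, q), r); last by [].
  move=> [x' y'] [/= px' qy']; apply: eU; split => /=.
    apply: (@le_ball _ _ _ (ratr r + ratr r)); first lra.
    by apply: ball_triangle px'; exact: ball_sym.
  apply: (@le_ball _ _ _ (ratr r + ratr r)); first lra.
  by apply: ball_triangle qy'; exact: ball_sym.
rewrite bigcup_mkcond; apply: (@countable_bigcupT_measurable _
  (measurableTypeR R * measurableTypeR R)%type _ _ (countableP _)) => q.
case: ifP => // _.
by apply: measurableX; apply: open_measurable; exact: ball_open.
Qed.

Lemma continuous_prod_measurable (F : R * R -> R) : continuous F ->
  measurable_fun setT (F : measurableTypeR R * measurableTypeR R -> R).
Proof.
move=> /continuousP cF; apply: (measurability _ (RGenOInfty.measurableE R)).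
move=> _ [_ [a ->] <-]; rewrite setTI; apply: open_prod_measurable.
exact/cF/interval_open.
Qed.

Lemma I1E a b f : continuous f -> (I1 a b f)%:E = (\int[mu]_(x in `[a, b]) (f x)%:E)%E.
Proof.
move=> cf; rewrite /I1 /Rintegral fineK//.
apply: integrable_fin_num => //; exact: cont_integrable.
Qed.

Lemma mpatch d (T : measurableType d) (D : set T) (f : T -> \bar R) :
  measurable D -> measurable_fun setT f ->
  measurable_fun setT (f \_ D : T -> \bar R).
Proof.
by move=> mD mf; apply/(measurable_restrictT f mD); exact: measurable_funTS.
Qed.

(** Tonelli's theorem for the patched integrand: for nonnegative functions measurability is enough
    to compare with the product integral that defines the energy. *)
Lemma I1_prod_ge0 a b c d (F : R * R -> R) : continuous F ->
  (forall z, 0 <= F z) ->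
  (I1 a b (fun s => I1 c d (fun t => F (s, t))))%:E =
  (\int[mu \x mu]_(z in (`[a, b] `*` `[c, d])%classic) (F z)%:E)%E.
Proof.
move=> cF F0; rewrite I1E; last exact: I1_continuous.
rewrite [RHS]integral_mkcond fubini_tonelli1; last 2 first.
- apply: mpatch; first exact: measurableX.
  apply/measurable_EFinP.
  exact: continuous_prod_measurable.
- by move=> z; rewrite /patch; case: ifP => //; rewrite lee_fin.
rewrite [LHS]integral_mkcond; apply: eq_integral => s _.
rewrite /fubini_F /patch; case: ifPn => [sab|sab].
  rewrite I1E; last exact: slice1_continuous.
  rewrite [LHS]integral_mkcond; apply: eq_integral => t _.
  rewrite /patch; congr (if _ then _ else _).
  apply/idP/idP; rewrite !inE/=; rewrite inE/= in sab; tauto.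
rewrite integral0_eq// => t _; case: ifPn => //.
by rewrite inE => -[/= ? ?]; move: sab; rewrite notin_setE/=.
Qed.

Lemma I1_swap_ge0 a b c d (F : R * R -> R) : continuous F ->
  (forall z, 0 <= F z) ->
  I1 a b (fun s => I1 c d (fun t => F (s, t))) =
  I1 c d (fun t => I1 a b (fun s => F (s, t))).
Proof.
move=> cF F0; apply: EFin_inj; rewrite I1_prod_ge0//.
have cG : continuous (fun z => F (z.2, z.1)).
  move=> z; apply: (@continuous_comp _ _ _ (fun z => (z.2, z.1)) F); last exact: cF.
  by apply: (@cvg_pair _ _ _ (nbhs z) (nbhs z.2) (nbhs z.1)); [exact: cvg_snd|exact: cvg_fst].
rewrite I1E; last by apply: (I1_continuous cG).
rewrite [LHS]integral_mkcond fubini_tonelli2; last 2 first.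
- apply: mpatch; first exact: measurableX.
  apply/measurable_EFinP.
  exact: continuous_prod_measurable.
- by move=> z; rewrite /patch; case: ifP => //; rewrite lee_fin.
rewrite [RHS]integral_mkcond; apply: eq_integral => t _.
rewrite /fubini_G /patch; case: ifPn => [sab|sab].
  rewrite I1E; last exact: slice2_continuous.
  rewrite [RHS]integral_mkcond; apply: eq_integral => s _.
  rewrite /patch; congr (if _ then _ else _).
  apply/idP/idP; rewrite !inE/=; rewrite inE/= in sab; tauto.
rewrite integral0_eq// => s _; case: ifPn => //.
by rewrite inE => -[/= ? ?]; move: sab; rewrite notin_setE/=.
Qed.

(** Tonelli covers nonnegative integrands; [F] is the difference of the nonnegative continuous
    functions [|F| + F] and [|F|]. *)
Lemma I1_swap a b c d (F : R * R -> R) : continuous F ->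
  I1 a b (fun s => I1 c d (fun t => F (s, t))) =
  I1 c d (fun t => I1 a b (fun s => F (s, t))).
Proof.
move=> cF.
pose G z : R := `|F z|; pose H z : R := `|F z| + F z.
have cG : continuous G by move=> z; apply: cvg_norm; exact: cF.
have cH : continuous H by move=> z; apply: cvgD; [exact: cG|exact: cF].
have G0 z : 0 <= G z by exact: normr_ge0.
have H0 z : 0 <= H z by rewrite /H; have := ler_norm (- F z); rewrite normrN; lra.
have cH' := fun s => @slice1_continuous H s cH.
have cG' := fun s => @slice1_continuous G s cG.
have cH'' := fun s => @slice2_continuous H s cH.
have cG'' := fun s => @slice2_continuous G s cG.
have -> : F = (fun z => H z - G z) by apply/funext => z; rewrite /H /G; lra.
have cS : continuous (fun z : R * R => (z.2, z.1)).
  by move=> z; apply: (@cvg_pair _ _ _ (nbhs z) (nbhs z.2) (nbhs z.1)); [exact: cvg_snd|exact: cvg_fst].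
have cHs : continuous (fun z => H (z.2, z.1)).
  by move=> z; apply: (@continuous_comp _ _ _ (fun z => (z.2, z.1)) H); [exact: cS|exact: cH].
have cGs : continuous (fun z => G (z.2, z.1)).
  by move=> z; apply: (@continuous_comp _ _ _ (fun z => (z.2, z.1)) G); [exact: cS|exact: cG].
rewrite (@I1_ext _ _ _ (fun s => I1 c d (fun t => H (s, t)) - I1 c d (fun t => G (s, t)))); last first.
  by move=> s _; rewrite I1B.
rewrite [RHS](@I1_ext _ _ _ (fun t => I1 a b (fun s => H (s, t)) - I1 a b (fun s => G (s, t)))); last first.
  by move=> s _; rewrite I1B.
rewrite !I1B; [|exact: (I1_continuous cHs)|exact: (I1_continuous cGs)|exact: I1_continuous..].
have h1 := @I1_swap_ge0 a b c d H cH H0; have h2 := @I1_swap_ge0 a b c d G cG G0.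
by rewrite [in LHS]h1 [in LHS]h2.
Qed.

(** The passage from the energy, an extended real over the whole cylinder, to real integrals over
    finite stretches of it. *)
Lemma I1_prod_le a b (F : R * R -> R) : continuous F -> (forall z, 0 <= F z) ->
  ((I1 a b (fun s => I1 0 1 (fun t => F (s, t))))%:E <=
  \int[mu \x mu]_(z in [set: R] `*` `[0%R, 1%R]) (F z)%:E)%E.
Proof.
move=> cF F0; rewrite I1_prod_ge0//; apply: ge0_subset_integral => //.
- exact: measurableX.
- exact: measurableX.
- apply/measurable_EFinP; apply: measurable_funTS; exact: continuous_prod_measurable.
- by move=> z _; rewrite lee_fin.
- by move=> z [].
Qed.

(** Nonnegativity of the variance of [sqrt f] on an interval of length one. *)
Lemma I1_sqrt a f : continuous f -> (forall x, 0 <= f x) ->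
  (I1 a (a + 1) (fun x => Num.sqrt (f x))) ^+ 2 <= I1 a (a + 1) f.
Proof.
move=> cf f0; set g := fun x => Num.sqrt (f x); set m := I1 _ _ g.
have cg : continuous g by move=> x; apply: continuous_comp; [exact: cf|exact: sqrt_continuous].
have cK k : continuous (fun _ : R => k : R) by move=> x; exact: cvg_cst.
have : 0 <= I1 a (a + 1) (fun x => (g x - m) ^+ 2) by apply: I1_ge0 => x _; exact: sqr_ge0.
rewrite (@I1_ext _ _ _ (fun x => f x + ((- (2 * m)) * g x + m ^+ 2))); last first.
  by move=> x _; rewrite /g sqrrB sqr_sqrtr//; ring.
have cg' : continuous (fun x => - (2 * m) * g x).
  by move=> x; apply: cvgM; [exact: cvg_cst|exact: cg].
rewrite I1D//; last by move=> x; apply: cvgD; [exact: cg'|exact: cK].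
rewrite I1D// I1Z// I1_cst; last by lra.
rewrite -/m; lra.
Qed.

End Integral.

(** * Directional derivatives *)

Section Calculus.
Context {R : realType}.

Lemma line_derive (V W : normedModType R) (f : V -> W) (x v : V) (t : R) :
  derivable f (x + t *: v) v ->
  is_derive t 1 (fun t => f (x + t *: v)) ('D_v f (x + t *: v)).
Proof.
move=> fd.
have E : (fun h : R => h^-1 *: (((fun t => f (x + t *: v)) \o shift t) (h *: 1) - f (x + t *: v)))
       = (fun h : R => h^-1 *: ((f \o shift (x + t *: v)) (h *: v) - f (x + t *: v))).
  apply/funext => h /=; congr (_ *: (f _ - _)).
  by rewrite [h *: 1]mulr1 scalerDl addrCA.
by apply: DeriveDef; rewrite /derivable /derive E.
Qed.

Lemma MVT_all (f df : R -> R) (a b : R) : a <= b ->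
  (forall x, a <= x <= b -> is_derive x 1 f (df x)) ->
  exists2 c, a <= c <= b & f b - f a = df c * (b - a).
Proof.
move=> ab fd; have [||c] := @MVT_segment R f df a b ab.
- move=> x; rewrite in_itv/= => /andP[ax xb]; apply: fd; lra.
- apply: derivable_within_continuous => x; rewrite in_itv/= => xab.
  by have := fd x xab => -[].
- by rewrite in_itv/= => cab E; exists c.
Qed.

Lemma MVT_line (V : normedModType R) (f : V -> R) (x v : V) (r : R) : 0 <= r ->
  (forall t : R, 0 <= t <= r -> derivable f (x + t *: v) v) ->
  exists2 t : R, 0 <= t <= r & f (x + r *: v) - f x = 'D_v f (x + t *: v) * r.
Proof.
move=> r0 fd.
have [|c c01 E] := @MVT_all (fun t => f (x + t *: v)) (fun t => 'D_v f (x + t *: v)) 0 r r0.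
  by move=> t t01; apply/line_derive/fd.
by exists c => //; rewrite scale0r addr0 subr0 in E.
Qed.

Lemma ball_line (V : normedModType R) (x0 x y : V) (r t : R) : 0 <= t <= 1 ->
  ball x0 r x -> ball x0 r y -> ball x0 r (x + t *: (y - x)).
Proof.
move=> /andP[t0 t1]; rewrite -!ball_normE /= => hx hy.
have -> : x0 - (x + t *: (y - x)) = (1 - t) *: (x0 - x) + t *: (x0 - y).
  rewrite scalerBl scale1r -[RHS]addrA [- _ + _]addrC -scalerBr opprB.
  by rewrite [x0 - y + _]addrC subrKA -[x - y]opprB scalerN -addrA -opprD.
apply: (le_lt_trans (ler_normD _ _)); rewrite !normrZ ger0_norm ?(ger0_norm t0); last lra.
have [->|tp] := eqVneq t 0; first by rewrite subr0 mul1r mul0r addr0.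
have : t * `|x0 - y| < t * r by rewrite ltr_pM2l// lt_neqAle eq_sym tp.
have : (1 - t) * `|x0 - x| <= (1 - t) * r by apply: ler_wpM2l; [lra|exact: ltW].
nra.
Qed.

Lemma ball_lipschitz (V : normedModType R) (f : V -> R) (x0 : V) (r L : R) :
  (forall y v, ball x0 r y -> derivable f y v /\ `|'D_v f y| <= L * `|v|) ->
  forall x y, ball x0 r x -> ball x0 r y -> `|f y - f x| <= L * `|y - x|.
Proof.
move=> H x y hx hy.
have [|t t01] := @MVT_line V f x (y - x) 1 ler01.
  by move=> t t01; have [] := H _ (y - x) (ball_line t01 hx hy).
rewrite scale1r mulr1 addrCA subrr addr0 => ->.
by have [] := H _ (y - x) (ball_line t01 hx hy).
Qed.

(** The mean value theorem, applied once in each direction to the second difference over the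
    parallelogram with sides [h v] and [h w]. *)
Lemma schwarz_aux (V : normedModType R) (f : V -> R) (x v w : V) (h : R) : 0 < h ->
  (forall a b : R, 0 <= a <= h -> 0 <= b <= h -> derivable f (x + a *: v + b *: w) v) ->
  (forall a b : R, 0 <= a <= h -> 0 <= b <= h -> derivable ('D_v f) (x + a *: v + b *: w) w) ->
  exists a b : R, [/\ 0 <= a <= h, 0 <= b <= h &
    f (x + h *: v + h *: w) - f (x + h *: v) - f (x + h *: w) + f x
    = 'D_w ('D_v f) (x + a *: v + b *: w) * h ^+ 2].
Proof.
move=> h0 fd fdd.
pose g (t : R) := f (x + h *: w + t *: v) - f (x + t *: v).
have [|a ah Ea] := @MVT_all g (fun t => 'D_v f (x + h *: w + t *: v) - 'D_v f (x + t *: v)) 0 h (ltW h0).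
  move=> t th; apply: is_deriveB; apply: line_derive.
    by rewrite addrAC; apply: fd => //; lra.
  by have := fd t 0 th; rewrite scale0r addr0; apply; lra.
have [|b bh Eb] := @MVT_line V ('D_v f) (x + a *: v) w h (ltW h0).
  by move=> t th; apply: fdd.
exists a, b; split => //.
move: Ea; rewrite /g !scale0r !addr0 subr0 addrAC.
rewrite [x + a *: v + h *: w]addrAC in Eb; rewrite Eb => E.
by rewrite expr2 mulrA -E [x + h *: v + h *: w]addrAC; lra.
Qed.

Lemma norm_sub_half (a b p e : R) :
  `|a - p| < e / 2 -> `|b - p| < e / 2 -> `|a - b| <= e.
Proof.
move=> h1 h2; rewrite (_ : a - b = (a - p) - (b - p)); last by ring.
by apply: (le_trans (ler_normB _ _)); lra.
Qed.

(** The second difference is symmetric in [v] and [w], so the two mixed derivatives agree at two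
    nearby points; continuity at [x] carries this to [x]. *)
Lemma schwarz (V : normedModType R) (f : V -> R) (U : set V) (x v w : V) :
  open U -> U x ->
  (forall y, U y -> derivable f y v) -> (forall y, U y -> derivable f y w) ->
  (forall y, U y -> derivable ('D_v f) y w) ->
  (forall y, U y -> derivable ('D_w f) y v) ->
  {for x, continuous ('D_w ('D_v f))} -> {for x, continuous ('D_v ('D_w f))} ->
  'D_w ('D_v f) x = 'D_v ('D_w f) x.
Proof.
move=> oU Ux fv fw fvw fwv c1 c2.
apply/eqP; rewrite -subr_eq0 -normr_le0; apply/ler_addgt0Pl => /= e e0; rewrite addr0.
have e2 : 0 < e / 2 by lra.
have [r [r0 rU]] : exists r : R, 0 < r /\ forall y, ball x r y -> [/\ U y,
    `|'D_w ('D_v f) x - 'D_w ('D_v f) y| < e / 2 &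
    `|'D_v ('D_w f) x - 'D_v ('D_w f) y| < e / 2].
  have : \forall y \near x, [/\ U y,
    `|'D_w ('D_v f) x - 'D_w ('D_v f) y| < e / 2 &
    `|'D_v ('D_w f) x - 'D_v ('D_w f) y| < e / 2].
    move/cvgrPdist_lt : c1 => /(_ _ e2) h1; move/cvgrPdist_lt : c2 => /(_ _ e2) h2.
    have h3 := open_nbhs_nbhs (conj oU Ux).
    by apply: filterS3 h3 h1 h2 => y k1 k2 k3; exact: And3 k1 k2 k3.
  by move=> /nbhs_ballP[r r0 rU]; exists r; split.
pose N := `|v| + `|w| + 1.
have N0 : 0 < N by rewrite /N; have := normr_ge0 v; have := normr_ge0 w; lra.
(* With this size the parallelogram fits into the ball where both mixed derivatives are within
   [e / 2] of their values at [x]. *)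
pose h := r / (2 * N).
have h0 : 0 < h by rewrite divr_gt0// mulr_gt0.
have inB (a b : R) : 0 <= a <= h -> 0 <= b <= h -> ball x r (x + a *: v + b *: w).
  move=> /andP[a0 ah] /andP[b0 bh]; rewrite -ball_normE /= opprD opprD !addrA subrr add0r.
  rewrite -opprD normrN; apply: (le_lt_trans (ler_normD _ _)).
  rewrite !normrZ !ger0_norm//.
  have : a * `|v| <= h * `|v| by apply: ler_wpM2r.
  have : b * `|w| <= h * `|w| by apply: ler_wpM2r.
  have : h * N = r / 2 by rewrite /h; field; rewrite gt_eqF.
  rewrite /N !mulrDr; lra.
have inB' (a b : R) : 0 <= a <= h -> 0 <= b <= h -> ball x r (x + a *: w + b *: v).
  by move=> ah bh; rewrite addrAC; exact: inB.
have [||a [b [ah bh Eab]]] := @schwarz_aux V f x v w h h0.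
- by move=> a b ah bh; apply: fv; have [] := rU _ (inB _ _ ah bh).
- by move=> a b ah bh; apply: fvw; have [] := rU _ (inB _ _ ah bh).
have [||c [d [ch dh Ecd]]] := @schwarz_aux V f x w v h h0.
- by move=> c d ch dh; apply: fw; have [] := rU _ (inB' _ _ ch dh).
- by move=> c d ch dh; apply: fwv; have [] := rU _ (inB' _ _ ch dh).
have [_ + _] := rU _ (inB _ _ ah bh).
have [_ _ +] := rU _ (inB' _ _ ch dh).
have -> : 'D_w ('D_v f) (x + a *: v + b *: w) = 'D_v ('D_w f) (x + c *: w + d *: v).
  apply: (@mulIf _ (h ^+ 2)); first by rewrite expf_eq0/= gt_eqF.
  rewrite -[LHS]Eab -[RHS]Ecd [x + h *: w + h *: v]addrAC; congr (_ + _).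
  exact: addrAC.
set p := 'D_v ('D_w f) (x + c *: w + d *: v).
move=> h1 h2.
exact: norm_sub_half h2 h1.
Qed.

Lemma chain (U V W : normedModType R) (g : U -> V) (f : V -> W) (x v : U) :
  differentiable g x -> differentiable f (g x) ->
  'D_v (f \o g) x = 'D_('D_v g x) f (g x).
Proof.
move=> dg df; rewrite deriveE; last exact: differentiable_comp.
by rewrite diff_comp// [RHS]deriveE// (deriveE v dg).
Qed.

Lemma derive_add (V : normedModType R) (f g : V -> R) x v :
  differentiable f x -> differentiable g x ->
  'D_v (fun z => f z + g z) x = 'D_v f x + 'D_v g x.
Proof. by move=> df dg; rewrite deriveD//; exact: diff_derivable. Qed.

Lemma derive_mul (V : normedModType R) (f g : V -> R) x v :
  differentiable f x -> differentiable g x ->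
  'D_v (fun z => f z * g z) x = f x * 'D_v g x + g x * 'D_v f x.
Proof. by move=> df dg; rewrite deriveM//; exact: diff_derivable. Qed.

Lemma cont_near (T U : topologicalType) (f g : T -> U) z (O : set T) :
  open O -> O z -> (forall w, O w -> f w = g w) ->
  {for z, continuous g} -> {for z, continuous f}.
Proof.
move=> oO Oz fg cg; rewrite /prop_for /continuous_at fg//.
apply: cvg_trans cg; apply: near_eq_cvg.
by apply: filterS (open_nbhs_nbhs (conj oO Oz)) => w /fg.
Qed.

Lemma derive_near (V W : normedModType R) (f g : V -> W) (v x : V) (O : set V) :
  open O -> O x -> (forall w, O w -> f w = g w) -> 'D_v f x = 'D_v g x.
Proof.
move=> oO Ox fg; apply: near_eq_derive.
by apply: filterS (open_nbhs_nbhs (conj oO Ox)) => w /fg.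
Qed.

Lemma deriveZr (V W : normedModType R) (f : V -> W) x k v : differentiable f x ->
  'D_(k *: v) f x = k *: 'D_v f x.
Proof. by move=> df; rewrite !deriveE// linearZ. Qed.

(** The first-order expansion of [f] is also one of [g], and uniqueness of the differential
    identifies its linear part with ['d g x]. *)
Lemma dif_near (V W : normedModType R) (f g : V -> W) x (U : set V) :
  open U -> U x -> (forall z, U z -> f z = g z) ->
  differentiable f x -> differentiable g x.
Proof.
move=> oU Ux fg df; have [cdf /eqaddoP E] := (diff_locallyP _ _).1 df.
have gE : g \o shift x = cst (g x) + 'd f x +o_ 0 id.
  apply/eqaddoP => _/posnumP[e].
  have Us : \forall y \near (0 : V), U (y + x).
    have : (y + x) @[y --> (0 : V)] --> 0 + x by apply: cvgD; [exact: cvg_id|exact: cvg_cst].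
    by apply; rewrite add0r; exact: open_nbhs_nbhs.
  apply: filterS2 (E _ (gt0 e)) Us => y h1 h2.
  by move: h1; rewrite !fctE /= -!fg.
have dE := diff_unique cdf gE.
by apply/diff_locallyP; rewrite dE.
Qed.

Lemma derive_comp1 (V : normedModType R) (f : V -> R) (phi : R -> R) (d : R) v z :
  differentiable f z -> is_derive (f z) 1 phi d ->
  'D_v (phi \o f) z = d * 'D_v f z.
Proof.
move=> df dp.
have dphi' : differentiable phi (f z) by apply/derivable1_diffP; exact: ex_derive.
rewrite chain// -[X in 'D_X phi _]mulr1 -[X in 'D_X phi _]/('D_v f z *: 1 : R).
by rewrite deriveZr// derive_val mulrC.
Qed.

Definition pd m (k : 'I_m) (f : 'rV[R]_m -> R) := 'D_(delta_mx 0 k : 'rV[R]_m) f.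

Lemma derive_rV m (f : 'rV[R]_m -> R) y v : differentiable f y ->
  'D_v f y = \sum_k v 0 k * pd k f y.
Proof.
move=> df; rewrite deriveE// [in LHS](row_sum_delta v) linear_sum/=.
by apply: eq_bigr => k _; rewrite linearZ/= /pd deriveE.
Qed.

Lemma rV_norm_entry m (v : 'rV[R]_m) k : `|v 0 k| <= `|v|.
Proof. rewrite [leRHS]mx_normrE.
exact: (le_bigmax _ (fun i : 'I_1 * 'I_m => `|v i.1 i.2|) (ord0, k)). Qed.

End Calculus.

(** * A Bochner estimate *)

Section Gram.
Context {R : rcfType}.

Lemma mulmx_tr_sqr m n (X : 'M[R]_(m, n)) : \tr (X^T *m X) = \sum_j \sum_i X i j ^+ 2.
Proof.
apply: eq_bigr => j _; rewrite !mxE; apply: eq_bigr => i _.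
by rewrite mxE expr2.
Qed.

(** Cholesky factorization by induction on the size: the Schur complement of the corner entry is
    again symmetric and positive. *)
Lemma gram m (P : 'M[R]_m) : P^T = P ->
  (forall x : 'rV_m, x != 0 -> 0 < (x *m P *m x^T) 0 0) ->
  exists L : 'M[R]_m, P = L *m L^T.
Proof.
elim: m P => [P _ _|m IH P Psym Ppos].
  by exists 0; apply/matrixP => -[].
rewrite -[m.+1]/(1 + m)%N in P Psym Ppos *.
set v := ursubmx P; set p := P 0 0.
have Pul : ulsubmx P = p%:M.
  by rewrite [LHS]mx11_scalar !mxE; congr (P _ _)%:M; apply/val_inj.
have Pdl : dlsubmx P = v^T by rewrite -[in LHS]Psym trmx_ursub.
have Pblock : P = block_mx p%:M v v^T (drsubmx P) by rewrite -[LHS]submxK Pul Pdl.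
have p0 : 0 < p.
  have /Ppos : row_mx 1 0 != 0 :> 'rV[R]_(1 + m).
    apply/eqP => /matrixP/(_ 0 (lshift m 0)); rewrite row_mxEl !mxE => /eqP.
    by rewrite oner_eq0.
  rewrite {1}Pblock tr_row_mx mul_row_block mul_row_col !mul0mx trmx0 mulmx0 !addr0.
  by rewrite mul1mx trmx1 mulmx1 mxE eqxx mulr1n.
pose S := drsubmx P - p^-1 *: (v^T *m v).
have Ssym : S^T = S.
  rewrite /S linearB linearZ/= trmx_mul trmxK; congr (_ - _).
  by rewrite trmx_drsub Psym.
have Spos (x : 'rV[R]_m) : x != 0 -> 0 < (x *m S *m x^T) 0 0.
  (* This completion of [x] minimizes the form of [P], and the minimum is the form of the Schur
     complement at [x]. *)
  move=> x0; pose y : 'rV[R]_(1 + m) := row_mx (- p^-1 *: (x *m v^T)) x.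
  have /Ppos : y != 0.
    by apply: contra x0 => /eqP yE; have := congr1 rsubmx yE; rewrite row_mxKr => ->; rewrite linear0.
  rewrite {1}Pblock /y tr_row_mx mul_row_block mul_row_col.
  rewrite mul_mx_scalar scalerA mulrN divff ?gt_eqF// scaleN1r addNr mul0mx add0r.
  rewrite mulmxDl -scalemxAl -scalemxAl /S mulmxBr mulmxBl -scalemxAr -scalemxAl.
  by rewrite mulmxA scaleNr addrC.
have [L SE] := IH S Ssym Spos.
exists (block_mx (Num.sqrt p)%:M 0 ((Num.sqrt p)^-1 *: v^T) L).
have sp : Num.sqrt p * Num.sqrt p = p by rewrite -expr2 sqr_sqrtr// ltW.
have sp0 : Num.sqrt p != 0 by rewrite sqrtr_eq0 -ltNge.
rewrite tr_block_mx mulmx_block tr_scalar_mx trmx0 !linearZ/= !trmxK.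
rewrite !mul0mx !mulmx0 !addr0 -scalar_mxM sp Pblock; congr block_mx.
- by rewrite mul_scalar_mx scalerA mulVf// scale1r.
- by rewrite -scalemxAl mul_mx_scalar scalerA mulVf// scale1r.
- by rewrite -?scalemxAl ?scalerA -invfM sp -SE /S addrC subrK.
Qed.

Lemma tr_ge m n (P : 'M[R]_m) (c : R) (X : 'M[R]_(m, n)) :
  (forall x : 'rV_m, c * (\sum_i x 0 i ^+ 2) <= (x *m P *m x^T) 0 0) ->
  c * \tr (X^T *m X) <= \tr (X^T *m P *m X).
Proof.
move=> Pc; rewrite mulmx_tr_sqr mulr_sumr; apply: ler_sum => j _.
have := Pc (col j X)^T; under eq_bigr do rewrite !mxE.
move=> /le_trans; apply; rewrite trmxK le_eqVlt; apply/orP; left; apply/eqP.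
by rewrite [LHS]mxE [RHS]mxE; apply: eq_bigr => k _; rewrite !mxE;
  congr (_ * _); apply: eq_bigr => l _; rewrite !mxE.
Qed.

(** With [P = L L^T], cyclicity of the trace turns the right side into [tr ((A L)^T P (A L))]. The
    lower bound of [P] is used once for [A L] and once for the transpose of [A]. *)
Lemma tr_conj_ge m (P : 'M[R]_m) (c : R) (A : 'M[R]_m) : 0 <= c -> P^T = P ->
  (forall x : 'rV_m, x != 0 -> 0 < (x *m P *m x^T) 0 0) ->
  (forall x : 'rV_m, c * (\sum_i x 0 i ^+ 2) <= (x *m P *m x^T) 0 0) ->
  c ^+ 2 * \tr (A^T *m A) <= \tr (P *m A^T *m P *m A).
Proof.
move=> c0 Psym Ppos Pc; have [L PE] := gram Psym Ppos.
have h1 : c * \tr (A^T *m A) <= \tr (A^T *m P *m A) by exact: tr_ge.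
have h2 : c * \tr ((A *m L)^T *m (A *m L)) <= \tr ((A *m L)^T *m P *m (A *m L)) by exact: tr_ge.
have h3 : c * \tr (A *m A^T) <= \tr (A *m P *m A^T).
  by have := @tr_ge _ _ P c A^T Pc; rewrite trmxK.
rewrite expr2 -mulrA; apply: le_trans (_ : c * \tr (A *m P *m A^T) <= _).
  by apply: ler_wpM2l => //; rewrite mxtrace_mulC.
have -> : \tr (A *m P *m A^T) = \tr ((A *m L)^T *m (A *m L)).
  by rewrite [RHS]mxtrace_mulC trmx_mul PE !mulmxA.
have -> // : \tr (P *m A^T *m P *m A) = \tr ((A *m L)^T *m P *m (A *m L)).
by rewrite {1}PE trmx_mul -!mulmxA mxtrace_mulC !mulmxA.
Qed.

End Gram.

(** * Derivatives of the symplectic matrix in terms of the metric *)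

Section Bochner.
Context {R : realType} (m : nat) (kap : R).
Hypothesis kap1 : 1 <= kap.

Notation V := 'rV[R]_m.
Notation dif := (@differentiable _ V R^o).

Implicit Types (f g : V -> R) (A B : V -> 'M[R]_m).

Lemma pdD k f g x : differentiable f x -> differentiable g x ->
  pd k (fun z => f z + g z) x = pd k f x + pd k g x.
Proof. by move=> df dg; rewrite /pd deriveD//; exact: diff_derivable. Qed.

Lemma pdB k f g x : differentiable f x -> differentiable g x ->
  pd k (fun z => f z - g z) x = pd k f x - pd k g x.
Proof. by move=> df dg; rewrite /pd deriveB//; exact: diff_derivable. Qed.

Lemma pdM k f g x : differentiable f x -> differentiable g x ->
  pd k (fun z => f z * g z) x = pd k f x * g x + f x * pd k g x.
Proof.
move=> df dg; rewrite /pd deriveM; [|exact: diff_derivable..].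
by rewrite addrC; congr (_ + _); rewrite [LHS]mulrC.
Qed.

Lemma differentiable_sum' (I : Type) (r : seq I) (F : I -> V -> R) x :
  (forall i, differentiable (F i) x) -> differentiable (fun z => \sum_(i <- r) F i z) x.
Proof.
move=> dF; elim: r => [|i r IH].
  by under eq_fun do rewrite big_nil; exact: differentiable_cst.
under eq_fun do rewrite big_cons; exact: differentiableD.
Qed.

Lemma pd_sum (I : Type) (r : seq I) (F : I -> V -> R) k x :
  (forall i, differentiable (F i) x) ->
  pd k (fun z => \sum_(i <- r) F i z) x = \sum_(i <- r) pd k (F i) x.
Proof.
move=> dF; elim: r => [|i r IH].
  by under eq_fun do rewrite big_nil; rewrite big_nil /pd derive_cst.
under eq_fun do rewrite big_cons; rewrite pdD//; last exact: differentiable_sum'.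
by rewrite big_cons IH.
Qed.

Lemma pd_cst (k : 'I_m) (c : R) (x : V) : pd k (fun=> c) x = 0.
Proof. by rewrite /pd derive_cst. Qed.

Lemma pd_near k f g x (U : set V) : open U -> U x -> (forall z, U z -> f z = g z) ->
  pd k f x = pd k g x.
Proof.
move=> oU Ux fg; apply: near_eq_derive.
by apply: filterS (open_nbhs_nbhs (conj oU Ux)) => z; exact: fg.
Qed.

Definition dm A x := forall i j, differentiable (fun z => A z i j) x.
Definition pdm k A x : 'M[R]_m := \matrix_(i, j) pd k (fun z => A z i j) x.

Lemma dm_mul A B x : dm A x -> dm B x -> dm (fun z => A z *m B z) x.
Proof.
move=> dA dB i j; under eq_fun do rewrite mxE; apply: differentiable_sum' => k.
exact: differentiableM.
Qed.

Lemma pdm_mul k A B x : dm A x -> dm B x ->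
  pdm k (fun z => A z *m B z) x = pdm k A x *m B x + A x *m pdm k B x.
Proof.
move=> dA dB; apply/matrixP => i j; rewrite !mxE.
under eq_fun do rewrite mxE; rewrite pd_sum; last by move=> l; exact: differentiableM.
by rewrite -big_split/=; apply: eq_bigr => l _; rewrite pdM// !mxE.
Qed.

Lemma pdm_near k A B x (U : set V) : open U -> U x -> (forall z, U z -> A z = B z) ->
  pdm k A x = pdm k B x.
Proof.
move=> oU Ux AB; apply/matrixP => i j; rewrite !mxE; apply: pd_near oU Ux _ => z Uz.
by rewrite AB.
Qed.

(** [Pi] stands for the inverse metric, [Om] for the symplectic matrix, and [POPO] encodes that the
    almost complex structure squares to -1. Derivatives are bounded only for [Pi], and only at the
    point [by0]; for [Om] such a bound is the goal, and its smoothness enters without constants. *)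
Record bdat := Bdat {
  Om : V -> 'M[R]_m ; Pi : V -> 'M[R]_m ; bU : set V ; by0 : V ;
  b_open : open bU ; b_in : bU by0 ;
  dOm : forall x, bU x -> dm Om x ; dPi : forall x, bU x -> dm Pi x ;
  ddOm : forall x k, bU x -> dm (pdm k Om) x ; ddPi : forall x k, bU x -> dm (pdm k Pi) x ;
  cddOm : forall k l i j, {for by0, continuous (pd k (pd l (fun z => Om z i j)))} ;
  OmT : forall x, bU x -> (Om x)^T = - Om x ;
  PiT : forall x, bU x -> (Pi x)^T = Pi x ;
  POPO : forall x, bU x -> Pi x *m Om x *m Pi x *m Om x = - 1%:M ;
  b_closed : forall x i j k, bU x ->
    pd i (fun z => Om z j k) x + pd j (fun z => Om z k i) x + pd k (fun z => Om z i j) x = 0 ;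
  Om_b : forall i j, `|Om by0 i j| <= kap ;
  Pi_b : forall i j, `|Pi by0 i j| <= kap ;
  dPi_b : forall k i j, `|pd k (fun z => Pi z i j) by0| <= kap ;
  ddPi_b : forall l k i j, `|pd l (pd k (fun z => Pi z i j)) by0| <= kap ;
  Pi_pos : forall v : 'rV_m, kap^-1 * (\sum_i v 0 i ^+ 2) <= (v *m Pi by0 *m v^T) 0 0
}.

Definition bM (d : bdat) : R :=
  Num.sqrt (\sum_k \sum_i \sum_j (pdm k (Om d) (by0 d) i j) ^+ 2).

Lemma bM_ge0 d : 0 <= bM d. Proof. exact: sqrtr_ge0. Qed.

Definition bounded (F : bdat -> R) := exists2 C, 0 <= C & forall d, `|F d| <= C.
(** Growth is measured against the unknown [bM], uniformly over all data. The estimate closes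
    because a quantity that dominates a multiple of [bM ^+ 2] turns out to be [lin]. *)
Definition lin (F : bdat -> R) := exists2 C, 0 <= C & forall d, `|F d| <= C * (1 + bM d).

Lemma bounded_lin F : bounded F -> lin F.
Proof.
move=> [C C0 H]; exists C => // d; apply: (le_trans (H d)).
by rewrite ler_peMr// lerDl bM_ge0.
Qed.

Lemma boundedM F G : bounded F -> bounded G -> bounded (fun d => F d * G d).
Proof.
move=> [C C0 HF] [D D0 HG]; exists (C * D); first exact: mulr_ge0.
by move=> d; rewrite normrM ler_pM.
Qed.

Lemma lin_boundedM F G : bounded F -> lin G -> lin (fun d => F d * G d).
Proof.
move=> [C C0 HF] [D D0 HG]; exists (C * D); first exact: mulr_ge0.
by move=> d; rewrite normrM -mulrA ler_pM.
Qed.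

Lemma linD F G : lin F -> lin G -> lin (fun d => F d + G d).
Proof.
move=> [C C0 HF] [D D0 HG]; exists (C + D); first exact: addr_ge0.
by move=> d; rewrite mulrDl; apply: (le_trans (ler_normD _ _)); exact: lerD.
Qed.

Lemma linN F : lin F -> lin (fun d => - F d).
Proof. by move=> [C C0 HF]; exists C => // d; rewrite normrN. Qed.

Lemma boundedD F G : bounded F -> bounded G -> bounded (fun d => F d + G d).
Proof.
move=> [C C0 HF] [D D0 HG]; exists (C + D); first exact: addr_ge0.
by move=> d; apply: (le_trans (ler_normD _ _)); exact: lerD.
Qed.

Lemma lin_cst c : lin (fun=> c).
Proof.
exists `|c| => // d; by rewrite ler_peMr// lerDl bM_ge0.
Qed.

Lemma bounded_cst c : bounded (fun=> c). Proof. by exists `|c|. Qed.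

Lemma lin_sum (I : Type) (r : seq I) (F : I -> bdat -> R) :
  (forall i, lin (F i)) -> lin (fun d => \sum_(i <- r) F i d).
Proof.
move=> lF; elim: r => [|i r IH].
  by under eq_fun do rewrite big_nil; exact: lin_cst.
by under eq_fun do rewrite big_cons; exact: linD.
Qed.

Lemma bounded_ext F G : F =1 G -> bounded F -> bounded G.
Proof. by move=> /funext ->. Qed.
Lemma lin_ext F G : F =1 G -> lin F -> lin G.
Proof. by move=> /funext ->. Qed.

(** The class of expressions in [Om], [Pi] and the first derivatives of [Pi]: no derivative of [Om]
    occurs, and one differentiation produces such derivatives only linearly. *)
Definition tame (F : bdat -> V -> R) :=
  [/\ forall d x, bU d x -> differentiable (F d) x,
      bounded (fun d => F d (by0 d)) & forall k, lin (fun d => pd k (F d) (by0 d))].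
Definition tamem (F : bdat -> V -> 'M[R]_m) := forall i j, tame (fun d x => F d x i j).

Lemma tameM F G : tame F -> tame G -> tame (fun d x => F d x * G d x).
Proof.
move=> [dF bF lF] [dG bG lG]; split.
- by move=> d x Ux; apply: differentiableM; [exact: dF|exact: dG].
- exact: boundedM.
- move=> k; apply: (@lin_ext (fun d => G d (by0 d) * pd k (F d) (by0 d) + F d (by0 d) * pd k (G d) (by0 d))).
    by move=> d; rewrite pdM; [rewrite [G _ _ * _]mulrC|exact: dF (b_in d)|exact: dG (b_in d)].
  by apply: linD; apply: lin_boundedM.
Qed.

Lemma tameD F G : tame F -> tame G -> tame (fun d x => F d x + G d x).
Proof.
move=> [dF bF lF] [dG bG lG]; split.
- by move=> d x Ux; apply: differentiableD; [exact: dF|exact: dG].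
- exact: boundedD.
- move=> k; apply: (@lin_ext (fun d => pd k (F d) (by0 d) + pd k (G d) (by0 d))).
    by move=> d; rewrite pdD; [|exact: dF (b_in d)|exact: dG (b_in d)].
  exact: linD.
Qed.

Lemma tame_cst c : tame (fun _ _ => c).
Proof.
split=> [d x _||k]; [exact: differentiable_cst|exact: bounded_cst|].
by apply: (@lin_ext (fun=> 0)); [move=> d; rewrite pd_cst|exact: lin_cst].
Qed.

Lemma tame_sum (I : Type) (r : seq I) (F : I -> bdat -> V -> R) :
  (forall i, tame (F i)) -> tame (fun d x => \sum_(i <- r) F i d x).
Proof.
move=> tF; elim: r => [|i r IH].
  rewrite (_ : (fun _ _ => _) = (fun _ _ => 0)); first exact: tame_cst.
  by apply/funext => d; apply/funext => x; rewrite big_nil.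
rewrite (_ : (fun _ _ => _) = (fun d x => F i d x + \sum_(j <- r) F j d x)); first exact: tameD.
by apply/funext => d; apply/funext => x; rewrite big_cons.
Qed.

Lemma tame_ext F G : (forall d x, bU d x -> F d x = G d x) -> tame F -> tame G.
Proof.
move=> FG [dF bF lF]; split.
- move=> d x Ux; apply: (@dif_near _ _ _ (F d) (G d) x (bU d) (@b_open d) Ux (FG d)).
  exact: dF.
- by apply: bounded_ext bF => d; apply: FG; exact: b_in.
- move=> k; apply: lin_ext (lF k) => d; apply: (pd_near _ (@b_open d) (b_in d)).
  exact: FG.
Qed.

Lemma tamem_mul F G : tamem F -> tamem G -> tamem (fun d x => F d x *m G d x).
Proof.
move=> tF tG i j.
rewrite (_ : (fun _ _ => _) = (fun d x => \sum_k F d x i k * G d x k j)).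
  by apply: tame_sum => k; exact: tameM.
by apply/funext => d; apply/funext => x; rewrite mxE.
Qed.

Lemma tamem_add F G : tamem F -> tamem G -> tamem (fun d x => F d x + G d x).
Proof.
move=> tF tG i j.
rewrite (_ : (fun _ _ => _) = (fun d x => F d x i j + G d x i j)).
  exact: tameD.
by apply/funext => d; apply/funext => x; rewrite mxE.
Qed.

Lemma tame_tr F : tamem F -> tame (fun d x => \tr (F d x)).
Proof. by move=> tF; apply: tame_sum. Qed.

Lemma lin_pdOm k i j : lin (fun d => pd k (fun z => Om d z i j) (by0 d)).
Proof.
exists 1 => // d; rewrite mul1r.
apply: (@le_trans _ _ (bM d)); last by rewrite lerDr.
rewrite -sqrtr_sqr /bM ler_wsqrtr// (bigD1 k)//= ler_wpDr//.
  by do 3! apply: sumr_ge0 => ? _; exact: sqr_ge0.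
rewrite (bigD1 i)//= ler_wpDr//; first by do 2! apply: sumr_ge0 => ? _; exact: sqr_ge0.
by rewrite (bigD1 j)//= mxE ler_wpDr//; apply: sumr_ge0 => ? _; exact: sqr_ge0.
Qed.

Lemma tame_Om : tamem Om.
Proof.
move=> i j; split=> [d x Ux||k]; [exact: dOm| |exact: lin_pdOm].
exists kap; [exact: le_trans ler01 kap1|by move=> d; exact: Om_b].
Qed.

Lemma tame_Pi : tamem Pi.
Proof.
have k0 : 0 <= kap by exact: le_trans ler01 kap1.
move=> i j; split=> [d x Ux||k]; first exact: dPi.
  by exists kap => // d; exact: Pi_b.
by apply: bounded_lin; exists kap => // d; exact: dPi_b.
Qed.

Lemma tame_dPi k : tamem (fun d => pdm k (Pi d)).
Proof.
have k0 : 0 <= kap by exact: le_trans ler01 kap1.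
move=> i j; split=> [d x Ux||l].
- by apply: ddPi.
- by exists kap => // d; rewrite mxE; exact: dPi_b.
- apply: bounded_lin; exists kap => // d.
  by under eq_fun do rewrite mxE; exact: ddPi_b.
Qed.

(** Minus the inverse of [Om], as [OmTh] shows, in a form that can be differentiated by the product
    rule. *)
Definition Th d x := Pi d x *m Om d x *m Pi d x.
Definition bq k d x := \tr (pdm k (Pi d) x *m Om d x *m Pi d x *m Om d x).

Lemma tame_Th : tamem Th.
Proof.
by apply: tamem_mul tame_Pi; apply: tamem_mul; [exact: tame_Pi|exact: tame_Om].
Qed.

Lemma tame_q k : tame (bq k).
Proof.
apply: tame_tr; apply: tamem_mul tame_Om; apply: tamem_mul tame_Pi.
by apply: tamem_mul tame_Om; exact: tame_dPi.
Qed.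

Lemma dm_Th d x : bU d x -> dm (Th d) x.
Proof.
move=> Ux; apply: dm_mul (dPi Ux); apply: dm_mul; [exact: dPi|exact: dOm].
Qed.

Lemma ThT d x : bU d x -> (Th d x)^T = - Th d x.
Proof.
by move=> Ux; rewrite !trmx_mul OmT// !PiT// mulNmx mulmxN mulmxA.
Qed.

Lemma OmTh d x : bU d x -> Om d x *m Th d x = - 1%:M.
Proof.
move=> /POPO; rewrite -!mulmxA => E; apply/oppr_inj; rewrite opprK -mulmxN.
rewrite /Th -mulmxN !mulmxA mulmxN -mulNmx; apply: mulmx1C.
by rewrite mulmxN !mulmxA in E *; rewrite E opprK.
Qed.

(** Trace of the derivative of [(Pi Om)^2 = -1]. By cyclicity the four terms are equal in pairs, so
    this contraction of [d Om] is expressed by derivatives of [Pi] alone. *)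
Lemma tr_Th_dOm k d x : bU d x -> \tr (Th d x *m pdm k (Om d) x) = - bq k d x.
Proof.
move=> Ux.
have dP := dPi Ux; have dO := dOm Ux.
have dPO : dm (fun z => Pi d z *m Om d z) x by exact: dm_mul.
have dPOP : dm (fun z => Pi d z *m Om d z *m Pi d z) x by exact: dm_mul.
have : pdm k (fun z => Pi d z *m Om d z *m Pi d z *m Om d z) x = 0.
  rewrite (@pdm_near _ _ (fun=> - 1%:M) _ _ (@b_open d) Ux); last by move=> z; exact: POPO.
  by apply/matrixP => i j; rewrite !mxE pd_cst.
rewrite !pdm_mul// => /(congr1 mxtrace); rewrite !mulmxDl !linearD /= linear0.
rewrite -/(bq k d x) -/(Th d x).
have -> : \tr (Pi d x *m pdm k (Om d) x *m Pi d x *m Om d x) = \tr (Th d x *m pdm k (Om d) x).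
  by rewrite -mulmxA mxtrace_mulC !mulmxA.
have -> : \tr (Pi d x *m Om d x *m pdm k (Pi d) x *m Om d x) = bq k d x.
  by rewrite -mulmxA mxtrace_mulC !mulmxA.
move: (\tr _) (bq _ _ _) => a b; lra.
Qed.

Lemma pd_OmN k d x i j : bU d x -> pd k (fun z => Om d z i j) x = - pd k (fun z => Om d z j i) x.
Proof.
move=> Ux; rewrite (@pd_near _ (fun z => Om d z i j) (fun z => - Om d z j i) _ _ (@b_open d) Ux).
  by rewrite /pd deriveN//; apply: diff_derivable; exact: dOm.
by move=> z /OmT/matrixP/(_ j i); rewrite !mxE.
Qed.

Lemma sum_Th_dOm k d x : bU d x ->
  \sum_i \sum_j Th d x i j * pd k (fun z => Om d z i j) x = bq k d x.
Proof.
move=> Ux; apply/oppr_inj; rewrite -tr_Th_dOm// -sumrN; apply: eq_bigr => i _.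
rewrite mxE -sumrN; apply: eq_bigr => j _.
by rewrite (pd_OmN k i j Ux) [pdm _ _ _ _ _]mxE mulrN opprK.
Qed.

Lemma ThN d x i j : bU d x -> Th d x i j = - Th d x j i.
Proof. by move=> /ThT/matrixP/(_ j i); rewrite !mxE. Qed.

(** Contracting the closedness relation with the antisymmetric [Th] shows that twice this sum plus
    [bq i] vanishes. *)
Lemma contraction i d x : bU d x ->
  \sum_j \sum_k Th d x j k * pd j (fun z => Om d z k i) x = - 2^-1 * bq i d x.
Proof.
move=> Ux.
set T := LHS.
have E : bq i d x + T + T = 0.
  have T' : T = \sum_j \sum_k Th d x k j * pd k (fun z => Om d z j i) x.
    by rewrite /T exchange_big.
  rewrite -sum_Th_dOm// {2}T' /T -!big_split/=; apply: big1 => j _.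
  rewrite -!big_split/=; apply: big1 => k _.
  rewrite (ThN k j Ux) (pd_OmN k j i Ux) mulrNN -!mulrDr.
  by rewrite b_closed// mulr0.
by move: E; move: T (bq _ _ _) => T q; lra.
Qed.

Definition bZ d x : 'rV[R]_m := \row_k \sum_j pd j (fun z => Th d z j k) x.

(** Differentiating [Th Om = -1] converts the divergence of [Th] into the sum of [contraction],
    which is free of derivatives of [Om]. *)
Lemma bZE d x : bU d x -> bZ d x = - 2^-1 *: ((\row_i bq i d x) *m Th d x).
Proof.
move=> Ux.
have E : bZ d x *m Om d x = 2^-1 *: \row_i bq i d x.
  apply/rowP => i; rewrite !mxE; apply: (@addIr _ (- 2^-1 * bq i d x)).
  rewrite mulNr subrr -mulNr -contraction// .
  under eq_bigr do rewrite mxE mulr_suml.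
  rewrite exchange_big/= -big_split/=; apply: big1 => j _.
  transitivity (pd j (fun z => (Th d z *m Om d z) j i) x).
    have -> : (fun z => (Th d z *m Om d z) j i) = (fun z => \sum_k Th d z j k * Om d z k i).
      by apply/funext => z; rewrite mxE.
    rewrite pd_sum; last by move=> k; apply: differentiableM; [exact: dm_Th|exact: dOm].
    rewrite -big_split/=; apply: eq_bigr => k _.
    by rewrite pdM; [|exact: dm_Th|exact: dOm].
  rewrite (@pd_near _ _ (fun=> (- 1%:M : 'M[R]_m) j i) _ _ (@b_open d) Ux) ?pd_cst//.
  by move=> z Uz; rewrite POPO.
by rewrite scaleNr scalemxAl -E -mulmxA OmTh// mulmxN mulmx1 opprK.
Qed.

Definition bE d x : 'rV[R]_m :=
  \row_k \sum_j (pdm j (Pi d) x *m Om d x *m Pi d x + Pi d x *m Om d x *m pdm j (Pi d) x) j k.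

(** The leading part of the codifferential of the 2-form [Om]. An almost Kaehler form is coclosed;
    [bYE] is the coordinate version of this fact and leaves only terms without derivatives of
    [Om]. *)
Definition bY d x : 'rV[R]_m :=
  \row_k \sum_a \sum_b Pi d x a b * pd a (fun z => Om d z b k) x.

Lemma bYE d x : bU d x ->
  bY d x = - ((bZ d x - bE d x) *m (Om d x *m Pi d x *m Om d x)).
Proof.
move=> Ux.
have dP := dPi Ux; have dO := dOm Ux.
have dPO : dm (fun z => Pi d z *m Om d z) x by exact: dm_mul.
have E : bY d x *m Pi d x = bZ d x - bE d x.
  apply/rowP => k; rewrite !mxE -sumrB.
  under eq_bigr do rewrite mxE mulr_suml.
  rewrite exchange_big/=; apply: eq_bigr => j _.
  have -> : pd j (fun z => Th d z j k) x = pdm j (Th d) x j k by rewrite mxE.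
  rewrite /Th !pdm_mul// mulmxDl !mxE.
  have E3 (a b c : R) : a + b + c - (a + c) = b by lra.
  rewrite E3; apply: eq_bigr => l _; rewrite [(_ *m _) _ _]mxE; congr (_ * _).
  by apply: eq_bigr => b _; rewrite mxE.
have E' : Pi d x *m (Om d x *m Pi d x *m Om d x) = - 1%:M by rewrite !mulmxA POPO.
by rewrite -E -mulmxA E' mulmxN mulmx1 opprK.
Qed.

(** By [bYE] the expression contains no derivative of [Om]. Its derivative is then linear in [d Om],
    although by definition it consists of second derivatives; [lin_S] relies on this gain. *)
Lemma tame_Y k : tame (fun d x => bY d x 0 k).
Proof.
apply: (@tame_ext (fun d x => -1 * \sum_i ((- 2^-1 * (\sum_j bq j d x * Th d x j i) +
   -1 * (\sum_j (pdm j (Pi d) x *m Om d x *m Pi d x + Pi d x *m Om d x *m pdm j (Pi d) x) j i))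
   * (Om d x *m Pi d x *m Om d x) i k))).
  move=> d x Ux; rewrite bYE// bZE// !mxE mulN1r; congr (- _).
  apply: eq_bigr => i _; rewrite !mxE mulN1r; congr ((_ - _) * _).
  by congr (_ * _); apply: eq_bigr => j _; rewrite [X in _ = X * _]mxE.
have tO := tame_Om; have tP := tame_Pi; have tT := tame_Th; have tq := tame_q.
have tdP := tame_dPi.
apply: tameM; first exact: tame_cst.
apply: tame_sum => i; apply: tameM.
  apply: tameD; apply: tameM; try exact: tame_cst.
    by apply: tame_sum => j; apply: tameM.
  apply: tame_sum => j; apply: tamem_add.
    by apply: tamem_mul tP; apply: tamem_mul tO; exact: tdP.
  by apply: tamem_mul (tdP j); apply: tamem_mul tO.
by apply: tamem_mul => //; exact: tamem_mul.
Qed.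

(** The squared norm of the first derivatives of [Om], with all three indices contracted by the
    inverse metric. *)
Definition bS d :=
  \sum_a \sum_b Pi d (by0 d) a b * (\sum_j \sum_k
    (Pi d (by0 d) *m pdm a (Om d) (by0 d) *m Pi d (by0 d)) j k * pdm b (Om d) (by0 d) j k).

Lemma antisym_sum (T A : 'I_m -> 'I_m -> R) : (forall j k, T j k = - T k j) ->
  \sum_j \sum_k T j k * (A j k - A k j) = 2 * \sum_j \sum_k T j k * A j k.
Proof.
move=> Ta; under eq_bigr do under eq_bigr do rewrite mulrBr.
under eq_bigr do rewrite sumrB.
rewrite sumrB [X in _ - X]exchange_big/= mulr2n mulrDl mul1r; congr (_ + _).
rewrite -sumrN; apply: eq_bigr => j _; rewrite -sumrN; apply: eq_bigr => k _.
by rewrite Ta mulNr opprK.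
Qed.

Lemma sum4_rearr (T P : 'M[R]_m) (Q : 'I_m -> 'I_m -> 'I_m -> 'I_m -> R) :
  2 * \sum_j \sum_k T j k * (\sum_a \sum_b P a b * Q a b j k) =
  \sum_a \sum_b P a b * (2 * \sum_j \sum_k T j k * Q a b j k).
Proof.
under [RHS]eq_bigr do under eq_bigr do rewrite mulrCA.
under [RHS]eq_bigr do rewrite -mulr_sumr.
rewrite -[RHS]mulr_sumr; congr (_ * _).
under [RHS]eq_bigr do under eq_bigr do rewrite mulr_sumr.
under [RHS]eq_bigr do rewrite exchange_big/=.
rewrite [RHS]exchange_big/=; apply: eq_bigr => j _.
under [RHS]eq_bigr do under eq_bigr do rewrite mulr_sumr.
under [RHS]eq_bigr do rewrite exchange_big/=.
rewrite [RHS]exchange_big/=; apply: eq_bigr => k _.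
rewrite mulr_sumr; apply: eq_bigr => a _; rewrite mulr_sumr; apply: eq_bigr => b _.
by rewrite mulrCA.
Qed.

(** The operator [sum Pi_ab d_a] is applied to the identity [sum_Th_dOm] for index [b].
    Differentiating [Th] yields [bS] and the terms [F1] with derivatives of [Pi]; the second
    derivatives of [Om] are collected in [B]; the other side is a derivative of the tame [bq]. *)
Lemma lin_S : lin bS.
Proof.
have lD k i j : lin (fun d => pdm k (Om d) (by0 d) i j).
  by apply: lin_ext (lin_pdOm k i j) => d; rewrite mxE.
have bT i j : bounded (fun d => Th d (by0 d) i j) by have [] := tame_Th i j.
have bP i j : bounded (fun d => Pi d (by0 d) i j) by have [] := tame_Pi i j.
have bdP a i j : bounded (fun d => pdm a (Pi d) (by0 d) i j) by have [] := tame_dPi a i j.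
pose F1 d := \sum_a \sum_b Pi d (by0 d) a b * (\sum_j \sum_k
  ((pdm a (Pi d) (by0 d) *m Om d (by0 d) *m Pi d (by0 d)
    + Pi d (by0 d) *m Om d (by0 d) *m pdm a (Pi d) (by0 d)) j k * pdm b (Om d) (by0 d) j k)).
pose B d := \sum_a \sum_b Pi d (by0 d) a b * (\sum_j \sum_k
  Th d (by0 d) j k * pd a (pd b (fun z => Om d z j k)) (by0 d)).
have lF1 : lin F1.
  apply: lin_sum => a; apply: lin_sum => b; apply: lin_boundedM => //.
  apply: lin_sum => j; apply: lin_sum => k; apply: lin_boundedM => //.
  have tdP := tame_dPi a.
  have [//] : tame (fun d x => (pdm a (Pi d) x *m Om d x *m Pi d x
    + Pi d x *m Om d x *m pdm a (Pi d) x) j k).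
  move: j k; apply: tamem_add.
    by apply: tamem_mul tame_Pi; apply: tamem_mul tame_Om.
  by apply: tamem_mul tdP; apply: tamem_mul tame_Om; exact: tame_Pi.
(* Closedness replaces [d_b Om_jk] by derivatives of [Om_bk] and [Om_bj]. After exchanging the two
   derivatives, [d_j] of the codifferential [bY] appears, up to terms that are linear in [d Om]. *)
have lB : lin B.
  apply: (@lin_ext (fun d => 2 * \sum_j \sum_k Th d (by0 d) j k *
    (pd j (fun x => bY d x 0 k) (by0 d) -
     \sum_a \sum_b pdm j (Pi d) (by0 d) a b * pdm a (Om d) (by0 d) b k))); last first.
    apply: lin_boundedM; first exact: bounded_cst.
    apply: lin_sum => j; apply: lin_sum => k; apply: lin_boundedM => //.
    apply: linD; first by have [_ _] := tame_Y k; apply.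
    by apply: linN; apply: lin_sum => a; apply: lin_sum => b; apply: lin_boundedM.
  move=> d; have Uy := b_in d; set y := by0 d.
  have ddO b j k : differentiable (pd b (fun z => Om d z j k)) y.
    have := ddOm b Uy j k; congr (differentiable _ _).
    by apply/funext => z; rewrite mxE.
  have SW a b j k : pd j (pd a (fun z => Om d z b k)) y = pd a (pd j (fun z => Om d z b k)) y.
    apply: (@schwarz R V (fun z => Om d z b k) (bU d)) => //; first exact: b_open.
    - by move=> z Uz; apply: diff_derivable; exact: dOm.
    - by move=> z Uz; apply: diff_derivable; exact: dOm.
    - move=> z Uz; apply: diff_derivable; have := ddOm a Uz b k.
      by congr (differentiable _ _); apply/funext => t; rewrite mxE.
    - move=> z Uz; apply: diff_derivable; have := ddOm j Uz b k.
      by congr (differentiable _ _); apply/funext => t; rewrite mxE.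
    - exact: cddOm.
    - exact: cddOm.
  have E1 a b : \sum_j \sum_k Th d y j k * pd a (pd b (fun z => Om d z j k)) y
      = 2 * \sum_j \sum_k Th d y j k * pd a (pd j (fun z => Om d z b k)) y.
    have E2 j k : pd a (pd b (fun z => Om d z j k)) y =
        pd a (pd j (fun z => Om d z b k)) y - pd a (pd k (fun z => Om d z b j)) y.
      rewrite (@pd_near _ _ (fun x => pd j (fun z => Om d z b k) x - pd k (fun z => Om d z b j) x) _ _ (@b_open d) Uy).
        by rewrite pdB//; exact: ddO.
      move=> z Uz; rewrite (pd_OmN _ b k Uz) .
      by have := b_closed b j k Uz; move: (pd b _ z) (pd j _ z) (pd k _ z) => p q r; lra.
    rewrite -(@antisym_sum (Th d y) (fun j k => pd a (pd j (fun z => Om d z b k)) y)).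
      by apply: eq_bigr => j _; apply: eq_bigr => k _; rewrite E2.
    by move=> j k; exact: ThN.
  have E3 j k : pd j (fun x => bY d x 0 k) y =
      \sum_a \sum_b pdm j (Pi d) y a b * pdm a (Om d) y b k
      + \sum_a \sum_b Pi d y a b * pd j (pd a (fun z => Om d z b k)) y.
    have -> : (fun x => bY d x 0 k) = (fun x => \sum_a \sum_b Pi d x a b * pd a (fun z => Om d z b k) x).
      by apply/funext => x; rewrite mxE.
    have dd a b : differentiable (fun x => Pi d x a b * pd a (fun z => Om d z b k) x) y.
      by apply: differentiableM; [exact: dPi|exact: ddO].
    rewrite pd_sum; last by move=> a; exact: differentiable_sum'.
    rewrite -big_split/=; apply: eq_bigr => a _.
    rewrite pd_sum// -big_split/=; apply: eq_bigr => b _.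
    by rewrite pdM ?mxE//; exact: dPi.
  transitivity (2 * \sum_j \sum_k Th d y j k *
      \sum_a \sum_b Pi d y a b * pd j (pd a (fun z => Om d z b k)) y).
    congr (_ * _); apply: eq_bigr => j _; apply: eq_bigr => k _; congr (_ * _).
    by rewrite E3 addrAC subrr add0r.
  rewrite (sum4_rearr (Th d y) (Pi d y) (fun a b j k => pd j (pd a (fun z => Om d z b k)) y)).
  rewrite /B; apply: eq_bigr => a _; apply: eq_bigr => b _; congr (_ * _).
  apply: (etrans _ (esym (E1 a b))).
  apply: (congr1 (fun t => 2 * t)); apply: eq_bigr => j _; apply: eq_bigr => k _.
  exact: (congr1 (fun t => Th d y j k * t) (SW a b j k)).
apply: (@lin_ext (fun d => (\sum_a \sum_b Pi d (by0 d) a b * pd a (bq b d) (by0 d)) - F1 d - B d)); last first.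
  apply: linD; last exact: linN.
  apply: linD; last exact: linN.
  apply: lin_sum => a; apply: lin_sum => b; apply: lin_boundedM => //.
  by have [_ _] := tame_q b; apply.
move=> d; have Uy := b_in d; set y := by0 d.
apply/eqP; rewrite subr_eq subr_eq; apply/eqP; rewrite /bS /F1 /B -!big_split/=.
apply: eq_bigr => a _; rewrite -!big_split/=; apply: eq_bigr => b _.
rewrite -!mulrDr; congr (_ * _).
have ddO j k : differentiable (pd b (fun z => Om d z j k)) y.
  have := ddOm b Uy j k; congr (differentiable _ _).
  by apply/funext => z; rewrite mxE.
rewrite -(@pd_near _ (fun x => \sum_j \sum_k Th d x j k * pd b (fun z => Om d z j k) x) _ _ _ (@b_open d) Uy); last first.
  by move=> z Uz; rewrite sum_Th_dOm.
have dd j k : differentiable (fun x => Th d x j k * pd b (fun z => Om d z j k) x) y.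
  by apply: differentiableM => //; exact: dm_Th.
rewrite pd_sum; last by move=> j; exact: differentiable_sum'.
rewrite -!big_split/=; apply: eq_bigr => j _; rewrite pd_sum// -!big_split/=.
apply: eq_bigr => k _; rewrite pdM//; last exact: dm_Th.
rewrite addrAC -mulrDl [pdm b _ _ _ _]mxE; congr (_ + _); apply: (congr1 (fun t => t * _)).
have -> : pd a (fun z => Th d z j k) y = pdm a (Th d) y j k by rewrite mxE.
have dP := dPi Uy; have dO := dOm Uy.
have dPO : dm (fun z => Pi d z *m Om d z) y by exact: dm_mul.
rewrite /Th !pdm_mul// mulmxDl; move: (_ *m _ *m _) (_ *m _ *m _) (_ *m _ *m _) => X Y Z.
by rewrite !mxE addrA; congr (_ + _); rewrite addrC.
Qed.

Lemma exchange_big3 (F : 'I_m -> 'I_m -> 'I_m -> R) :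
  \sum_l \sum_j \sum_i F l i j = \sum_i \sum_j \sum_l F l i j.
Proof.
rewrite exchange_big/=; under eq_bigr do rewrite exchange_big/=.
by rewrite exchange_big.
Qed.

Lemma gram_sum (T : 'I_m -> 'I_m -> R) (L : 'M[R]_m) :
  \sum_a \sum_b (\sum_l L a l * L b l) * T a b = \sum_l \sum_a \sum_b L a l * L b l * T a b.
Proof.
under eq_bigr do under eq_bigr do rewrite mulr_suml.
under eq_bigr do rewrite exchange_big/=.
by rewrite exchange_big.
Qed.

(** Factoring [Pi = L L^T] on the index of differentiation makes [bS] a sum of traces
    [tr (P F^T P F)]. Each is bounded by [tr_conj_ge], which gives two factors [kap^-1]; the third
    comes from the index of differentiation. *)
Lemma bS_ge d : kap^-1 ^+ 3 * bM d ^+ 2 <= bS d.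
Proof.
have kap0 : 0 < kap by exact: lt_le_trans ltr01 kap1.
have c0 : 0 < kap^-1 by rewrite invr_gt0.
have Uy := b_in d; set y := by0 d; set P := Pi d y; set c := kap^-1.
have Psym : P^T = P by exact: PiT.
have Pc (x : 'rV[R]_m) : c * (\sum_i x 0 i ^+ 2) <= (x *m P *m x^T) 0 0 by exact: Pi_pos.
have Ppos (x : 'rV[R]_m) : x != 0 -> 0 < (x *m P *m x^T) 0 0.
  move=> x0; apply: lt_le_trans (Pc x); rewrite mulr_gt0// lt_neqAle sumr_ge0 ?andbT; last first.
    by move=> i _; exact: sqr_ge0.
  apply: contra x0; rewrite eq_sym psumr_eq0; last by move=> i _; exact: sqr_ge0.
  move=> /allP x0; apply/eqP/rowP => i; rewrite mxE; apply/eqP.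
  by have := x0 i (mem_index_enum i); rewrite /= sqrf_eq0.
have [L PE] := gram Psym Ppos.
set D := fun a => pdm a (Om d) y.
have [F FE] : exists F : 'I_m -> 'M[R]_m, forall l, F l = \sum_a L a l *: D a by eexists.
have -> : bS d = \sum_l \tr (P *m (F l)^T *m P *m F l).
  rewrite /bS -/y -/P.
  transitivity (\sum_a \sum_b (\sum_l L a l * L b l) * \tr (P *m (D a)^T *m P *m D b)).
    apply: eq_bigr => a _; apply: eq_bigr => b _; rewrite [in P a b]PE mxE; congr (_ * _).
      by apply: eq_bigr => l _; rewrite mxE.
    have -> : P *m (D a)^T *m P = (P *m D a *m P)^T by rewrite !trmx_mul Psym mulmxA.
    by rewrite exchange_big/=; apply: eq_bigr => j _; rewrite [RHS]mxE; apply: eq_bigr => k _; rewrite [_^T _ _]mxE.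
  transitivity (\sum_l \sum_a \sum_b L a l * L b l * \tr (P *m (D a)^T *m P *m D b)).
    exact: gram_sum.
  apply: eq_bigr => l _.
  have FT : (F l)^T = \sum_a L a l *: (D a)^T.
    by apply/matrixP => i j; rewrite FE mxE !summxE; apply: eq_bigr => a _; rewrite !mxE.
  rewrite FT mulmx_sumr !mulmx_suml raddf_sum; apply: eq_bigr => a _.
  rewrite FE mulmx_sumr raddf_sum; apply: eq_bigr => b _.
  rewrite -[RHS]/(\tr (P *m (L a l *: (D a)^T) *m P *m (L b l *: D b))).
  rewrite -!scalemxAr -!scalemxAl -?scalemxAr mxtraceZ mxtraceZ mulrA.
  by rewrite [L b l * _]mulrC.
have -> : kap^-1 ^+ 3 * bM d ^+ 2 = c ^+ 2 * (c * \sum_i \sum_j \sum_a D a i j ^+ 2).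
  rewrite mulrA -exprSr; congr (_ * _); rewrite sqr_sqrtr; last first.
    by do 3! apply: sumr_ge0 => ? _; exact: sqr_ge0.
  rewrite exchange_big/=; apply: eq_bigr => i _; rewrite exchange_big/=.
  by apply: eq_bigr.
apply: (@le_trans _ _ (c ^+ 2 * \sum_l \tr ((F l)^T *m F l))); last first.
  by rewrite mulr_sumr; apply: ler_sum => l _; apply: tr_conj_ge => //; exact: ltW.
rewrite ler_pM2l; last by rewrite exprn_gt0.
have -> : \sum_l \tr ((F l)^T *m F l) = \sum_i \sum_j \sum_l F l i j ^+ 2.
  by rewrite -exchange_big3; apply: eq_bigr => l _; rewrite mulmx_tr_sqr.
rewrite mulr_sumr; apply: ler_sum => i _; rewrite mulr_sumr; apply: ler_sum => j _.
have := Pc (\row_a D a i j); under eq_bigr do rewrite mxE.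
move=> /le_trans; apply; rewrite PE mulmxA -mulmxA -[L^T]trmxK -trmx_mul.
rewrite trmxK mxE; apply: ler_sum => l _.
rewrite [(_ ^T) _ _]mxE -expr2 FE summxE; set a := (X in X ^+ 2 <= _).
have -> // : a = \sum_k (L k l *: D k) i j.
by rewrite /a mxE; apply: eq_bigr => k _; rewrite !mxE mulrC.
Qed.

Theorem bochner : exists2 C, 0 <= C & forall (d : bdat) k i j,
  `|pd k (fun z => Om d z i j) (by0 d)| <= C.
Proof.
have kap0 : 0 < kap by exact: lt_le_trans ltr01 kap1.
have [C C0 HS] := lin_S; pose c := kap^-1 ^+ 3.
have c0 : 0 < c by rewrite exprn_gt0// invr_gt0.
exists (1 + 2 * C / c) => [|d k i j]; first by apply: addr_ge0 => //; apply: divr_ge0; [exact: mulr_ge0|exact: ltW].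
apply: (@le_trans _ _ (bM d)).
  rewrite -sqrtr_sqr /bM ler_wsqrtr// (bigD1 k)//= ler_wpDr//.
    by do 3! apply: sumr_ge0 => ? _; exact: sqr_ge0.
  rewrite (bigD1 i)//= ler_wpDr//; first by do 2! apply: sumr_ge0 => ? _; exact: sqr_ge0.
  by rewrite (bigD1 j)//= mxE ler_wpDr//; apply: sumr_ge0 => ? _; exact: sqr_ge0.
(* For [M > 1] the inequality [c M^2 <= C (1 + M) <= 2 C M] gives [M <= 2 C / c]. *)
have [M1|M1] := leP (bM d) 1; first by apply: ler_wpDr => //; apply: divr_ge0; [exact: mulr_ge0|exact: ltW].
rewrite ler_wpDl// ler_pdivlMr//.
have := le_trans (bS_ge d) (le_trans (ler_norm _) (HS d)); rewrite -/c.
move: (bM d) M1 => M M1 H.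
rewrite -(@ler_pM2l _ M); last by lra.
have : C * M >= C by rewrite ler_peMr// ltW.
rewrite expr2 in H; nra.
Qed.

End Bochner.

(** * Energy concentration on a square *)

Section C1.
Context {R : realType} {V : normedModType R} (e1 e2 : V).
Implicit Types (f g : V -> R) (z : V) (O : set V).

Definition C1 O f := forall z, O z ->
  [/\ differentiable f z, {for z, continuous ('D_e1 f)} & {for z, continuous ('D_e2 f)}].

Lemma C1_eq O f g : open O -> (forall z, O z -> f z = g z) -> C1 O f -> C1 O g.
Proof.
move=> oO fg Hf z Oz; have [df cs ct] := Hf z Oz; split.
- by apply: (dif_near oO Oz fg).
- by apply: (cont_near oO Oz _ cs) => w Ow; apply/esym/(derive_near _ oO Ow).
- by apply: (cont_near oO Oz _ ct) => w Ow; apply/esym/(derive_near _ oO Ow).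
Qed.

Lemma C1_cst O (k : R) : C1 O (fun=> k).
Proof.
move=> z Oz; split; first exact: differentiable_cst.
- by rewrite (_ : 'D_e1 _ = cst 0); [exact: cvg_cst|apply/funext => w; exact: derive_cst].
- by rewrite (_ : 'D_e2 _ = cst 0); [exact: cvg_cst|apply/funext => w; exact: derive_cst].
Qed.

Lemma C1D O f g : open O -> C1 O f -> C1 O g -> C1 O (fun z => f z + g z).
Proof.
move=> oO Hf Hg z Oz; have [df fs ft] := Hf z Oz; have [dg gs gt] := Hg z Oz.
have E v w : O w -> 'D_v (fun z => f z + g z) w = 'D_v f w + 'D_v g w.
  by move=> Ow; have [? _ _] := Hf w Ow; have [? _ _] := Hg w Ow; exact: derive_add.
split; first exact: differentiableD.
- by apply: (cont_near oO Oz (E e1)); exact: (cvgD fs gs).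
- by apply: (cont_near oO Oz (E e2)); exact: (cvgD ft gt).
Qed.

Lemma C1M O f g : open O -> C1 O f -> C1 O g -> C1 O (fun z => f z * g z).
Proof.
move=> oO Hf Hg z Oz; have [df fs ft] := Hf z Oz; have [dg gs gt] := Hg z Oz.
have cf := differentiable_continuous df; have cg := differentiable_continuous dg.
have E v w : O w -> 'D_v (fun z => f z * g z) w = f w * 'D_v g w + g w * 'D_v f w.
  by move=> Ow; have [? _ _] := Hf w Ow; have [? _ _] := Hg w Ow; exact: derive_mul.
split; first exact: differentiableM.
- by apply: (cont_near oO Oz (E e1)); exact: (cvgD (cvgM cf gs) (cvgM cg fs)).
- by apply: (cont_near oO Oz (E e2)); exact: (cvgD (cvgM cf gt) (cvgM cg ft)).
Qed.

Lemma C1_sum O (I : Type) (r : seq I) (F : I -> V -> R) : open O ->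
  (forall i, C1 O (F i)) -> C1 O (fun z => \sum_(i <- r) F i z).
Proof.
move=> oO HF; elim: r => [|i r IH].
  by under eq_fun do rewrite big_nil; exact: C1_cst.
by under eq_fun do rewrite big_cons; exact: C1D.
Qed.

Lemma C1_comp O f (phi dphi : R -> R) : open O -> C1 O f ->
  (forall z, O z -> is_derive (f z) 1 phi (dphi (f z))) ->
  (forall z, O z -> {for f z, continuous dphi}) -> C1 O (fun z => phi (f z)).
Proof.
move=> oO Hf dphiE cdphi z Oz; have [df fs ft] := Hf z Oz.
have E v w : O w -> 'D_v (fun z => phi (f z)) w = dphi (f w) * 'D_v f w.
  by move=> Ow; have [dfw _ _] := Hf w Ow; exact: derive_comp1 dfw (dphiE w Ow).
have cc : {for z, continuous (fun z => dphi (f z))}.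
  by apply: continuous_comp; [exact: differentiable_continuous|exact: cdphi].
split.
- apply: differentiable_comp => //; apply/derivable1_diffP.
  by have := dphiE z Oz => -[].
- by apply: (cont_near oO Oz (E e1)); exact: (cvgM cc fs).
- by apply: (cont_near oO Oz (E e2)); exact: (cvgM cc ft).
Qed.

(** The open sets [O] and the complement of [F] cover the space; the extended function is [f] on the
    first and zero on the second. *)
Lemma C1_glue O (F : set V) f : open O -> closed F -> F `<=` O ->
  (forall z, O z -> ~ F z -> f z = 0) -> C1 O f ->
  C1 setT (fun z => if z \in O then f z else 0).
Proof.
move=> oO cF FO f0 Hf z _; have [Oz|nOz] := pselect (O z).
  have : C1 O (fun z => if z \in O then f z else 0).
    by apply: C1_eq oO _ Hf => w Ow; rewrite mem_set.
  by apply.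
have oF : open (~` F) by exact: closed_openC.
have : C1 (~` F) (fun z => if z \in O then f z else 0).
  apply: C1_eq oF _ (@C1_cst _ 0) => w nFw; case: ifPn => //.
  by rewrite inE => Ow; rewrite f0.
by apply => /FO.
Qed.

End C1.

Section Planar.
Context {R : realType}.
Notation P := (R * R)%type.
Implicit Types (f g : P -> R) (z : P) (O : set P).

Definition es : P := (1, 0).
Definition et : P := (0, 1).
Notation C1 := (C1 es et).

Lemma slice_s f (s t : R) : differentiable f (s, t) ->
  is_derive s 1 (fun s => f (s, t)) ('D_es f (s, t)).
Proof.
move=> df.
have E0 r : ((0, t) : P) + r *: es = (r, t).
  have -> : r *: es = (r * 1, r * 0) by [].
  rewrite mulr1 mulr0; have -> : ((0, t) : P) + (r, 0) = (0 + r, t + 0) by [].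
  by rewrite add0r addr0.
have := @line_derive R P R f (0, t) es s; rewrite E0 => /(_ (diff_derivable df)).
by under eq_fun do rewrite E0.
Qed.

Lemma slice_t f (s t : R) : differentiable f (s, t) ->
  is_derive t 1 (fun t => f (s, t)) ('D_et f (s, t)).
Proof.
move=> df.
have E0 r : ((s, 0) : P) + r *: et = (s, r).
  have -> : r *: et = (r * 0, r * 1) by [].
  rewrite mulr1 mulr0; have -> : ((s, 0) : P) + (0, r) = (s + 0, 0 + r) by [].
  by rewrite add0r addr0.
have := @line_derive R P R f (s, 0) et t; rewrite E0 => /(_ (diff_derivable df)).
by under eq_fun do rewrite E0.
Qed.

Lemma C1_cont_s f : C1 setT f -> continuous ('D_es f).
Proof. by move=> Hf z; case: (Hf z I) => _ H _; exact: H. Qed.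
Lemma C1_cont_t f : C1 setT f -> continuous ('D_et f).
Proof. by move=> Hf z; case: (Hf z I) => _ _ H; exact: H. Qed.
Lemma C1_dif f : C1 setT f -> forall z, differentiable f z.
Proof. by move=> Hf z; case: (Hf z I) => H _ _; exact: H. Qed.

Lemma I1_ds f (s1 s2 t : R) : C1 setT f -> s1 <= s2 ->
  I1 s1 s2 (fun s => 'D_es f (s, t)) = f (s2, t) - f (s1, t).
Proof.
move=> Hf s12; apply: (@I1_FTC _ _ _ _ (fun s => f (s, t))) => //.
  by apply: (@slice2_continuous _ ('D_es f)); exact: C1_cont_s.
by move=> s _; apply: slice_s; exact: C1_dif.
Qed.

Lemma I1_dt f (s t1 t2 : R) : C1 setT f -> t1 <= t2 ->
  I1 t1 t2 (fun t => 'D_et f (s, t)) = f (s, t2) - f (s, t1).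
Proof.
move=> Hf t12; apply: (@I1_FTC _ _ _ _ (fun t => f (s, t))) => //.
  by apply: (@slice1_continuous _ ('D_et f)); exact: C1_cont_t.
by move=> t _; apply: slice_t; exact: C1_dif.
Qed.

Lemma I1_sub2 (F G : P -> R) (s1 s2 t1 t2 : R) : continuous F -> continuous G ->
  I1 s1 s2 (fun s => I1 t1 t2 (fun t => F (s, t) - G (s, t))) =
  I1 s1 s2 (fun s => I1 t1 t2 (fun t => F (s, t))) -
  I1 s1 s2 (fun s => I1 t1 t2 (fun t => G (s, t))).
Proof.
move=> cF cG; rewrite -I1B; [|exact: I1_continuous|exact: I1_continuous].
by apply: I1_ext => s _; rewrite -I1B//; exact: slice1_continuous.
Qed.

Lemma stokes f g (s1 s2 t1 t2 : R) : s1 <= s2 -> t1 <= t2 ->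
  C1 setT f -> C1 setT g ->
  (forall t, t1 <= t <= t2 -> f (s1, t) = 0 /\ f (s2, t) = 0) ->
  (forall s, s1 <= s <= s2 -> g (s, t1) = 0 /\ g (s, t2) = 0) ->
  I1 s1 s2 (fun s => I1 t1 t2 (fun t => 'D_es f (s, t) - 'D_et g (s, t))) = 0.
Proof.
move=> s12 t12 Hf Hg f0 g0.
have cf := C1_cont_s Hf; have cg := C1_cont_t Hg.
have H1 : I1 s1 s2 (fun s => I1 t1 t2 (fun t => 'D_es f (s, t))) = 0.
  rewrite (@I1_swap R s1 s2 t1 t2 ('D_es f) cf) -[RHS](mul0r (t2 - t1)) -I1_cst//.
  by apply: I1_ext => t tt; rewrite I1_ds//; have [-> ->] := f0 t tt; rewrite subrr.
have H2 : I1 s1 s2 (fun s => I1 t1 t2 (fun t => 'D_et g (s, t))) = 0.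
  rewrite -[RHS](mul0r (s2 - s1)) -I1_cst//.
  by apply: I1_ext => s ss; rewrite I1_dt//; have [-> ->] := g0 s ss; rewrite subrr.
apply: etrans (I1_sub2 s1 s2 t1 t2 cf cg) _.
by apply: etrans (congr2 (fun a b => a - b) H1 H2) _; rewrite subrr.
Qed.

Lemma square_gain (F G : P -> R) (s1 s2 t1 t2 L h : R) z0 : continuous F -> continuous G ->
  0 <= h -> s1 <= z0.1 - h -> z0.1 + h <= s2 -> t1 <= z0.2 - h -> z0.2 + h <= t2 ->
  (forall s t, s1 <= s <= s2 -> t1 <= t <= t2 -> F (s, t) <= G (s, t)) ->
  (forall s t, z0.1 - h <= s <= z0.1 + h -> z0.2 - h <= t <= z0.2 + h ->
     F (s, t) + L <= G (s, t)) ->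
  I1 s1 s2 (fun s => I1 t1 t2 (fun t => F (s, t))) + L * (2 * h) ^+ 2 <=
  I1 s1 s2 (fun s => I1 t1 t2 (fun t => G (s, t))).
Proof.
move: z0 => [s0 t0] /= cF cG h0 hs1 hs2 ht1 ht2 FG FGL.
pose D z := G z - F z.
have cD : continuous D by move=> z; apply: cvgB; [exact: cG|exact: cF].
have cF1 s := @slice1_continuous R F s cF; have cG1 s := @slice1_continuous R G s cG.
have cD1 s := @slice1_continuous R D s cD.
have cFi := @I1_continuous R t1 t2 F cF; have cGi := @I1_continuous R t1 t2 G cG.
rewrite -lerBrDl -I1B//.
rewrite (@I1_ext _ s1 s2 _ (fun s => I1 t1 t2 (fun t => D (s, t)))); last by move=> s _; rewrite -I1B.
have cDi := @I1_continuous R t1 t2 D cD; have cDj := @I1_continuous R (t0 - h) (t0 + h) D cD.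
have D0 s t : s1 <= s <= s2 -> t1 <= t <= t2 -> 0 <= D (s, t).
  by move=> ss tt; rewrite subr_ge0; exact: FG.
have Dg s : s1 <= s <= s2 -> 0 <= I1 t1 t2 (fun t => D (s, t)).
  by move=> ss; apply: I1_ge0 => t tt; exact: D0.
apply: (@le_trans _ _ (I1 (s0 - h) (s0 + h) (fun s => I1 t1 t2 (fun t => D (s, t))))); last first.
  rewrite (@I1_cat _ s1 (s0 - h) s2)//; last by lra.
  rewrite (@I1_cat _ (s0 - h) (s0 + h) s2)//; last by lra.
  have : 0 <= I1 s1 (s0 - h) (fun s => I1 t1 t2 (fun t => D (s, t))).
    by apply: I1_ge0 => s ss; apply: Dg; lra.
  have : 0 <= I1 (s0 + h) s2 (fun s => I1 t1 t2 (fun t => D (s, t))).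
    by apply: I1_ge0 => s ss; apply: Dg; lra.
  lra.
have -> : L * (2 * h) ^+ 2 = I1 (s0 - h) (s0 + h) (fun=> L * (2 * h)).
  by rewrite I1_cst; [ring|lra].
apply: I1_le => [x||s ss]; [exact: cvg_cst|exact: cDi|].
apply: (@le_trans _ _ (I1 (t0 - h) (t0 + h) (fun t => D (s, t)))).
  have -> : L * (2 * h) = I1 (t0 - h) (t0 + h) (fun=> L).
    by rewrite I1_cst; [ring|lra].
  apply: I1_le => [x||t tt]; [exact: cvg_cst|exact: cD1|].
  by rewrite /D lerBrDl; exact: FGL.
rewrite (@I1_cat _ t1 (t0 - h) t2)//; last by lra.
rewrite (@I1_cat _ (t0 - h) (t0 + h) t2)//; last by lra.
have : 0 <= I1 t1 (t0 - h) (fun t => D (s, t)) by apply: I1_ge0 => t tt; apply: D0; lra.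
have : 0 <= I1 (t0 + h) t2 (fun t => D (s, t)) by apply: I1_ge0 => t tt; apply: D0; lra.
lra.
Qed.

End Planar.

(** * The radial weight of the monotonicity formula *)

Section Pos.
Context {R : realType}.

Definition pos (x : R) := Num.max 0 x.

Lemma pos_ge0 x : 0 <= pos x. Proof. by rewrite le_max lexx. Qed.
Lemma pos_id x : 0 <= x -> pos x = x. Proof. by move=> x0; apply/max_idPr. Qed.
Lemma pos_0 x : x <= 0 -> pos x = 0. Proof. by move=> x0; apply/max_idPl. Qed.

Lemma pos_continuous : continuous pos.
Proof.
move=> x; apply: (@continuous_max _ _ (fun=> 0) id x); first exact: cvg_cst.
exact: cvg_id.
Qed.

Lemma posXn_derive n (x : R) : is_derive x 1 (fun x => pos x ^+ n.+2) (n.+2%:R * pos x ^+ n.+1).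
Proof.
have [x0|x0|->] := ltgtP x 0.
- rewrite pos_0 ?ltW// expr0n mulr0.
  have H : is_derive x 1 (cst 0 : R -> R) 0 by exact: is_derive_cst.
  apply: near_eq_is_derive H; near=> y; rewrite pos_0 ?expr0n//.
  by apply: ltW; near: y; exact: lt_nbhsl.
- rewrite pos_id ?ltW//.
  have H : is_derive x 1 (fun y : R => y ^+ n.+2) (n.+2%:R * x ^+ n.+1).
    by apply: DeriveDef; [exact: exprn_derivable|rewrite exp_derive /GRing.scale /= mulr1].
  apply: near_eq_is_derive H; near=> y; rewrite pos_id//.
  by apply: ltW; near: y; exact: lt_nbhsr.
- rewrite pos_0// expr0n mulr0.
  suff H : h^-1 *: (((fun x => pos x ^+ n.+2) \o shift 0) (h *: 1) - pos 0 ^+ n.+2)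
      @[h --> (0 : R)^'] --> (0 : R).
    by apply: DeriveDef; [apply/cvg_ex; exists 0; exact: H|exact/cvg_lim].
  apply/cvgrPdist_le => e e0; near=> h.
  have h0 : h != 0 by near: h; exact: nbhs_dnbhs_neq.
  have h1 : `|h| <= 1 by near: h; apply: dnbhs0_le.
  have he : `|h| <= e by near: h; apply: dnbhs0_le.
  rewrite sub0r normrN pos_0// expr0n subr0 /= addr0 [h *: 1]mulr1 normrM normfV.
  rewrite ler_pdivrMl ?normr_gt0//.
  have p1 : pos h <= `|h| by rewrite ge_max normr_ge0 ler_norm.
  rewrite ger0_norm ?exprn_ge0 ?pos_ge0//.
  apply: (@le_trans _ _ (`|h| ^+ n.+2)); first by apply: lerXn2r => //; rewrite nnegrE ?pos_ge0.
  rewrite exprS ler_wpM2l//; apply: le_trans he; rewrite exprS ler_piMr//.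
  by apply: exprn_ile1.
Unshelve. all: by end_near. Qed.

End Pos.

Section Der.
Context {R : realType}.
Implicit Types (f g : R -> R) (x : R).

Lemma der_mul f g x (df dg : R) : is_derive x 1 f df -> is_derive x 1 g dg ->
  is_derive x 1 (fun y => f y * g y) (df * g x + f x * dg).
Proof.
move=> h1 h2; have := is_deriveM h1 h2; move=> h; apply: is_derive_eq h _.
by rewrite /GRing.scale /= addrC [g x * _]mulrC.
Qed.

Lemma der_add f g x (df dg : R) : is_derive x 1 f df -> is_derive x 1 g dg ->
  is_derive x 1 (fun y => f y + g y) (df + dg).
Proof. by move=> h1 h2; exact: is_deriveD h1 h2. Qed.

Lemma der_scale f x (k df : R) : is_derive x 1 f df ->
  is_derive x 1 (fun y => k * f y) (k * df).
Proof.
move=> h1; have := der_mul (is_derive_cst k x 1) h1 => h.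
by apply: is_derive_eq h _; rewrite mul0r add0r.
Qed.

End Der.

Lemma eta_ineq_aux {R : realType} (K r qx dx : R) : K * r <= 8^-1 ->
  K * qx <= K * (3 / 2 * r) -> 0 < dx -> 1 - dx + 12 * K * qx <= 13 / 4.
Proof. by move=> *; lra. Qed.

Lemma eta_ineq_aux2 {R : realType} (X Y Z kp : R) : kp * X <= Z -> Z * kp <= Z * 8^-1 ->
  0 <= X * Y * kp -> 0 <= Z * Y -> 0 <= Z * Y * kp ->
  (X * (1 - Y) + 6 * Z * (1 - Y)) * (1 + 2 * kp) - (X + 12 * Z) * (1 - kp) <= - (X * Y).
Proof. by move=> *; lra. Qed.

Section Eta.
Context {R : realType} (r K dl : R).
Hypotheses (r0 : 0 < r) (K0 : 0 <= K) (Kr : K * r <= 8^-1) (dl0 : 0 < dl) (dlr : dl <= r ^+ 2).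

(** A regularization of [1 / q], where [q] will be a squared distance from the crossing; [dl > 0]
    removes the singularity at the centre. *)
Definition theta (q : R) := (Num.sqrt (q + dl)) ^- 2 + 12 * K * (Num.sqrt (q + dl))^-1.
Definition dtheta (q : R) := - (Num.sqrt (q + dl)) ^- 4 - 6 * K * (Num.sqrt (q + dl)) ^- 3.
(** For [K = 0] one finds [- eta' q - eta = 2 (r^2 - q) q / (q + dl) - (r^2 - q)^2 dl / (q + dl)^2]
    inside the ball. The first term is bounded by [2 r^2], and the second is an approximate Dirac
    mass at the centre. The squared positive part is continuously differentiable at [q = r^2]. *)
Definition eta (q : R) := pos (r ^+ 2 - q) ^+ 2 * theta q.
Definition deta (q : R) :=
  - (2 * pos (r ^+ 2 - q)) * theta q + pos (r ^+ 2 - q) ^+ 2 * dtheta q.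

Lemma theta_derive (q : R) : 0 <= q -> is_derive q 1 theta (dtheta q).
Proof.
move=> q0; have qd : 0 < q + dl by rewrite ltr_wpDl.
set g := Num.sqrt (q + dl); have g0 : g != 0 by rewrite sqrtr_eq0 -ltNge.
have d1 : is_derive q 1 (fun q => Num.sqrt (q + dl)) ((2 * g)^-1).
  have h1 : is_derive q 1 (fun x => x + dl) 1.
    by rewrite -[X in is_derive _ _ _ X]addr0; exact: is_deriveD.
  have h2 : is_derive (q + dl) 1 Num.sqrt ((2 * g)^-1) by exact: is_derive1_sqrt.
  by have := @is_derive1_comp _ Num.sqrt (fun x => x + dl) q _ _ h2 h1; rewrite mulr1.
have d2 : is_derive q 1 (fun q => (Num.sqrt (q + dl))^-1) (- g ^- 2 * (2 * g)^-1).
  by have := @is_deriveV R (fun q => Num.sqrt (q + dl)) q _ 1 g0 d1; rewrite /GRing.scale.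
have d3 : is_derive q 1 (fun q => (Num.sqrt (q + dl)) ^- 2) (dtheta q + 6 * K * g ^- 3).
  have -> : (fun q => Num.sqrt (q + dl) ^- 2) =
      (fun q => (Num.sqrt (q + dl))^-1 * (Num.sqrt (q + dl))^-1).
    by apply/funext => y; rewrite -expr2 exprVn.
  by apply: is_derive_eq (der_mul d2 d2) _; rewrite /dtheta -/g; field.
apply: is_derive_eq (der_add d3 (der_scale (12 * K) d2)) _.
by rewrite /dtheta -/g; field.
Qed.

Lemma eta_derive (q : R) : 0 <= q -> is_derive q 1 eta (deta q).
Proof.
move=> q0; have d1 := theta_derive q0.
have d2 : is_derive q 1 (fun q => pos (r ^+ 2 - q) ^+ 2) (- (2 * pos (r ^+ 2 - q))).
  have h1 : is_derive q 1 (fun x => r ^+ 2 - x) (-1).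
    by rewrite -[X in is_derive _ _ _ X]add0r; exact: is_deriveB.
  have h2 := posXn_derive 0 (r ^+ 2 - q).
  have := @is_derive1_comp _ _ (fun x => r ^+ 2 - x) q _ _ h2 h1.
  by rewrite mulrN1 expr1.
by apply: is_derive_eq (der_mul d2 d1) _.
Qed.

Lemma deta_continuous (q : R) : 0 <= q -> {for q, continuous deta}.
Proof.
move=> q0; have qd : 0 < q + dl by rewrite ltr_wpDl.
have g0 : Num.sqrt (q + dl) != 0 by rewrite sqrtr_eq0 -ltNge.
have cg : {for q, continuous (fun q => Num.sqrt (q + dl))}.
  apply: continuous_comp; last exact: sqrt_continuous.
  by apply: cvgD; [exact: cvg_id|exact: cvg_cst].
have cgV n : {for q, continuous (fun q => (Num.sqrt (q + dl)) ^- n)}.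
  apply: cvgV; first by rewrite expf_eq0 (negbTE g0) andbF.
  apply: (@continuous_comp _ _ _ (fun q => Num.sqrt (q + dl)) (fun x => x ^+ n)) => //.
  exact: exprn_continuous.
have cp : {for q, continuous (fun q => pos (r ^+ 2 - q))}.
  apply: continuous_comp; last exact: pos_continuous.
  by apply: cvgB; [exact: cvg_cst|exact: cvg_id].
have cgi : {for q, continuous (fun q => (Num.sqrt (q + dl))^-1)} by exact: (cgV 1%N).
have ct : {for q, continuous theta}.
  by apply: cvgD; [exact: (cgV 2%N)|apply: cvgM; [exact: cvg_cst|exact: cgi]].
have cdt : {for q, continuous dtheta}.
  apply: cvgB; first by apply: cvgN; exact: (cgV 4%N).
  by apply: cvgM; [exact: cvg_cst|exact: (cgV 3%N)].
apply: cvgD; apply: cvgM => //.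
  by apply: cvgN; apply: cvgM; [exact: cvg_cst|exact: cp].
apply: (@continuous_comp _ _ _ (fun q => pos (r ^+ 2 - q)) (fun x => x ^+ 2)) => //.
exact: exprn_continuous.
Qed.

Lemma theta_ge0 q : 0 <= theta q.
Proof.
by rewrite addr_ge0// ?mulr_ge0// ?invr_ge0 ?exprn_ge0// sqrtr_ge0.
Qed.

Lemma eta_ge0 q : 0 <= eta q.
Proof. by rewrite mulr_ge0 ?exprn_ge0 ?pos_ge0 ?theta_ge0. Qed.

Lemma deta_le0 q : deta q <= 0.
Proof.
have t0 := theta_ge0 q; have p0 := pos_ge0 (r ^+ 2 - q).
have : 0 <= (Num.sqrt (q + dl)) ^- 4 by rewrite invr_ge0 exprn_ge0// sqrtr_ge0.
have : 0 <= 6 * K * (Num.sqrt (q + dl)) ^- 3.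
  by rewrite !mulr_ge0// invr_ge0 exprn_ge0// sqrtr_ge0.
rewrite /deta /dtheta; set p := pos _ in p0 *; set t := theta _ in t0 *.
set a := _ ^- 4; set b := 6 * K * _ => b0 a0.
have : 0 <= p * t by rewrite mulr_ge0.
have : 0 <= p ^+ 2 * (a + b) by rewrite mulr_ge0 ?exprn_ge0 ?addr_ge0.
lra.
Qed.

Lemma eta_out q : r ^+ 2 <= q -> eta q = 0 /\ deta q = 0.
Proof.
by move=> rq; rewrite /eta /deta pos_0 ?subr_le0// expr0n /= !mulr0 oppr0 !mul0r addr0.
Qed.

(* 12 K is chosen so that the second term of theta absorbs the error K * sqrt q *)
Lemma eta_ineq (q : R) : 0 <= q -> q < r ^+ 2 ->
  - deta q * q * (1 + 2 * (K * Num.sqrt q)) - eta q * (1 - K * Num.sqrt q) <=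
  10 * r ^+ 2 - (r ^+ 2 - q) ^+ 2 * dl / (q + dl) ^+ 2.
Proof.
move=> q0 qr; have qd : 0 < q + dl by rewrite ltr_wpDl.
rewrite /eta /deta pos_id; last by rewrite subr_ge0 ltW.
rewrite /theta /dtheta.
set g : R := Num.sqrt (q + dl); set rho : R := Num.sqrt q.
have g0 : 0 < g by rewrite sqrtr_gt0.
have gg : g ^+ 2 = q + dl by rewrite sqr_sqrtr// ltW.
have rho0 : 0 <= rho by rewrite sqrtr_ge0.
have rhog : rho <= g by rewrite ler_wsqrtr// lerDl ltW.
have rhor : rho < r.
  by rewrite -ltr_sqr ?nnegrE ?(ltW r0)// sqr_sqrtr.
have gr : g <= 3 / 2 * r.
  have : g ^+ 2 <= (3 / 2 * r) ^+ 2.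
    rewrite gg; have -> : (3 / 2 * r) ^+ 2 = 9 / 4 * r ^+ 2 by field.
    apply: (@le_trans _ _ (r ^+ 2 + r ^+ 2)); first by apply: lerD => //; exact: ltW.
    by have := sqr_ge0 r; lra.
  by rewrite ler_sqr ?nnegrE; [|exact: ltW|lra].
(* From here on everything is polynomial in [x = 1 / g], with the relation [q x^2 = 1 - dl x^2]. *)
have [x [x0 xg xE]] : exists x : R, [/\ 0 < x, x * g = 1 & g^-1 = x].
  by exists g^-1; rewrite invr_gt0 g0 mulVf// gt_eqF.
have -> : g ^- 2 = x ^+ 2 by rewrite -exprVn xE.
have -> : g ^- 3 = x ^+ 3 by rewrite -exprVn xE.
have -> : g ^- 4 = x ^+ 4 by rewrite -exprVn xE.
have -> : (q + dl) ^- 2 = x ^+ 4 by rewrite -gg -exprM -exprVn xE.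
rewrite xE; move: g rho g0 gg rho0 rhog rhor gr xg {xE} => g rho g0 gg rho0 rhog rhor gr xg.
have qE : q = g ^+ 2 - dl by rewrite gg addrK.
have qx : q * x ^+ 2 = 1 - dl * x ^+ 2.
  by rewrite qE mulrBl -exprMn [g * x]mulrC xg expr1n.
have [kp kpE] : exists kp : R, kp = K * rho by eexists.
have kp0 : 0 <= kp by rewrite kpE mulr_ge0.
rewrite -kpE.
have kp8 : kp <= 8^-1 by rewrite kpE; apply: le_trans Kr; rewrite ler_wpM2l// ltW.
have kpx : kp * x <= K.
  by rewrite kpE -mulrA ler_piMr// -[leRHS]xg mulrC ler_wpM2l// ltW.
have w0 : 0 < r ^+ 2 - q by rewrite subr_gt0.
have wr : r ^+ 2 - q <= r ^+ 2 by rewrite gerBl.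
move: (r ^+ 2 - q) w0 wr => w w0 wr.
have d2 : 0 < dl * x ^+ 2 by rewrite mulr_gt0// exprn_gt0.
have S1 : q * x ^+ 2 + 12 * K * (q * x) <= 13 / 4.
  have qx1 : q * x <= g.
    have -> : q * x = q * x ^+ 2 * g by rewrite expr2 -!mulrA xg mulr1.
    by rewrite qx mulrBl mul1r gerBl mulr_ge0// ltW.
  have : K * (q * x) <= K * (3 / 2 * r) by rewrite ler_wpM2l// (le_trans qx1).
  by rewrite qx => h; exact: eta_ineq_aux Kr h d2.
(* The terms in [x^2] without [kp] cancel. Since [kp x^2 <= K x] and [kp <= 1/8], the errors cost at
   most [6 K x], which the surplus of [12 K x] over [6 K x] covers. *)
have B : (x ^+ 4 * q + 6 * K * x ^+ 3 * q) * (1 + 2 * kp) - (x ^+ 2 + 12 * K * x) * (1 - kp)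
    <= - (dl * x ^+ 4).
  have -> : x ^+ 4 * q = x ^+ 2 * (1 - dl * x ^+ 2) by rewrite -qx; ring.
  have -> : 6 * K * x ^+ 3 * q = 6 * K * x * (1 - dl * x ^+ 2) by rewrite -qx; ring.
  have h1 : kp * x ^+ 2 <= K * x by rewrite expr2 mulrA ler_wpM2r// ltW.
  have Kx : 0 <= K * x by rewrite mulr_ge0// ltW.
  have h2 : K * x * kp <= K * x * 8^-1 by rewrite ler_wpM2l.
  have h3 : 0 <= x ^+ 2 * (dl * x ^+ 2) * kp by rewrite !mulr_ge0 ?exprn_ge0// ltW.
  have h4 : 0 <= K * x * (dl * x ^+ 2) by rewrite mulr_ge0// ltW.
  have h5 : 0 <= K * x * (dl * x ^+ 2) * kp by rewrite mulr_ge0.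
  have -> : dl * x ^+ 4 = x ^+ 2 * (dl * x ^+ 2) by ring.
  by have := eta_ineq_aux2 h1 h2 h3 h4 h5; rewrite !mulrA.
have S0 : 0 <= q * x ^+ 2 + 12 * K * (q * x) by rewrite addr_ge0// !mulr_ge0// ?exprn_ge0// ltW.
have [S SE] : exists S : R, S = q * x ^+ 2 + 12 * K * (q * x) by eexists.
rewrite -SE in S0 S1.
have h6 : 2 * w * S * (1 + 2 * kp) <= 10 * r ^+ 2.
  have : w * S <= r ^+ 2 * (13 / 4) by apply: ler_pM => //; exact: ltW.
  have : 0 <= w * S by rewrite mulr_ge0// ltW.
  have : 0 < r ^+ 2 by rewrite exprn_gt0.
  nra.
have h7 : w ^+ 2 * ((x ^+ 4 * q + 6 * K * x ^+ 3 * q) * (1 + 2 * kp) - (x ^+ 2 + 12 * K * x) * (1 - kp))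
    <= w ^+ 2 * (- (dl * x ^+ 4)) by rewrite ler_wpM2l// exprn_ge0// ltW.
rewrite [leRHS](_ : _ = 10 * r ^+ 2 + w ^+ 2 * - (dl * x ^+ 4)); last by ring.
by apply: le_trans (lerD h6 h7); rewrite SE le_eqVlt; apply/orP; left; apply/eqP; ring.
Qed.

End Eta.

(** * Weighted Stokes argument on a rectangle *)

Section Concentration.
Context {R : realType}.
Notation P := (R * R)%type.

(** With [dl] equal to the upper bound of [q] on a square of half-side [h], the peak of the weight
    is of order [h^-2] there and thus compensates the area of the square. *)
Lemma gain_aux (q r h C D0 D : R) : 0 < r -> 0 < C -> 0 < D0 -> 0 < h -> 0 <= q ->
  q <= C * D0 * h ^+ 2 -> C * D0 * h ^+ 2 <= r ^+ 2 / 2 -> D0 / 2 <= D ->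
  r ^+ 4 / (16 * C * h ^+ 2) <=
  2 * D * ((r ^+ 2 - q) ^+ 2 * (C * D0 * h ^+ 2) / (q + C * D0 * h ^+ 2) ^+ 2).
Proof.
move=> r0 C0 D00 h0 q0 qd dr DD.
have [dl dlE] : exists dl : R, dl = C * D0 * h ^+ 2 by eexists.
have h2 : 0 < h ^+ 2 by rewrite exprn_gt0.
have dl0 : 0 < dl by rewrite dlE !mulr_gt0.
rewrite -dlE in qd dr *.
have e1 : r ^+ 4 / (16 * C * h ^+ 2) = 2 * (D0 / 2) * ((r ^+ 2 / 2) ^+ 2 * dl / (dl + dl) ^+ 2).
  have -> : C = dl / (D0 * h ^+ 2) by rewrite dlE; field; rewrite !gt_eqF.
  have -> : dl + dl = 2 * dl by ring.
  by field; rewrite (lt0r_neq0 h0) (lt0r_neq0 D00) (lt0r_neq0 dl0).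
rewrite e1; apply: ler_pM; [by rewrite mulr_ge0// ltW// divr_gt0| | by rewrite ler_pM2l|].
  by rewrite mulr_ge0 ?invr_ge0 ?exprn_ge0 ?mulr_ge0 ?exprn_ge0 ?divr_ge0 ?exprn_ge0 ?addr_ge0 ?(ltW r0) ?(ltW dl0).
apply: ler_pM.
- by rewrite mulr_ge0 ?exprn_ge0 ?divr_ge0 ?exprn_ge0 ?(ltW r0) ?(ltW dl0).
- by rewrite invr_ge0 exprn_ge0// addr_ge0// ltW.
- rewrite ler_pM2r// ler_sqr ?nnegrE ?divr_ge0 ?exprn_ge0 ?(ltW r0)//; lra.
- by rewrite lef_pV2 ?posrE ?exprn_gt0 ?ltr_wpDl// ?ler_sqr ?nnegrE ?lerD2r ?addr_ge0// ltW.
Qed.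

(** The 1-form with components [a] and [c] models [d^c Q], and [D] the energy density. Multiplied by
    [eta (Q)] it vanishes on the boundary of the rectangle and outside [F], so its differential has
    integral zero: the peak of the weight at [z0] must be paid for by the energy in the
    rectangle. *)
Lemma concentration (O F : set P) (Q a c D Db : P -> R) (r K C3 D0 rho s1 s2 t1 t2 : R) (z0 : P) :
  0 < r -> 0 <= K -> K * r <= 8^-1 -> 0 < C3 -> 0 < D0 -> 0 < rho ->
  open O -> closed F -> F `<=` O ->
  C1 es et O Q -> C1 es et O a -> C1 es et O c ->
  (forall z, O z -> 0 <= Q z) ->
  (forall z, O z -> ~ F z -> r ^+ 2 <= Q z) ->
  (forall s t, O (s, t) -> s1 <= s <= s2 -> t1 <= t <= t2 ->
    s = s1 \/ s = s2 \/ t = t1 \/ t = t2 -> r ^+ 2 <= Q (s, t)) ->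
  (forall z, O z -> Q z < r ^+ 2 ->
    [/\ 'D_es a z - 'D_et c z <= - 2 * D z * (1 - K * Num.sqrt (Q z)),
        - 2 * (Q z * D z) * (1 + 2 * (K * Num.sqrt (Q z))) <=
          'D_es Q z * a z - 'D_et Q z * c z,
        0 <= D z & D z <= Db z]) ->
  continuous Db -> (forall z, 0 <= Db z) ->
  s1 <= z0.1 - rho -> z0.1 + rho <= s2 -> t1 <= z0.2 - rho -> z0.2 + rho <= t2 ->
  (forall s t h : R, 0 < h <= rho -> z0.1 - h <= s <= z0.1 + h -> z0.2 - h <= t <= z0.2 + h ->
     [/\ O (s, t), Q (s, t) <= C3 * D0 * h ^+ 2 & D0 / 2 <= D (s, t)]) ->
  r ^+ 2 <= 80 * C3 * I1 s1 s2 (fun s => I1 t1 t2 (fun t => Db (s, t))).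
Proof.
move=> r0 K0 Kr C30 D00 rho0 oO cF FO HQ Ha Hc Q0 QF Qb ineq cDb Db0 hs1 hs2 ht1 ht2 sq.
have [h [h0 hrho hr]] : exists h : R, [/\ 0 < h, h <= rho & C3 * D0 * h ^+ 2 <= r ^+ 2 / 2].
  pose b : R := r ^+ 2 / 2 / (C3 * D0).
  have b0 : 0 < b by rewrite !divr_gt0 ?exprn_gt0 ?mulr_gt0.
  exists (Num.min rho (Num.sqrt b)); split.
  - by rewrite lt_min rho0 sqrtr_gt0.
  - by rewrite ge_min lexx.
  - rewrite mulrC -ler_pdivlMr ?mulr_gt0// -/b -[leRHS]sqr_sqrtr ?(ltW b0)//.
    by rewrite ler_sqr ?nnegrE ?sqrtr_ge0 ?ge_min ?lexx ?orbT// le_min (ltW rho0) sqrtr_ge0.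
have h2 : 0 < h ^+ 2 by rewrite exprn_gt0.
(* The width of the peak is matched to the values of [Q] on the square of half-side [h]. *)
pose dl : R := C3 * D0 * h ^+ 2.
have dl0 : 0 < dl by rewrite !mulr_gt0.
have dlr : dl <= r ^+ 2 by apply: le_trans hr _; have : 0 <= r ^+ 2 := sqr_ge0 r; lra.
pose E (z : P) : R := eta r K dl (Q z).
have HE : C1 es et O E.
  apply: (C1_comp (dphi := deta r K dl)) => // z Oz.
    by apply: eta_derive => //; exact: Q0.
  by apply: deta_continuous => //; exact: Q0.
have HA : C1 es et O (fun z => E z * a z) by exact: C1M.
have HC : C1 es et O (fun z => E z * c z) by exact: C1M.
have E0 z : O z -> r ^+ 2 <= Q z -> E z = 0 by move=> _ /(eta_out K dl) [].
pose GA (z : P) : R := if z \in O then E z * a z else 0.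
pose GC (z : P) : R := if z \in O then E z * c z else 0.
have HGA : C1 es et setT GA.
  by apply: C1_glue cF FO _ HA => // z Oz nF; rewrite E0 ?mul0r//; exact: QF.
have HGC : C1 es et setT GC.
  by apply: C1_glue cF FO _ HC => // z Oz nF; rewrite E0 ?mul0r//; exact: QF.
have dE v w : O w -> 'D_v E w = deta r K dl (Q w) * 'D_v Q w.
  move=> Ow; have [dfw _ _] := HQ w Ow.
  by apply: (derive_comp1 _ dfw); apply: eta_derive => //; exact: Q0.
have Lam z : O z -> 'D_es GA z - 'D_et GC z =
    deta r K dl (Q z) * ('D_es Q z * a z - 'D_et Q z * c z) + E z * ('D_es a z - 'D_et c z).
  move=> Oz; have [dEz _ _] := HE z Oz; have [daz _ _] := Ha z Oz; have [dcz _ _] := Hc z Oz.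
  rewrite (@derive_near _ _ _ GA (fun z => E z * a z) es z O)//; last by move=> w Ow; rewrite /GA mem_set.
  rewrite (@derive_near _ _ _ GC (fun z => E z * c z) et z O)//; last by move=> w Ow; rewrite /GC mem_set.
  rewrite (derive_mul _ dEz daz) (derive_mul _ dEz dcz) (dE es z Oz) (dE et z Oz).
  move: ('D_es Q z) ('D_et Q z) ('D_es a z) ('D_et c z) (a z) (c z) (E z) (deta r K dl (Q z)).
  by move=> q1 q2 a1 c1 a2 c2 x y; ring.
have LamO z : ~ O z -> 'D_es GA z - 'D_et GC z = 0.
  move=> nO; have oF : open (~` F) by exact: closed_openC.
  have nF : (~` F) z by move=> /FO.
  rewrite (@derive_near _ _ _ GA (fun=> 0) es z (~` F))//; last first.
    move=> w nFw; rewrite /GA; case: ifPn => //; rewrite inE => Ow.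
    by rewrite E0 ?mul0r//; exact: QF.
  rewrite (@derive_near _ _ _ GC (fun=> 0) et z (~` F))//; last first.
    move=> w nFw; rewrite /GC; case: ifPn => //; rewrite inE => Ow.
    by rewrite E0 ?mul0r//; exact: QF.
  by rewrite !derive_cst subrr.
have LamI z : O z -> Q z < r ^+ 2 -> 'D_es GA z - 'D_et GC z <=
    2 * D z * (10 * r ^+ 2) - 2 * D z * ((r ^+ 2 - Q z) ^+ 2 * dl / (Q z + dl) ^+ 2).
  move=> Oz Qr; rewrite Lam//; have [i1 i2 Dz0 _] := ineq z Oz Qr.
  have j1 : E z * ('D_es a z - 'D_et c z) <= E z * (- 2 * D z * (1 - K * Num.sqrt (Q z))).
    by rewrite ler_wpM2l// eta_ge0.
  have j2 : deta r K dl (Q z) * ('D_es Q z * a z - 'D_et Q z * c z) <=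
     deta r K dl (Q z) * (- 2 * (Q z * D z) * (1 + 2 * (K * Num.sqrt (Q z)))).
    by rewrite ler_wnM2l// deta_le0.
  apply: le_trans (lerD j2 j1) _.
  rewrite -mulrBr [leLHS](_ : _ = 2 * D z * (- deta r K dl (Q z) * Q z * (1 + 2 * (K * Num.sqrt (Q z)))
      - E z * (1 - K * Num.sqrt (Q z)))); last by ring.
  by rewrite ler_wpM2l ?mulr_ge0//; apply: eta_ineq => //; exact: Q0.
have LamL z : 'D_es GA z - 'D_et GC z <= 20 * r ^+ 2 * Db z.
  have DB : 0 <= 20 * r ^+ 2 * Db z by rewrite !mulr_ge0 ?exprn_ge0// ltW.
  have [Oz|nO] := pselect (O z); last by rewrite LamO.
  have [Qr|rQ] := ltP (Q z) (r ^+ 2); last first.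
    by rewrite Lam// (eta_out K dl rQ).2 E0// !mul0r addr0.
  have [_ _ Dz0 Dz1] := ineq z Oz Qr.
  apply: le_trans (LamI z Oz Qr) _.
  apply: (@le_trans _ _ (2 * D z * (10 * r ^+ 2))).
    rewrite lerBlDr lerDl; apply: mulr_ge0; first exact: mulr_ge0.
    apply: mulr_ge0; last by rewrite invr_ge0 sqr_ge0.
    by apply: mulr_ge0; [exact: sqr_ge0|exact: ltW].
  rewrite [leLHS](_ : _ = 20 * r ^+ 2 * D z); last by ring.
  by rewrite ler_wpM2l// mulr_ge0// exprn_ge0// ltW.
pose L : R := r ^+ 4 / (16 * C3 * h ^+ 2).
have sc s t : z0.1 - h <= s <= z0.1 + h -> z0.2 - h <= t <= z0.2 + h ->
    'D_es GA (s, t) - 'D_et GC (s, t) + L <= 20 * r ^+ 2 * Db (s, t).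
  move=> ss tt; have [Oz Qz Dz] := sq s t h ltac:(by rewrite h0) ss tt.
  have Qr : Q (s, t) < r ^+ 2.
    apply: le_lt_trans Qz _; apply: le_lt_trans hr _.
    by have : 0 < r ^+ 2 := exprn_gt0 2 r0; lra.
  have [_ _ Dz0 Dz1] := ineq _ Oz Qr.
  have g := gain_aux r0 C30 D00 h0 (Q0 _ Oz) Qz hr Dz.
  have l := LamI _ Oz Qr.
  have m : 20 * r ^+ 2 * D (s, t) <= 20 * r ^+ 2 * Db (s, t).
    by rewrite ler_wpM2l// mulr_ge0// exprn_ge0// ltW.
  rewrite /L; rewrite -/dl in g.
  apply: le_trans m.
  move: g l; rewrite -/dl; set X := 2 * D (s, t) * (_ / _); set W := 'D_es GA _ - _; set Y := r ^+ 4 / _.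
  rewrite (_ : 2 * D (s, t) * (10 * r ^+ 2) = 20 * r ^+ 2 * D (s, t)); last by ring.
  by move=> g l; rewrite -lerBrDr (le_trans l)// lerB.
have cLam : continuous (fun z => 'D_es GA z - 'D_et GC z).
  by move=> z; apply: cvgB; [exact: C1_cont_s|exact: C1_cont_t].
have cDb' : continuous (fun z => 20 * r ^+ 2 * Db z).
  by move=> z; apply: cvgM; [exact: cvg_cst|exact: cDb].
have := @square_gain R (fun z => 'D_es GA z - 'D_et GC z) (fun z => 20 * r ^+ 2 * Db z)
  s1 s2 t1 t2 L h z0 cLam cDb' (ltW h0).
have GAb s t : s1 <= s <= s2 -> t1 <= t <= t2 -> s = s1 \/ s = s2 \/ t = t1 \/ t = t2 ->
    GA (s, t) = 0 /\ GC (s, t) = 0.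
  move=> ss tt b; rewrite /GA /GC; case: ifPn => //; rewrite inE => Oz.
  by rewrite E0 ?mul0r//; exact: Qb.
have s12 : s1 <= s2 by lra.
have t12 : t1 <= t2 by lra.
rewrite stokes//; last 2 first.
- move=> t tt; split.
    by apply: (GAb s1 t _ tt _).1; [lra|left].
  by apply: (GAb s2 t _ tt _).1; [lra|right; left].
- move=> s ss; split.
    by apply: (GAb s t1 ss _ _).2; [lra|right; right; left].
  by apply: (GAb s t2 ss _ _).2; [lra|right; right; right].
have H1 : s1 <= z0.1 - h by lra.
have H2 : z0.1 + h <= s2 by lra.
have H3 : t1 <= z0.2 - h by lra.
have H4 : z0.2 + h <= t2 by lra.
move=> /(_ H1 H2 H3 H4 (fun s t _ _ => LamL _) sc).
have -> : I1 s1 s2 (fun s => I1 t1 t2 (fun t => 20 * r ^+ 2 * Db (s, t))) =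
    20 * r ^+ 2 * I1 s1 s2 (fun s => I1 t1 t2 (fun t => Db (s, t))).
  rewrite -I1Z; last exact: I1_continuous.
  by apply: I1_ext => s _; rewrite I1Z//; exact: slice1_continuous.
set J := I1 s1 s2 _ => g.
(* The auxiliary scale disappears: [L (2 h)^2 = r^4 / (4 C3)]. *)
have : r ^+ 2 * (r ^+ 2 / (4 * C3)) <= r ^+ 2 * (20 * J).
  rewrite [leLHS](_ : _ = 0 + L * (2 * h) ^+ 2); last by rewrite /L; field; rewrite !gt_eqF.
  by rewrite [leRHS](_ : _ = 20 * r ^+ 2 * J)//; ring.
rewrite ler_pM2l ?exprn_gt0// ler_pdivrMr ?mulr_gt0// => {}g.
by apply: le_trans g _; rewrite le_eqVlt; apply/orP; left; apply/eqP; ring.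
Qed.

End Concentration.

(** * Compatible bilinear forms *)

Section Bil.
Context {R : realType} {m : nat}.
Implicit Types (B G : 'M[R]_m) (v w x y : 'rV[R]_m).

Lemma bilE B v w : bil B v w = \sum_i \sum_j B i j * (v 0 i * w 0 j).
Proof.
rewrite /bil mxE exchange_big /=; apply: eq_bigr => j _.
by rewrite !mxE mulr_suml; apply: eq_bigr => i _; ring.
Qed.

Lemma bilDl B v w x : bil B (v + w) x = bil B v x + bil B w x.
Proof. by rewrite /bil !mulmxDl mxE. Qed.
Lemma bilDr B v w x : bil B x (v + w) = bil B x v + bil B x w.
Proof. by rewrite /bil linearD/= mulmxDr mxE. Qed.
Lemma bilZl B k v x : bil B (k *: v) x = k * bil B v x.
Proof. by rewrite /bil -!scalemxAl mxE. Qed.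
Lemma bilZr B k v x : bil B x (k *: v) = k * bil B x v.
Proof. by rewrite /bil linearZ/= -scalemxAr mxE. Qed.
Lemma bilNl B v x : bil B (- v) x = - bil B v x.
Proof. by rewrite -scaleN1r bilZl mulN1r. Qed.
Lemma bilNr B v x : bil B x (- v) = - bil B x v.
Proof. by rewrite -scaleN1r bilZr mulN1r. Qed.
Lemma bilBl B v w x : bil B (v - w) x = bil B v x - bil B w x.
Proof. by rewrite bilDl bilNl. Qed.
Lemma bilBr B v w x : bil B x (v - w) = bil B x v - bil B x w.
Proof. by rewrite bilDr bilNr. Qed.
Lemma bil0l B x : bil B 0 x = 0.
Proof. by rewrite -(scale0r 0) bilZl mul0r. Qed.

Lemma bil_mulr B J v w : bil B v (w *m J) = bil (B *m J^T) v w.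
Proof. by rewrite /bil trmx_mul !mulmxA. Qed.

Section Psd.
Context (G : 'M[R]_m).
Hypotheses (Gsym : forall v w, bil G v w = bil G w v) (Gpsd : forall v, 0 <= bil G v v).

Definition nrm v : R := Num.sqrt (bil G v v).

Lemma nrm_ge0 v : 0 <= nrm v. Proof. exact: sqrtr_ge0. Qed.
Lemma nrm_sqr v : nrm v ^+ 2 = bil G v v. Proof. by rewrite sqr_sqrtr. Qed.

(** The form is only semidefinite, so vectors of norm zero are treated apart: for them the quadratic
    polynomial has no leading term, and nonnegativity forces its linear coefficient to vanish. *)
Lemma bil_CS v w : `|bil G v w| <= nrm v * nrm w.
Proof.
have H a b : 0 <= a ^+ 2 * bil G v v + 2 * a * b * bil G v w + b ^+ 2 * bil G w w.
  have := Gpsd (a *: v + b *: w).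
  rewrite bilDl !bilDr !bilZl !bilZr (Gsym w v) => h.
  by apply: le_trans h _; rewrite le_eqVlt; apply/orP; left; apply/eqP; ring.
have [vw0|vw0] := ltP 0 (nrm v * nrm w); last first.
  have : nrm v * nrm w = 0 by apply/le_anti; rewrite vw0 mulr_ge0 ?nrm_ge0.
  move=> E; have : bil G v v * bil G w w = 0 by rewrite -!nrm_sqr -exprMn E expr0n.
  move/eqP; rewrite mulf_eq0 => vw; rewrite E normr_le0.
  have Z x y : bil G x x = 0 -> (forall a b : R, 0 <= a ^+ 2 * bil G x x + 2 * a * b * bil G x y + b ^+ 2 * bil G y y) ->
      bil G x y = 0.
    move=> x0 H'; have yy := Gpsd y.
    have := H' (- bil G x y * (bil G y y + 1)) (1 : R).
    rewrite x0 mulr0 add0r mulr1 expr1n mul1r => h.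
    have [q qE] : exists q : R, q = bil G x y by eexists.
    rewrite -qE in h *; have : q ^+ 2 * (2 * bil G y y + 2) <= bil G y y by lra.
    have := H' (- bil G x y) (1 : R); have := H' (- bil G x y * ((bil G y y + 1) * bil G y y)) (1 : R).
    rewrite x0 -qE => _ _ h2.
    have [//|q0] := eqVneq q 0.
    have q2 : 0 < q ^+ 2 by rewrite exprn_even_gt0.
    have := H' (- bil G x y * ((bil G y y + 1) / q ^+ 2)) (1 : R).
    rewrite x0 -qE mulr0 add0r mulr1 expr1n mul1r.
    have -> : 2 * (- q * ((bil G y y + 1) / q ^+ 2)) * q = - 2 * (bil G y y + 1).
      by field.
    by move=> h3; exfalso; lra.
  case/orP: vw => /eqP /Z z0; first by rewrite (z0 w H).
  rewrite Gsym (z0 v) // => a b; apply: le_trans (H b a) _.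
  by rewrite le_eqVlt; apply/orP; left; apply/eqP; rewrite (Gsym w v); ring.
rewrite ler_norml; apply/andP; split.
  have := H (nrm w) (nrm v); rewrite -!nrm_sqr => h.
  have : 0 <= (nrm v * nrm w) * (nrm v * nrm w + bil G v w).
    have -> : (nrm v * nrm w) * (nrm v * nrm w + bil G v w) = 2^-1 *
      (nrm w ^+ 2 * nrm v ^+ 2 + 2 * nrm w * nrm v * bil G v w + nrm v ^+ 2 * nrm w ^+ 2) by field.
    by rewrite mulr_ge0.
  by rewrite pmulr_rge0//; lra.
have := H (nrm w) (- nrm v); rewrite -!nrm_sqr => h.
have : 0 <= (nrm v * nrm w) * (nrm v * nrm w - bil G v w).
  have -> : (nrm v * nrm w) * (nrm v * nrm w - bil G v w) = 2^-1 *
    (nrm w ^+ 2 * nrm v ^+ 2 + 2 * nrm w * - nrm v * bil G v w + (- nrm v) ^+ 2 * nrm w ^+ 2) by field.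
  by rewrite mulr_ge0.
by rewrite pmulr_rge0// subr_ge0.
Qed.

Section Pointwise.
Context (J : 'M[R]_m) (Y A B S : 'rV[R]_m) (k sg tau K : R).
Hypothesis (k0 : 0 < k).
Hypotheses (Jiso : forall v w, bil G (v *m J) (w *m J) = bil G v w).
Hypotheses (Jskew : forall v w, bil G (v *m J) w = - bil G v (w *m J)).
Hypothesis (JJ : forall v : 'rV[R]_m, v *m J *m J = - v).
Let r := A + B *m J.
Let Q := bil G Y Y + k ^+ 2 * (sg ^+ 2 + tau ^+ 2).
Let D := bil G A A + k ^+ 2.
Hypothesis (rb : nrm r <= K * (Num.sqrt Q * Num.sqrt D)).

Let Q0 : 0 <= Q. Proof. by rewrite addr_ge0// mulr_ge0 ?exprn_ge0 ?addr_ge0 ?sqr_ge0// ltW. Qed.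
Let D0 : 0 < D. Proof. by rewrite ltr_wpDl// exprn_gt0. Qed.

(** Here [A] and [B] are the derivatives of [Y] in [s] and [t], [S] is its mixed derivative and [r]
    the Cauchy-Riemann defect. The terms with [S] cancel, so no derivative of the defect occurs; for
    [r = 0] the left side is exactly [- 2 D]. *)
Lemma pointwise1 :
  (bil G A (B *m J) + bil G Y (S *m J) - k ^+ 2) - (bil G B (A *m J) + bil G Y (S *m J) + k ^+ 2)
  <= - 2 * D * (1 - K * Num.sqrt Q).
Proof.
have -> : bil G B (A *m J) = - bil G A (B *m J).
  by rewrite Gsym Jskew.
have -> : bil G A (B *m J) = bil G A r - bil G A A by rewrite /r bilDr; ring.
have Ar : bil G A r <= D * (K * Num.sqrt Q).
  apply: le_trans (ler_norm _) _; apply: le_trans (bil_CS _ _) _.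
  apply: le_trans (_ : Num.sqrt D * (K * (Num.sqrt Q * Num.sqrt D)) <= _).
    apply: ler_pM => //; try exact: nrm_ge0.
    by rewrite ler_wsqrtr// lerDl exprn_ge0// ltW.
  rewrite -[X in _ <= X * _](sqr_sqrtr (ltW D0)).
  by rewrite le_eqVlt; apply/orP; left; apply/eqP; ring.
by move: Ar; rewrite /D; lra.
Qed.

(** For zero defect the right side is [- 2 (a^2 + b^2)], where [a] and [b] are the products of the
    extended [Y] with the extended derivatives; the defect perturbs one factor of each product. *)
Lemma pointwise2 :
  - 2 * (Q * D) * (1 + 2 * (K * Num.sqrt Q)) <=
  (2 * bil G Y A + 2 * k ^+ 2 * sg) * (bil G Y (B *m J) - k ^+ 2 * sg)
  - (2 * bil G Y B + 2 * k ^+ 2 * tau) * (bil G Y (A *m J) + k ^+ 2 * tau).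
Proof.
have [a aE] : exists a : R, a = bil G Y A + k ^+ 2 * sg by eexists.
have [b bE] : exists b : R, b = bil G Y (A *m J) + k ^+ 2 * tau by eexists.
have AJA : bil G A (A *m J) = 0 by have := Jskew A A; rewrite Gsym => h; lra.
(* Bessel's inequality: extended by [k] in one of two additional coordinates each, [A] and [A J] are
   orthogonal with common squared norm [D]. *)
have bes : a ^+ 2 + b ^+ 2 <= Q * D.
  have : 0 <= bil G (D *: Y - a *: A - b *: (A *m J)) (D *: Y - a *: A - b *: (A *m J))
     + k ^+ 2 * ((D * sg - a) ^+ 2 + (D * tau - b) ^+ 2).
    by rewrite addr_ge0// mulr_ge0 ?exprn_ge0 ?addr_ge0 ?sqr_ge0// ltW.
  rewrite !bilBl !bilBr !bilZl !bilZr Jiso (Gsym A Y) (Gsym (A *m J) Y) (Gsym (A *m J) A) AJA.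
  have -> : bil G Y A = a - k ^+ 2 * sg by rewrite aE; ring.
  have -> : bil G Y (A *m J) = b - k ^+ 2 * tau by rewrite bE; ring.
  have -> : bil G Y Y = Q - k ^+ 2 * (sg ^+ 2 + tau ^+ 2) by rewrite /Q; ring.
  have -> : bil G A A = D - k ^+ 2 by rewrite /D; ring.
  move: Q D D0 => q d d0 h.
  have : 0 <= d * (q * d - (a ^+ 2 + b ^+ 2)).
    by apply: le_trans h _; rewrite le_eqVlt; apply/orP; left; apply/eqP; ring.
  by rewrite pmulr_rge0// subr_ge0.
have sQD : Num.sqrt Q * Num.sqrt D = Num.sqrt (Q * D) by rewrite sqrtrM.
have QD0 : 0 <= Q * D by rewrite mulr_ge0// ltW.
have abd : `|a| <= Num.sqrt Q * Num.sqrt D.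
  by rewrite sQD -sqrtr_sqr ler_wsqrtr//; have := sqr_ge0 b; lra.
have bbd : `|b| <= Num.sqrt Q * Num.sqrt D.
  by rewrite sQD -sqrtr_sqr ler_wsqrtr//; have := sqr_ge0 a; lra.
have YQ : nrm Y <= Num.sqrt Q.
  by rewrite ler_wsqrtr// lerDl mulr_ge0 ?exprn_ge0 ?addr_ge0 ?sqr_ge0// ltW.
have Yr : `|bil G Y r| <= Num.sqrt Q * (K * (Num.sqrt Q * Num.sqrt D)).
  by apply: le_trans (bil_CS _ _) _; apply: ler_pM => //; exact: nrm_ge0.
have YrJ : `|bil G Y (r *m J)| <= Num.sqrt Q * (K * (Num.sqrt Q * Num.sqrt D)).
  apply: le_trans (bil_CS _ _) _; apply: ler_pM => //; try exact: nrm_ge0.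
  by rewrite /nrm Jiso.
have -> : bil G Y (B *m J) - k ^+ 2 * sg = bil G Y r - a.
  by rewrite /r bilDr aE; ring.
have -> : 2 * bil G Y B + 2 * k ^+ 2 * tau = 2 * (b - bil G Y (r *m J)).
  by rewrite /r mulmxDl JJ bilBr bE; ring.
have -> : 2 * bil G Y A + 2 * k ^+ 2 * sg = 2 * a by rewrite aE; ring.
rewrite -bE.
have E1 : Num.sqrt Q * Num.sqrt D * (Num.sqrt Q * (K * (Num.sqrt Q * Num.sqrt D))) =
    Q * D * (K * Num.sqrt Q).
  transitivity (Num.sqrt Q ^+ 2 * Num.sqrt D ^+ 2 * (K * Num.sqrt Q)); first by ring.
  by rewrite !sqr_sqrtr// ltW.
have h1 : `|a * bil G Y r| <= Q * D * (K * Num.sqrt Q).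
  by rewrite normrM -E1; apply: ler_pM.
have h2 : `|b * bil G Y (r *m J)| <= Q * D * (K * Num.sqrt Q).
  by rewrite normrM -E1; apply: ler_pM.
move: h1 h2; rewrite !ler_norml => /andP[h1 _] /andP[h2 _].
lra.
Qed.

End Pointwise.
End Psd.
End Bil.

Lemma derive_scal {R : realType} {V : normedModType R} (f : V -> R) (k : R) (z v : V) :
  differentiable f z -> 'D_v (fun z => k * f z) z = k * 'D_v f z.
Proof.
move=> df; rewrite (derive_mul _ (differentiable_cst k z) df) derive_cst.
by rewrite mulr0 addr0.
Qed.

(** * Calculus of vector-valued and matrix-valued maps by entries *)

Section VecC1.
Context {R : realType} {V : normedModType R} {m : nat} (e1 e2 : V).
Implicit Types (f g : V -> 'rV[R]_m) (O : set V).

Definition C1r O f := forall j, C1 e1 e2 O (fun z => f z 0 j).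

Lemma dif_sum (I : Type) (r : seq I) (F : I -> V -> R) x :
  (forall i, differentiable (F i) x) -> differentiable (fun z => \sum_(i <- r) F i z) x.
Proof.
move=> dF; elim: r => [|i r IH].
  by under eq_fun do rewrite big_nil; exact: differentiable_cst.
by under eq_fun do rewrite big_cons; exact: differentiableD.
Qed.

Lemma D_sum (I : Type) (r : seq I) (F : I -> V -> R) x v :
  (forall i, differentiable (F i) x) ->
  'D_v (fun z => \sum_(i <- r) F i z) x = \sum_(i <- r) 'D_v (F i) x.
Proof.
move=> dF; elim: r => [|i r IH].
  by under eq_fun do rewrite big_nil; rewrite big_nil derive_cst.
under eq_fun do rewrite big_cons.
by rewrite big_cons derive_add ?IH//; exact: dif_sum.
Qed.

Lemma C1_bil O f g B : open O -> C1r O f -> C1r O g ->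
  C1 e1 e2 O (fun z => bil B (f z) (g z)).
Proof.
move=> oO Hf Hg; under eq_fun do rewrite bilE.
apply: (@C1_sum R V e1 e2 O _ _ (fun i z => \sum_j B i j * (f z 0 i * g z 0 j)) oO) => i.
apply: (@C1_sum R V e1 e2 O _ _ (fun j z => B i j * (f z 0 i * g z 0 j)) oO) => j.
exact: (C1M oO (@C1_cst _ _ _ _ _ (B i j)) (C1M oO (Hf i) (Hg j))).
Qed.

Lemma dif_entry f z : differentiable f z -> forall j, differentiable (fun z => f z 0 j) z.
Proof.
move=> df j; apply: (@differentiable_comp _ _ _ _ f (fun N : 'rV[R]_m => N 0 j)) => //.
exact: differentiable_coord.
Qed.

Lemma D_entry f z v : differentiable f z -> forall j, ('D_v f z) 0 j = 'D_v (fun z => f z 0 j) z.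
Proof. by move=> df j; rewrite derive_mx ?mxE//; exact: diff_derivable. Qed.

Lemma D_bil f g z v B : differentiable f z -> differentiable g z ->
  'D_v (fun z => bil B (f z) (g z)) z = bil B ('D_v f z) (g z) + bil B (f z) ('D_v g z).
Proof.
move=> df dg; have df' := dif_entry df; have dg' := dif_entry dg.
rewrite (_ : (fun z => _) = (fun z => \sum_i \sum_j B i j * (f z 0 i * g z 0 j))); last first.
  by apply/funext => y; rewrite bilE.
have dfg i j : differentiable (fun z => f z 0 i * g z 0 j) z by exact: differentiableM.
have dBfg i j : differentiable (fun z => B i j * (f z 0 i * g z 0 j)) z.
  by apply: differentiableM => //; exact: differentiable_cst.
rewrite D_sum; last by move=> i; apply: dif_sum.
rewrite !bilE -big_split /=; apply: eq_bigr => i _.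
rewrite D_sum// -big_split /=; apply: eq_bigr => j _.
rewrite derive_scal// derive_mul// !D_entry//.
by move: ('D_v _ z) ('D_v _ z) => x y; ring.
Qed.

End VecC1.

Section SmoothApi.
Context {R : realType} {V W : normedModType R}.
Implicit Types (f g : V -> W) (U : set V).

Lemma smooth_cont U f x : smooth U f -> U x -> {for x, continuous f}.
Proof. by move=> /(_ 0%N)[h _]; exact: h. Qed.

Lemma smooth_dif U f x : smooth U f -> U x -> differentiable f x.
Proof. by move=> /(_ 1%N)[_ [h _]]; exact: h. Qed.

Lemma smooth_D U f v : smooth U f -> smooth U ('D_v f).
Proof. by move=> Hf k; have [_ [_ h]] := Hf k.+1; exact: h. Qed.

Lemma Ck_eq k U f g : open U -> (forall x, U x -> f x = g x) -> Ck k U f -> Ck k U g.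
Proof.
move=> oU; elim: k f g => [|k IH] f g fg [cf Hf]; split => //=.
- by move=> x Ux; apply: (cont_near oU Ux _ (cf x Ux)) => w Uw; rewrite fg.
- by move=> x Ux; apply: (cont_near oU Ux _ (cf x Ux)) => w Uw; rewrite fg.
- have [df Df] := Hf; split.
    by move=> x Ux; apply: (dif_near oU Ux fg); exact: df.
  by move=> v; apply: IH (Df v) => x Ux; exact: derive_near oU Ux fg.
Qed.

Lemma smooth_eq U f g : open U -> (forall x, U x -> f x = g x) -> smooth U f -> smooth U g.
Proof. by move=> oU fg Hf k; exact: Ck_eq (Hf k). Qed.

Lemma smooth_sub U U' f : U' `<=` U -> smooth U f -> smooth U' f.
Proof.
move=> UU Hf k; move: (Hf k); elim: k f {Hf} => [|k IH] f [cf Hf]; split => //=.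
- by move=> x /UU; exact: cf.
- by move=> x /UU; exact: cf.
- have [df Df] := Hf; split; first by move=> x /UU; exact: df.
  by move=> v; exact: IH _ (Df v).
Qed.

End SmoothApi.

Section SmoothEntry.
Context {R : realType} {V : normedModType R} {p m : nat}.
Implicit Types (f : V -> 'M[R]_(p, m)) (U : set V).

Lemma dif_mentry f z i j : differentiable f z -> differentiable (fun z => f z i j) z.
Proof.
move=> df; apply: (@differentiable_comp _ _ _ _ f (fun N : 'M[R]_(p, m) => N i j)) => //.
exact: differentiable_coord.
Qed.

Lemma D_mentry f z v i j : differentiable f z -> ('D_v f z) i j = 'D_v (fun z => f z i j) z.
Proof. by move=> df; rewrite derive_mx ?mxE//; exact: diff_derivable. Qed.

Lemma Ck_entry k U f i j : open U -> Ck k U f -> Ck k U (fun z => f z i j).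
Proof.
move=> oU; elim: k f => [|k IH] f [cf Hf]; split => //=.
- move=> x Ux; apply: (@continuous_comp _ _ _ f (fun N : 'M[R]_(p, m) => N i j)); first exact: cf.
  exact: coord_continuous.
- move=> x Ux; apply: (@continuous_comp _ _ _ f (fun N : 'M[R]_(p, m) => N i j)); first exact: cf.
  exact: coord_continuous.
- have [df Df] := Hf; split.
    by move=> x Ux; apply: dif_mentry; exact: df.
  move=> v; have := IH _ (Df v); apply: Ck_eq => // x Ux.
  by rewrite D_mentry//; exact: df.
Qed.

Lemma smooth_entry U f i j : open U -> smooth U f -> smooth U (fun z => f z i j).
Proof. by move=> oU Hf k; exact: Ck_entry (Hf k). Qed.

End SmoothEntry.

Section SmoothC1.
Context {R : realType} {V : normedModType R} (e1 e2 : V).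

Lemma smooth_C1 (U : set V) (f : V -> R) : smooth U f -> C1 e1 e2 U f.
Proof.
move=> Hf z Uz; split; first exact: smooth_dif Hf Uz.
- exact: smooth_cont (smooth_D e1 Hf) Uz.
- exact: smooth_cont (smooth_D e2 Hf) Uz.
Qed.

Lemma smooth_schwarz (U : set V) (f : V -> R) (x v w : V) : open U -> U x -> smooth U f ->
  'D_w ('D_v f) x = 'D_v ('D_w f) x.
Proof.
move=> oU Ux Hf; apply: (@schwarz _ _ f U) => //.
- by move=> y Uy; apply: diff_derivable; exact: smooth_dif Hf Uy.
- by move=> y Uy; apply: diff_derivable; exact: smooth_dif Hf Uy.
- by move=> y Uy; apply: diff_derivable; exact: smooth_dif (smooth_D _ Hf) Uy.
- by move=> y Uy; apply: diff_derivable; exact: smooth_dif (smooth_D _ Hf) Uy.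
- exact: smooth_cont (smooth_D _ (smooth_D _ Hf)) Ux.
- exact: smooth_cont (smooth_D _ (smooth_D _ Hf)) Ux.
Qed.

Lemma smooth_schwarz_rV m (U : set V) (f : V -> 'rV[R]_m) (x v w : V) :
  open U -> U x -> smooth U f -> 'D_w ('D_v f) x = 'D_v ('D_w f) x.
Proof.
move=> oU Ux Hf; apply/rowP => j.
have dv := smooth_dif (smooth_D v Hf) Ux; have dw := smooth_dif (smooth_D w Hf) Ux.
apply: etrans (D_mentry w 0 j dv) _; apply: etrans (esym (D_mentry v 0 j dw)).
have E a y : U y -> 'D_a f y 0 j = 'D_a (fun z => f z 0 j) y.
  by move=> Uy; apply: D_mentry; exact: smooth_dif Hf Uy.
apply: (etrans (@derive_near R V R _ _ w x U oU Ux (E v))).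
apply: (etrans _ (esym (@derive_near R V R _ _ v x U oU Ux (E w)))).
apply: (@smooth_schwarz U (fun z => f z 0 j) x v w oU Ux).
exact: smooth_entry.
Qed.

End SmoothC1.

(** * Energy concentration in a chart *)

Section Affine.
Context {R : realType}.
Notation P := (R * R)%type.

Lemma dif_fst (c : R) (z : P) : differentiable (fun z : P => z.1 - c) z.
Proof.
apply: differentiableB; last exact: differentiable_cst.
by apply: (@linear_differentiable _ _ _ (fst : {linear P -> R})) => y; exact: cvg_fst.
Qed.
Lemma dif_snd (c : R) (z : P) : differentiable (fun z : P => z.2 - c) z.
Proof.
apply: differentiableB; last exact: differentiable_cst.
by apply: (@linear_differentiable _ _ _ (snd : {linear P -> R})) => y; exact: cvg_snd.
Qed.

Lemma D_aff (l : P -> R) (c : R) (v z : P) : (forall h : R, l (h *: v + z) = h * l v + l z) ->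
  'D_v (fun z => l z - c) z = l v.
Proof.
move=> H; apply: (@cvg_lim _ (@norm_hausdorff _ _)).
have : (fun=> l v) @ (0 : R)^' --> l v by exact: cvg_cst.
apply: cvg_trans; apply: near_eq_cvg; near=> h.
have h0 : h != 0 by near: h; exact: nbhs_dnbhs_neq.
rewrite /= H /GRing.scale /=; field.
by [].
Unshelve. all: by end_near. Qed.

Lemma D_fst (c : R) (v z : P) : 'D_v (fun z : P => z.1 - c) z = v.1.
Proof. by apply: (D_aff (l := fst)). Qed.
Lemma D_snd (c : R) (v z : P) : 'D_v (fun z : P => z.2 - c) z = v.2.
Proof. by apply: (D_aff (l := snd)). Qed.

Lemma C1_fst (c : R) (O : set P) : C1 es et O (fun z : P => z.1 - c).
Proof.
move=> z _; split; first exact: dif_fst.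
- by rewrite (_ : 'D_es _ = fun=> (1 : R)); [exact: cvg_cst|apply/funext => y; rewrite D_fst].
- by rewrite (_ : 'D_et _ = fun=> (0 : R)); [exact: cvg_cst|apply/funext => y; rewrite D_fst].
Qed.
Lemma C1_snd (c : R) (O : set P) : C1 es et O (fun z : P => z.2 - c).
Proof.
move=> z _; split; first exact: dif_snd.
- by rewrite (_ : 'D_es _ = fun=> (0 : R)); [exact: cvg_cst|apply/funext => y; rewrite D_snd].
- by rewrite (_ : 'D_et _ = fun=> (1 : R)); [exact: cvg_cst|apply/funext => y; rewrite D_snd].
Qed.

Lemma first_order m (Y : P -> 'rV[R]_m) (z0 : P) (e : R) : differentiable Y z0 -> 0 < e ->
  exists2 rho : R, 0 < rho & forall z, `|z - z0| <= rho ->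
    `|Y z - Y z0 - ((z.1 - z0.1) *: 'D_es Y z0 + (z.2 - z0.2) *: 'D_et Y z0)| <= e * `|z - z0|.
Proof.
move=> dY e0; have [_ /eqaddoP] := (diff_locallyP _ _).1 dY.
move=> /(_ _ e0) /nbhs_ballP[rho /= rho0 H].
exists (rho / 2); first by rewrite divr_gt0.
move=> z zr.
have h : `|Y (z - z0 + z0) - (Y z0 + 'd Y z0 (z - z0))| <= e * `|z - z0|.
  apply: (H (z - z0)); rewrite -ball_normE /= sub0r normrN.
  by apply: le_lt_trans zr _; rewrite ltr_pdivrMr// mulr_natr mulr2n ltrDl.
rewrite subrK in h; move: h.
have -> : 'd Y z0 (z - z0) = (z.1 - z0.1) *: 'D_es Y z0 + (z.2 - z0.2) *: 'D_et Y z0.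
  rewrite !deriveE// -!linearZ -linearD; congr ('d Y z0 _).
  case: z z0 {dY H zr} => [a b] [c d]; rewrite /es /et /=.
  have -> : (a - c) *: ((1, 0) : P) + (b - d) *: ((0, 1) : P) =
    ((a - c) * 1 + (b - d) * 0, (a - c) * 0 + (b - d) * 1) by [].
  by rewrite !mulr1 !mulr0 addr0 add0r.
by rewrite opprD addrA.
Qed.

Lemma prod_norm_le (z : P) (h : R) : `|z.1| <= h -> `|z.2| <= h -> `|z| <= h.
Proof. by move=> h1 h2; rewrite prod_normE ge_max h1. Qed.

End Affine.

Lemma dif_bil {R : realType} {V : normedModType R} m (f g : V -> 'rV[R]_m) z B :
  differentiable f z -> differentiable g z -> differentiable (fun z => bil B (f z) (g z)) z.
Proof.
move=> df dg; have df' := dif_entry df; have dg' := dif_entry dg.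
rewrite (_ : (fun z => _) = (fun z => \sum_i \sum_j B i j * (f z 0 i * g z 0 j))); last first.
  by apply/funext => y; rewrite bilE.
apply: (@dif_sum _ _ _ _ (fun i z => \sum_j B i j * (f z 0 i * g z 0 j))) => i.
apply: (@dif_sum _ _ _ _ (fun j z => B i j * (f z 0 i * g z 0 j))) => j.
exact: differentiableM (differentiable_cst (B i j) z) (differentiableM (df' i) (dg' j)).
Qed.

Lemma self_opp {R : realType} (x : R) : x = - x -> x = 0.
Proof. by move=> h; lra. Qed.

Lemma bil_par {R : realType} m (G : 'M[R]_m) (v w : 'rV[R]_m) :
  (forall v w, bil G v w = bil G w v) -> (forall v, 0 <= bil G v v) ->
  bil G v v <= 2 * bil G (v - w) (v - w) + 2 * bil G w w.
Proof.
move=> Gsym Gpsd; have := Gpsd (v - 2 *: w).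
rewrite !bilBl !bilBr !bilZl !bilZr (Gsym w v).
by move: (bil G v v) (bil G v w) (bil G w w) => x y z; lra.
Qed.

Lemma near_aux {R : realType} (yy d w a n q : R) : yy <= 2 * d + 2 * w -> d <= a ->
  w <= 2 * n -> q <= 2 * a -> yy + q <= 4 * n + 4 * a.
Proof. by move=> *; lra. Qed.

Lemma ww_aux {R : realType} (a b h n : R) : a ^+ 2 <= h ^+ 2 -> b ^+ 2 <= h ^+ 2 -> 0 <= n ->
  a * (a * n) + b * (b * n) <= 2 * h ^+ 2 * n.
Proof.
move=> h1 h2 n0; rewrite (_ : _ + _ = (a ^+ 2 + b ^+ 2) * n); last by ring.
by rewrite ler_wpM2r// mulr_natl mulr2n; exact: lerD.
Qed.

Section Local.
Context {R : realType} {m : nat}.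
Notation P := (R * R)%type.
Context (kap L r eps rho : R) (G0 J0 : 'M[R]_m) (J : 'rV[R]_m -> 'M[R]_m) (X : 'rV[R]_m -> 'rV[R]_m).
Context (y0 : 'rV[R]_m) (O0 : set P) (f : P -> 'rV[R]_m) (z0 : P) (Ed : P -> R).
Hypotheses (kap1 : 1 <= kap) (L0 : 0 <= L) (r0 : 0 < r) (eps0 : 0 < eps) (epsr : eps <= r)
  (rrho : 4 * kap * r <= rho).
Hypothesis (Kr : 4 * kap ^+ 3 * L * r <= 8^-1).
Hypotheses (Gsym : forall v w, bil G0 v w = bil G0 w v) (Gpsd : forall v, 0 <= bil G0 v v).
Hypotheses (Gup : forall v : 'rV[R]_m, nrm G0 v <= kap * `|v|) (Glo : forall v : 'rV[R]_m, `|v| <= kap * nrm G0 v).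
Hypotheses (Jiso : forall v w, bil G0 (v *m J0) (w *m J0) = bil G0 v w)
  (Jskew : forall v w, bil G0 (v *m J0) w = - bil G0 v (w *m J0))
  (JJ0 : forall v : 'rV[R]_m, v *m J0 *m J0 = - v).
Hypothesis (J0E : J y0 = J0).
Hypothesis (JJ : forall y : 'rV[R]_m, `|y - y0| < rho -> J y *m J y = - 1%:M).
Hypothesis (JL : forall y v : 'rV[R]_m, `|y - y0| < rho -> `|v *m (J y - J0)| <= L * `|y - y0| * `|v|).
Hypothesis (XL : forall y : 'rV[R]_m, `|y - y0| < rho -> `|X y - X y0| <= L * `|y - y0|).
Hypothesis (Xk : `|X y0| <= kap).
Hypotheses (oO0 : open O0) (sf : smooth O0 f) (fO0 : forall z, O0 z -> `|f z - y0| < rho).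
Hypothesis (clO0 : closed [set z | O0 z /\ `|f z - y0| <= rho / 2]).
Hypotheses (z0O : O0 z0) (fz0 : f z0 = y0).
Hypothesis (floer : forall z, O0 z ->
  'D_es f z + ('D_et f z - eps *: X (f z)) *m J (f z) = 0).
Hypothesis (cEd : continuous Ed).
Hypothesis (Ed0 : forall z, 0 <= Ed z).
Hypothesis (EdE : forall z, O0 z -> bil G0 ('D_es f z) ('D_es f z) <= Ed z).

Let Y (z : P) : 'rV[R]_m := f z - y0 - (eps * (z.2 - z0.2)) *: X y0.
Let Ys := 'D_es f.
Let Yt (z : P) : 'rV[R]_m := 'D_et f z - eps *: X y0.
Let O := O0 `&` [set z : P | `|z.2 - z0.2| < 2].
Let F := [set z | O0 z /\ `|f z - y0| <= rho / 2] `&` [set z : P | `|z.2 - z0.2| <= 1].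
Let Q (z : P) : R := bil G0 (Y z) (Y z) + r ^+ 2 * ((z.1 - z0.1) ^+ 2 + (z.2 - z0.2) ^+ 2).
(** For zero defect [a] and [c] equal [- d_s Q / 2] and [d_t Q / 2]. Expressing each by the other
    derivative of [Y] through [J0] lets the mixed derivatives cancel in [d_s a - d_t c]. *)
Let a (z : P) : R := bil (G0 *m J0^T) (Y z) (Yt z) - r ^+ 2 * (z.1 - z0.1).
Let c (z : P) : R := bil (G0 *m J0^T) (Y z) (Ys z) + r ^+ 2 * (z.2 - z0.2).
Let D (z : P) : R := bil G0 (Ys z) (Ys z) + r ^+ 2.

Let kap0 : 0 < kap. Proof. exact: lt_le_trans kap1. Qed.

Let cabs : continuous (fun z : P => `|z.2 - z0.2| : R).
Proof. move=> z; apply: cvg_norm; exact: differentiable_continuous (dif_snd z0.2 z). Qed.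

Let oO : open O.
Proof.
apply: openI => //; apply: (@open_comp _ _ (fun z : P => `|z.2 - z0.2| : R) [set x | x < 2]).
  by move=> z _; exact: cabs.
exact: open_lt.
Qed.

Let cF : closed F.
Proof.
apply: closedI => //; apply: (@preimage_closed _ _ (fun z : P => `|z.2 - z0.2| : R) [set x | x <= 1]).
  by move=> z _; exact: cabs.
exact: closed_le.
Qed.

Let FO : F `<=` O.
Proof. by move=> z [[? _] /= h]; split => //=; apply: le_lt_trans h _; rewrite ltr1n. Qed.

Let difY z : O0 z -> differentiable Y z.
Proof.
move=> Oz; apply: differentiableB.
  by apply: differentiableB; [exact: smooth_dif sf Oz|exact: differentiable_cst].
apply: differentiableZl; apply: differentiableM; [exact: differentiable_cst|exact: dif_snd].
Qed.

Let DY z v : O0 z -> 'D_v Y z = 'D_v f z - (eps * v.2) *: X y0.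
Proof.
move=> Oz; have df := smooth_dif sf Oz.
apply/rowP => j; rewrite (D_entry v (difY Oz)).
have E : (fun z => Y z 0 j) = (fun z => f z 0 j - y0 0 j - eps * (z.2 - z0.2) * X y0 0 j).
  by apply/funext => y; rewrite /Y !mxE.
rewrite E !mxE (D_entry v df).
have d1 := dif_entry df j.
have d2 : differentiable (fun z : P => eps * (z.2 - z0.2) * X y0 0 j) z.
  by apply: differentiableM; [apply: differentiableM; [exact: differentiable_cst|exact: dif_snd]|exact: differentiable_cst].
rewrite deriveB; [|by apply: diff_derivable; apply: differentiableB; [|exact: differentiable_cst]|exact: diff_derivable].
rewrite deriveB; [|exact: diff_derivable|exact: derivable_cst].
rewrite derive_cst subr0; congr (_ - _).
under eq_fun do rewrite mulrAC.
by rewrite derive_scal ?D_snd 1?mulrAC//; exact: dif_snd.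
Qed.

Let C1rYs : C1r es et O Ys.
Proof. by move=> j; apply: smooth_C1; apply: smooth_sub (@subIsetl _ _ _) _; apply: smooth_entry => //; exact: smooth_D. Qed.

Let C1rf : C1r es et O f.
Proof. by move=> j; apply: smooth_C1; apply: smooth_sub (@subIsetl _ _ _) _; exact: smooth_entry. Qed.

Let C1rYt : C1r es et O Yt.
Proof.
move=> j; have h : C1 es et O (fun z => 'D_et f z 0 j).
  by apply: smooth_C1; apply: smooth_sub (@subIsetl _ _ _) _; apply: smooth_entry => //; exact: smooth_D.
have := C1D oO h (@C1_cst _ _ es et O (- (eps * X y0 0 j))).
by apply: C1_eq => // z _; rewrite /Yt !mxE.
Qed.

Let C1rY : C1r es et O Y.
Proof.
move=> j; have h := C1D oO (C1rf j) (@C1_cst _ _ es et O (- y0 0 j)).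
have := C1D oO h (C1M oO (@C1_cst _ _ es et O (- (eps * X y0 0 j))) (@C1_snd R z0.2 O)).
by apply: C1_eq => // z _; rewrite /Y !mxE; ring.
Qed.

Let C1Q : C1 es et O Q.
Proof.
apply: C1D => //; first exact: C1_bil.
apply: C1M => //; first exact: C1_cst.
have h1 := @C1_fst R z0.1 O; have h2 := @C1_snd R z0.2 O.
exact: (C1D oO (C1M oO h1 h1) (C1M oO h2 h2)).
Qed.

Let C1a : C1 es et O a.
Proof.
have := C1D oO (C1_bil (G0 *m J0^T) oO C1rY C1rYt)
   (C1M oO (@C1_cst _ _ es et O (- r ^+ 2)) (@C1_fst R z0.1 O)).
by apply: C1_eq => // z _; rewrite /a mulNr.
Qed.

Let C1c : C1 es et O c.
Proof.
exact: (C1D oO (C1_bil (G0 *m J0^T) oO C1rY C1rYs)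
   (C1M oO (@C1_cst _ _ es et O (r ^+ 2)) (@C1_snd R z0.2 O))).
Qed.

Let Q0 z : 0 <= Q z.
Proof. by rewrite addr_ge0// mulr_ge0 ?exprn_ge0 ?addr_ge0 ?sqr_ge0// ltW. Qed.

Let Yf z : `|f z - y0| <= `|Y z| + eps * `|z.2 - z0.2| * kap.
Proof.
have -> : f z - y0 = Y z + (eps * (z.2 - z0.2)) *: X y0 by rewrite /Y subrK.
apply: le_trans (ler_normD _ _) _; rewrite lerD2l normrZ normrM gtr0_norm//.
by rewrite ler_wpM2l// mulr_ge0// ltW.
Qed.

(** For [|t - t0| <= 1] the subtracted drift is at most [kap r], because [eps <= r]; half of the
    distance [2 kap r] is left for [Y]. *)
Let Qfar z : `|z.2 - z0.2| <= 1 -> 2 * kap * r <= `|f z - y0| -> r ^+ 2 <= Q z.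
Proof.
move=> t1 fy; have : kap * r <= `|Y z|.
  have := Yf z; have : eps * `|z.2 - z0.2| * kap <= r * kap.
    rewrite ler_wpM2r ?(ltW kap0)//; apply: le_trans epsr; rewrite ler_piMr// ltW//.
  by rewrite [r * kap]mulrC; lra.
move=> h; have : kap * r <= kap * nrm G0 (Y z) by exact: le_trans h (Glo _).
rewrite ler_pM2l// => {}h.
apply: (@le_trans _ _ (nrm G0 (Y z) ^+ 2)); first by rewrite ler_sqr ?nnegrE ?nrm_ge0 ?(ltW r0).
by rewrite nrm_sqr// /Q lerDl mulr_ge0 ?exprn_ge0 ?addr_ge0 ?sqr_ge0// ltW.
Qed.

Let Qtau z : 1 <= `|z.2 - z0.2| -> r ^+ 2 <= Q z.
Proof.
move=> t1; have t2 : 1 <= (z.2 - z0.2) ^+ 2 by rewrite -real_normK ?num_real// exprn_ege1.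
rewrite /Q; have := Gpsd (Y z).
have : r ^+ 2 * 1 <= r ^+ 2 * ((z.1 - z0.1) ^+ 2 + (z.2 - z0.2) ^+ 2).
  by rewrite ler_wpM2l ?sqr_ge0//; have := sqr_ge0 (z.1 - z0.1); lra.
lra.
Qed.

Let QF z : O z -> ~ F z -> r ^+ 2 <= Q z.
Proof.
move=> [Oz _] nF; have [t1|t1] := leP 1 (`|z.2 - z0.2|); first exact: Qtau.
apply: Qfar; first exact: ltW.
rewrite leNgt; apply/negP => h; apply: nF; split => /=; last exact: ltW.
by split => //; apply: ltW; apply: lt_le_trans h _; move: rrho; lra.
Qed.

(** The variation of [J] and [X] is [O(|f - y0|)], and [|f - y0| <= 2 kap sqrt Q]. In the
    Hamiltonian term [eps <= r <= sqrt D], so the bound is free of [eps]. *)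
Let resid z : O z -> nrm G0 (Ys z + Yt z *m J0) <=
  4 * kap ^+ 3 * L * (Num.sqrt (Q z) * Num.sqrt (D z)).
Proof.
move=> [Oz _]; have fz := fO0 Oz.
have ft : 'D_et f z = 'D_es f z *m J (f z) + eps *: X (f z).
  have := congr1 (fun v => v *m J (f z)) (floer Oz).
  rewrite mulmxDl mul0mx -mulmxA (JJ fz) mulmxN mulmx1 => /eqP.
  by rewrite subr_eq0 => /eqP ->; rewrite subrK.
have -> : Ys z + Yt z *m J0 = (Ys z *m (J (f z) - J0) + eps *: (X (f z) - X y0)) *m J0.
  rewrite /Yt ft -/(Ys z) mulmxBr scalerBr [X in _ = X *m _]addrAC [in RHS]mulmxBl JJ0 opprK.
  by rewrite [RHS]addrC addrA.
have -> : forall w, nrm G0 (w *m J0) = nrm G0 w by move=> w; rewrite /nrm Jiso.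
apply: le_trans (Gup _) _.
set d := `|f z - y0|; have d0 : 0 <= d by exact: normr_ge0.
have h1 : `|Ys z *m (J (f z) - J0) + eps *: (X (f z) - X y0)| <= L * d * (kap * nrm G0 (Ys z) + r).
  apply: le_trans (ler_normD _ _) _; rewrite mulrDr; apply: lerD.
    by apply: le_trans (JL _ fz) _; rewrite ler_wpM2l ?mulr_ge0.
  rewrite normrZ gtr0_norm// mulrC; apply: ler_pM => //; [exact: ltW|exact: XL].
have sD : 0 <= D z by rewrite addr_ge0// sqr_ge0.
have h2 : nrm G0 (Ys z) <= Num.sqrt (D z) by rewrite ler_wsqrtr// lerDl sqr_ge0.
have h3 : r <= Num.sqrt (D z).
  by rewrite -[leLHS](ger0_norm (ltW r0)) -sqrtr_sqr ler_wsqrtr// lerDr.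
have h4 : nrm G0 (Y z) <= Num.sqrt (Q z).
  by rewrite ler_wsqrtr// lerDl mulr_ge0 ?exprn_ge0 ?addr_ge0 ?sqr_ge0// ltW.
have h5 : r * `|z.2 - z0.2| <= Num.sqrt (Q z).
  rewrite -[in leLHS](ger0_norm (ltW r0)) -normrM -sqrtr_sqr ler_wsqrtr// exprMn /Q mulrDr addrA lerDr.
  by rewrite addr_ge0// mulr_ge0 ?sqr_ge0.
have h6 : d <= 2 * kap * Num.sqrt (Q z).
  apply: le_trans (Yf z) _.
  have k1 := Glo (Y z).
  have k2 : kap * nrm G0 (Y z) <= kap * Num.sqrt (Q z) by rewrite ler_pM2l.
  have k3 : eps * `|z.2 - z0.2| * kap <= Num.sqrt (Q z) * kap.
    by rewrite ler_pM2r//; apply: le_trans h5; rewrite ler_wpM2r.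
  by rewrite [X in _ <= X](_ : _ = kap * Num.sqrt (Q z) + Num.sqrt (Q z) * kap); [lra|ring].
have h7 : kap * nrm G0 (Ys z) + r <= 2 * kap * Num.sqrt (D z).
  have k2 : kap * nrm G0 (Ys z) <= kap * Num.sqrt (D z) by rewrite ler_pM2l.
  have k3 : 1 * Num.sqrt (D z) <= kap * Num.sqrt (D z) by rewrite ler_wpM2r// sqrtr_ge0.
  by rewrite [X in _ <= X](_ : _ = kap * Num.sqrt (D z) + kap * Num.sqrt (D z)); [lra|ring].
apply: (@le_trans _ _ (kap * (L * (2 * kap * Num.sqrt (Q z)) * (2 * kap * Num.sqrt (D z))))).
  rewrite ler_pM2l//; apply: le_trans h1 _; apply: ler_pM => //.
  - by rewrite mulr_ge0.
  - by rewrite addr_ge0 ?mulr_ge0 ?nrm_ge0 ?(ltW kap0) ?(ltW r0).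
  - by rewrite ler_wpM2l.
by rewrite le_eqVlt; apply/orP; left; apply/eqP; ring.
Qed.

Let Kge0 : 0 <= 4 * kap ^+ 3 * L.
Proof. by rewrite !mulr_ge0 ?exprn_ge0// ltW. Qed.

Let DYs z : O z -> 'D_es Y z = Ys z.
Proof. by move=> [Oz _]; rewrite DY// /es /= mulr0 scale0r subr0. Qed.
Let DYt z : O z -> 'D_et Y z = Yt z.
Proof. by move=> [Oz _]; rewrite DY// /et /= mulr1. Qed.

Let dYs z : O z -> differentiable Ys z.
Proof. by move=> [Oz _]; apply: smooth_dif Oz; exact: smooth_D. Qed.
Let dYt z : O z -> differentiable Yt z.
Proof.
move=> [Oz _]; apply: differentiableB; last exact: differentiable_cst.
by apply: smooth_dif Oz; exact: smooth_D.
Qed.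

Let DYtE z v : O z -> 'D_v Yt z = 'D_v ('D_et f) z.
Proof.
move=> Oz; rewrite deriveB; last exact: derivable_cst.
  by rewrite derive_cst subr0.
by apply: diff_derivable; case: Oz => Oz _; apply: smooth_dif Oz; exact: smooth_D.
Qed.

Let mixed z : O z -> 'D_es ('D_et f) z = 'D_et Ys z.
Proof. by move=> [Oz _]; exact: (@smooth_schwarz_rV R _ m O0 f z et es oO0 Oz sf). Qed.

Let D_quad z v : 'D_v (fun z : P => r ^+ 2 * ((z.1 - z0.1) ^+ 2 + (z.2 - z0.2) ^+ 2)) z =
  r ^+ 2 * (2 * (z.1 - z0.1) * v.1 + 2 * (z.2 - z0.2) * v.2).
Proof.
have h1 := dif_fst z0.1 z; have h2 := dif_snd z0.2 z.
have d1 : differentiable (fun z : P => (z.1 - z0.1) * (z.1 - z0.1)) z by exact: differentiableM.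
have d2 : differentiable (fun z : P => (z.2 - z0.2) * (z.2 - z0.2)) z by exact: differentiableM.
rewrite (_ : (fun z => _) = (fun z : P => r ^+ 2 * ((z.1 - z0.1) * (z.1 - z0.1) + (z.2 - z0.2) * (z.2 - z0.2)))); last first.
  by apply/funext => y; rewrite !expr2.
rewrite derive_scal; last exact: differentiableD.
rewrite (derive_add _ d1 d2) (derive_mul _ h1 h1) (derive_mul _ h2 h2) D_fst D_snd.
by ring.
Qed.

Let dquad z : differentiable (fun z : P => r ^+ 2 * ((z.1 - z0.1) ^+ 2 + (z.2 - z0.2) ^+ 2)) z.
Proof.
have h1 := dif_fst z0.1 z; have h2 := dif_snd z0.2 z.
apply: differentiableM; first exact: differentiable_cst.
apply: differentiableD; first exact: (differentiableM h1 h1).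
exact: (differentiableM h2 h2).
Qed.

Let DQ z v : O z -> 'D_v Q z = 2 * bil G0 (Y z) ('D_v Y z) +
  r ^+ 2 * (2 * (z.1 - z0.1) * v.1 + 2 * (z.2 - z0.2) * v.2).
Proof.
move=> [Oz _]; have dY := difY Oz.
rewrite (derive_add v (dif_bil G0 dY dY) (dquad z)) (D_bil v G0 dY dY) D_quad.
by rewrite (Gsym ('D_v Y z)); congr (_ + _); ring.
Qed.

Let Da z : O z -> 'D_es a z =
  bil (G0 *m J0^T) (Ys z) (Yt z) + bil (G0 *m J0^T) (Y z) ('D_et Ys z) - r ^+ 2.
Proof.
move=> Oz; have dY := difY Oz.1; have dt := dYt Oz.
rewrite (_ : a = fun z => bil (G0 *m J0^T) (Y z) (Yt z) + (- r ^+ 2) * (z.1 - z0.1)); last first.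
  by apply/funext => y; rewrite mulNr.
rewrite (derive_add _ (dif_bil _ dY dt) (differentiableM (differentiable_cst (- r ^+ 2) z) (dif_fst z0.1 z))).
have e1 : 'D_es (fun z : P => (- r ^+ 2) * (z.1 - z0.1)) z = - r ^+ 2.
  apply: etrans (derive_scal (- r ^+ 2) es (dif_fst z0.1 z)) _.
  by rewrite D_fst mulr1.
apply: (congr2 (fun x y => x + y) _ e1).
apply: etrans (D_bil es (G0 *m J0^T) dY dt) _.
by rewrite (DYs Oz) (DYtE es Oz) (mixed Oz).
Qed.

Let Dc z : O z -> 'D_et c z =
  bil (G0 *m J0^T) (Yt z) (Ys z) + bil (G0 *m J0^T) (Y z) ('D_et Ys z) + r ^+ 2.
Proof.
move=> Oz; have dY := difY Oz.1; have ds := dYs Oz.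
rewrite (derive_add _ (dif_bil _ dY ds) (differentiableM (differentiable_cst (r ^+ 2) z) (dif_snd z0.2 z))).
have e1 : 'D_et (fun z : P => r ^+ 2 * (z.2 - z0.2)) z = r ^+ 2.
  apply: etrans (derive_scal (r ^+ 2) et (dif_snd z0.2 z)) _.
  by rewrite D_snd mulr1.
apply: (congr2 (fun x y => x + y) _ e1).
apply: etrans (D_bil et (G0 *m J0^T) dY ds) _.
by rewrite (DYt Oz).
Qed.

Let ineq z : O z ->
    [/\ 'D_es a z - 'D_et c z <= - 2 * D z * (1 - 4 * kap ^+ 3 * L * Num.sqrt (Q z)),
        - 2 * (Q z * D z) * (1 + 2 * (4 * kap ^+ 3 * L * Num.sqrt (Q z))) <=
          'D_es Q z * a z - 'D_et Q z * c z,
        0 <= D z & D z <= Ed z + r ^+ 2].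
Proof.
move=> Oz; have rb := resid Oz; split.
- rewrite Da// Dc// -!bil_mulr.
  exact: (@pointwise1 R m G0 Gsym Gpsd J0 (Y z) (Ys z) (Yt z) ('D_et Ys z) r (z.1 - z0.1) (z.2 - z0.2) _ r0 Jskew rb).
- rewrite (DQ es Oz) (DQ et Oz) (DYs Oz) (DYt Oz) /a /c -!bil_mulr /es /et /= !mulr1 !mulr0 addr0 add0r.
  have E x : r ^+ 2 * (2 * x) = 2 * r ^+ 2 * x by ring.
  rewrite !E.
  exact: (@pointwise2 R m G0 Gsym Gpsd J0 (Y z) (Ys z) (Yt z) r (z.1 - z0.1) (z.2 - z0.2) _ r0 Jiso Jskew JJ0 rb).
- by rewrite addr_ge0// sqr_ge0.
- by rewrite lerD2r; apply: EdE; case: Oz.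
Qed.

Let Oz0 : O z0. Proof. by split => //=; rewrite subrr normr0. Qed.
Let Yz0 : Y z0 = 0. Proof. by rewrite /Y fz0 !subrr mulr0 scale0r subr0. Qed.

Let Yt0 : Yt z0 = Ys z0 *m J0.
Proof.
have := congr1 (fun v => v *m J0) (floer z0O).
rewrite fz0 J0E mulmxDl mul0mx JJ0 => /eqP; rewrite subr_eq0 => /eqP E.
by rewrite /Yt -E.
Qed.

Let Dz0 : 0 < D z0. Proof. by rewrite ltr_wpDl// exprn_gt0. Qed.

(** At the centre [Y] vanishes and the defect is zero, so that [Ys] and [Yt = Ys J0] are orthogonal
    of equal length. A first-order expansion with error [r h] in the metric then bounds [Q] by
    [4 D h^2]. *)
Let near_z0 : exists2 rho1 : R, 0 < rho1 & forall s t h : R, 0 < h <= rho1 ->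
   z0.1 - h <= s <= z0.1 + h -> z0.2 - h <= t <= z0.2 + h ->
     [/\ O (s, t), Q (s, t) <= 4 * D z0 * h ^+ 2 & D z0 / 2 <= D (s, t)].
Proof.
have e0 : 0 < r / kap by exact: divr_gt0.
have [rho1 rho10 H1] := first_order (difY z0O) e0.
have cD : {for z0, continuous D}.
  have dD : differentiable D z0.
    by apply: differentiableD; [exact: dif_bil (dYs Oz0) (dYs Oz0)|exact: differentiable_cst].
  exact: differentiable_continuous dD.
have D2 : 0 < D z0 / 2 by rewrite divr_gt0.
move/cvgrPdist_lt : (cD) => /(_ _ D2) H2.
have H3 := open_nbhs_nbhs (conj oO Oz0).
have /nbhs_ballP[rho2 /= rho20 H4] : nbhs z0 [set z | `|D z0 - D z| < D z0 / 2 /\ O z].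
  by apply: filterS2 H2 H3.
exists (Num.min rho1 (rho2 / 2)); first by rewrite lt_min rho10 divr_gt0.
move=> s t h /andP[h0]; rewrite le_min => /andP[hr1 hr2] ss tt.
have z1 : `|s - z0.1| <= h by rewrite ler_norml; lra.
have z2 : `|t - z0.2| <= h by rewrite ler_norml; lra.
have zh : `|((s, t) : P) - z0| <= h by apply: prod_norm_le.
have [|H5 Oz] := H4 (s, t).
  rewrite -ball_normE /= distrC; apply: le_lt_trans zh _; apply: le_lt_trans hr2 _.
  by rewrite ltr_pdivrMr// mulr_natr mulr2n ltrDl.
have H5' : D z0 / 2 <= D (s, t).
  by move: H5; rewrite /= ltr_norml => /andP[_]; move: (D z0) (D (s, t)) => x y; lra.
suff Qb : Q (s, t) <= 4 * D z0 * h ^+ 2 by exact: And3 Oz Qb H5'.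
have := H1 (s, t) (le_trans zh hr1).
rewrite Yz0 subr0 (DYs Oz0) (DYt Oz0) Yt0 /= => H6.
pose W : 'rV[R]_m := (s - z0.1) *: Ys z0 + (t - z0.2) *: (Ys z0 *m J0).
have sq1 : (s - z0.1) ^+ 2 <= h ^+ 2 by rewrite -real_normK ?num_real// ler_sqr ?nnegrE// ltW.
have sq2 : (t - z0.2) ^+ 2 <= h ^+ 2 by rewrite -real_normK ?num_real// ler_sqr ?nnegrE// ltW.
have AJA : bil G0 (Ys z0) (Ys z0 *m J0) = 0.
  by apply: self_opp; rewrite -Jskew Gsym.
have N0 := Gpsd (Ys z0).
have WW : bil G0 W W <= 2 * h ^+ 2 * bil G0 (Ys z0) (Ys z0).
  rewrite /W bilDl !bilDr !bilZl !bilZr Jiso (Gsym (Ys z0 *m J0)) AJA !mulr0 addr0 add0r.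
  exact: ww_aux sq1 sq2 N0.
have YW : nrm G0 (Y (s, t) - W) <= r * h.
  apply: le_trans (Gup _) _.
  have H7 : `|Y (s, t) - W| <= r / kap * h.
    by apply: le_trans H6 _; rewrite ler_wpM2l// ltW.
  have : kap * `|Y (s, t) - W| <= kap * (r / kap * h) by rewrite ler_pM2l.
  by rewrite [X in _ <= X -> _](_ : _ = r * h)//; field; exact: lt0r_neq0.
have YWsq : bil G0 (Y (s, t) - W) (Y (s, t) - W) <= r ^+ 2 * h ^+ 2.
  by rewrite -nrm_sqr// -exprMn ler_sqr ?nnegrE ?nrm_ge0// mulr_ge0// ltW.
have par : bil G0 (Y (s, t)) (Y (s, t)) <= 2 * bil G0 (Y (s, t) - W) (Y (s, t) - W) + 2 * bil G0 W W.
  exact: bil_par.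
rewrite /Q /=; have : r ^+ 2 * ((s - z0.1) ^+ 2 + (t - z0.2) ^+ 2) <= r ^+ 2 * (2 * h ^+ 2).
  by rewrite ler_wpM2l ?sqr_ge0// mulr_natl mulr2n; exact: lerD.
rewrite [X in _ -> _ <= X](_ : _ = 4 * h ^+ 2 * bil G0 (Ys z0) (Ys z0) + 4 * (r ^+ 2 * h ^+ 2)); last first.
  by rewrite /D; ring.
rewrite [r ^+ 2 * (2 * h ^+ 2)](_ : _ = 2 * (r ^+ 2 * h ^+ 2)); last by ring.
rewrite -[4 * _ * _]mulrA; rewrite -[2 * _ * _]mulrA in WW; exact: near_aux par YWsq WW.
Qed.

(** The weight vanishes on the sides [s = s1] and [s = s2] by the assumed distance, and on the two
    others by the graph coordinate [t]. The summand [r^2] is the energy density of the graph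
    coordinates, and 320 is 80 times the constant 4 of [near_z0]. *)
Lemma local_energy (s1 s2 : R) : s1 < z0.1 < s2 ->
  (forall s t, O0 (s, t) -> z0.2 - 1 <= t <= z0.2 + 1 -> s = s1 \/ s = s2 ->
    2 * kap * r <= `|f (s, t) - y0|) ->
  r ^+ 2 <= 320 * I1 s1 s2 (fun s => I1 (z0.2 - 1) (z0.2 + 1) (fun t => Ed (s, t) + r ^+ 2)).
Proof.
move=> /andP[s10 s20] far; have [rho1 rho10 H1] := near_z0.
have [rh [rh0 h1 h2 h3 h4]] : exists rh : R,
    [/\ 0 < rh, rh <= rho1, rh <= z0.1 - s1, rh <= s2 - z0.1 & rh <= 1].
  exists (Num.min (Num.min rho1 1) (Num.min (z0.1 - s1) (s2 - z0.1))).
  by rewrite !lt_min !ge_min !lexx rho10 ltr01 !subr_gt0 s10 s20 !orbT.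
have -> : 320 = 80 * 4 :> R by rewrite -natrM.
apply: (@concentration R O F Q a c D (fun z => Ed z + r ^+ 2) r (4 * kap ^+ 3 * L) 4 (D z0) rh
   s1 s2 (z0.2 - 1) (z0.2 + 1) z0 r0 Kge0 Kr _ Dz0 rh0 oO cF FO C1Q C1a C1c).
- by rewrite ltr0n.
- by move=> z _; exact: Q0.
- exact: QF.
- move=> s t Oz ss tt.
  have t1 : `|(s, t).2 - z0.2| <= 1 by rewrite ler_norml /=; lra.
  case=> [E|[E|[E|E]]].
  + by apply: Qfar => //; apply: far => //; [case: Oz|left].
  + by apply: Qfar => //; apply: far => //; [case: Oz|right].
  + by apply: Qtau; rewrite E /= addrAC subrr add0r normrN normr1.
  + by apply: Qtau; rewrite E /= addrAC subrr add0r normr1.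
- by move=> z Oz _; exact: ineq.
- by move=> z; apply: cvgD; [exact: cEd|exact: cvg_cst].
- by move=> z; rewrite addr_ge0// sqr_ge0.
- lra.
- lra.
- lra.
- lra.
- move=> s t h /andP[h0 hrh]; apply: H1; rewrite h0; exact: le_trans hrh h1.
Qed.

End Local.

(** * Smooth functions *)

Section SmoothLocal.
Context {R : realType} {V W : normedModType R}.

Lemma Ck_pt k (U : set V) (f : V -> W) :
  (forall x, U x -> exists U', [/\ open U', U' x & Ck k U' f]) -> Ck k U f.
Proof.
elim: k f => [|k IH] f H; split => //=.
- by move=> x /H [U' [_ U'x [cf _]]]; exact: cf.
- by move=> x /H [U' [_ U'x [cf _]]]; exact: cf.
- split.
    by move=> x /H [U' [_ U'x [_ [df _]]]]; exact: df.
  move=> v; apply: IH => x /H [U' [oU' U'x [_ [_ Df]]]]; exists U'; split => //; exact: Df.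
Qed.

Lemma smooth_local (U : set V) (f : V -> W) :
  (forall x, U x -> exists U' g, [/\ open U', U' x, smooth U' g & forall y, U' y -> g y = f y]) ->
  smooth U f.
Proof.
move=> H k; apply: Ck_pt => x /H [U' [g [oU' U'x sg gf]]]; exists U'; split => //.
exact: Ck_eq oU' gf (sg k).
Qed.

Lemma Ck_weak k (U : set V) (f : V -> W) : Ck k.+1 U f -> Ck k U f.
Proof.
elim: k f => [|k IH] f [cf [df Df]]; split => //=; split => // v.
exact: IH _ (Df v).
Qed.

End SmoothLocal.

Section SmoothAlg.
Context {R : realType} {V : normedModType R} (U : set V) (oU : open U).
Implicit Types f g : V -> R.

Lemma Ck_cst k (c : R) : Ck k U (fun=> c).
Proof.
have H : forall k (c : R), Ck k U (cst c).
  elim=> [|n IH] a; split => //=.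
  - by move=> x _; exact: cvg_cst.
  - by move=> x _; exact: cvg_cst.
  - split; first by move=> x _; exact: differentiable_cst.
    move=> v; have -> : 'D_v (cst a : V -> R) = cst 0; last exact: IH.
    by apply/funext => y; exact: derive_cst.
exact: H.
Qed.

Lemma CkD k f g : Ck k U f -> Ck k U g -> Ck k U (fun x => f x + g x).
Proof.
elim: k f g => [|k IH] f g [cf Hf] [cg Hg]; split => //=.
- by move=> x Ux; apply: cvgD; [exact: cf|exact: cg].
- by move=> x Ux; apply: cvgD; [exact: cf|exact: cg].
- have [df Df] := Hf; have [dg Dg] := Hg; split.
    by move=> x Ux; apply: differentiableD; [exact: df|exact: dg].
  move=> v; have := IH _ _ (Df v) (Dg v); apply: (Ck_eq oU) => x Ux.
  by rewrite derive_add//; [exact: df|exact: dg].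
Qed.

Lemma CkM k f g : Ck k U f -> Ck k U g -> Ck k U (fun x => f x * g x).
Proof.
elim: k f g => [|k IH] f g Hf0 Hg0; have [cf Hf] := Hf0; have [cg Hg] := Hg0; split => //=.
- by move=> x Ux; apply: cvgM; [exact: cf|exact: cg].
- by move=> x Ux; apply: cvgM; [exact: cf|exact: cg].
- have [df Df] := Hf; have [dg Dg] := Hg; split.
    by move=> x Ux; apply: differentiableM; [exact: df|exact: dg].
  move=> v.
  have h1 := IH _ _ (Ck_weak Hf0) (Dg v); have h2 := IH _ _ (Ck_weak Hg0) (Df v).
  have := CkD h1 h2; apply: (Ck_eq oU) => x Ux.
  by rewrite derive_mul//; [exact: df|exact: dg].
Qed.

Lemma CkV k f : (forall x, U x -> f x != 0) -> Ck k U f -> Ck k U (fun x => (f x)^-1).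
Proof.
move=> f0; elim: k => [|k IH] Hf0; have [cf Hf] := Hf0; split => //=.
- by move=> x Ux; apply: cvgV; [exact: f0|exact: cf].
- by move=> x Ux; apply: cvgV; [exact: f0|exact: cf].
- have [df Df] := Hf; split.
    by move=> x Ux; apply: differentiableV; [exact: df|exact: f0].
  move=> v; have h := IH (Ck_weak Hf0).
  have := CkM (Ck_cst k (-1)) (CkM (CkM h h) (Df v)); apply: (Ck_eq oU) => x Ux.
  rewrite deriveV; [|exact: f0|by apply: diff_derivable; exact: df].
  by rewrite /GRing.scale /= -exprVn expr2 mulN1r mulNr.
Qed.

Lemma smooth_cst (c : R) : smooth U (fun=> c).
Proof. by move=> k; exact: Ck_cst. Qed.
Lemma smooth_add f g : smooth U f -> smooth U g -> smooth U (fun x => f x + g x).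
Proof. by move=> Hf Hg k; exact: CkD. Qed.
Lemma smooth_mul f g : smooth U f -> smooth U g -> smooth U (fun x => f x * g x).
Proof. by move=> Hf Hg k; exact: CkM. Qed.

Lemma smooth_inv f : (forall x, U x -> f x != 0) -> smooth U f -> smooth U (fun x => (f x)^-1).
Proof. by move=> f0 Hf k; exact: CkV. Qed.
Lemma smooth_sum (I : Type) (r : seq I) (F : I -> V -> R) :
  (forall i, smooth U (F i)) -> smooth U (fun x => \sum_(i <- r) F i x).
Proof.
move=> H; elim: r => [|i r IH].
  by under eq_fun do rewrite big_nil; exact: smooth_cst.
by under eq_fun do rewrite big_cons; exact: smooth_add.
Qed.
Lemma smooth_bigprod (I : Type) (r : seq I) (F : I -> V -> R) :
  (forall i, smooth U (F i)) -> smooth U (fun x => \prod_(i <- r) F i x).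
Proof.
move=> H; elim: r => [|i r IH].
  by under eq_fun do rewrite big_nil; exact: smooth_cst.
by under eq_fun do rewrite big_cons; exact: smooth_mul.
Qed.

Definition msmooth p q (F : V -> 'M[R]_(p, q)) := forall i j, smooth U (fun x => F x i j).

Lemma smooth_det n (F : V -> 'M[R]_n) : msmooth F -> smooth U (fun x => \det (F x)).
Proof.
move=> H; rewrite /determinant; apply: smooth_sum => s.
apply: smooth_mul; first exact: smooth_cst.
by apply: smooth_bigprod => i; exact: H.
Qed.

(** Cramer's rule: the entries are cofactors divided by the determinant. *)
Lemma msmooth_inv n (F : V -> 'M[R]_n) : (forall x, U x -> F x \in unitmx) -> msmooth F ->
  msmooth (fun x => invmx (F x)).
Proof.
move=> Fu H i j.
have sd := smooth_det H.
have d0 x : U x -> \det (F x) != 0 by move=> /Fu; rewrite unitmxE unitfE.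
have sc : smooth U (fun x => cofactor (F x) j i).
  rewrite /cofactor; apply: smooth_mul; first exact: smooth_cst.
  apply: (@smooth_det _ (fun x => row' j (col' i (F x)))) => k l.
  under eq_fun do rewrite !mxE; exact: H.
apply: (smooth_eq oU _ (smooth_mul (smooth_inv d0 sd) sc)) => x Ux.
by rewrite /invmx Fu// !mxE.
Qed.

Lemma msmooth_mul p q s (F : V -> 'M[R]_(p, q)) (G : V -> 'M[R]_(q, s)) :
  msmooth F -> msmooth G -> msmooth (fun x => F x *m G x).
Proof.
move=> HF HG i j; under eq_fun do rewrite mxE.
by apply: smooth_sum => k; apply: smooth_mul.
Qed.

Lemma msmooth_tr p q (F : V -> 'M[R]_(p, q)) : msmooth F -> msmooth (fun x => (F x)^T).
Proof. by move=> HF i j; under eq_fun do rewrite mxE; exact: HF. Qed.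

Lemma smooth_msmooth p q (F : V -> 'M[R]_(p, q)) : smooth U F -> msmooth F.
Proof. by move=> HF i j; exact: smooth_entry. Qed.

End SmoothAlg.

(** * Linear algebra of a compatible triple *)

Section Compat.
Context {R : realType} {m : nat}.
Implicit Types (Om J G P : 'M[R]_m).

Lemma bil_inj (A B : 'M[R]_m) : (forall v w, bil A v w = bil B v w) -> A = B.
Proof.
move=> H; apply/matrixP => i j.
have E C : bil C (delta_mx 0 i) (delta_mx 0 j) = C i j.
  rewrite /bil -rowE trmx_delta -colE !mxE; exact: erefl.
by rewrite -!E.
Qed.

Lemma bil_trE (A : 'M[R]_m) v w : bil A^T v w = bil A w v.
Proof.
rewrite !bilE exchange_big /=; apply: eq_bigr => i _; apply: eq_bigr => j _.
by rewrite mxE [v 0 j * _]mulrC.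
Qed.

Lemma bil_alt (A : 'M[R]_m) : (forall v, bil A v v = 0) -> A^T = - A.
Proof.
move=> H; apply: bil_inj => v w.
have := H (v + w); rewrite bilDl !bilDr !H add0r addr0 => /eqP; rewrite addr_eq0 => /eqP E.
have -> : bil (- A) v w = - bil A v w by rewrite /bil mulmxN mulNmx mxE.
by rewrite bil_trE E opprK.
Qed.

Lemma bil_sym_tr (A : 'M[R]_m) : (forall v w, bil A v w = bil A w v) -> A^T = A.
Proof.
by move=> H; apply: bil_inj => v w; rewrite bil_trE.
Qed.

Record compat Om J G := Compat {
  c_alt : Om^T = - Om; c_unit : Om \in unitmx; c_JJ : J *m J = - 1%:M;
  c_G : G = Om *m J^T; c_sym : G^T = G; c_pos : forall v : 'rV[R]_m, v != 0 -> 0 < bil G v v }.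

Context (Om J G : 'M[R]_m) (c : compat Om J G).
Let P := invmx G.

Lemma c_Gunit : G \in unitmx.
Proof.
rewrite (c_G c) unitmx_mul (c_unit c) unitmx_tr.
have : J *m (- J) = 1%:M by rewrite mulmxN (c_JJ c) opprK.
by case/mulmx1_unit.
Qed.

Lemma c_JG : J *m G = Om.
Proof.
have : G = - (J *m Om) by rewrite -(c_sym c) (c_G c) trmx_mul trmxK (c_alt c) mulmxN.
by move=> ->; rewrite mulmxN mulmxA (c_JJ c) mulNmx mul1mx opprK.
Qed.

Lemma c_J : J = Om *m P.
Proof. by rewrite -c_JG mulmxK// c_Gunit. Qed.

Lemma c_PT : P^T = P.
Proof. by rewrite /P trmx_inv (c_sym c). Qed.

Lemma c_POPO : P *m Om *m P *m Om = - 1%:M.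
Proof.
rewrite -!mulmxA (mulmxA Om) -c_J -c_JG mulmxA (c_JJ c).
by rewrite mulmxA mulmxN mulmx1 mulNmx mulVmx ?c_Gunit.
Qed.

Lemma c_iso v w : bil G (v *m J) (w *m J) = bil G v w.
Proof.
by rewrite /bil trmx_mul mulmxA -(mulmxA v) c_JG -(mulmxA v) -(c_G c).
Qed.

Lemma c_skew v w : bil G (v *m J) w = - bil G v (w *m J).
Proof.
rewrite /bil trmx_mul mulmxA -(mulmxA v) c_JG -(mulmxA v G).
have -> : G *m J^T = Om^T by rewrite -c_JG trmx_mul (c_sym c).
by rewrite (c_alt c) mulmxN mulNmx [in RHS]mxE opprK.
Qed.

Lemma c_JJv (v : 'rV[R]_m) : v *m J *m J = - v.
Proof. by rewrite -mulmxA (c_JJ c) mulmxN mulmx1. Qed.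

Lemma c_bsym v w : bil G v w = bil G w v.
Proof. by rewrite -[in LHS](c_sym c) bil_trE. Qed.

Lemma c_psd v : 0 <= bil G v v.
Proof.
by have [->|v0] := eqVneq v 0; [rewrite bil0l|apply: ltW; exact: (c_pos c)].
Qed.

(* The vector field X with omega(X, .) = - d *)
Definition hamX (d : 'rV[R]_m) := d *m P *m J.

Lemma hamXO d : hamX d *m Om = - d.
Proof.
rewrite /hamX -!mulmxA -c_JG (mulmxA J) (c_JJ c) mulNmx mul1mx mulmxN.
by rewrite mulVmx ?c_Gunit// mulmxN mulmx1.
Qed.

Lemma hamX_uniq (X d : 'rV[R]_m) : X *m Om = - d -> X = hamX d.
Proof.
move=> E; rewrite -[LHS](mulmxK (c_unit c)) E -(hamXO d) mulmxK//.
exact: (c_unit c).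
Qed.

Lemma hamX_J d : hamX d *m J = - (d *m P).
Proof. by rewrite /hamX c_JJv. Qed.

(** Conservation of the Hamiltonian by its own flow: the matrix [P Om P] is antisymmetric. *)
Lemma hamX_d d : hamX d *m d^T = 0.
Proof.
rewrite /hamX c_J -!mulmxA; apply/matrixP => i j; rewrite !ord1 [RHS]mxE.
have := bil_trE (P *m (Om *m P)) d d; rewrite /bil.
have -> : (P *m (Om *m P))^T = - (P *m (Om *m P)).
  by rewrite !trmx_mul c_PT (c_alt c) mulmxN mulNmx -!mulmxA.
rewrite mulmxN mulNmx mxE => /esym h.
by rewrite !mulmxA; rewrite !mulmxA in h; exact: self_opp.
Qed.

End Compat.

(** * Uniform bounds in a chart *)

Section ChartBounds.
Context {R : realType} {m : nat}.
Notation V := 'rV[R]_m.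
Implicit Types (G Om J : V -> 'M[R]_m) (hh f g : V -> R).

Definition invm G (y : V) : 'M[R]_m := invmx (G y).
Definition grd hh (y : V) : V := \row_k pd k hh y.

(** Built from the metric and [hh] alone. The two derivatives of the inverse metric are those that
    the Bochner estimate consumes; the last summand blows up at critical points of [hh]. *)
Definition chart_size G hh (y : V) : R :=
  (\sum_i \sum_j `|G y i j|) + (\sum_i \sum_j `|invm G y i j|)
  + (\sum_k \sum_i \sum_j `|pd k (fun z => invm G z i j) y|)
  + (\sum_l \sum_k \sum_i \sum_j `|pd l (pd k (fun z => invm G z i j)) y|)
  + (\sum_k `|pd k hh y|) + (\sum_l \sum_k `|pd l (pd k hh) y|)
  + (bil (invm G y) (grd hh y) (grd hh y))^-1.

Lemma sumc (c : R) : \sum_(i < m) c = m%:R * c.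
Proof. by rewrite sumr_const card_ord mulr_natl. Qed.

Lemma le_sum1 (I : finType) (F : I -> R) i : (forall i, 0 <= F i) -> F i <= \sum_i F i.
Proof. by move=> F0; rewrite (bigD1 i)//= lerDl sumr_ge0. Qed.

Lemma compat_posP (Om J G : 'M[R]_m) (v : V) : compat Om J G -> v != 0 -> 0 < bil (invmx G) v v.
Proof.
move=> c v0; have := c_pos c (v := v *m invmx G).
have GP : invmx G *m G = 1%:M by rewrite mulVmx// (c_Gunit c).
have w0 : v *m invmx G != 0.
  by apply: contra v0 => /eqP E; rewrite -[v]mulmx1 -GP mulmxA E mul0mx.
move=> /(_ w0); rewrite /bil trmx_mul (c_PT c).
by rewrite !mulmxA -(mulmxA v) GP mulmx1.
Qed.

Context (kap : R) (kap1 : 1 <= kap).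

(** Charts of arbitrary manifolds of dimension [m] under one common bound: a constant valid for the
    whole type depends on [m] and [kap] only. The same [kap] controls the size and, through its
    inverse, the radius. *)
Record cdata := Cdata {
  cO : V -> 'M[R]_m ; cJ : V -> 'M[R]_m ; cg : V -> 'M[R]_m ; chh : V -> R ; cy : V ;
  cO_s : smooth (ball cy kap^-1) cO ; cJ_s : smooth (ball cy kap^-1) cJ ;
  cg_s : msmooth (ball cy kap^-1) cg ; chh_s : smooth (ball cy kap^-1) chh ;
  c_compat : forall y, ball cy kap^-1 y -> compat (cO y) (cJ y) (cg y) ;
  c_closed : forall y v1 v2 v3, ball cy kap^-1 y ->
     'D_v1 (fun x => bil (cO x) v2 v3) y + 'D_v2 (fun x => bil (cO x) v3 v1) y
     + 'D_v3 (fun x => bil (cO x) v1 v2) y = 0 ;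
  c_size : forall y, ball cy kap^-1 y -> chart_size cg chh y <= kap ;
  c_grd : forall y, ball cy kap^-1 y -> grd chh y != 0 }.

Definition cB (d : cdata) : set V := ball (cy d) kap^-1.
Implicit Types (d : cdata) (y v w : V).

Let oB d : open (cB d). Proof. exact: ball_open. Qed.
Let kap0 : 0 < kap. Proof. exact: lt_le_trans kap1. Qed.

Let B0 d : cB d (cy d). Proof. by apply: ballxx; rewrite invr_gt0. Qed.

Lemma cP_s d : msmooth (cB d) (invm (cg d)).
Proof.
apply: msmooth_inv; [exact: oB| |].
  by move=> y By; exact: (c_Gunit (c_compat By)).
exact: cg_s.
Qed.

Lemma sizes d y : cB d y -> [/\ forall i j, `|cg d y i j| <= kap, forall i j, `|invm (cg d) y i j| <= kap,
   forall k i j, `|pd k (fun z => invm (cg d) z i j) y| <= kap,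
   forall l k i j, `|pd l (pd k (fun z => invm (cg d) z i j)) y| <= kap &
   [/\ forall k, `|pd k (chh d) y| <= kap, forall l k, `|pd l (pd k (chh d)) y| <= kap &
     kap^-1 <= bil (invm (cg d) y) (grd (chh d) y) (grd (chh d) y)]].
Proof.
move=> By; have := c_size By; rewrite /chart_size.
set S1 := \sum_i \sum_j `|cg d y i j|; set S2 := \sum_i \sum_j `|invm (cg d) y i j|.
set S3 := \sum_k \sum_i \sum_j `|pd k _ y|; set S4 := \sum_l \sum_k \sum_i \sum_j `|pd l _ y|.
set S5 := \sum_k `|pd k _ y|; set S6 := \sum_l \sum_k `|pd l _ y|; set S7 := _^-1.
have s1 : 0 <= S1 by do 2 (apply: sumr_ge0 => ? _).
have s2 : 0 <= S2 by do 2 (apply: sumr_ge0 => ? _).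
have s3 : 0 <= S3 by do 3 (apply: sumr_ge0 => ? _).
have s4 : 0 <= S4 by do 4 (apply: sumr_ge0 => ? _).
have s5 : 0 <= S5 by do 1 (apply: sumr_ge0 => ? _).
have s6 : 0 <= S6 by do 2 (apply: sumr_ge0 => ? _).
have p7 : 0 < bil (invm (cg d) y) (grd (chh d) y) (grd (chh d) y).
  by apply: compat_posP (c_compat By) _; exact: c_grd.
have s7 : 0 < S7 by rewrite invr_gt0.
move=> H; split.
- move=> i j; apply: (@le_trans _ _ S1); last by lra.
  apply: le_trans (@le_sum1 _ (fun j => `|cg d y i j|) j _) _ => //.
  by apply: (@le_sum1 _ (fun i => \sum_j `|cg d y i j|)) => i'; exact: sumr_ge0.
- move=> i j; apply: (@le_trans _ _ S2); last by lra.
  apply: le_trans (@le_sum1 _ (fun j => `|invm (cg d) y i j|) j _) _ => //.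
  by apply: (@le_sum1 _ (fun i => \sum_j `|invm (cg d) y i j|)) => i'; exact: sumr_ge0.
- move=> k i j; apply: (@le_trans _ _ S3); last by lra.
  apply: le_trans (@le_sum1 _ (fun j => `|pd k (fun z => invm (cg d) z i j) y|) j _) _ => //.
  apply: le_trans (@le_sum1 _ (fun i => \sum_j `|pd k (fun z => invm (cg d) z i j) y|) i _) _.
    by move=> i'; exact: sumr_ge0.
  apply: (@le_sum1 _ (fun k => \sum_i \sum_j `|pd k (fun z => invm (cg d) z i j) y|)) => i'.
  by do 2 (apply: sumr_ge0 => ? _).
- move=> l k i j; apply: (@le_trans _ _ S4); last by lra.
  apply: le_trans (@le_sum1 _ (fun j => `|pd l (pd k (fun z => invm (cg d) z i j)) y|) j _) _ => //.
  apply: le_trans (@le_sum1 _ (fun i => \sum_j `|pd l (pd k (fun z => invm (cg d) z i j)) y|) i _) _.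
    by move=> i'; exact: sumr_ge0.
  apply: le_trans (@le_sum1 _ (fun k => \sum_i \sum_j `|pd l (pd k (fun z => invm (cg d) z i j)) y|) k _) _.
    by move=> i'; do 2 (apply: sumr_ge0 => ? _).
  apply: (@le_sum1 _ (fun l => \sum_k \sum_i \sum_j `|pd l (pd k (fun z => invm (cg d) z i j)) y|)) => i'.
  by do 3 (apply: sumr_ge0 => ? _).
split.
- move=> k; apply: (@le_trans _ _ S5); last by lra.
  exact: (@le_sum1 _ (fun k => `|pd k (chh d) y|)).
- move=> l k; apply: (@le_trans _ _ S6); last by lra.
  apply: le_trans (@le_sum1 _ (fun k => `|pd l (pd k (chh d)) y|) k _) _ => //.
  by apply: (@le_sum1 _ (fun l => \sum_k `|pd l (pd k (chh d)) y|)) => i'; exact: sumr_ge0.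
- rewrite -[leRHS]invrK -/S7 lef_pV2 ?posrE//; lra.
Qed.

Definition ubl (F : cdata -> V -> R) := exists2 c, 0 <= c & forall d,
  (forall y, cB d y -> `|F d y| <= c) /\
  (forall y y', cB d y -> cB d y' -> `|F d y - F d y'| <= c * `|y - y'|).

Lemma ubl_mul F F' : ubl F -> ubl F' -> ubl (fun d y => F d y * F' d y).
Proof.
move=> [c c0 H] [c' c'0 H']; exists (2 * c * c' + c * c'); first by rewrite addr_ge0 ?mulr_ge0.
move=> d; have [b l] := H d; have [b' l'] := H' d; split.
  move=> y By; rewrite normrM; apply: le_trans (ler_pM _ _ (b y By) (b' y By)) _ => //.
  by rewrite lerDr !mulr_ge0.
move=> y y' By By'.
rewrite (_ : _ - _ = F d y * (F' d y - F' d y') + (F d y - F d y') * F' d y'); last by ring.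
apply: le_trans (ler_normD _ _) _; rewrite !normrM.
have h1 := ler_pM (normr_ge0 _) (normr_ge0 _) (b y By) (l' y y' By By').
have h2 := ler_pM (normr_ge0 _) (normr_ge0 _) (l y y' By By') (b' y' By').
apply: le_trans (lerD h1 h2) _.
have -> : c * (c' * `|y - y'|) + c * `|y - y'| * c' = 2 * c * c' * `|y - y'| by ring.
by rewrite ler_wpM2r// lerDl mulr_ge0.
Qed.

Lemma ubl_add F F' : ubl F -> ubl F' -> ubl (fun d y => F d y + F' d y).
Proof.
move=> [c c0 H] [c' c'0 H']; exists (c + c'); first by rewrite addr_ge0.
move=> d; have [b l] := H d; have [b' l'] := H' d; split.
  by move=> y By; apply: le_trans (ler_normD _ _) _; apply: lerD; [exact: b|exact: b'].
move=> y y' By By'; rewrite opprD addrACA mulrDl.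
by apply: le_trans (ler_normD _ _) _; apply: lerD; [exact: l|exact: l'].
Qed.

Lemma ubl_cst c : ubl (fun _ _ => c).
Proof. by exists `|c| => // d; split => // y y' _ _; rewrite subrr normr0 mulr_ge0. Qed.

Lemma ubl_sum (I : Type) (r : seq I) (F : I -> cdata -> V -> R) :
  (forall i, ubl (F i)) -> ubl (fun d y => \sum_(i <- r) F i d y).
Proof.
move=> H; elim: r => [|i r IH].
  have -> : (fun (d : cdata) (y : V) => \sum_(i <- [::]) F i d y) = (fun _ _ => 0).
    by apply/funext => d; apply/funext => y; rewrite big_nil.
  exact: ubl_cst.
have -> : (fun (d : cdata) (y : V) => \sum_(j <- i :: r) F j d y) =
    (fun d y => F i d y + \sum_(j <- r) F j d y).
  by apply/funext => d; apply/funext => y; rewrite big_cons.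
exact: ubl_add.
Qed.

Definition ublm p q (F : cdata -> V -> 'M[R]_(p, q)) := forall i j, ubl (fun d y => F d y i j).

Lemma ublm_mul p q s (F : cdata -> V -> 'M[R]_(p, q)) (F' : cdata -> V -> 'M[R]_(q, s)) :
  ublm F -> ublm F' -> ublm (fun d y => F d y *m F' d y).
Proof.
move=> H H' i j.
have -> : (fun d y => (F d y *m F' d y) i j) = (fun d y => \sum_k F d y i k * F' d y k j).
  by apply/funext => d; apply/funext => y; rewrite mxE.
by apply: ubl_sum => k; exact: ubl_mul.
Qed.

Lemma ubl_pd (F : cdata -> V -> R) c : 0 <= c ->
  (forall d y, cB d y -> `|F d y| <= c) -> (forall d y, cB d y -> differentiable (F d) y) ->
  (forall d y k, cB d y -> `|pd k (F d) y| <= c) -> ubl F.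
Proof.
move=> c0 b dF b'; exists (c + m%:R * c); first by rewrite addr_ge0// mulr_ge0.
move=> d; split.
  by move=> y By; apply: le_trans (b d y By) _; rewrite lerDl mulr_ge0.
move=> y y' By By'; apply: (@le_trans _ _ (m%:R * c * `|y - y'|)); last first.
  by rewrite ler_wpM2r// lerDr.
apply: (@ball_lipschitz _ _ (F d) (cy d) kap^-1) By' By => z v Bz.
have dz := dF d z Bz; split; first exact: diff_derivable.
rewrite derive_rV//; apply: le_trans (ler_norm_sum _ _ _) _.
apply: (@le_trans _ _ (\sum_(k < m) c * `|v|)).
  apply: ler_sum => k _; rewrite normrM mulrC; apply: ler_pM => //; first exact: b'.
  exact: rV_norm_entry.
by rewrite sumc !mulrA.
Qed.

Lemma ublm_P : ublm (fun d => invm (cg d)).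
Proof.
move=> i j; apply: (ubl_pd (ltW kap0)).
- by move=> d y By; have [_ h _ _ _] := sizes By; exact: h.
- by move=> d y By; exact: smooth_dif (cP_s d i j) By.
- by move=> d y k By; have [_ _ h _ _] := sizes By; exact: h.
Qed.

Lemma ublm_grd : ublm (fun d => grd (chh d)).
Proof.
move=> i j; have -> : (fun d y => grd (chh d) y i j) = (fun d y => pd j (chh d) y).
  by apply/funext => d; apply/funext => y; rewrite mxE.
apply: (ubl_pd (ltW kap0)).
- by move=> d y By; have [_ _ _ _ [h _ _]] := sizes By; exact: h.
- move=> d y By; exact: smooth_dif (smooth_D (delta_mx 0 j : V) (chh_s d)) By.
- by move=> d y k By; have [_ _ _ _ [_ h _]] := sizes By; exact: h.
Qed.

Lemma norm_rV_le (v : V) (c : R) : 0 <= c -> (forall j, `|v 0 j| <= c) -> `|v| <= c.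
Proof.
move=> c0 H; rewrite [leLHS]mx_normrE; apply: bigmax_le => // -[i j] _ /=.
by rewrite ord1.
Qed.

Lemma bil_le (A : 'M[R]_m) (v w : V) (c : R) : (forall i j, `|A i j| <= c) ->
  `|bil A v w| <= m%:R * (m%:R * c) * (`|v| * `|w|).
Proof.
move=> H; rewrite bilE; apply: le_trans (ler_norm_sum _ _ _) _.
apply: (@le_trans _ _ (\sum_(i < m) m%:R * c * (`|v| * `|w|))).
  apply: ler_sum => i _; apply: le_trans (ler_norm_sum _ _ _) _.
  apply: (@le_trans _ _ (\sum_(j < m) c * (`|v| * `|w|))).
    apply: ler_sum => j _; rewrite !normrM; apply: ler_pM => //.
    by apply: ler_pM => //; exact: rV_norm_entry.
  by rewrite sumc !mulrA.
by rewrite sumc !mulrA.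
Qed.

Lemma mulmx_le (A : 'M[R]_m) (v : V) (c : R) : 0 <= c -> (forall i j, `|A i j| <= c) ->
  `|v *m A| <= m%:R * c * `|v|.
Proof.
move=> c0 H; apply: norm_rV_le => [|j]; first by rewrite !mulr_ge0.
rewrite mxE; apply: le_trans (ler_norm_sum _ _ _) _.
apply: (@le_trans _ _ (\sum_(k < m) c * `|v|)).
  by apply: ler_sum => k _; rewrite normrM mulrC; apply: ler_pM => //; exact: rV_norm_entry.
by rewrite sumc !mulrA.
Qed.

Definition k1 : R := 1 + m%:R * (m%:R * kap) + kap.
Let k1ge : 1 <= k1. Proof. by rewrite /k1 -addrA lerDl addr_ge0 ?mulr_ge0// ltW. Qed.
Let k10 : 0 < k1. Proof. exact: lt_le_trans k1ge. Qed.

Lemma nrm_up d y v : cB d y -> nrm (cg d y) v <= k1 * `|v|.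
Proof.
move=> By; have [H _ _ _ _] := sizes By.
have := bil_le v v (H) => h.
rewrite -ler_sqr ?nnegrE ?nrm_ge0 ?mulr_ge0 ?(ltW k10)//.
rewrite (nrm_sqr (c_bsym (c_compat By)) (c_psd (c_compat By))).
apply: le_trans (ler_norm _) _; apply: le_trans h _.
rewrite exprMn -expr2 ler_wpM2r ?exprn_ge0//.
apply: (@le_trans _ _ k1); last by rewrite expr2 ler_peMl// ltW.
by rewrite /k1 addrAC lerDr addr_ge0// ltW.
Qed.

(** A coordinate is a metric product, [v_j = g (v, e)], with [e] a row of the inverse metric; the
    squared norm of [e] is a diagonal entry of that inverse. *)
Lemma nrm_lo d y v : cB d y -> `|v| <= k1 * nrm (cg d y) v.
Proof.
move=> By; have c := c_compat By; have [_ H _ _ _] := sizes By.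
apply: norm_rV_le => [|j]; first by rewrite mulr_ge0 ?nrm_ge0// ltW.
set P := invm (cg d) y; pose e : V := (delta_mx 0 j *m P).
have E : v 0 j = bil (cg d y) v e.
  rewrite /bil /e trmx_mul (c_PT c) mulmxA -(mulmxA v) mulmxV ?(c_Gunit c)// mulmx1.
  by rewrite trmx_delta -colE mxE.
have E2 : bil (cg d y) e e = P j j.
  rewrite /bil /e trmx_mul (c_PT c) mulmxA -(mulmxA _ P) mulVmx ?(c_Gunit c)// mulmx1.
  by rewrite -rowE trmx_delta -colE !mxE.
rewrite E; apply: le_trans (bil_CS (c_bsym c) (c_psd c) _ _) _.
rewrite mulrC ler_wpM2r ?nrm_ge0//.
rewrite /nrm E2 -[leRHS](ger0_norm (ltW k10)) -sqrtr_sqr ler_wsqrtr//.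
apply: (@le_trans _ _ kap); first exact: le_trans (ler_norm _) (H j j).
apply: (@le_trans _ _ k1); last by rewrite expr2 ler_peMl// ltW.
by rewrite /k1 lerDr addr_ge0// !mulr_ge0// ltW.
Qed.

Lemma J_bound d y v : cB d y -> `|v *m cJ d y| <= k1 ^+ 2 * `|v|.
Proof.
move=> By; have c := c_compat By; apply: le_trans (nrm_lo _ By) _.
rewrite /nrm (c_iso c) expr2 -mulrA ler_pM2l//; exact: nrm_up.
Qed.

(** [Om = J G], and [J] is bounded because it is an isometry of [G]; the metric alone thus controls
    the size of [Om]. *)
Lemma Om_entry d y i j : cB d y -> `|cO d y i j| <= k1 ^+ 2 * (m%:R * kap * m%:R).
Proof.
move=> By; have c := c_compat By; have [H _ _ _ _] := sizes By.
have E : cO d y i j = ((delta_mx 0 i : V) *m cJ d y *m cg d y) 0 j.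
  by rewrite -mulmxA (c_JG c) -rowE mxE.
rewrite E; apply: le_trans (rV_norm_entry _ _) _.
apply: le_trans (mulmx_le _ (ltW kap0) H) _.
have h := J_bound (delta_mx 0 i : V) By.
have h2 : `|delta_mx 0 i : V| <= 1.
  apply: norm_rV_le => // l; rewrite mxE; case: eqP => _ /=; last by rewrite normr0.
  by case: eqP => _; rewrite ?normr1 ?normr0.
have h3 : `|(delta_mx 0 i : V) *m cJ d y| <= k1 ^+ 2.
  by apply: le_trans h _; rewrite ler_piMr ?sqr_ge0.
have m1 : 1 <= m%:R :> R by rewrite ler1n (leq_trans _ (ltn_ord i)).
rewrite mulrC; apply: ler_pM => //; first by rewrite mulr_ge0// ltW.
by rewrite ler_peMr// mulr_ge0// ltW.
Qed.

Definition kO : R := k1 ^+ 2 * (m%:R * kap * m%:R) + kap + 1 + m%:R * kap.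

Let kO_ge : 1 <= kO.
Proof. by rewrite /kO addrAC lerDr !addr_ge0 ?mulr_ge0 ?exprn_ge0 ?(ltW k10) ?(ltW kap0)//. Qed.
Let kapO : kap <= kO.
Proof. by rewrite /kO -addrA [leRHS]addrAC lerDr !addr_ge0 ?mulr_ge0 ?exprn_ge0 ?(ltW k10) ?(ltW kap0)//. Qed.
Let mkapO : m%:R * kap <= kO.
Proof. by rewrite /kO lerDr !addr_ge0 ?mulr_ge0 ?exprn_ge0 ?(ltW k10) ?(ltW kap0)//. Qed.

(** With [w = v P] one has [v_i = g (w, e_i)], so Cauchy-Schwarz bounds each [v_i ^+ 2] by [kap]
    times the squared norm of [w]. *)
Lemma P_pos d y v : cB d y -> kO^-1 * (\sum_i v 0 i ^+ 2) <= (v *m invm (cg d) y *m v^T) 0 0.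
Proof.
move=> By; have c := c_compat By; have [H _ _ _ _] := sizes By.
have kO0 : 0 < kO by exact: lt_le_trans kO_ge.
pose w := v *m invm (cg d) y.
have E : (v *m invm (cg d) y *m v^T) 0 0 = bil (cg d y) w w.
  by rewrite /bil /w trmx_mul (c_PT c) mulmxKV ?(c_Gunit c)// mulmxA.
rewrite E mulrC ler_pdivrMr//.
apply: (@le_trans _ _ (\sum_(i < m) bil (cg d y) w w * kap)); last first.
  rewrite sumc mulrCA ler_wpM2l ?(c_psd c)//.
apply: ler_sum => i _.
have -> : v 0 i = bil (cg d y) w (delta_mx 0 i).
  by rewrite /bil /w -(mulmxA v) mulVmx ?(c_Gunit c)// mulmx1 trmx_delta -colE mxE.
have CS := bil_CS (c_bsym c) (c_psd c) w (delta_mx 0 i).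
rewrite -real_normK ?num_real//.
apply: (@le_trans _ _ ((nrm (cg d y) w * nrm (cg d y) (delta_mx 0 i)) ^+ 2)).
  by rewrite ler_sqr ?nnegrE// mulr_ge0 ?nrm_ge0.
rewrite exprMn !(nrm_sqr (c_bsym c) (c_psd c)) ler_wpM2l ?(c_psd c)//.
apply: le_trans (ler_norm _) _; rewrite /bil -rowE trmx_delta -colE !mxE; exact: H.
Qed.

Lemma dm_smooth (U : set V) (F : V -> 'M[R]_m) y : msmooth U F -> U y -> dm F y.
Proof. by move=> H Uy i j; exact: smooth_dif (H i j) Uy. Qed.

Lemma dm_smooth2 (U : set V) (F : V -> 'M[R]_m) y k : msmooth U F -> U y -> dm (pdm k F) y.
Proof.
move=> H Uy i j; rewrite (_ : (fun z => _) = pd k (fun z => F z i j)); last first.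
  by apply/funext => z; rewrite mxE.
exact: smooth_dif (smooth_D (delta_mx 0 k : V) (H i j)) Uy.
Qed.

(** The Bochner estimate is a statement at one point; every point of the ball can serve as that
    point. *)
Lemma bdat_of d y : cB d y -> exists b : bdat m kO, Om b = cO d /\ by0 b = y.
Proof.
move=> By; have sO : msmooth (cB d) (cO d) by apply: smooth_msmooth; [exact: oB|exact: cO_s].
have sP := cP_s d; have [_ H1 H2 H3 _] := sizes By.
unshelve (eexists (@Bdat _ _ _ (cO d) (invm (cg d)) (cB d) y (@oB d) By _ _ _ _ _ _ _ _ _ _ _ _ _ _); split; reflexivity).
- by move=> x; exact: dm_smooth.
- by move=> x; exact: dm_smooth.
- by move=> x k; exact: dm_smooth2.
- by move=> x k; exact: dm_smooth2.
- by move=> k l i j; exact: smooth_cont (smooth_D (delta_mx 0 k : V) (smooth_D (delta_mx 0 l : V) (sO i j))) By.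
- by move=> x Bx; exact: c_alt (c_compat Bx).
- by move=> x Bx; exact: c_PT (c_compat Bx).
- by move=> x Bx; exact: c_POPO (c_compat Bx).
- move=> x i j k Bx; have := c_closed (delta_mx 0 i) (delta_mx 0 j) (delta_mx 0 k) Bx.
  have E a b : (fun x => bil (cO d x) (delta_mx 0 a) (delta_mx 0 b)) = (fun x => cO d x a b).
    by apply/funext => z; rewrite /bil -rowE trmx_delta -colE !mxE.
  by rewrite !E.
- move=> i j; apply: le_trans (Om_entry i j By) _; rewrite /kO -!addrA lerDl.
  by rewrite !addr_ge0 ?mulr_ge0 ?(ltW kap0).
- by move=> i j; apply: le_trans (H1 i j) _.
- by move=> k i j; apply: le_trans (H2 k i j) _.
- by move=> l k i j; apply: le_trans (H3 l k i j) _.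
- by move=> v; exact: P_pos.
Qed.

(** The Lipschitz bound comes from [bochner] at each point. The bounds for [J = Om P] and for the
    Hamiltonian field follow from this one by the product rules. *)
Lemma ublm_O : ublm cO.
Proof.
move=> i j; have [C C0 H] := @bochner R m kO kO_ge.
apply: (@ubl_pd _ (k1 ^+ 2 * (m%:R * kap * m%:R) + C)).
- by rewrite addr_ge0// !mulr_ge0 ?exprn_ge0 ?(ltW k10) ?(ltW kap0).
- by move=> d y By; apply: le_trans (Om_entry i j By) _; rewrite lerDl.
- move=> d y By; apply: dif_mentry; exact: smooth_dif (cO_s d) By.
- move=> d y k By; have [b [bO by_]] := bdat_of By.
  have := H b k i j; rewrite bO by_ => h; apply: (le_trans h).
  by rewrite lerDr !mulr_ge0 ?exprn_ge0 ?(ltW k10) ?(ltW kap0).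
Qed.

Definition cX (d : cdata) (y : V) : V := hamX (cJ d y) (cg d y) (grd (chh d) y).

Lemma ubl_ext F F' : (forall d y, cB d y -> F d y = F' d y) -> ubl F -> ubl F'.
Proof.
move=> E [c c0 H]; exists c => // d; have [b l] := H d; split.
  by move=> y By; rewrite -E//; exact: b.
by move=> y y' By By'; rewrite -!E//; exact: l.
Qed.

Lemma ublm_J : ublm cJ.
Proof.
move=> i j; apply: ubl_ext (ublm_mul ublm_O ublm_P i j) => d y By.
by rewrite (c_J (c_compat By)).
Qed.

Lemma ublm_X : ublm cX.
Proof. exact: (ublm_mul (ublm_mul ublm_grd ublm_P) ublm_J). Qed.

Lemma ublm_unif p q (F : cdata -> V -> 'M[R]_(p, q)) : ublm F -> exists2 c, 0 <= c & forall d,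
  (forall y i j, cB d y -> `|F d y i j| <= c) /\
  (forall y y' i j, cB d y -> cB d y' -> `|F d y i j - F d y' i j| <= c * `|y - y'|).
Proof.
move=> H.
have [f Hf] : exists f : 'I_p -> 'I_q -> R, forall i j, 0 <= f i j /\ forall d,
    (forall y, cB d y -> `|F d y i j| <= f i j) /\
    (forall y y', cB d y -> cB d y' -> `|F d y i j - F d y' i j| <= f i j * `|y - y'|).
  have H' i j : exists c, 0 <= c /\ forall d,
    (forall y, cB d y -> `|F d y i j| <= c) /\
    (forall y y', cB d y -> cB d y' -> `|F d y i j - F d y' i j| <= c * `|y - y'|).
    by have [c c0 Hc] := H i j; exists c.
  exists (fun i j => sval (cid (H' i j))) => i j; exact: (svalP (cid (H' i j))).
have le i j : f i j <= \sum_i \sum_j f i j.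
  apply: le_trans (@le_sum1 _ (fun j => f i j) j _) _; first by move=> j'; have [] := Hf i j'.
  apply: (@le_sum1 _ (fun i => \sum_j f i j)) => i'; apply: sumr_ge0 => j' _.
  by have [] := Hf i' j'.
exists (\sum_i \sum_j f i j).
  by apply: sumr_ge0 => i _; apply: sumr_ge0 => j _; have [] := Hf i j.
move=> d; split.
  by move=> y i j By; have [_ /(_ d)[h _]] := Hf i j; apply: le_trans (h y By) _.
move=> y y' i j By By'; have [_ /(_ d)[_ h]] := Hf i j.
by apply: le_trans (h y y' By By') _; rewrite ler_wpM2r.
Qed.

Lemma sum7_le (b c d e f g : R) : 0 <= b -> 0 <= c -> 0 <= d -> 0 <= e -> 0 <= f -> 0 <= g ->
  [/\ 1 <= 1 + b + c + d + e + f + g, b <= 1 + b + c + d + e + f + g,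
    c <= 1 + b + c + d + e + f + g, d <= 1 + b + c + d + e + f + g &
  [/\ e <= 1 + b + c + d + e + f + g, f <= 1 + b + c + d + e + f + g &
    g <= 1 + b + c + d + e + f + g]].
Proof. by move=> *; do !split; lra. Qed.

(** Being quantified over all data, this is a property of the numbers [m], [kap] and [k], which is
    what allows it to enter the definition of the final constant. *)
Definition chart_const (k : R) : Prop := forall d y, cB d y ->
  [/\ forall v, nrm (cg d y) v <= k * `|v|, forall v, `|v| <= k * nrm (cg d y) v,
    forall v : V, `|v *m cJ d y| <= k * `|v|,
    `|cX d y| <= k /\ k^-1 <= `|cX d y| &
    [/\ forall v : V, `|(v *m (grd (chh d) y)^T) 0 0| <= k * `|v|,
     forall y' (v : V), cB d y' -> `|v *m (cJ d y - cJ d y')| <= k * `|y - y'| * `|v|,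
     forall y', cB d y' -> `|cX d y - cX d y'| <= k * `|y - y'| &
     forall y' (v : V), cB d y' -> `|(v *m (grd (chh d) y - grd (chh d) y')^T) 0 0| <= k * `|y - y'| * `|v|]].

Theorem chart_bounds : exists2 k : R, 1 <= k & chart_const k.
Proof.
have [cJ' cJ0 HJ] := ublm_unif ublm_J; have [cX' cX0 HX] := ublm_unif ublm_X.
have [cg' cg0 Hg] := ublm_unif ublm_grd.
have [t tE] : exists t : R, t = 1 + k1 + k1 ^+ 2 + m%:R * cJ' + cX' + m%:R * cg' + k1 ^+ 2 * kap by eexists.
have mJ : 0 <= m%:R * cJ' by rewrite mulr_ge0.
have mg : 0 <= m%:R * cg' by rewrite mulr_ge0.
have k12 : 0 < k1 ^+ 2 by rewrite exprn_gt0.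
have kk : 0 < k1 ^+ 2 * kap by rewrite mulr_gt0.
have [t1 tk tk2 tJ [tX tg tkk]] := sum7_le (ltW k10) (ltW k12) mJ cX0 mg (ltW kk).
rewrite -tE in t1 tk tk2 tJ tX tg tkk.
have t0 : 0 < t by exact: lt_le_trans t1.
have rowb (w v : V) (c : R) : (forall j, `|w 0 j| <= c) -> `|(v *m w^T) 0 0| <= m%:R * c * `|v|.
  move=> H; rewrite mxE; apply: le_trans (ler_norm_sum _ _ _) _.
  apply: (@le_trans _ _ (\sum_(j < m) c * `|v|)).
    apply: ler_sum => j _; rewrite mxE normrM mulrC; apply: ler_pM => //.
    exact: rV_norm_entry.
  by rewrite sumc !mulrA.
exists t => // d y By; have c := c_compat By; split.
- by move=> v; apply: le_trans (nrm_up v By) _; rewrite ler_wpM2r.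
- by move=> v; apply: le_trans (nrm_lo v By) _; rewrite ler_wpM2r ?nrm_ge0.
- by move=> v; apply: le_trans (J_bound v By) _; rewrite ler_wpM2r.
- split.
    apply: (@le_trans _ _ cX') => //; apply: norm_rV_le => // j.
    by have [h _] := HX d; exact: h.
  have [_ _ _ _ [_ _ h]] := sizes By.
  (* The Hamiltonian field has the same metric norm as the differential of the function, and
     [chart_size] bounds the latter from below. *)
  have E : bil (cg d y) (cX d y) (cX d y) = bil (invm (cg d) y) (grd (chh d) y) (grd (chh d) y).
    rewrite /cX /hamX (c_iso c) /bil trmx_mul (c_PT c) mulmxKV ?(c_Gunit c)//.
    by rewrite mulmxA.
  have h1 : kap^-1 <= (k1 * `|cX d y|) ^+ 2.
    apply: le_trans h _; rewrite -E -(nrm_sqr (c_bsym c) (c_psd c)) ler_sqr ?nnegrE ?nrm_ge0 ?mulr_ge0 ?(ltW k10)//.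
    exact: nrm_up.
  have [//|lt] := leP t^-1 `|cX d y|.
  exfalso; have : (k1 * `|cX d y|) ^+ 2 < kap^-1.
    apply: (@lt_le_trans _ _ ((k1 * t^-1) ^+ 2)).
      by rewrite ltr_sqr ?nnegrE ?mulr_ge0 ?invr_ge0 ?(ltW k10) ?(ltW t0)// ltr_pM2l.
    rewrite exprMn exprVn ler_pdivrMr ?exprn_gt0// -ler_pdivrMl ?invr_gt0// invrK mulrC.
    by apply: le_trans tkk _; rewrite expr2 ler_peMl// ltW.
  by rewrite ltNge h1.
split.
- move=> v; apply: le_trans (rowb _ v cg' _) _; last by rewrite ler_wpM2r.
  by move=> j; have [h _] := Hg d; exact: h.
- move=> y' v By'.
  apply: le_trans (@mulmx_le _ _ (cJ' * `|y - y'|) _ _) _.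
  + by rewrite mulr_ge0.
  + by move=> i j; rewrite !mxE; have [_ h] := HJ d; exact: h.
  + by rewrite mulrA ler_wpM2r// ler_wpM2r.
- move=> y' By'; apply: (@le_trans _ _ (cX' * `|y - y'|)); last by rewrite ler_wpM2r.
  apply: norm_rV_le => [|j]; first by rewrite mulr_ge0.
  have [_ h] := HX d; have := h y y' 0 j By By'.
  suff -> : (cX d y - cX d y') 0 j = cX d y 0 j - cX d y' 0 j by [].
  by move: (cX d y) (cX d y') => a b; rewrite !mxE.
- move=> y' v By'; apply: le_trans (rowb _ v (cg' * `|y - y'|) _) _.
    by move=> j; have [_ h] := Hg d; have := h y y' 0 j By By'; rewrite !mxE.
  by rewrite mulrA ler_wpM2r// ler_wpM2r.
Qed.

End ChartBounds.

(** * The tubular neighborhood and the cut-off *)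

Section ManifoldBasics.
Context {R : realType} {m : nat} {M : topologicalType} (A : smooth_atlas R m M).
Notation dom := (@dom R m M A).
Notation phi := (@phi R m M A).
Notation psi := (@psi R m M A).
Implicit Types (W : set M) (F : M -> R) (p q : M).

Lemma phi_rng i p W : dom i p -> W p -> (phi i @` (dom i `&` W)) (phi i p).
Proof. by move=> dp Wp; exists p. Qed.

Lemma psi_in i y W : (phi i @` (dom i `&` W)) y -> [/\ dom i (psi i y), W (psi i y) & phi i (psi i y) = y].
Proof. by move=> [p [dp Wp] <-]; rewrite phiK. Qed.

Lemma open_img i W : open W -> open (phi i @` (dom i `&` W)).
Proof.
move=> oW; rewrite openE => y Hy; have [dy Wy yE] := psi_in Hy.
have ry : rng i y by exists (psi i y).
have cy := psi_continuous ry.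
have h1 : nbhs y (psi i @^-1` W) by apply: cy; exact: open_nbhs_nbhs.
have h2 : nbhs y (rng i) by apply: open_nbhs_nbhs; split => //; exact: rng_open.
rewrite /interior; apply: filterS2 h1 h2 => z /= Wz [p dp E]; exists p; last by [].
by split => //; rewrite -(phiK dp) E.
Qed.

Lemma smooth_fun_cont W F p : open W -> W p -> smooth_fun A W F -> {for p, continuous F}.
Proof.
move=> oW Wp sF; have [i dp] := dom_cover A p.
have h : {for phi i p, continuous (F \o psi i)}.
  by apply: smooth_cont (sF i) _; exact: phi_rng.
have h2 : {for p, continuous ((F \o psi i) \o phi i)}.
  by apply: continuous_comp; [exact: phi_continuous|].
apply: (cont_near (dom_open i) dp _ h2) => q dq.
by rewrite /= phiK.
Qed.

Lemma smooth_fun_sub W W' F : W' `<=` W -> smooth_fun A W F -> smooth_fun A W' F.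
Proof.
move=> WW sF i; apply: smooth_sub (sF i) => y [p [dp Wp] <-]; exists p => //.
by split => //; exact: WW.
Qed.

Lemma smooth_fun_local W F : (forall p, W p -> exists W' F', [/\ open W', W' p, smooth_fun A W' F' &
  forall q, W' q -> F' q = F q]) -> smooth_fun A W F.
Proof.
move=> H i; apply: smooth_local => y [p [dp Wp] <-].
have [W' [F' [oW' Wp' sF' E]]] := H p Wp.
exists (phi i @` (dom i `&` W')), (F' \o psi i); split => //.
- exact: open_img.
- exact: phi_rng.
- by move=> z /psi_in[_ Wz _]; exact: E.
Qed.

Lemma subset_interior_smooth (N : set M) (h : M -> R) :
  smooth_on_subset (smooth_fun A) N h -> smooth_fun A N° h.
Proof.
move=> sh; apply: smooth_fun_local => p Np.
have [W [F [oW Wp sF E]]] := sh p (interior_subset Np).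
exists (W `&` N°), F; split.
- by apply: openI => //; exact: open_interior.
- by [].
- by apply: smooth_fun_sub sF; exact: subIsetl.
- by move=> q [Wq Nq]; apply: E => //; exact: interior_subset.
Qed.

Lemma ext_cont (N : set M) (h : M -> R) p :
  smooth_on_subset (smooth_fun A) N h -> N p -> forall e : R, 0 < e ->
  exists W, [/\ open W, W p & forall q, W q -> N q -> `|h p - h q| < e].
Proof.
move=> sh Np e e0; have [W [F [oW Wp sF E]]] := sh p Np.
have := smooth_fun_cont oW Wp sF; move/cvgrPdist_lt => /(_ e e0) H.
have : nbhs p [set q | `|F p - F q| < e /\ W q].
  by apply: filterS2 H (open_nbhs_nbhs (conj oW Wp)).
rewrite nbhsE => -[W' [oW' Wp'] HW']; exists W'; split => //.
by move=> q /HW' [/= Hq Wq] Nq; rewrite -E// -E.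
Qed.

Lemma smooth_prod_cont (W : set (R * M)) (Phi : R * M -> M) z :
  open W -> W z -> smooth_prod A W Phi -> {for z, continuous Phi}.
Proof.
move: z => [a p] oW Wz sP; have [i dp] := dom_cover A p.
have [h _] := sP i.
have hz : {for (a, phi i p), continuous (fun z => Phi (z.1, psi i z.2))}.
  by apply: h; split; [exists p|rewrite /= phiK].
have cg : {for (a, p), continuous (fun z : R * M => (z.1, phi i z.2))}.
  apply: (@cvg_pair _ _ _ (nbhs (a, p)) (nbhs a) (nbhs (phi i p))); first exact: cvg_fst.
  have h2 : {for (a, p), continuous (phi i \o (snd : R * M -> M))}.
    by apply: continuous_comp; [exact: cvg_snd|exact: phi_continuous].
  exact: h2.
have h2 : {for (a, p), continuous ((fun z => Phi (z.1, psi i z.2)) \o (fun z : R * M => (z.1, phi i z.2)))}.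
  by apply: continuous_comp.
have oD : open [set z : R * M | dom i z.2].
  apply: (@open_comp _ _ (snd : R * M -> M) (dom i)); last exact: dom_open.
  by move=> z _; exact: cvg_snd.
apply: (cont_near oD _ _ h2) => // -[b q] dq.
by rewrite /= phiK.
Qed.

End ManifoldBasics.

Section Region.
Context {R : realType} {m : nat} {M : topologicalType} (A : smooth_atlas R m M).
Hypotheses (Mc : compact [set: M]) (Mh : hausdorff_space M).
Context (V N : set M) (h : M -> R).
Hypotheses (oV : open V) (tub : tubular_neighborhood A V N)
  (sh : smooth_on_subset (smooth_fun A) N h)
  (h0 : forall x, bdry V x -> h x = 0) (h1 : forall x, bdry (closure V `|` N) x -> h x = 1).
Implicit Types (p q : M).

Lemma bdry_closed (S : set M) : closed (bdry S).
Proof.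
by apply: closedI; [exact: closed_closure|rewrite closedC; exact: open_interior].
Qed.

Lemma closed_compactT (S : set M) : closed S -> compact S.
Proof. by move=> cS; exact: subclosed_compact cS Mc (@subsetT _ S). Qed.

(** [N] is the image of the compact set [[0, 1] x bdry V]. The parametrization is smooth only as a
    local restriction of smooth maps, which still gives continuity relative to that set. *)
Lemma N_compact : compact N.
Proof.
have [Phi [rho [pr [_ <- _ [sP _ _] _]]]] := tub.
apply: continuous_compact; last first.
  by apply: compact_setX; [exact: segment_compact|apply: closed_compactT; exact: bdry_closed].
apply/subspace_continuousP => z Xz.
have [W [F [oW Wz sF E]]] := sP z Xz.
have cF := smooth_prod_cont oW Wz sF.
change (Phi @ within (`[0, 1] `*` bdry V) (nbhs z) --> Phi z).
move=> B HB; rewrite -E// in HB; have {}HB := cF _ HB.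
have nW := open_nbhs_nbhs (conj oW Wz).
have : nbhs z (fun w => (`[0, 1] `*` bdry V) w -> B (Phi w)).
  have HB' : nbhs z (F @^-1` B) := HB.
  by apply: filterS2 HB' nW => w /= Bw Ww Xw; rewrite -E.
by [].
Qed.

Lemma N_closed : closed N.
Proof. exact: compact_closed N_compact. Qed.

Lemma NV : N `<=` ~` V. Proof. by have [Phi [rho [pr []]]] := tub. Qed.

Lemma bdryV_N : bdry V `<=` N.
Proof.
have [Phi [rho [pr [_ <- _ _ E]]]] := tub; move=> p; rewrite -{1}E => -[[a q] [/= -> bq] <-].
by exists (0, q) => //; split => //=; rewrite in_itv/= lexx ler01.
Qed.

Lemma closureV p : closure V p -> V p \/ bdry V p.
Proof.
move=> cp; have [Vp|nVp] := pselect (V p); [by left|right; split => //].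
by move=> /interior_subset.
Qed.

Definition Vhat := closure V `|` N.

Lemma Vhat_closed : closed Vhat.
Proof. by apply: closedU; [exact: closed_closure|exact: N_closed]. Qed.

Lemma Vhat_split p : Vhat p -> V p \/ N p.
Proof. by case=> [/closureV[|/bdryV_N]|]; [left|right|right]. Qed.

(** Such a point is interior to [Vhat] and outside the closure of [V], and there [Vhat] coincides
    with [N]. *)
Lemma in_int p : N p -> ~ bdry V p -> ~ bdry Vhat p -> N° p.
Proof.
move=> Np nb nb'.
have iV : Vhat° p.
  apply: contrapT => H; apply: nb'; split => //.
  by apply: subset_closure; right.
have ncl : ~ closure V p by move=> /closureV[/(NV Np)|].
have oN : open (Vhat° `&` ~` closure V).
  apply: openI; first exact: open_interior.
  by rewrite openC; exact: closed_closure.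
rewrite /interior; have := open_nbhs_nbhs (conj oN (conj iV ncl)).
apply: filterS => q [/interior_subset Vq nq].
by case: Vq.
Qed.

(** The two boundaries are disjoint because [h] is 0 on one and 1 on the other. *)
Lemma bdryVhat_N p : bdry Vhat p -> N p /\ ~ closure V p.
Proof.
move=> bp; have [cp np] := bp.
have Vp : Vhat p.
  by move: cp; rewrite -(closure_id _).1//; exact: Vhat_closed.
have nV : ~ V p.
  move=> Vp'; apply: np; rewrite /interior.
  have := open_nbhs_nbhs (conj oV Vp'); apply: filterS => q Vq.
  by left; exact: subset_closure.
have Np : N p by case: (Vhat_split Vp).
split => // /closureV[//|b0].
by have := h0 b0; rewrite (h1 bp) => /eqP; rewrite oner_eq0.
Qed.

Lemma trichotomy p : [\/ N° p,
  exists W, [/\ open W, W p & forall q, W q -> V q \/ (N q /\ h q < 4^-1)] |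
  exists W, [/\ open W, W p & forall q, W q -> ~ Vhat q \/ (N q /\ 3 / 4 < h q)]].
Proof.
have q0 : (0 : R) < 4^-1 by [].
have [Np|nN] := pselect (N p); last first.
  have [Vp|nV] := pselect (V p).
    by apply: Or32; exists V; split => // q Vq; left.
  apply: Or33; exists (~` Vhat); split.
  - by rewrite openC; exact: Vhat_closed.
  - by move=> /Vhat_split[].
  - by move=> q nq; left.
have [bp|nb] := pselect (bdry V p).
  apply: Or32; have [W [oW Wp HW]] := ext_cont sh Np q0.
  have nb' : Vhat° p.
    apply: contrapT => np; have bp' : bdry Vhat p.
      by split => //; apply: subset_closure; right.
    by have := h0 bp; rewrite (h1 bp') => /eqP; rewrite oner_eq0.
  exists (W `&` Vhat°); split => //; first by apply: openI => //; exact: open_interior.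
  move=> q [Wq /interior_subset /Vhat_split[Vq|Nq]]; [by left|right; split => //].
  have := HW q Wq Nq; rewrite (h0 bp) sub0r normrN.
  by apply: le_lt_trans; exact: ler_norm.
have [bp|nb'] := pselect (bdry Vhat p); last by apply: Or31; exact: in_int.
apply: Or33; have [W [oW Wp HW]] := ext_cont sh Np q0.
have [_ ncl] := bdryVhat_N bp.
exists (W `&` ~` closure V); split => //.
  by apply: openI => //; rewrite openC; exact: closed_closure.
move=> q [Wq nq]; have [Vq|] := pselect (Vhat q); last by left.
right; have Nq : N q by case: Vq.
split => //; have := HW q Wq Nq; rewrite (h1 bp) ltr_norml => /andP[_]; lra.
Qed.

(** The differential of the cut-off vanishes outside this set. It is compact and lies in the
    interior of [N], so chart bounds can be taken uniform on it. *)
Definition core : set M := N `&` [set q | 4^-1 <= h q <= 3 / 4].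

Lemma core_int : core `<=` N°.
Proof.
move=> p [Np /andP[hp1 hp2]]; case: (trichotomy p) => // -[W [_ Wp H]].
- by case: (H p Wp) => [/(NV Np)//|[_]]; rewrite ltNge hp1.
- by case: (H p Wp) => [[]|[_]]; [right|rewrite ltNge hp2].
Qed.

Lemma core_closed : closed core.
Proof.
rewrite -openC openE => p ncp; rewrite /interior.
have [Np|nN] := pselect (N p); last first.
  have oN : open (~` N) by rewrite openC; exact: N_closed.
  by have := open_nbhs_nbhs (conj oN nN); apply: filterS => q nq [].
have [e [e0 He]] : exists e : R, 0 < e /\ (h p + e < 4^-1 \/ 3 / 4 < h p - e).
  have [lt1|le1] := ltP (h p) 4^-1; first by exists ((4^-1 - h p) / 2); split; [lra|left; lra].
  have [lt2|le2] := ltP (3 / 4) (h p); first by exists ((h p - 3 / 4) / 2); split; [lra|right; lra].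
  by exfalso; apply: ncp; split => //=; rewrite le1 le2.
have [W [oW Wp HW]] := ext_cont sh Np e0.
have := open_nbhs_nbhs (conj oW Wp); apply: filterS => q Wq [Nq /= /andP[g1 g2]].
have := HW q Wq Nq; rewrite ltr_norml => /andP[g3 g4].
by case: He => He; lra.
Qed.

Lemma core_compact : compact core.
Proof. exact: closed_compactT core_closed. Qed.

End Region.

(** * The smooth step *)

Section Cutoff.
Context {R : realType}.

Lemma pos_lip (x y : R) : `|pos x - pos y| <= `|x - y|.
Proof.
wlog xy : x y / x <= y.
  by move=> H; have [/H//|/ltW/H] := leP x y; rewrite distrC [`|y - x|]distrC.
rewrite /pos; have [x0|x0] := ltP 0 x; have [y0|y0] := ltP 0 y => //; rewrite ?subrr ?normr0//.
- by rewrite !ler0_norm; lra.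
- by rewrite !ler0_norm; lra.
Qed.

(* sg x = 3 y^2 - 2 y^3, where y is 2 x - 1/2 truncated to [0, 1] *)
Definition sg (x : R) : R := 12 * pos (x - 4^-1) ^+ 2 - 16 * pos (x - 4^-1) ^+ 3
  + 12 * pos (x - 3 / 4) ^+ 2 + 16 * pos (x - 3 / 4) ^+ 3.
Definition dsg (x : R) : R := 24 * pos (x - 4^-1) - 48 * pos (x - 4^-1) ^+ 2
  + 24 * pos (x - 3 / 4) + 48 * pos (x - 3 / 4) ^+ 2.

Lemma sg_lo (x : R) : x <= 4^-1 -> sg x = 0.
Proof. by move=> h; rewrite /sg !pos_0 ?expr0n/=; [ring|lra|lra]. Qed.
Lemma sg_hi (x : R) : 3 / 4 <= x -> sg x = 1.
Proof. by move=> h; rewrite /sg !pos_id; [field|lra|lra]. Qed.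

Lemma dsgE (x : R) : exists y : R, [/\ 0 <= y <= 1, dsg x = 12 * (y * (1 - y)),
  y = 2 * pos (x - 4^-1) - 2 * pos (x - 3 / 4) & sg x = 3 * y ^+ 2 - 2 * y ^+ 3].
Proof.
exists (2 * pos (x - 4^-1) - 2 * pos (x - 3 / 4)); rewrite /dsg /sg.
have [h|h] := leP x 4^-1.
  by rewrite !pos_0; [|lra|lra]; split => //; [lra|field|field].
have [h'|h'] := leP x (3 / 4).
  rewrite (@pos_id _ (x - 4^-1)); last by lra.
  by rewrite pos_0; [|lra]; split => //; [lra|field|field].
by rewrite !pos_id; [|lra|lra]; split => //; [lra|field|field].
Qed.

Lemma dsg_ge0 (x : R) : 0 <= dsg x.
Proof.
have [y [/andP[y0 y1] -> _ _]] := dsgE x.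
by rewrite !mulr_ge0// subr_ge0.
Qed.
Lemma dsg_le3 (x : R) : dsg x <= 3.
Proof.
have [y [_ -> _ _]] := dsgE x; have := sqr_ge0 (2 * y - 1).
have -> : (2 * y - 1) ^+ 2 = 1 - 4 * (y * (1 - y)) by ring.
by move: (y * (1 - y)) => z; lra.
Qed.
Lemma dsg_lo (x : R) : x <= 4^-1 -> dsg x = 0.
Proof. by move=> h; rewrite /dsg !pos_0 ?expr0n/=; [ring|lra|lra]. Qed.
Lemma dsg_hi (x : R) : 3 / 4 <= x -> dsg x = 0.
Proof. by move=> h; rewrite /dsg !pos_id; [field|lra|lra]. Qed.

(** In the parameter [y] of [dsgE] the function is [12 y (1 - y)], which is 12-Lipschitz on the unit
    interval, and [y] is estimated as a 4-Lipschitz function of [x]. *)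
Lemma dsg_lip (x x' : R) : `|dsg x - dsg x'| <= 48 * `|x - x'|.
Proof.
have [y [/andP[y0 y1] -> yE _]] := dsgE x; have [z [/andP[z0 z1] -> zE _]] := dsgE x'.
rewrite (_ : _ - _ = 12 * ((1 - y - z) * (y - z))); last by ring.
rewrite !normrM (ger0_norm (_ : 0 <= 12))//.
have h1 : `|1 - y - z| <= 1 by rewrite ler_norml; lra.
have h2 : `|y - z| <= 4 * `|x - x'|.
  have a1 := pos_lip (x - 4^-1) (x' - 4^-1); have a2 := pos_lip (x - 3 / 4) (x' - 3 / 4).
  have E1 : x - 4^-1 - (x' - 4^-1) = x - x' by ring.
  have E2 : x - 3 / 4 - (x' - 3 / 4) = x - x' by ring.
  rewrite ?E1 ?E2 in a1 a2.
  rewrite yE zE; move: a1 a2; rewrite !ler_norml => /andP[? ?] /andP[? ?].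
  by apply/andP; split; lra.
have : `|1 - y - z| * `|y - z| <= 1 * (4 * `|x - x'|) by apply: ler_pM.
by lra.
Qed.

Lemma pos_shift_derive n (c x : R) :
  is_derive x 1 (fun x => pos (x - c) ^+ n.+2) (n.+2%:R * pos (x - c) ^+ n.+1).
Proof.
have d1 : is_derive x 1 (fun x => x - c) (1 : R).
  by rewrite -[X in is_derive _ _ _ X]subr0; exact: is_deriveB.
have d2 := posXn_derive n (x - c).
by have := @is_derive1_comp _ _ (fun x => x - c) x _ _ d2 d1; rewrite mulr1.
Qed.

Lemma sg_derive (x : R) : is_derive x 1 sg (dsg x).
Proof.
have d1 := pos_shift_derive 0 4^-1 x; have d2 := pos_shift_derive 1 4^-1 x.
have d3 := pos_shift_derive 0 (3 / 4) x; have d4 := pos_shift_derive 1 (3 / 4) x.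
have := der_add (der_add (der_add (der_scale 12 d1) (der_scale (-16) d2)) (der_scale 12 d3)) (der_scale 16 d4).
rewrite (_ : (fun y => _) = sg); last by apply/funext => y; rewrite /sg mulNr.
by move=> d; apply: is_derive_eq d _; rewrite /dsg; ring.
Qed.

Lemma dsg_continuous : continuous dsg.
Proof.
move=> x; apply/cvgrPdist_lt => e e0.
have e48 : 0 < e / 48 by rewrite divr_gt0.
exists (e / 48) => //= y; rewrite /ball_/= => xy.
by apply: le_lt_trans (dsg_lip x y) _; rewrite mulrC -ltr_pdivlMr.
Qed.

End Cutoff.

(** * Calculus in charts *)

Section ContSum.
Context {R : realType}.
Lemma cont_sum (T : topologicalType) (I : Type) (r : seq I) (F : I -> T -> R) y :
  (forall i, {for y, continuous (F i)}) -> {for y, continuous (fun z => \sum_(i <- r) F i z)}.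
Proof.
move=> H; elim: r => [|i r IH].
  have -> : (fun z => \sum_(i <- [::]) F i z) = (fun=> 0) by apply/funext => z; rewrite big_nil.
  exact: cvg_cst.
have -> : (fun z => \sum_(j <- i :: r) F j z) = (fun z => F i z + \sum_(j <- r) F j z).
  by apply/funext => z; rewrite big_cons.
exact: (cvgD (H i) IH).
Qed.

Lemma cont_norm (T : topologicalType) (f : T -> R) y : {for y, continuous f} ->
  {for y, continuous (fun z => `|f z| : R)}.
Proof. by move=> cf; apply: (@continuous_comp _ _ _ f (fun x : R => `|x| : R)) => //; exact: norm_continuous. Qed.

Lemma cont_add (T : topologicalType) (f f' : T -> R) y : {for y, continuous f} ->
  {for y, continuous f'} -> {for y, continuous (fun z => f z + f' z)}.
Proof. by move=> cf cf'; exact: cvgD cf cf'. Qed.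

Lemma cont_mul (T : topologicalType) (f f' : T -> R) y : {for y, continuous f} ->
  {for y, continuous f'} -> {for y, continuous (fun z => f z * f' z)}.
Proof. by move=> cf cf'; exact: cvgM cf cf'. Qed.

Lemma cont_inv (T : topologicalType) (f : T -> R) y : f y != 0 -> {for y, continuous f} ->
  {for y, continuous (fun z => (f z)^-1)}.
Proof. by move=> f0 cf; exact: cvgV f0 cf. Qed.

End ContSum.

Section ChartCalculus.
Context {R : realType} {m : nat} {M : topologicalType} (A : smooth_atlas R m M).
Notation dom := (@dom R m M A).
Notation phi := (@phi R m M A).
Notation psi := (@psi R m M A).
Implicit Types (W : set M) (F : M -> R) (p q : M).

Lemma row_dot (v w : 'rV[R]_m) : (v *m w^T) 0 0 = \sum_k v 0 k * w 0 k.
Proof. by rewrite mxE; apply: eq_bigr => k _; rewrite mxE. Qed.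

Lemma D_grd (f : 'rV[R]_m -> R) y v : differentiable f y -> 'D_v f y = (v *m (grd f y)^T) 0 0.
Proof.
by move=> df; rewrite derive_rV// row_dot; apply: eq_bigr => k _; rewrite [in RHS]mxE.
Qed.

Lemma sfun_dif W F i p : smooth_fun A W F -> W p -> dom i p -> differentiable (F \o psi i) (phi i p).
Proof. by move=> sF Wp dp; apply: smooth_dif (sF i) _; exact: phi_rng. Qed.

Lemma trans_dif i j p : dom i p -> dom j p -> differentiable (phi j \o psi i) (phi i p).
Proof. by move=> di dj; apply: smooth_dif (transition_smooth (s := A) i j) _; exists p. Qed.

(** A critical point is defined by all charts at once; the chain rule for the transition maps
    reduces the condition to one chart. *)
Lemma critical_chart W F i p : open W -> W p -> smooth_fun A W F -> dom i p ->
  grd (F \o psi i) (phi i p) = 0 -> critical_point A F p.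
Proof.
move=> oW Wp sF di g0 j dj v.
have dfi := sfun_dif sF Wp di; have dfj := sfun_dif sF Wp dj.
have dt := trans_dif dj di.
have E : 'D_v (F \o psi j) (phi j p) = 'D_v ((F \o psi i) \o (phi i \o psi j)) (phi j p).
  apply: (@derive_near _ _ _ _ _ v (phi j p) (phi j @` (dom j `&` dom i))).
  - exact: open_img (dom_open i).
  - by exists p.
  - by move=> y [q [dqj dqi] <-] /=; rewrite !phiK.
have dfi' : differentiable (F \o psi i) ((phi i \o psi j) (phi j p)) by rewrite /= phiK.
apply: (etrans E); apply: (etrans (chain v dt dfi')); apply: (etrans (D_grd _ dfi')).
have -> : (phi i \o psi j) (phi j p) = phi i p by rewrite /= phiK.
by rewrite g0 trmx0 mulmx0 mxE.
Qed.

Lemma chart_curve {U : normedModType R} (u : U -> M) i j z e :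
  smooth_map A setT u -> dom i (u z) -> dom j (u z) ->
  'D_e (phi j \o u) z = dtrans i j (u z) ('D_e (phi i \o u) z).
Proof.
move=> [cu su] di dj.
have oi : open (u @^-1` dom i `&` u @^-1` dom j).
  apply: openI; apply: (@open_comp _ _ u) => //; try exact: dom_open.
    by move=> x _; exact: cu.
  by move=> x _; exact: cu.
have dfi : differentiable (phi i \o u) z by apply: smooth_dif (su i) _; split.
have dt := trans_dif di dj.
rewrite /dtrans -[X in _ = 'D_X _ _]/('D_e (phi i \o u) z).
rewrite -(chain e dfi dt).
apply: (derive_near e oi) => // x [/= dxi dxj].
by rewrite phiK.
Qed.

Lemma preim_open {U : normedModType R} (u : U -> M) W : smooth_map A setT u -> open W -> open (u @^-1` W).
Proof. by move=> [cu _] oW; apply: (@open_comp _ _ u) => // x _; exact: cu. Qed.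

Lemma smap_smooth {U : normedModType R} (u : U -> M) i : smooth_map A setT u ->
  smooth (u @^-1` dom i) (phi i \o u).
Proof. by move=> [_ su]; apply: smooth_sub (su i) => x dx; split. Qed.

Lemma smap_dif {U : normedModType R} (u : U -> M) i z : smooth_map A setT u -> dom i (u z) ->
  differentiable (phi i \o u) z.
Proof. by move=> su dz; exact: smooth_dif (smap_smooth i su) dz. Qed.

End ChartCalculus.

(** * Metric, Hamiltonian field and energy density in charts *)

Section Geometry.
Context {R : realType} {m : nat} {M : topologicalType} (A : smooth_atlas R m M).
Notation dom := (@dom R m M A).
Notation phi := (@phi R m M A).
Notation psi := (@psi R m M A).
Context (omega J : tensor A).
Hypotheses (sy : symplectic_form omega) (ac : almost_complex J) (co : compatible omega J).
Let g := gJ omega J.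
Implicit Types (p q : M).

Lemma compat_at i y : rng i y -> compat (omega i y) (J i y) (g i y).
Proof.
move=> ry; have [_ _ alt un _] := sy; have [_ _ jj] := ac; have [s p] := co ry.
split.
- by apply: bil_alt => v; exact: alt.
- exact: un.
- exact: jj.
- by [].
- by apply: bil_sym_tr.
- exact: p.
Qed.

Lemma rng_phi i p : dom i p -> rng i (phi i p). Proof. by move=> d; exists p. Qed.

Lemma g_smooth i : msmooth (rng i) (g i).
Proof.
have [_ so _ _ _] := sy; have [_ sj _] := ac.
apply: msmooth_mul; first exact: rng_open.
  by apply: smooth_msmooth; [exact: rng_open|exact: so].
by apply: msmooth_tr; apply: smooth_msmooth; [exact: rng_open|exact: sj].
Qed.

Lemma g_trans i j p v w : dom i p -> dom j p ->
  bil (g i (phi i p)) v w = bil (g j (phi j p)) (dtrans i j p v) (dtrans i j p w).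
Proof.
move=> di dj; have [ot _ _ _ _] := sy; have [jt _ _] := ac.
by rewrite /g /gJ -!bil_mulr (ot i j p)// jt.
Qed.

(** [ham_vec] chooses a solution of its defining equation. A solution exists and nondegeneracy makes
    it unique, so the default 0 of the choice does not intervene. *)
Lemma ham_vecE (f : M -> R) i p : dom i p -> differentiable (f \o psi i) (phi i p) ->
  ham_vec omega f i p = hamX (J i (phi i p)) (g i (phi i p)) (grd (f \o psi i) (phi i p)).
Proof.
move=> dp df; have c := compat_at (rng_phi dp).
have eqv (X : 'rV[R]_m) : (forall w, bil (omega i (phi i p)) X w = - 'D_w (f \o psi i) (phi i p)) <->
    X *m omega i (phi i p) = - grd (f \o psi i) (phi i p).
  have E w : - 'D_w (f \o psi i) (phi i p) = ((- grd (f \o psi i) (phi i p)) *m w^T) 0 0.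
    by rewrite D_grd// !row_dot -sumrN; apply: eq_bigr => k _; rewrite [in RHS]mxE mulNr mulrC.
  split=> [H|H w]; last by rewrite E /bil H.
  apply/rowP => k; have := H (delta_mx 0 k); rewrite E /bil trmx_delta -!colE !mxE => ->; by [].
rewrite /ham_vec; set S := [set X | _].
have S0 : S (hamX (J i (phi i p)) (g i (phi i p)) (grd (f \o psi i) (phi i p))).
  by apply/eqv; exact: hamXO.
have := xgetI 0 S0 => H.
by apply: (hamX_uniq c); apply/eqv.
Qed.

Section Energy.
Context (u : R * R -> M) (su : smooth_map A setT u).

(** Invariance of the metric under coordinate changes shows that a value common to all charts
    exists, so [xget] does not return its default. *)
Lemma energy_densityE i z : dom i (u z) -> energy_density omega J u z =
  bil (g i (phi i (u z))) ('D_es (phi i \o u) z) ('D_es (phi i \o u) z).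
Proof.
move=> di; rewrite /energy_density; set S := [set e | _].
set b := bil _ _ _.
have S0 : S b.
  by move=> j dj; rewrite /b (g_trans _ _ di dj) -(chart_curve es su di dj).
by have := xgetI 0 S0; move=> /(_ i di).
Qed.

Lemma energy_density_ge0 z : 0 <= energy_density omega J u z.
Proof.
have [i di] := dom_cover A (u z); rewrite (energy_densityE di).
exact: c_psd (compat_at (rng_phi di)) _.
Qed.

Lemma energy_density_cont : continuous (energy_density omega J u).
Proof.
move=> z; have [i di] := dom_cover A (u z).
have oi : open (u @^-1` dom i) by exact: preim_open su (dom_open i).
apply: (cont_near oi di) => [w dw|]; first exact: (energy_densityE dw).
have cf : {for z, continuous (phi i \o u)} by exact: smooth_cont (smap_smooth i su) di.
have cD k : {for z, continuous (fun z => 'D_es (phi i \o u) z 0 k)}.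
  have := smooth_entry 0 k oi (smooth_D es (smap_smooth i su)).
  by move=> h; exact: smooth_cont h di.
have cg a b : {for z, continuous (fun z => g i (phi i (u z)) a b)}.
  have h : {for (phi i \o u) z, continuous (fun y => g i y a b)}.
    by apply: smooth_cont (g_smooth i a b) _; exact: rng_phi.
  exact: (continuous_comp cf h).
have -> : (fun z => bil (g i (phi i (u z))) ('D_es (phi i \o u) z) ('D_es (phi i \o u) z)) =
   (fun z => \sum_a \sum_b g i (phi i (u z)) a b * ('D_es (phi i \o u) z 0 a * 'D_es (phi i \o u) z 0 b)).
  by apply/funext => w; rewrite bilE.
apply: cont_sum => a; apply: cont_sum => b.
exact: cont_mul (cg a b) (cont_mul (cD a) (cD b)).
Qed.

End Energy.

Context (V N : set M) (h : M -> R).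
Hypotheses (sh : smooth_on_subset (smooth_fun A) N h) (nc : no_critical_points_on A N h).

(** Formulated with [N], [h] and a metric tensor only, so that it may be part of the definition of
    the final constant. *)
Definition good (gg : tensor A) (kap : R) p : Prop := exists i, dom i p /\
  forall y, ball (phi i p) kap^-1 y ->
    (phi i @` (dom i `&` N°)) y /\ chart_size (gg i) (h \o psi i) y <= kap.

Lemma good_mono gg k k' p : 0 < k -> k <= k' -> good gg k p -> good gg k' p.
Proof.
move=> k0 kk [i [di H]]; exists i; split => // y By.
have k'0 : 0 < k' by exact: lt_le_trans kk.
have [|h1 h2] := H y.
  by apply: le_ball By; rewrite lef_pV2.
by split => //; exact: le_trans h2 kk.
Qed.

Lemma grd_neq0 i y : (phi i @` (dom i `&` N°)) y -> grd (h \o psi i) y != 0.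
Proof.
move=> [p [dp Np] <-]; apply/eqP => g0.
have sN := subset_interior_smooth sh.
apply: (nc (interior_subset Np) (@open_interior _ N) Np sN) => //.
exact: critical_chart (@open_interior _ N) Np sN dp g0.
Qed.

Lemma chart_size_cont i y : (phi i @` (dom i `&` N°)) y ->
  {for y, continuous (chart_size (g i) (h \o psi i))}.
Proof.
set U := phi i @` _ => Uy.
have oU : open U by exact: open_img (@open_interior _ N).
have UU : U `<=` rng i by move=> z [q [dq _] <-]; exists q.
have sg : msmooth U (g i) by move=> a b; apply: smooth_sub UU (g_smooth i a b).
have sP : msmooth U (invm (g i)).
  by apply: msmooth_inv => // z /UU rz; exact: c_Gunit (compat_at rz).
have s_h : smooth U (h \o psi i) by exact: (subset_interior_smooth sh i).
have cn (f : 'rV[R]_m -> R) : smooth U f -> {for y, continuous (fun z => `|f z|)}.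
  by move=> sf; apply: cont_norm; exact: smooth_cont sf Uy.
have cd k : {for y, continuous (pd k (h \o psi i))}.
  exact: smooth_cont (smooth_D (delta_mx 0 k : 'rV[R]_m) s_h) Uy.
apply: cont_add; last first.
  apply: cont_inv.
    apply: lt0r_neq0; apply: compat_posP (compat_at (UU _ Uy)) _; exact: grd_neq0.
  have -> : (fun z => bil (invm (g i) z) (grd (h \o psi i) z) (grd (h \o psi i) z)) =
     (fun z => \sum_a \sum_b invm (g i) z a b * (pd a (h \o psi i) z * pd b (h \o psi i) z)).
    by apply/funext => z; rewrite bilE; apply: eq_bigr => a _; apply: eq_bigr => b _; rewrite !mxE.
  apply: cont_sum => a; apply: cont_sum => b; apply: cont_mul.
    exact: smooth_cont (sP a b) Uy.
  by apply: cont_mul; exact: cd.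
apply: cont_add; last first.
  apply: cont_sum => a; apply: cont_sum => b; apply: cn.
  exact: (smooth_D (delta_mx 0 a : 'rV[R]_m) (smooth_D (delta_mx 0 b : 'rV[R]_m) s_h)).
apply: cont_add; last first.
  apply: cont_sum => a; apply: cn; exact: (smooth_D (delta_mx 0 a : 'rV[R]_m) s_h).
apply: cont_add; last first.
  do 4 apply: cont_sum => ?; apply: cn.
  apply: (smooth_D (_ : 'rV[R]_m) (smooth_D (_ : 'rV[R]_m) (sP _ _))).
apply: cont_add; last first.
  do 3 apply: cont_sum => ?; apply: cn.
  apply: (smooth_D (_ : 'rV[R]_m) (sP _ _)).
apply: cont_add; first by do 2 apply: cont_sum => ?; apply: cn; exact: sg.
by do 2 apply: cont_sum => ?; apply: cn; exact: sP.
Qed.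

(** Continuity of [chart_size], together with the room left by halving the radius: a ball of radius
    [rho / 2] around a nearby point stays in the ball of radius [rho] around [p]. *)
Lemma good_near p : N° p -> exists2 k0 : R, 1 <= k0 & exists W, [/\ open W, W p &
  forall q k, W q -> k0 <= k -> good g k q].
Proof.
move=> Np; have [i di] := dom_cover A p.
pose U := phi i @` (dom i `&` N°); have Uy : U (phi i p) by exists p.
have oU : open U by exact: open_img (@open_interior _ N).
pose c := chart_size (g i) (h \o psi i) (phi i p).
have := chart_size_cont Uy; move/cvgrPdist_lt => /(_ 1 ltr01) H.
have /nbhs_ballP[rho /= rho0 Hr] : nbhs (phi i p)
    [set y | `|c - chart_size (g i) (h \o psi i) y| < 1 /\ U y].
  by apply: filterS2 H (open_nbhs_nbhs (conj oU Uy)).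
have [k0 [k01 k0c k0r]] : exists k0 : R, [/\ 1 <= k0, c + 1 <= k0 & k0^-1 <= rho / 2].
  exists (1 + `|c| + 1 + (rho / 2)^-1).
  have r2 : 0 < (rho / 2)^-1 by rewrite invr_gt0 divr_gt0.
  have c0 := normr_ge0 c; have cc := ler_norm c; split; [lra|lra|].
  rewrite -[leRHS]invrK lef_pV2 ?posrE//; lra.
exists k0 => //; exists (dom i `&` phi i @^-1` ball (phi i p) (rho / 2)); split.
- rewrite openE => q [dq Bq].
  have h1 : nbhs q (dom i) by apply: open_nbhs_nbhs; split => //; exact: dom_open.
  have h2 : nbhs q (phi i @^-1` ball (phi i p) (rho / 2)).
    apply: (phi_continuous dq); apply: open_nbhs_nbhs; split => //; exact: ball_open.
  by apply: filterI.
- by split => //; apply: ballxx; rewrite divr_gt0.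
move=> q k [dq Bq] kk; apply: (good_mono (lt_le_trans ltr01 k01) kk).
exists i; split => // y By.
have /Hr[/= h1 Uy'] : ball (phi i p) rho y.
  rewrite [rho]splitr; apply: ball_triangle Bq _; apply: le_ball By; exact: k0r.
split => //; move: h1; rewrite ltr_norml => /andP[h1 _]; lra.
Qed.

(** Compactness in the form of near coverings along [k --> +oo], which applies because [good] is
    preserved when [k] grows. *)
Lemma good_unif (K : set M) : compact K -> K `<=` N° -> exists2 k : R, 1 <= k & forall p, K p -> good g k p.
Proof.
move=> cK KN; have := (compact_near_coveringP _).1 cK.
move=> /(_ R (+oo)%R (fun k p => good g k p) _) /= H.
have [|k0 [k0r H2]] := H.
  move=> p Kp; have [k0 k01 [W [oW Wp HW]]] := good_near (KN p Kp).
  exists (W, [set k : R | k0 <= k]) => /=.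
    split; first exact: open_nbhs_nbhs.
    by exists k0; split; [exact: num_real|move=> k /ltW].
  by move=> [q k] /= [Wq kk]; exact: HW.
exists (Num.max 1 (k0 + 1)); first by rewrite le_max lexx.
move=> p; apply: H2 => /=.
by rewrite lt_max ltrDl ltr01 orbT.
Qed.

Lemma good_cdata k i p : dom i p -> (forall y, ball (phi i p) k^-1 y ->
    (phi i @` (dom i `&` N°)) y /\ chart_size (g i) (h \o psi i) y <= k) ->
  exists d : @cdata R m k, [/\ cO d = omega i, cJ d = J i, cg d = g i, chh d = h \o psi i & cy d = phi i p].
Proof.
move=> di H; have [_ so _ _ clo] := sy; have [_ sj _] := ac.
have Br y : ball (phi i p) k^-1 y -> rng i y.
  by move=> /H[[q [dq _] <-] _]; exists q.
unshelve (eexists (@Cdata R m k (omega i) (J i) (g i) (h \o psi i) (phi i p) _ _ _ _ _ _ _ _); split; reflexivity).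
- by apply: smooth_sub (so i) => y /Br.
- by apply: smooth_sub (sj i) => y /Br.
- by move=> a b; apply: smooth_sub (g_smooth i a b) => y /Br.
- by apply: smooth_sub (subset_interior_smooth sh i) => y /H[].
- by move=> y /Br; exact: compat_at.
- by move=> y v1 v2 v3 /Br; exact: clo.
- by move=> y /H[].
- by move=> y /H[Uy _]; exact: grd_neq0.
Qed.

End Geometry.

(** * Integral inequalities and continuity arguments on the line *)

Section OneVariable.
Context {R : realType}.
Implicit Types (f g F G q : R -> R) (a b t : R).

Lemma nonneg_derive_le (f df : R -> R) a b : a <= b ->
  (forall x, a <= x <= b -> is_derive x 1 f (df x) /\ 0 <= df x) -> f a <= f b.
Proof.
move=> ab H; have [|c cab E] := @MVT_all R f df a b ab.
  by move=> x xab; have [] := H x xab.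
by rewrite -subr_ge0 E mulr_ge0 ?subr_ge0//; have [] := H c cab.
Qed.

Lemma der_sub f g (x df dg : R) : is_derive x 1 f df -> is_derive x 1 g dg ->
  is_derive x 1 (fun y => f y - g y) (df - dg).
Proof. by move=> h1 h2; exact: is_deriveB h1 h2. Qed.

(** Primitives of [F] and [G] reduce the claim to the monotonicity of a function with nonnegative
    derivative; [dg] itself is never integrated. *)
Lemma I1_le_primitive F G (g dg : R -> R) a b : a <= b -> continuous F -> continuous G ->
  (forall t, a <= t <= b -> is_derive t 1 g (dg t) /\ F t <= dg t + G t) ->
  I1 a b F <= g b - g a + I1 a b G.
Proof.
move=> ab cF cG H.
have [PF dPF] := I1_primitive a b cF; have [PG dPG] := I1_primitive a b cG.
rewrite (I1_FTC ab cF dPF) (I1_FTC ab cG dPG).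
have := @nonneg_derive_le (fun t => g t + PG t - PF t) (fun t => dg t + G t - F t) a b ab.
have H' x : a <= x <= b -> is_derive x 1 (fun t => g t + PG t - PF t) (dg x + G x - F x) /\ 0 <= dg x + G x - F x.
  move=> xab; have [d1 d2] := H x xab; split; last by rewrite subr_ge0.
  exact: der_sub (der_add d1 (dPG x xab)) (dPF x xab).
by move=> /(_ H'); lra.
Qed.

Lemma derive_bound (g dg : R -> R) G a b : a <= b -> continuous G ->
  (forall t, a <= t <= b -> is_derive t 1 g (dg t) /\ `|dg t| <= G t) ->
  `|g b - g a| <= I1 a b G.
Proof.
move=> ab cG H; have c0 : continuous (fun _ : R => 0 : R) by move=> x; exact: cvg_cst.
have h1 : I1 a b (fun=> 0) <= (g b - g a) + I1 a b G.
  apply: (I1_le_primitive (dg := dg)) => // t tab; have [d1 d2] := H t tab; split => //.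
  by move: d2; rewrite ler_norml => /andP[]; lra.
have h2 : I1 a b (fun=> 0) <= (- g b - - g a) + I1 a b G.
  apply: (@I1_le_primitive _ _ (fun t => - g t) (fun t => - dg t)) => // t tab.
  have [d1 d2] := H t tab; split; first exact: is_deriveN.
  by move: d2; rewrite ler_norml => /andP[]; lra.
rewrite I1_cst// mul0r in h1 h2.
by rewrite ler_norml; lra.
Qed.

(** As a function of its left end, the integral over a period has derivative
    [q (c + 1) - q c = 0]. *)
Lemma I1_periodic q a : continuous q -> (forall t, q (t + 1) = q t) -> I1 a (a + 1) q = I1 0 1 q.
Proof.
move=> cq per.
have [Q dQ] := @I1_primitive R (Num.min a 0 - 1) (Num.max a 0 + 2) q cq.
have a1 : Num.min a 0 <= a by rewrite ge_min lexx.
have a2 : Num.min a 0 <= 0 by rewrite ge_min lexx orbT.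
have a3 : a <= Num.max a 0 by rewrite le_max lexx.
have a4 : 0 <= Num.max a 0 by rewrite le_max lexx orbT.
move: (Num.min a 0) (Num.max a 0) dQ a1 a2 a3 a4 => u v dQ a1 a2 a3 a4.
have inv c : u <= c <= v -> I1 c (c + 1) q = Q (c + 1) - Q c.
  by move=> cc; apply: I1_FTC => // [|x xx]; [lra|apply: dQ; lra].
have dD c : u <= c <= v -> is_derive c 1 (fun c => Q (c + 1) - Q c) 0.
  move=> cc; have d1 : is_derive c 1 (fun c => c + 1) (1 : R).
    by rewrite -[X in is_derive _ _ _ X]addr0; exact: is_deriveD.
  have d2 : is_derive (c + 1) 1 Q (q (c + 1)) by apply: dQ; lra.
  have d3 : is_derive c 1 Q (q c) by apply: dQ; lra.
  have := @is_derive1_comp _ Q (fun x => x + 1) c _ _ d2 d1; rewrite mulr1 => d4.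
  by apply: is_derive_eq (der_sub d4 d3) _; rewrite per subrr.
have cst c c' : u <= c <= v -> u <= c' <= v -> c <= c' -> Q (c + 1) - Q c = Q (c' + 1) - Q c'.
  move=> cc cc' le; have [x xx E] := @MVT_all R (fun c => Q (c + 1) - Q c) (fun=> 0) c c' le
    (fun x xx => dD x ltac:(lra)).
  by apply/eqP; rewrite eq_sym -subr_eq0 E mul0r.
have -> : I1 0 1 q = Q (0 + 1) - Q 0 by rewrite -inv ?add0r//; lra.
rewrite inv; last by lra.
by have [h|/ltW h] := leP a 0; [|apply/esym]; apply: cst => //; lra.
Qed.

(** Bootstrap: the supremum of the times up to which the path stays in [C] can only be [b]. It
    serves to keep a curve in a chart whose estimates presuppose that the curve is there. *)
Lemma stay (M : topologicalType) (x : R -> M) (U C : set M) a b :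
  (forall t, a <= t <= b -> {for t, continuous x}) -> open U -> closed C -> U `<=` C ->
  a <= b -> U (x a) ->
  (forall c, a <= c <= b -> (forall t, a <= t <= c -> C (x t)) -> U (x c)) ->
  forall c, a <= c <= b -> U (x c).
Proof.
move=> cx oU cC UC ab Ua H.
suff HC : forall t, a <= t <= b -> C (x t).
  by move=> c /andP[ac cb]; apply: H => [|t /andP[a_t tc]]; [rewrite ac cb|apply: HC; rewrite a_t (le_trans tc)].
pose S : set R := [set c | a <= c <= b /\ forall t, a <= t <= c -> C (x t)].
have Sa : S a.
  split; first by rewrite lexx ab.
  by move=> t /andP[h1 h2]; have -> : t = a; [by apply/le_anti; rewrite h1 h2|exact: UC].
have hS : has_sup S.
  by split; [exists a|exists b => c [/andP[]]].
pose s := sup S.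
have as_ : a <= s by exact: sup_upper_bound.
have sb : s <= b by apply: ge_sup; [exists a|move=> c [/andP[]]].
have below t : a <= t < s -> C (x t).
  move=> /andP[a_t ts]; have st : 0 < s - t by rewrite subr_gt0.
  have [c [/andP[ac cb] Hc] lt] := sup_adherent st hS.
  by apply: Hc; rewrite a_t /=; apply: ltW; move: lt; rewrite -/s; lra.
have cxs : {for s, continuous x} by apply: cx; rewrite as_ sb.
have Cs : C (x s).
  apply: contrapT => nC; have oC : open (~` C) by exact: closed_openC.
  have /nbhs_ballP[e /= e0 He] : nbhs s (x @^-1` (~` C)).
    by apply: cxs; exact: open_nbhs_nbhs.
  have [sa|sa] := eqVneq s a; first by apply: nC; rewrite sa; exact: UC.
  have as' : a < s by rewrite lt_neqAle eq_sym sa.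
  pose t := Num.max a (s - e / 2).
  have ts : t < s by rewrite gt_max as'/=; lra.
  have a_t : a <= t by rewrite le_max lexx.
  have te : s - e / 2 <= t by rewrite le_max lexx orbT.
  have : (~` C) (x t) by apply: He; rewrite /ball /= ger0_norm; lra.
  by apply; apply: below; rewrite a_t.
have Ss : S s.
  split; first by rewrite as_ sb.
  move=> t /andP[a_t ts]; move: ts; rewrite le_eqVlt => /predU1P[->//|ts].
  by apply: below; rewrite a_t.
have Us : U (x s) by case: Ss => h1 h2; exact: H.
have [sb'|bs] := ltP s b; last first.
  have -> : b = s by apply/le_anti; rewrite bs sb.
  by case: Ss.
have /nbhs_ballP[e /= e0 He] : nbhs s (x @^-1` U) by apply: cxs; exact: open_nbhs_nbhs.
pose c := Num.min b (s + e / 2).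
have cs : s < c by rewrite lt_min sb' /=; lra.
have cb : c <= b by rewrite ge_min lexx.
have ce : c <= s + e / 2 by rewrite ge_min lexx orbT.
have Sc : S c.
  split; first by rewrite cb; lra.
  move=> t /andP[a_t tc]; have [ts|st] := ltP t s; first by apply: below; rewrite a_t.
  by apply: UC; apply: He; rewrite /ball /= ler0_norm; lra.
by have := sup_upper_bound hS Sc; rewrite -/s; lra.
Qed.

Lemma closed_ball_compact n (y : 'rV[R]_n) (r : R) : compact [set z | `|z - y| <= r].
Proof.
apply: bounded_closed_compact.
  exists (`|y| + r); split; first exact: num_real.
  move=> k kr z /= zr; apply: ltW; apply: le_lt_trans kr.
  by rewrite -[z](subrK y) addrC; apply: le_trans (ler_normD _ _) _; rewrite lerD2l.
apply: (@preimage_closed _ _ (fun z : 'rV[R]_n => `|z - y| : R) [set x | x <= r]); last exact: closed_le.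
move=> z _; apply: (@continuous_comp _ _ _ (fun z : 'rV[R]_n => z - y) (fun z : 'rV[R]_n => `|z| : R)).
  by apply: differentiable_continuous; apply: differentiableB.
exact: norm_continuous.
Qed.

End OneVariable.

Section ChartBall.
Context {R : realType} {m : nat} {M : topologicalType} (A : smooth_atlas R m M).
Hypothesis (Mh : hausdorff_space M).
Notation dom := (@dom R m M A).
Notation phi := (@phi R m M A).
Notation psi := (@psi R m M A).

(** A closed coordinate ball is compact, hence closed in the Hausdorff space [M]. Thus a curve
    cannot leave the domain of the chart while its coordinates remain in the ball. *)
Lemma chart_cball_closed i (y0 : 'rV[R]_m) (r rho : R) : r < rho -> ball y0 rho `<=` rng i ->
  closed [set p | dom i p /\ `|phi i p - y0| <= r].
Proof.
move=> rr Br; apply: compact_closed => //.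
have -> : [set p | dom i p /\ `|phi i p - y0| <= r] = psi i @` [set z | `|z - y0| <= r].
  apply/seteqP; split=> [p [dp pr]|p [z /= zr <-]].
    by exists (phi i p) => //; rewrite phiK.
  have [q dq E] : rng i z by apply: Br; rewrite -ball_normE /= distrC (le_lt_trans zr).
  rewrite -E phiK//; split => //.
  by rewrite E.
apply: continuous_compact; last exact: closed_ball_compact.
apply: continuous_in_subspaceT => z; rewrite inE /= => zr.
apply: psi_continuous; apply: Br.
by rewrite -ball_normE /= distrC (le_lt_trans zr).
Qed.

Lemma chart_ball_open i (y0 : 'rV[R]_m) (r : R) : open [set p | dom i p /\ `|phi i p - y0| < r].
Proof.
rewrite openE => p [dp pr]; rewrite /interior.
have h1 : nbhs p (dom i) by apply: open_nbhs_nbhs; split => //; exact: dom_open.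
have h2 : nbhs p (phi i @^-1` ball y0 r).
  apply: (phi_continuous dp); apply: open_nbhs_nbhs; split; first exact: ball_open.
  by rewrite -ball_normE /= distrC.
by apply: filterS2 h1 h2 => q dq /=; rewrite -ball_normE /= distrC.
Qed.

End ChartBall.

(** * The cut-off along a trajectory *)

(** Final arithmetic of [no_cross]: the energy contributes less than half of [r2] and the graph
    coordinates at most the other half. *)
Lemma no_cross_aux {R : realType} (r2 kk I E d l : R) : 640 * (4 * l) = 2^-1 ->
  E * (1280 * kk) < r2 -> 2 * r2 * d <= 2 * r2 * (4 * l) -> 2 * kk * I <= 2 * kk * E ->
  r2 <= 320 * (2 * kk * I + 2 * r2 * d) -> False.
Proof.
move=> lE h1 h2 h3 h4; have p320 : (0 : R) < 320 by rewrite ltr0n.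
have e1 : E * (1280 * kk) = 640 * (2 * kk * E) by ring.
have e2 : 320 * (2 * r2 * (4 * l)) = r2 * 2^-1 by rewrite -lE; ring.
have h2' : 320 * (2 * r2 * d) <= 320 * (2 * r2 * (4 * l)) by rewrite (ler_pM2l p320).
have h3' : 320 * (2 * kk * I) <= 320 * (2 * kk * E) by rewrite (ler_pM2l p320).
rewrite e1 in h1; rewrite e2 in h2'; rewrite mulrDr in h4.
have e3 : 640 * (2 * kk * E) = 320 * (2 * kk * E) + 320 * (2 * kk * E) by ring.
rewrite e3 in h1.
move: (320 * (2 * kk * E)) (320 * (2 * kk * I)) (320 * (2 * r2 * d)) h1 h2' h3' h4 => a b c *.
by lra.
Qed.

Lemma slices_around {R : realType} (s0 s1 s2 l : R) : 0 < l -> s0 - 2 * l <= s1 -> s1 <= s0 - 2 * l + l ->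
  s0 + l <= s2 -> s2 <= s0 + l + l -> s1 < s0 < s2 /\ s2 - s1 <= 4 * l.
Proof. by move=> *; split; lra. Qed.

Lemma oscillation_left {R : realType} (a b c : R) : a <= b + c -> b <= 16^-1 -> 8^-1 <= a -> 16^-1 <= c.
Proof. lra. Qed.

Lemma unit_window {R : realType} (t0 t : R) : 0 <= t0 <= 1 -> t0 - 1 <= t <= t0 + 1 -> -1 <= t <= 2.
Proof. lra. Qed.

Section Traj.
Context {R : realType} {m : nat} {M : topologicalType} (A : smooth_atlas R m M).
Notation dom := (@dom R m M A).
Notation phi := (@phi R m M A).
Notation psi := (@psi R m M A).
Notation P := (R * R)%type.
Hypotheses (Mc : compact [set: M]) (Mh : hausdorff_space M).
Context (omega J : tensor A).
Hypotheses (sy : symplectic_form omega) (ac : almost_complex J) (co : compatible omega J).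
Context (V N : set M) (h : M -> R).
Hypotheses (oV : open V) (tub : tubular_neighborhood A V N)
  (sh : smooth_on_subset (smooth_fun A) N h) (nc : no_critical_points_on A N h)
  (h0 : forall x, bdry V x -> h x = 0) (h1 : forall x, bdry (closure V `|` N) x -> h x = 1).
Context (H : M -> R -> R -> R) (eps : R) (beta : R -> R -> R).
Hypothesis HN : forall x t s, N x -> H x t s = eps * h x + beta s t.
Context (u : P -> M).
Hypotheses (su : smooth_map A setT u) (per : forall s t, u (s, t + 1) = u (s, t))
  (fl : floer_equation omega J H u).
Let g := gJ omega J.
Let e := energy_density omega J u.
Let oN : open N°. Proof. exact: open_interior. Qed.
Let sN : smooth_fun A N° h. Proof. exact: subset_interior_smooth. Qed.

Definition Xh (i : chart A) (y : 'rV[R]_m) : 'rV[R]_m := hamX (J i y) (g i y) (grd (h \o psi i) y).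

(** The summand [beta s t] is constant in space and drops out of the differential. *)
Lemma ham_eps i p s t : N° p -> dom i p -> ham_vec omega (fun p => H p t s) i p = eps *: Xh i (phi i p).
Proof.
move=> Np dp; have dh := sfun_dif sN Np dp.
pose U := phi i @` (dom i `&` N°); have oU : open U by exact: open_img.
have Uy : U (phi i p) by exists p.
have E y : U y -> eps * (h \o psi i) y + beta s t = ((fun p => H p t s) \o psi i) y.
  by move=> /psi_in[_ Ny _]; rewrite /= HN//; exact: interior_subset.
have d1 : differentiable (fun y => eps * (h \o psi i) y + beta s t) (phi i p).
  apply: differentiableD; last exact: differentiable_cst.
  by apply: differentiableM => //; exact: differentiable_cst.
have d2 : differentiable ((fun p => H p t s) \o psi i) (phi i p) by exact: dif_near oU Uy E d1.
rewrite (ham_vecE sy ac co dp d2).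
have -> : grd ((fun p => H p t s) \o psi i) (phi i p) = eps *: grd (h \o psi i) (phi i p).
  apply/rowP => k; rewrite !mxE; apply: etrans (esym (derive_near _ oU Uy E)) _.
  have d3 : differentiable (fun y => eps * (h \o psi i) y) (phi i p).
    by apply: differentiableM => //; exact: differentiable_cst.
  rewrite (derive_add _ d3 (differentiable_cst (beta s t) (phi i p))) derive_cst addr0.
  exact: derive_scal.
by rewrite /Xh /hamX -!scalemxAl.
Qed.

Lemma floer_chart i z : N° (u z) -> dom i (u z) ->
  'D_es (phi i \o u) z + ('D_et (phi i \o u) z - eps *: Xh i (phi i (u z))) *m J i (phi i (u z)) = 0.
Proof.
case: z => s t Nz dz; have := fl dz; rewrite ham_eps//.
Qed.

Definition cut (p : M) : R := if p \in N then sg (h p) else if p \in V then 0 else 1.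

Lemma cutN p : N p -> cut p = sg (h p).
Proof. by move=> Np; rewrite /cut mem_set. Qed.

Lemma cut_const p : ~ N° p -> exists W c, [/\ open W, W p & forall q, W q -> cut q = c].
Proof.
move=> nN; case: (trichotomy Mc Mh oV tub sh h0 h1 p) => // -[W [oW Wp HW]].
- exists W, 0; split => // q /HW[Vq|[Nq hq]]; last by rewrite cutN// sg_lo// ltW.
  rewrite /cut memNset ?mem_set//; move=> Nq; exact: (NV tub Nq).
- exists W, 1; split => // q /HW[nq|[Nq hq]]; last by rewrite cutN// sg_hi// ltW.
  rewrite /cut memNset; last by move=> Nq; apply: nq; right.
  by rewrite memNset// => Vq; apply: nq; left; exact: subset_closure.
Qed.

Lemma cutV p : V p -> cut p = 0.
Proof. by move=> Vp; rewrite /cut memNset ?mem_set// => /(NV tub). Qed.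
Lemma cut_out p : ~ Vhat V N p -> cut p = 1.
Proof.
move=> np; rewrite /cut memNset; last by move=> Np; apply: np; right.
by rewrite memNset// => Vp; apply: np; left; exact: subset_closure.
Qed.

Lemma hu_dif i z v : N° (u z) -> dom i (u z) -> differentiable (h \o u) z /\
  'D_v (h \o u) z = ('D_v (phi i \o u) z *m (grd (h \o psi i) (phi i (u z)))^T) 0 0.
Proof.
move=> Nz dz.
have oO : open (u @^-1` (dom i)) by exact: preim_open su (dom_open i).
have E w : (u @^-1` dom i) w -> ((h \o psi i) \o (phi i \o u)) w = (h \o u) w.
  by move=> dw; rewrite /= phiK.
have df := smap_dif su dz; have dh := sfun_dif sN Nz dz.
have dc : differentiable ((h \o psi i) \o (phi i \o u)) z by exact: differentiable_comp.
split; first exact: dif_near oO dz E dc.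
apply: etrans (esym (derive_near v oO dz E)) _.
apply: etrans (chain v df dh) _; exact: D_grd.
Qed.

Lemma hu_C1 i : C1 es et (u @^-1` (dom i `&` N°)) (h \o u).
Proof.
set O := _ @^-1` _; have oO : open O.
  by apply: preim_open su _; apply: openI => //; exact: dom_open.
have cD v z : O z -> {for z, continuous ('D_v (h \o u))}.
  move=> Oz; have [dz Nz] := Oz.
  apply: (cont_near oO Oz (g := fun z => \sum_k 'D_v (phi i \o u) z 0 k * pd k (h \o psi i) (phi i (u z)))).
    move=> w [dw Nw]; rewrite (hu_dif v Nw dw).2 row_dot; apply: eq_bigr => k _.
    by rewrite [in LHS]mxE.
  apply: cont_sum => k; apply: cont_mul.
    have oD : open (u @^-1` dom i) by exact: preim_open su (dom_open i).
    exact: smooth_cont (smooth_entry 0 k oD (smooth_D v (smap_smooth i su))) dz.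
  have cf : {for z, continuous (phi i \o u)} by exact: smooth_cont (smap_smooth i su) dz.
  have cp : {for (phi i \o u) z, continuous (pd k (h \o psi i))}.
    by apply: smooth_cont (smooth_D (delta_mx 0 k : 'rV[R]_m) (sN i)) _; exists (u z).
  exact: (continuous_comp cf cp).
move=> z Oz; have [dz Nz] := Oz; split; [|exact: cD|exact: cD].
by have [] := hu_dif es Nz dz.
Qed.

Lemma cut_C1 : C1 es et setT (cut \o u).
Proof.
move=> z _; have [Nz|nN] := pselect (N° (u z)).
  have [i dz] := dom_cover A (u z).
  set O := u @^-1` (dom i `&` N°); have oO : open O.
    by apply: preim_open su _; apply: openI => //; exact: dom_open.
  have hC : C1 es et O (cut \o u).
    apply: (C1_eq oO _ (C1_comp oO (@hu_C1 i) (fun z _ => sg_derive _) (fun z _ => @dsg_continuous R _))).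
    by move=> w [_ Nw]; rewrite /= cutN//; exact: interior_subset.
  by apply: hC.
have [W [c [oW Wp HW]]] := cut_const nN.
have oO : open (u @^-1` W) := preim_open su oW.
have hC : C1 es et (u @^-1` W) (cut \o u).
  by apply: (C1_eq oO _ (@C1_cst _ _ es et _ c)) => w Ww; rewrite /= HW.
by apply: hC.
Qed.

Lemma cutD i z v : N° (u z) -> dom i (u z) -> 'D_v (cut \o u) z =
  dsg (h (u z)) * ('D_v (phi i \o u) z *m (grd (h \o psi i) (phi i (u z)))^T) 0 0.
Proof.
move=> Nz dz; have [dh <-] := hu_dif v Nz dz.
have oO : open (u @^-1` N°) := preim_open su oN.
apply: etrans (derive_near v oO Nz (g := sg \o (h \o u)) _) _.
  by move=> w Nw; rewrite /= cutN//; exact: interior_subset.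
exact: derive_comp1 dh (sg_derive _).
Qed.

Lemma cutD0 z v : ~ core N h (u z) -> 'D_v (cut \o u) z = 0.
Proof.
move=> nc'; have [Nz|nN] := pselect (N° (u z)).
  have [i dz] := dom_cover A (u z); rewrite (cutD v Nz dz).
  have [lt|ge] := ltP (h (u z)) 4^-1; first by rewrite dsg_lo ?mul0r// ltW.
  have [lt'|ge'] := ltP (3 / 4) (h (u z)); first by rewrite dsg_hi ?mul0r// ltW.
  by exfalso; apply: nc'; split; [exact: interior_subset|rewrite /= ge ge'].
have [W [c [oW Wp HW]]] := cut_const nN.
have oO : open (u @^-1` W) := preim_open su oW.
apply: etrans (derive_near v oO Wp (g := fun=> c) _) _; last exact: derive_cst.
by move=> w Ww; rewrite /= HW.
Qed.

Section Bounds.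
Context (kap k : R) (kap1 : 1 <= kap) (k1 : 1 <= k).
Hypothesis kE : @chart_const R m kap k.
Hypothesis gk : forall p, core N h p -> good N h g kap p.

Record lpack (i : chart A) (y0 : 'rV[R]_m) : Prop := Lpack {
  lp_sub : ball y0 kap^-1 `<=` phi i @` (dom i `&` N°) ;
  lp_up : forall y (v : 'rV[R]_m), ball y0 kap^-1 y -> nrm (g i y) v <= k * `|v| ;
  lp_lo : forall y (v : 'rV[R]_m), ball y0 kap^-1 y -> `|v| <= k * nrm (g i y) v ;
  lp_J : forall y (v : 'rV[R]_m), ball y0 kap^-1 y -> `|v *m J i y| <= k * `|v| ;
  lp_X : forall y, ball y0 kap^-1 y -> `|Xh i y| <= k ;
  lp_Xlo : forall y, ball y0 kap^-1 y -> k^-1 <= `|Xh i y| ;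
  lp_grd : forall y (v : 'rV[R]_m), ball y0 kap^-1 y -> `|(v *m (grd (h \o psi i) y)^T) 0 0| <= k * `|v| ;
  lp_JL : forall y y' (v : 'rV[R]_m), ball y0 kap^-1 y -> ball y0 kap^-1 y' ->
    `|v *m (J i y - J i y')| <= k * `|y - y'| * `|v| ;
  lp_XL : forall y y', ball y0 kap^-1 y -> ball y0 kap^-1 y' -> `|Xh i y - Xh i y'| <= k * `|y - y'| ;
  lp_grdL : forall y y' (v : 'rV[R]_m), ball y0 kap^-1 y -> ball y0 kap^-1 y' ->
    `|(v *m (grd (h \o psi i) y - grd (h \o psi i) y')^T) 0 0| <= k * `|y - y'| * `|v| }.

Lemma core_pack p : core N h p -> exists i, dom i p /\ lpack i (phi i p).
Proof.
move=> /gk[i [di Hi]]; exists i; split => //.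
have [d [E1 E2 E3 E4 E5]] := good_cdata sy ac co sh nc di Hi.
have EX y : cX d y = Xh i y by rewrite /cX /Xh E2 E3 E4.
have B y : ball (phi i p) kap^-1 y -> cB d y by rewrite /cB E5.
split.
- by move=> y /Hi[].
- by move=> y v /B By; have [] := kE By; rewrite E3.
- by move=> y v /B By; have [] := kE By; rewrite E3.
- by move=> y v /B By; have [] := kE By; rewrite E2.
- by move=> y /B By; have [_ _ _ [a b] _] := kE By; rewrite -EX.
- by move=> y /B By; have [_ _ _ [a b] _] := kE By; rewrite -EX.
- by move=> y v /B By; have [_ _ _ _ [a _ _ _]] := kE By; rewrite -E4.
- by move=> y y' v /B By /B By'; have [_ _ _ _ [_ a _ _]] := kE By; rewrite -E2; exact: a.
- by move=> y y' /B By /B By'; have [_ _ _ _ [_ _ a _]] := kE By; rewrite -!EX; exact: a.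
- by move=> y y' v /B By /B By'; have [_ _ _ _ [_ _ _ a]] := kE By; rewrite -E4; exact: a.
Qed.

Let k0 : 0 < k. Proof. exact: lt_le_trans k1. Qed.
Let kap0 : 0 < kap. Proof. exact: lt_le_trans kap1. Qed.

Let q (z : P) : R := Num.sqrt (e z).

Lemma q_ge0 z : 0 <= q z. Proof. exact: sqrtr_ge0. Qed.

Lemma q_cont : continuous q.
Proof.
move=> z; apply: (@continuous_comp _ _ _ e Num.sqrt); last exact: sqrt_continuous.
exact: energy_density_cont.
Qed.

Lemma es_le i y0 z : lpack i y0 -> dom i (u z) -> ball y0 kap^-1 (phi i (u z)) ->
  `|'D_es (phi i \o u) z| <= k * q z.
Proof.
move=> lp dz Bz; apply: le_trans (lp_lo lp _ Bz) _.
by rewrite /q /e (energy_densityE sy ac su dz).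
Qed.

Lemma et_E i z : N° (u z) -> dom i (u z) ->
  'D_et (phi i \o u) z = 'D_es (phi i \o u) z *m J i (phi i (u z)) + eps *: Xh i (phi i (u z)).
Proof.
move=> Nz dz; have := congr1 (fun v => v *m J i (phi i (u z))) (floer_chart Nz dz).
have c := compat_at sy ac co (rng_phi dz).
rewrite mulmxDl mul0mx (c_JJv c) => /eqP; rewrite subr_eq0 => /eqP ->.
by rewrite subrK.
Qed.

Lemma et_le i y0 z : 0 <= eps -> lpack i y0 -> dom i (u z) -> ball y0 kap^-1 (phi i (u z)) ->
  `|'D_et (phi i \o u) z| <= k ^+ 2 * (q z + eps).
Proof.
move=> eps0 lp dz Bz; have [p' [dp' Np'] E] := lp_sub lp Bz.
have Nz : N° (u z) by rewrite -(phiK dz) -E phiK.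
rewrite (et_E Nz dz); apply: le_trans (ler_normD _ _) _; rewrite mulrDr; apply: lerD.
  apply: le_trans (lp_J lp _ Bz) _; rewrite expr2 -mulrA ler_pM2l//; exact: es_le lp dz Bz.
rewrite normrZ ger0_norm// mulrC ler_wpM2r//; apply: le_trans (lp_X lp Bz) _.
by rewrite expr2 ler_peMl// ltW.
Qed.

Lemma core_ball i (p : M) : ball (phi i p) kap^-1 (phi i p).
Proof. by apply: ballxx; rewrite invr_gt0. Qed.

Lemma cut_es z : `|'D_es (cut \o u) z| <= 3 * k ^+ 3 * q z.
Proof.
have [cz|nc'] := pselect (core N h (u z)); last first.
  by rewrite cutD0// normr0 !mulr_ge0 ?exprn_ge0 ?q_ge0// ltW.
have [i [dz lp]] := core_pack cz; have Bz := core_ball i (u z).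
have Nz := core_int Mc Mh oV tub sh h0 h1 cz.
rewrite (cutD _ Nz dz) normrM (ger0_norm (dsg_ge0 _)) -!mulrA.
apply: ler_pM => //; [exact: dsg_ge0|exact: dsg_le3|].
apply: le_trans (lp_grd lp _ Bz) _; rewrite ler_pM2l//.
apply: le_trans (es_le lp dz Bz) _; rewrite ler_pM2l//; apply: ler_peMl => //; exact: q_ge0.
Qed.

(** The bound is free of [eps] because [d h] vanishes on the Hamiltonian field of [h]; only the part
    [d_s u J] of [d_t u] is seen by the cut-off. *)
Lemma cut_et z : `|'D_et (cut \o u) z| <= 3 * k ^+ 3 * q z.
Proof.
have [cz|nc'] := pselect (core N h (u z)); last first.
  by rewrite cutD0// normr0 !mulr_ge0 ?exprn_ge0 ?q_ge0// ltW.
have [i [dz lp]] := core_pack cz; have Bz := core_ball i (u z).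
have Nz := core_int Mc Mh oV tub sh h0 h1 cz.
have c := compat_at sy ac co (rng_phi dz).
rewrite (cutD _ Nz dz) normrM (ger0_norm (dsg_ge0 _)) -!mulrA.
apply: ler_pM => //; [exact: dsg_ge0|exact: dsg_le3|].
rewrite (et_E Nz dz) mulmxDl -scalemxAl /Xh (hamX_d c) scaler0 addr0.
apply: le_trans (lp_grd lp _ Bz) _; rewrite ler_pM2l//.
apply: le_trans (lp_J lp _ Bz) _; rewrite ler_pM2l//; exact: es_le lp dz Bz.
Qed.

Hypothesis eps0 : 0 < eps.

Let slice_entry i s t j : dom i (u (s, t)) ->
  is_derive t 1 (fun t => (phi i \o u) (s, t) 0 j) ('D_et (phi i \o u) (s, t) 0 j).
Proof.
move=> dz; have df := smap_dif su dz.
rewrite (D_entry _ df); exact: (slice_t (dif_entry df j)).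
Qed.

Let qs s : continuous (fun t => q (s, t)).
Proof. by apply: slice1_continuous; exact: q_cont. Qed.
Lemma q_per s t : q (s, t + 1) = q (s, t).
Proof.
have [i dz] := dom_cover A (u (s, t)).
have dz' : dom i (u (s, t + 1)) by rewrite per.
rewrite /q /e (energy_densityE sy ac su dz) (energy_densityE sy ac su dz') per.
have -> // : 'D_es (phi i \o u) (s, t + 1) = 'D_es (phi i \o u) (s, t).
apply/rowP => j; have d1 := smap_dif su dz; have d2 := smap_dif su dz'.
apply: (etrans (D_entry es d2 j)); apply: (etrans _ (esym (D_entry es d1 j))).
have e1 := slice_s (dif_entry d1 j); have e2 := slice_s (dif_entry d2 j).
have E : (fun s => (phi i \o u) (s, t + 1) 0 j) = (fun s => (phi i \o u) (s, t) 0 j).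
  by apply/funext => s'; rewrite /= per.
by rewrite E in e2; rewrite -(derive_val (is_derive := e1)) -(derive_val (is_derive := e2)).
Qed.

Definition Iq s : R := I1 0 1 (fun t => q (s, t)).
Lemma Iq_ge0 s : 0 <= Iq s. Proof. by apply: I1_ge0 => t _; exact: q_ge0. Qed.
Lemma Iq_shift s t0 : I1 t0 (t0 + 1) (fun t => q (s, t)) = Iq s.
Proof. by apply: I1_periodic => // t; exact: q_per. Qed.

Let bq s : continuous (fun t => k ^+ 2 * (q (s, t) + eps)).
Proof. by move=> t; apply: cvgM; [exact: cvg_cst|apply: cvgD; [exact: qs|exact: cvg_cst]]. Qed.

Let bqI s t0 : I1 t0 (t0 + 1) (fun t => k ^+ 2 * (q (s, t) + eps)) = k ^+ 2 * (Iq s + eps).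
Proof.
have cc : continuous (fun _ : R => eps) by move=> t; exact: cvg_cst.
have cq : continuous (fun t => q (s, t) + eps) by move=> t; apply: cvgD; [exact: qs|exact: cvg_cst].
rewrite I1Z// I1D// Iq_shift I1_cst ?lerDl//; congr (_ * (_ + _)); ring.
Qed.

Section Loop.
Context (s t0 : R) (i : chart A).
Let y0 := phi i (u (s, t0)).
(** A bound for the variation of the coordinates along the loop, obtained by integrating [et_le]
    over one period. *)
Let eta := k ^+ 2 * (Iq s + eps).
Hypotheses (d0 : dom i (u (s, t0))) (lp : lpack i y0).
Hypotheses (eta1 : eta < kap^-1 / 2) (eta2 : k * eta <= (2 * k)^-1).

Let half : kap^-1 / 2 < kap^-1.
Proof. by rewrite gtr_pMr ?invr_gt0// invf_lt1// ltr1n. Qed.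

Let inball (p : M) : `|phi i p - y0| < kap^-1 / 2 -> ball y0 kap^-1 (phi i p).
Proof. by move=> h'; rewrite -ball_normE /= distrC (lt_trans h')//. Qed.

Let est c : t0 <= c <= t0 + 1 ->
  (forall t, t0 <= t <= c -> dom i (u (s, t)) /\ `|phi i (u (s, t)) - y0| <= kap^-1 / 2) ->
  `|phi i (u (s, c)) - y0| <= eta.
Proof.
move=> /andP[tc ct] Hc; have eta_ge0 : 0 <= eta by rewrite mulr_ge0 ?exprn_ge0 ?addr_ge0 ?Iq_ge0 ?(ltW k0) ?(ltW eps0).
apply: norm_rV_le => // j; rewrite !mxE.
have hb : `|(phi i \o u) (s, c) 0 j - (phi i \o u) (s, t0) 0 j| <=
    I1 t0 c (fun t => k ^+ 2 * (q (s, t) + eps)).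
  apply: (@derive_bound R (fun t => (phi i \o u) (s, t) 0 j) (fun t => 'D_et (phi i \o u) (s, t) 0 j)) => // t ttc.
  have [dt bt] := Hc t ttc; split; first exact: slice_entry.
  apply: le_trans (rV_norm_entry _ _) _; apply: et_le (ltW eps0) lp dt _.
  by rewrite -ball_normE /= distrC (le_lt_trans bt).
apply: le_trans hb _.
have -> : eta = I1 t0 (t0 + 1) (fun t => k ^+ 2 * (q (s, t) + eps)) by rewrite bqI.
rewrite [leRHS](@I1_cat _ t0 c (t0 + 1))//; last by rewrite tc ct.
rewrite lerDl; apply: I1_ge0 => t _.
by rewrite mulr_ge0 ?exprn_ge0 ?addr_ge0 ?q_ge0 ?(ltW k0) ?(ltW eps0).
Qed.

(** As long as the loop is in the ball of half radius, its variation is at most [eta], which is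
    smaller than that radius; [stay] closes the circle. *)
Lemma loop_stay t : t0 <= t <= t0 + 1 -> dom i (u (s, t)) /\ `|phi i (u (s, t)) - y0| <= eta.
Proof.
have U0 c : t0 <= c <= t0 + 1 -> dom i (u (s, c)) /\ `|phi i (u (s, c)) - y0| < kap^-1 / 2.
  apply: (@stay R M (fun t => u (s, t)) [set p | dom i p /\ `|phi i p - y0| < kap^-1 / 2]
     [set p | dom i p /\ `|phi i p - y0| <= kap^-1 / 2] t0 (t0 + 1)).
  - move=> t' _; apply: (@continuous_comp _ _ _ (fun t => (s, t)) u); last by have [cu _] := su; exact: cu.
    by apply: (@cvg_pair _ _ _ (nbhs t') (nbhs s) (nbhs t')); [exact: cvg_cst|exact: cvg_id].
  - exact: chart_ball_open.
  - apply: (chart_cball_closed Mh half) => y /(lp_sub lp)[p [dp _] <-]; exact: rng_phi.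
  - by move=> p [dp hp]; split => //; exact: ltW.
  - by rewrite lerDl.
  - by split => //; rewrite subrr normr0 divr_gt0// invr_gt0.
  - move=> c' cc Hc; have [dc _] := Hc c' ltac:(by case/andP: cc => -> _ /=).
    by split => //; apply: le_lt_trans (est cc Hc) _.
move=> tt; have [dt _] := U0 t tt; split => //; apply: est => // t' /andP[h1' h2'].
have [|dt' bt'] := U0 t'; last by split => //; exact: ltW.
by rewrite h1'; case/andP: tt => _; exact: le_trans.
Qed.

Let Bt t : t0 <= t <= t0 + 1 -> ball y0 kap^-1 (phi i (u (s, t))).
Proof. by move=> /loop_stay[_ bt]; apply: inball; exact: le_lt_trans bt eta1. Qed.
Let Nt t : t0 <= t <= t0 + 1 -> N° (u (s, t)).
Proof.
move=> tt; have [dt _] := loop_stay tt; have [p [dp Np] E] := lp_sub lp (Bt tt).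
by rewrite -(phiK dt) -E phiK.
Qed.
Let B0 : ball y0 kap^-1 y0. Proof. by apply: ballxx; rewrite invr_gt0. Qed.

(** In a coordinate with [|Xh_j| >= 1 / k] the constant drift [eps Xh_j t] is subtracted. The loop
    closes after one period, so exactly [- eps Xh_j] remains; the variation of [Xh] along the loop
    explains at most half of it, and the rest must come from [d_s u]. *)
Lemma loop_eps : eps <= 2 * k ^+ 3 * Iq s.
Proof.
have [j Hj] : exists j, k^-1 <= `|Xh i y0 0 j|.
  apply: contrapT => Hn; have := lp_Xlo lp B0; rewrite leNgt => /negP; apply.
  have [m0|m0] := posnP m.
    rewrite (_ : Xh i y0 = 0) ?normr0 ?invr_gt0//; apply/rowP => j.
    by exfalso; case: j => j; rewrite m0.
  rewrite [ltLHS]mx_normrE; apply/bigmax_ltP; split; first by rewrite invr_gt0.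
  move=> [a b] _ /=; rewrite ord1 ltNge; apply/negP => Hab; apply: Hn; by exists b.
have := @derive_bound R (fun t => (phi i \o u) (s, t) 0 j - eps * Xh i y0 0 j * t)
  (fun t => 'D_et (phi i \o u) (s, t) 0 j - eps * Xh i y0 0 j)
  (fun t => k ^+ 2 * q (s, t) + eps * (k * eta)) t0 (t0 + 1).
have cG : continuous (fun t => k ^+ 2 * q (s, t) + eps * (k * eta)).
  by move=> t; apply: cvgD; [apply: cvgM; [exact: cvg_cst|exact: qs]|exact: cvg_cst].
have HH t : t0 <= t <= t0 + 1 -> is_derive t 1 (fun t => (phi i \o u) (s, t) 0 j - eps * Xh i y0 0 j * t)
    ('D_et (phi i \o u) (s, t) 0 j - eps * Xh i y0 0 j) /\
    `|'D_et (phi i \o u) (s, t) 0 j - eps * Xh i y0 0 j| <= k ^+ 2 * q (s, t) + eps * (k * eta).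
  move=> tt; have [dt bt] := loop_stay tt; split.
    apply: der_sub; first exact: slice_entry.
    by have := der_scale (eps * Xh i y0 0 j) (is_derive_id t (1 : R)); rewrite mulr1.
  rewrite (et_E (Nt tt) dt).
  set yt := phi i _; set w := 'D_es _ _ *m _.
  have -> : (w + eps *: Xh i yt) 0 j - eps * Xh i y0 0 j = w 0 j + eps * ((Xh i yt - Xh i y0) 0 j).
    by rewrite !mxE; move: (w 0 j) (Xh i yt 0 j) (Xh i y0 0 j) => a b c'; ring.
  apply: le_trans (ler_normD _ _) _; apply: lerD.
    apply: le_trans (rV_norm_entry _ _) _; apply: le_trans (lp_J lp _ (Bt tt)) _.
    rewrite expr2 -mulrA ler_pM2l//; exact: es_le lp dt (Bt tt).
  rewrite normrM gtr0_norm// ler_pM2l//; apply: le_trans (rV_norm_entry _ _) _.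
  by apply: le_trans (lp_XL lp (Bt tt) B0) _; rewrite ler_pM2l.
move=> /(_ ltac:(by rewrite lerDl) cG HH).
have -> : (phi i \o u) (s, t0 + 1) 0 j - eps * Xh i y0 0 j * (t0 + 1) -
   ((phi i \o u) (s, t0) 0 j - eps * Xh i y0 0 j * t0) = - (eps * Xh i y0 0 j).
  by rewrite /= per; ring.
have -> : I1 t0 (t0 + 1) (fun t => k ^+ 2 * q (s, t) + eps * (k * eta)) = k ^+ 2 * Iq s + eps * (k * eta).
  rewrite I1D; [|by move=> t; apply: cvgM; [exact: cvg_cst|exact: qs]|by move=> t; exact: cvg_cst].
  by rewrite I1Z// Iq_shift I1_cst ?lerDl//; congr (_ + _); ring.
rewrite normrN normrM gtr0_norm// => h2.
have h3 : eps * k^-1 <= k ^+ 2 * Iq s + eps * (2 * k)^-1.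
  apply: le_trans (_ : eps * `|Xh i y0 0 j| <= _); first by rewrite ler_pM2l.
  by apply: le_trans h2 _; rewrite lerD2l ler_pM2l.
have h4 : eps * (2 * k)^-1 <= k ^+ 2 * Iq s.
  have E : eps * k^-1 = eps * (2 * k)^-1 + eps * (2 * k)^-1 by field; exact: lt0r_neq0.
  by rewrite E in h3; rewrite lerD2r in h3.
rewrite -[leLHS](_ : eps * (2 * k)^-1 * (2 * k) = _); last by field; exact: lt0r_neq0.
rewrite [leRHS](_ : _ = k ^+ 2 * Iq s * (2 * k)); last by ring.
by rewrite ler_pM2r// mulr_gt0.
Qed.

(** The 1-form [- d (cut) o J] at the point with coordinates [y], evaluated on [v]. *)
Let al (y v : 'rV[R]_m) : R := - (dsg (h (psi i y)) * (v *m J i y *m (grd (h \o psi i) y)^T) 0 0).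

(** The term with 48 comes from the Lipschitz constant of [dsg]; the remaining 6 comes from
    [dsg <= 3] and the variation of [J] and of the gradient. *)
Let al_lip y v : ball y0 kap^-1 y -> `|al y v - al y0 v| <= 54 * k ^+ 3 * `|y - y0| * `|v|.
Proof.
move=> By; pose a y v : R := ((v : 'rV[R]_m) *m J i y *m (grd (h \o psi i) y)^T) 0 0.
have k1' : k <= k ^+ 3 by rewrite exprS ler_peMr ?(ltW k0)// exprn_ege1.
have k2' : k ^+ 2 <= k ^+ 3 by rewrite [leRHS]exprS ler_peMl ?exprn_ge0 ?(ltW k0).
have a1 : `|a y v| <= k ^+ 2 * `|v|.
  apply: le_trans (lp_grd lp _ By) _; rewrite [leRHS](_ : _ = k * (k * `|v|)); last by ring.
  by rewrite ler_pM2l//; exact: (lp_J lp v By).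
have hl : `|h (psi i y) - h (psi i y0)| <= k * `|y - y0|.
  apply: (@ball_lipschitz R _ (h \o psi i) y0 kap^-1 k) => // z w Bz.
  have [p [dp Np] E] := lp_sub lp Bz.
  have dz : differentiable (h \o psi i) z by rewrite -E; exact: sfun_dif sN Np dp.
  split; first exact: diff_derivable.
  by rewrite (D_grd _ dz); exact: (lp_grd lp w Bz).
have a2 : `|a y v - a y0 v| <= 2 * k ^+ 2 * `|y - y0| * `|v|.
  have -> : a y v - a y0 v = ((v *m (J i y - J i y0)) *m (grd (h \o psi i) y)^T) 0 0 +
     ((v *m J i y0) *m (grd (h \o psi i) y - grd (h \o psi i) y0)^T) 0 0.
    have trB (w1 w2 : 'rV[R]_m) : (w1 - w2)^T = w1^T - w2^T by apply/matrixP => ? ?; rewrite !mxE.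
    rewrite /a mulmxBr mulmxBl trB mulmxBr.
    move: (v *m J i y *m _) (v *m J i y0 *m _) (v *m J i y0 *m _) => b1 b2 b3.
    by rewrite !mxE; ring.
  apply: le_trans (ler_normD _ _) _.
  have e1 : `|((v *m (J i y - J i y0)) *m (grd (h \o psi i) y)^T) 0 0| <= k * (k * `|y - y0| * `|v|).
    by apply: le_trans (lp_grd lp _ By) _; rewrite ler_pM2l//; exact: (lp_JL lp v By B0).
  have e2 : `|((v *m J i y0) *m (grd (h \o psi i) y - grd (h \o psi i) y0)^T) 0 0| <= k * `|y - y0| * (k * `|v|).
    by apply: le_trans (lp_grdL lp _ By B0) _; rewrite ler_wpM2l ?mulr_ge0 ?(ltW k0)//; exact: (lp_J lp v B0).
  by apply: le_trans (lerD e1 e2) _; rewrite le_eqVlt; apply/orP; left; apply/eqP; ring.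
have -> : al y v - al y0 v = - ((dsg (h (psi i y)) - dsg (h (psi i y0))) * a y v + dsg (h (psi i y0)) * (a y v - a y0 v)).
  by rewrite /al /a; ring.
rewrite normrN; apply: le_trans (ler_normD _ _) _; rewrite !normrM.
have b1 : `|dsg (h (psi i y)) - dsg (h (psi i y0))| <= 48 * (k * `|y - y0|).
  by apply: le_trans (dsg_lip _ _) _; rewrite ler_pM2l.
have b2 : `|dsg (h (psi i y0))| <= 3 by rewrite ger0_norm ?dsg_ge0 ?dsg_le3.
apply: le_trans (lerD (ler_pM _ _ b1 a1) (ler_pM _ _ b2 a2)) _ => //.
have -> : 48 * (k * `|y - y0|) * (k ^+ 2 * `|v|) = 48 * k ^+ 3 * (`|y - y0| * `|v|) by ring.
have -> : 3 * (2 * k ^+ 2 * `|y - y0| * `|v|) = 6 * k ^+ 2 * (`|y - y0| * `|v|) by ring.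
rewrite -mulrDl -[leRHS]mulrA ler_wpM2r ?mulr_ge0//.
by move: (k ^+ 2) (k ^+ 3) k2' => a' b'; lra.
Qed.

(** Frozen at [y0], the 1-form is constant in the chart and hence exact, so its integral over the
    closed loop vanishes. The error is the Lipschitz constant times [eta] for the distance and once
    more [eta] for the length. *)
Lemma loop_cut : I1 0 1 (fun t => 'D_es (cut \o u) (s, t)) <= 54 * k ^+ 3 * eta ^+ 2.
Proof.
have eta_ge0 : 0 <= eta by rewrite mulr_ge0 ?exprn_ge0 ?addr_ge0 ?Iq_ge0 ?(ltW k0) ?(ltW eps0).
have cs : continuous (fun t => 'D_es (cut \o u) (s, t)).
  by apply: (@slice1_continuous _ ('D_es (cut \o u))); exact: C1_cont_s cut_C1.
have pers t : 'D_es (cut \o u) (s, t + 1) = 'D_es (cut \o u) (s, t).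
  have d1 := C1_dif cut_C1 (s, t); have d2 := C1_dif cut_C1 (s, t + 1).
  have e1 := slice_s d1; have e2 := slice_s d2.
  have E : (fun s => (cut \o u) (s, t + 1)) = (fun s => (cut \o u) (s, t)).
    by apply/funext => s'; rewrite /= per.
  by rewrite E in e2; rewrite -(derive_val (is_derive := e1)) -(derive_val (is_derive := e2)).
rewrite -(I1_periodic t0 cs pers).
pose g0 (t : R) : R := al y0 ((phi i \o u) (s, t)).
pose w : 'rV[R]_m := - dsg (h (psi i y0)) *: (grd (h \o psi i) y0 *m (J i y0)^T).
have alE v : al y0 v = \sum_j w 0 j * v 0 j.
  rewrite /al -mulNr /w -mulmxA.
  have -> : J i y0 *m (grd (h \o psi i) y0)^T = (grd (h \o psi i) y0 *m (J i y0)^T)^T.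
    by rewrite trmx_mul trmxK.
  rewrite row_dot mulr_sumr; apply: eq_bigr => j _.
  by rewrite [in RHS]mxE; ring.
have dg0 t : t0 <= t <= t0 + 1 -> is_derive t 1 g0 (al y0 ('D_et (phi i \o u) (s, t))).
  move=> tt; have [dt _] := loop_stay tt.
  have -> : g0 = (fun t => \sum_j w 0 j * (phi i \o u) (s, t) 0 j).
    by apply/funext => x; rewrite /g0 alE.
  rewrite alE.
  have := @is_derive_sum R _ _ m (fun j t => w 0 j * (phi i \o u) (s, t) 0 j) t 1 _
    (fun j => der_scale (w 0 j) (slice_entry j dt)).
  rewrite (_ : (\sum_(j < m) (fun t => w 0 j * (phi i \o u) (s, t) 0 j)) =
     (fun t => \sum_j w 0 j * (phi i \o u) (s, t) 0 j))//.
  by apply/funext => x; rewrite fct_sumE.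
have cG : continuous (fun t => 54 * k ^+ 3 * eta * (k ^+ 2 * (q (s, t) + eps))).
  by move=> t; apply: cvgM; [exact: cvg_cst|exact: bq].
have := @I1_le_primitive R (fun t => 'D_es (cut \o u) (s, t))
  (fun t => 54 * k ^+ 3 * eta * (k ^+ 2 * (q (s, t) + eps))) g0
  (fun t => al y0 ('D_et (phi i \o u) (s, t))) t0 (t0 + 1) ltac:(by rewrite lerDl) cs cG.
have HH t : t0 <= t <= t0 + 1 -> is_derive t 1 g0 (al y0 ('D_et (phi i \o u) (s, t))) /\
  'D_es (cut \o u) (s, t) <= al y0 ('D_et (phi i \o u) (s, t)) + 54 * k ^+ 3 * eta * (k ^+ 2 * (q (s, t) + eps)).
  move=> tt; split; first exact: dg0.
  have [dt bt] := loop_stay tt; have Bz := Bt tt; have Nz := Nt tt.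
  set yt := phi i (u (s, t)) in bt Bz; set v := 'D_et (phi i \o u) (s, t).
  have c := compat_at sy ac co (rng_phi dt).
  (* By the Floer equation [d_s u = - (d_t u - eps X) J], and [X J] is minus the gradient of [h];
     what is dropped here is the term [- eps |grad h|^2] times [dsg >= 0]. *)
  have h1' : 'D_es (cut \o u) (s, t) <= al yt v.
    rewrite (cutD _ Nz dt) /al /yt phiK// -mulrN ler_wpM2l ?dsg_ge0//.
    have := floer_chart Nz dt; rewrite -/v -/yt => /eqP; rewrite addr_eq0 => /eqP ->.
    rewrite mulmxBl -scalemxAl /Xh (hamX_J c) scalerN opprK opprD.
    set G := grd _ _.
    have pG : 0 <= (G *m invmx (g i yt) *m G^T) 0 0.
      have [G0|G0] := eqVneq G 0; first by rewrite G0 !mul0mx mxE.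
      by apply: ltW; exact: (compat_posP c G0).
    rewrite mulmxDl !mulNmx -scalemxAl.
    move: (v *m J i yt *m G^T) (G *m invmx (g i yt) *m G^T) pG => b1 b2 pG.
    by rewrite !mxE gerDl oppr_le0 mulr_ge0// ltW.
  have h2' := al_lip v Bz; have h3' : `|v| <= k ^+ 2 * (q (s, t) + eps) by exact: et_le (ltW eps0) lp dt Bz.
  have h4' : 54 * k ^+ 3 * `|yt - y0| * `|v| <= 54 * k ^+ 3 * eta * (k ^+ 2 * (q (s, t) + eps)).
    apply: ler_pM => //; first by rewrite !mulr_ge0 ?exprn_ge0 ?(ltW k0).
    by rewrite ler_wpM2l// mulr_ge0 ?exprn_ge0 ?(ltW k0).
  have := le_trans h2' h4'; rewrite ler_norml => /andP[_ h5'].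
  by apply: le_trans h1' _; rewrite -lerBlDl.
move=> /(_ HH); rewrite I1Z; last exact: bq.
rewrite bqI -/eta.
have -> : g0 (t0 + 1) = g0 t0 by rewrite /g0 /= per.
by rewrite subrr add0r -mulrA -expr2.
Qed.

End Loop.

(** If [Iq s] and [eps] are below [dl1], then the loop bound [k ^+ 2 * (Iq s + eps)] is below [dl0].
    The two entries of the minimum are what [loop_stay] and [loop_eps] require. *)
Definition dl0 : R := Num.min (kap^-1 / 4) (2 * k ^+ 2)^-1.
Definition dl1 : R := dl0 / (2 * k ^+ 2).
(** The first summand serves slices with [Iq s >= dl1], where a linear bound is already quadratic.
    The second serves small slices, where [loop_eps] turns the loop bound into a multiple of
    [Iq s]. *)
Definition C1B : R := 3 * k ^+ 3 / dl1 + 54 * k ^+ 3 * (k ^+ 2 * (1 + 2 * k ^+ 3)) ^+ 2.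

Lemma dl1_gt0 : 0 < dl1.
Proof. by rewrite divr_gt0 ?mulr_gt0 ?exprn_gt0// lt_min divr_gt0 ?invr_gt0 ?mulr_gt0 ?exprn_gt0. Qed.

Let c3_ge0 : 0 <= 3 * k ^+ 3 / dl1.
Proof.
apply: divr_ge0; last exact: ltW dl1_gt0.
by apply: mulr_ge0 => //; apply: exprn_ge0; exact: ltW.
Qed.

Lemma C1B_ge0 : 0 <= C1B.
Proof.
apply: addr_ge0 => //; apply: mulr_ge0; last exact: sqr_ge0.
by apply: mulr_ge0 => //; apply: exprn_ge0; exact: ltW.
Qed.

Hypothesis epsd : eps < dl1.

Lemma cut_slice s : I1 0 1 (fun t => 'D_es (cut \o u) (s, t)) <= C1B * I1 0 1 (fun t => e (s, t)).
Proof.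
have cs : continuous (fun t => 'D_es (cut \o u) (s, t)).
  by apply: (@slice1_continuous _ ('D_es (cut \o u))); exact: C1_cont_s cut_C1.
have ce : continuous (fun t => e (s, t)) by apply: slice1_continuous; exact: energy_density_cont.
have e0 t : 0 <= e (s, t) by exact: energy_density_ge0.
have Ie0 : 0 <= I1 0 1 (fun t => e (s, t)) by apply: I1_ge0 => t _.
have sq : (Iq s) ^+ 2 <= I1 0 1 (fun t => e (s, t)).
  by have := @I1_sqrt R 0 (fun t => e (s, t)) ce e0; rewrite add0r.
have I0 := Iq_ge0 s; have d1 := dl1_gt0.
have k3 : 0 < k ^+ 3 by rewrite exprn_gt0.
have [small|big] := ltP (Iq s) dl1; last first.
  apply: (@le_trans _ _ (3 * k ^+ 3 * Iq s)).
    rewrite -I1Z//; apply: I1_le => //.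
      by move=> t; apply: cvgM; [exact: cvg_cst|exact: qs].
    by move=> t _; apply: le_trans (ler_norm _) _; exact: cut_es.
  apply: (@le_trans _ _ (3 * k ^+ 3 / dl1 * (Iq s) ^+ 2)).
    have -> : 3 * k ^+ 3 / dl1 * Iq s ^+ 2 = 3 * k ^+ 3 * (Iq s * (Iq s / dl1)) by ring.
    by rewrite ler_pM2l ?mulr_gt0// ler_peMr// ler_pdivlMr// mul1r.
  apply: (@le_trans _ _ (3 * k ^+ 3 / dl1 * I1 0 1 (fun t => e (s, t)))).
    by rewrite ler_wpM2l.
  rewrite ler_wpM2r// lerDl; apply: mulr_ge0; last exact: sqr_ge0.
  by apply: mulr_ge0 => //; exact: ltW.
(* A slice that misses [core] contributes nothing; otherwise the loop is based at a point of [core],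
   where a controlled chart is available. *)
have [[t0 ct0]|none] := pselect (exists t0, core N h (u (s, t0))); last first.
  rewrite (@I1_ext _ 0 1 _ (fun=> 0)); last by move=> t _; apply: cutD0 => ct; apply: none; exists t.
  by rewrite I1_cst// mul0r mulr_ge0 ?C1B_ge0.
have [i [di lp]] := core_pack ct0.
have k2 : 0 < k ^+ 2 by rewrite exprn_gt0.
have etab : k ^+ 2 * (Iq s + eps) < dl0.
  have -> : dl0 = k ^+ 2 * (dl1 + dl1) by rewrite /dl1; field; exact: lt0r_neq0.
  by rewrite ltr_pM2l// ltrD.
have eta1 : k ^+ 2 * (Iq s + eps) < kap^-1 / 2.
  apply: lt_le_trans etab _; rewrite /dl0 ge_min; apply/orP; left.
  by rewrite ler_pM2l ?invr_gt0// lef_pV2 ?posrE// ler_nat.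
have eta2 : k * (k ^+ 2 * (Iq s + eps)) <= (2 * k)^-1.
  apply: (@le_trans _ _ (k * (2 * k ^+ 2)^-1)).
    by rewrite ler_pM2l// (le_trans (ltW etab))// ge_min lexx orbT.
  by rewrite le_eqVlt; apply/orP; left; apply/eqP; field; exact: lt0r_neq0.
apply: (le_trans (loop_cut di lp eta1)).
have heps := loop_eps di lp eta1 eta2.
have h2 : (k ^+ 2 * (Iq s + eps)) ^+ 2 <= (k ^+ 2 * (1 + 2 * k ^+ 3)) ^+ 2 * I1 0 1 (fun t => e (s, t)).
  apply: (@le_trans _ _ ((k ^+ 2 * (1 + 2 * k ^+ 3) * Iq s) ^+ 2)).
    have p1 : 0 <= k ^+ 2 * (Iq s + eps) by apply: mulr_ge0; [exact: ltW|apply: addr_ge0 => //; exact: ltW].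
    have p2 : 0 <= k ^+ 2 * (1 + 2 * k ^+ 3) * Iq s.
      by apply: mulr_ge0 => //; apply: mulr_ge0; [exact: ltW|apply: addr_ge0 => //; apply: mulr_ge0 => //; exact: ltW].
    rewrite ler_sqr ?nnegrE//.
    by rewrite -mulrA ler_pM2l// mulrDl mul1r lerD2l.
  by rewrite exprMn ler_wpM2l// sqr_ge0.
apply: (@le_trans _ _ (54 * k ^+ 3 * (k ^+ 2 * (1 + 2 * k ^+ 3)) ^+ 2 * I1 0 1 (fun t => e (s, t)))).
  by rewrite -[leRHS]mulrA ler_wpM2l// mulr_ge0// ltW.
by rewrite ler_wpM2r// lerDr.
Qed.

Definition bav (s : R) : R := I1 0 1 (fun t => cut (u (s, t))).

Lemma bav_le s1 s2 (E : R) : s1 <= s2 -> (energy omega J u <= E%:E)%E -> bav s2 - bav s1 <= C1B * E.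
Proof.
move=> s12 HE.
have cs : continuous ('D_es (cut \o u)) := C1_cont_s cut_C1.
have ce : continuous e by exact: energy_density_cont.
have -> : bav s2 - bav s1 = I1 s1 s2 (fun s => I1 0 1 (fun t => 'D_es (cut \o u) (s, t))).
  apply: (etrans _ (esym (@I1_swap R s1 s2 0 1 ('D_es (cut \o u)) cs))).
  have cc s : continuous (fun t => (cut \o u) (s, t)).
    by apply: slice1_continuous => z; apply: differentiable_continuous; exact: C1_dif cut_C1 z.
  rewrite /bav -(I1B 0 1 (cc s2) (cc s1)); apply: I1_ext => t _.
  by rewrite (I1_ds t cut_C1 s12).
apply: (@le_trans _ _ (I1 s1 s2 (fun s => C1B * I1 0 1 (fun t => e (s, t))))).
  have c1 := @I1_continuous R 0 1 _ cs.
  have c2 : continuous (fun s => C1B * I1 0 1 (fun t => e (s, t))).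
    by move=> s; apply: cvgM; [exact: cvg_cst|exact: (I1_continuous ce)].
  by apply: (I1_le c1 c2) => s _; exact: cut_slice.
rewrite I1Z; last exact: I1_continuous.
rewrite ler_wpM2l ?C1B_ge0//.
have := le_trans (@I1_prod_le R s1 s2 e ce (energy_density_ge0 sy ac co su)) HE.
by rewrite lee_fin.
Qed.

Let ce : continuous e. Proof. exact: energy_density_cont. Qed.
Let e0 z : 0 <= e z. Proof. exact: energy_density_ge0. Qed.
Let eI (s : R) : R := I1 0 1 (fun t => e (s, t)).
Let ceI : continuous eI. Proof. exact: I1_continuous. Qed.

Lemma cut_core p : 4^-1 <= cut p <= 3 / 4 -> core N h p.
Proof.
move=> /andP[p1 p2]; have [Np|nN] := pselect (N p); last first.
  by move: p1 p2; rewrite /cut memNset//; case: ifP => _; lra.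
move: p1 p2; rewrite cutN// => p1 p2; split => //=; apply/andP; split.
  by rewrite leNgt; apply/negP => lt; move: p1; rewrite sg_lo ?(ltW lt)//; lra.
by rewrite leNgt; apply/negP => lt; move: p2; rewrite sg_hi ?(ltW lt)//; lra.
Qed.

Lemma slice_osc s t0 t : t0 - 1 <= t <= t0 + 1 ->
  `|cut (u (s, t)) - cut (u (s, t0))| <= 3 * k ^+ 3 * Num.sqrt (eI s).
Proof.
move=> /andP[ta tb].
have c3 : 0 < 3 * k ^+ 3 by rewrite mulr_gt0// exprn_gt0.
have cb : continuous (fun t => 3 * k ^+ 3 * q (s, t)).
  by move=> x; apply: cvgM; [exact: cvg_cst|exact: qs].
have per1 a : I1 a (a + 1) (fun t => 3 * k ^+ 3 * q (s, t)) = 3 * k ^+ 3 * Iq s.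
  by rewrite I1Z ?Iq_shift//; exact: qs.
have fin : 3 * k ^+ 3 * Iq s <= 3 * k ^+ 3 * Num.sqrt (eI s).
  rewrite ler_pM2l// -[leLHS]ger0_norm; last by apply: I1_ge0 => x _; exact: sqrtr_ge0.
  rewrite -sqrtr_sqr ler_wsqrtr//.
  have := @I1_sqrt R 0 (fun t => e (s, t)) (@slice1_continuous R e s ce) (fun t => e0 (s, t)).
  by rewrite add0r.
have db a b : a <= b -> `|(cut \o u) (s, b) - (cut \o u) (s, a)| <= I1 a b (fun t => 3 * k ^+ 3 * q (s, t)).
  move=> ab; have HD x : a <= x <= b -> is_derive x 1 (fun t => (cut \o u) (s, t)) ('D_et (cut \o u) (s, x)) /\
      `|'D_et (cut \o u) (s, x)| <= 3 * k ^+ 3 * q (s, x).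
    by move=> _; split; [exact: (slice_t (C1_dif cut_C1 (s, x)))|exact: cut_et].
  exact: (derive_bound ab cb HD).
have pos_ a b : 0 <= I1 a b (fun t => 3 * k ^+ 3 * q (s, t)).
  by apply: I1_ge0 => x _; rewrite mulr_ge0 ?(ltW c3)// sqrtr_ge0.
apply: le_trans fin; have [le|/ltW le] := leP t0 t.
  apply: le_trans (db _ _ le) _; rewrite -(per1 t0) [leRHS](@I1_cat _ t0 t (t0 + 1))//; last by rewrite le tb.
  by rewrite lerDl.
rewrite distrC; apply: le_trans (db _ _ le) _; rewrite -(per1 (t0 - 1)) subrK.
rewrite [leRHS](@I1_cat _ (t0 - 1) t t0)//; last by rewrite ta le.
by rewrite lerDr.
Qed.

Lemma energy_I1 s1 s2 E : (energy omega J u <= E%:E)%E -> I1 s1 s2 eI <= E.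
Proof.
move=> HE; have := le_trans (@I1_prod_le R s1 s2 e ce e0) HE.
by rewrite lee_fin.
Qed.

(** Markov's inequality in the variable [s] on a stretch of length [l]. *)
Lemma good_slice a l c E : 0 < l -> (energy omega J u <= E%:E)%E -> E < c * l ->
  exists2 s, a <= s <= a + l & eI s < c.
Proof.
move=> l0 HE Ec; apply: contrapT => Hn.
have : I1 a (a + l) (fun=> c) <= I1 a (a + l) eI.
  apply: I1_le => [x||s sa]; [exact: cvg_cst|exact: ceI|].
  by rewrite leNgt; apply/negP => lt; apply: Hn; exists s.
rewrite I1_cst ?lerDl ?(ltW l0)// addrAC subrr add0r => h2.
have := le_trans h2 (energy_I1 a (a + l) HE); lra.
Qed.

Definition rT : R := Num.min (kap^-1 / (4 * k)) (96 * k ^+ 4)^-1.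
(** Chosen so that the oscillation bound [3 k^3 sqrt cT] of [slice_osc] equals 1/16. *)
Definition cT : R := (48 * k ^+ 3) ^- 2.
(** The rectangle used in [no_cross] has width at most [4 lT] in [s]; with this value its graph
    coordinates account for at most half of [rT ^+ 2]. *)
Definition lT : R := (16 * 320)^-1.
(** Below the first entry two quiet slices can be found on both sides of the crossing; below the
    second the energy cannot supply the other half of [rT ^+ 2]. *)
Definition C2T : R := Num.min (cT * lT) (rT ^+ 2 / (1280 * k ^+ 4)).

Lemma rT_gt0 : 0 < rT.
Proof. by rewrite lt_min divr_gt0 ?invr_gt0 ?mulr_gt0 ?exprn_gt0. Qed.
Lemma lT_gt0 : 0 < lT.
Proof. by rewrite invr_gt0 mulr_gt0 ?ltr0n. Qed.
Lemma C2T_gt0 : 0 < C2T.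
Proof.
have k30 : 0 < 48 * k ^+ 3 by rewrite mulr_gt0 ?ltr0n ?exprn_gt0.
have k40 : 0 < 1280 * k ^+ 4 by rewrite mulr_gt0 ?ltr0n ?exprn_gt0.
rewrite lt_min; apply/andP; split; first by apply: mulr_gt0 lT_gt0; rewrite invr_gt0 exprn_gt0.
by apply: divr_gt0 => //; apply: exprn_gt0; exact: rT_gt0.
Qed.

Lemma sg_lip (x y : R) : `|sg x - sg y| <= 3 * `|x - y|.
Proof.
wlog xy : x y / x <= y.
  by move=> W; have [/W//|/ltW/W] := leP x y; rewrite distrC [`|y - x|]distrC.
have [|c cxy E] := @MVT_all R sg dsg x y xy; first by move=> z _; exact: sg_derive.
rewrite distrC [`|x - y|]distrC E normrM (ger0_norm (dsg_ge0 _)) ler_wpM2r//; exact: dsg_le3.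
Qed.

Lemma pack_lip i y0 y : lpack i y0 -> ball y0 kap^-1 y ->
  `|cut (psi i y) - cut (psi i y0)| <= 3 * k * `|y - y0|.
Proof.
move=> lp By; have B0 : ball y0 kap^-1 y0 by apply: ballxx; rewrite invr_gt0.
have Nn z : ball y0 kap^-1 z -> N (psi i z).
  by move=> Bz; have [p [dp Np] <-] := lp_sub lp Bz; rewrite phiK//; exact: interior_subset.
rewrite !cutN; [|exact: Nn|exact: Nn].
apply: le_trans (sg_lip _ _) _; rewrite -mulrA ler_pM2l//.
apply: (@ball_lipschitz R _ (h \o psi i) y0 kap^-1 k) => // z w Bz.
have [p [dp Np] E] := lp_sub lp Bz.
have dz : differentiable (h \o psi i) z by rewrite -E; exact: sfun_dif sN Np dp.
split; first exact: diff_derivable.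
by rewrite (D_grd _ dz); exact: (lp_grd lp w Bz).
Qed.

(** Among the levels 1/4, 1/2 and 3/4 each of the two values is closer than 1/8 to at most one, so
    one level remains. *)
Lemma choose_level (v1 v2 : R) : exists c : R, [/\ 4^-1 <= c <= 3 / 4, 8^-1 <= `|v1 - c| & 8^-1 <= `|v2 - c|].
Proof.
have d1 c c' v : 4^-1 <= c' - c -> `|v - c| < 8^-1 -> 8^-1 <= `|v - c'| :> R.
  by move=> cc; rewrite ltr_norml => /andP[a b]; rewrite ler0_norm; lra.
have d2 c c' v : 4^-1 <= c' - c -> `|v - c'| < 8^-1 -> 8^-1 <= `|v - c| :> R.
  by move=> cc; rewrite ltr_norml => /andP[a b]; rewrite ger0_norm; lra.
have [a1|a1] := leP 8^-1 `|v1 - 4^-1|; have [a2|a2] := leP 8^-1 `|v2 - 4^-1|.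
- by exists 4^-1; split => //; lra.
- have [b1|b1] := leP 8^-1 `|v1 - 2^-1|.
    by exists 2^-1; split => //; [lra|apply: d1 a2; lra].
  by exists (3 / 4); split; [lra|apply: d1 b1; lra|apply: d1 a2; lra].
- have [b1|b1] := leP 8^-1 `|v2 - 2^-1|.
    by exists 2^-1; split => //; [lra|apply: d1 a1; lra].
  by exists (3 / 4); split; [lra|apply: d1 a1; lra|apply: d1 b1; lra].
- by exists 2^-1; split; [lra|apply: d1 a1; lra|apply: d1 a2; lra].
Qed.

Hypothesis epsr : eps <= rT.

Lemma per_int s t (n : int) : u (s, t + n%:~R) = u (s, t).
Proof.
have pn (j : nat) x : u (s, x + j%:R) = u (s, x).
  by elim: j => [|j IH]; rewrite ?addr0// -natr1 addrA per.
case: n => j; first exact: pn.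
rewrite NegzE mulrNz -[in RHS](subrK (j.+1%:R) t) pn; congr (u (s, _ - _)).
Qed.

Lemma per_unit s t : exists2 t' : R, 0 <= t' <= 1 & u (s, t') = u (s, t).
Proof.
exists (t - (Num.floor t)%:~R); last by rewrite -mulrNz per_int.
have := real_floor_itv (num_real t); rewrite intrD => /andP[a b].
by rewrite subr_ge0 a /= lerBlDl ltW.
Qed.

(** The slice [s0] attains every level between 1/4 and 3/4, in particular one that is far from the
    values of [cut] on two quiet slices around it. [local_energy] is applied at a point of that
    level; its crossing ball is not reached by the quiet slices. *)
Lemma no_cross E s0 t1 t2 : (energy omega J u <= E%:E)%E -> E < C2T ->
  cut (u (s0, t1)) <= 4^-1 -> 3 / 4 <= cut (u (s0, t2)) -> False.
Proof.
move=> HE EC; have [t1' u1 <-] := per_unit s0 t1; have [t2' u2 <-] := per_unit s0 t2.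
move: t1' t2' u1 u2 => {}t1 {}t2 /andP[t10 t11] /andP[t20 t21] lo hi.
have r0 := rT_gt0; have k3 : 0 < k ^+ 3 by rewrite exprn_gt0.
have k4 : 0 < k ^+ 4 by rewrite exprn_gt0.
have l0 := lT_gt0; have lE : 640 * (4 * lT) = 2^-1 by rewrite /lT; field.
have EcT : E < cT * lT by apply: lt_le_trans EC _; rewrite ge_min lexx.
have [s1 /andP[s1a s1b] c1] := @good_slice (s0 - 2 * lT) lT cT E l0 HE EcT.
have [s2 /andP[s2a s2b] c2] := @good_slice (s0 + lT) lT cT E l0 HE EcT.
have osc1 s t t' : eI s < cT -> t' - 1 <= t <= t' + 1 -> `|cut (u (s, t)) - cut (u (s, t'))| <= 16^-1.
  move=> cs tt; apply: le_trans (slice_osc s tt) _.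
  have c48 : 0 <= (48 * k ^+ 3)^-1 by rewrite invr_ge0 mulr_ge0// ltW.
  have sq : Num.sqrt (eI s) <= (48 * k ^+ 3)^-1.
    rewrite -[leRHS](ger0_norm c48) -sqrtr_sqr ler_wsqrtr// exprVn; exact: ltW.
  apply: (@le_trans _ _ (3 * k ^+ 3 * (48 * k ^+ 3)^-1)).
    by rewrite ler_pM2l// mulr_gt0.
  by rewrite le_eqVlt; apply/orP; left; apply/eqP; field; exact: lt0r_neq0.
have osc s t : eI s < cT -> -1 <= t <= 2 -> `|cut (u (s, t)) - cut (u (s, 0))| <= 16^-1.
  move=> cs /andP[ta tb]; have [le|lt] := leP t 1; first by apply: osc1 => //; lra.
  have -> : u (s, 0) = u (s, 1) by rewrite -[in RHS](add0r 1) per.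
  by apply: osc1 => //; lra.
have cphi s : continuous (fun t => cut (u (s, t))).
  have cc : continuous (cut \o u) by move=> z; apply: differentiable_continuous; exact: C1_dif cut_C1 z.
  exact: (@slice1_continuous R (cut \o u) s cc).
have [c [cc b1 b2]] := choose_level (cut (u (s1, 0))) (cut (u (s2, 0))).
have [t0 t01 ct0] : exists2 t0 : R, 0 <= t0 <= 1 & cut (u (s0, t0)) = c.
  have [c14 c34] := andP cc.
  have [le|/ltW le] := leP t1 t2.
    have [t0 t0i E0] := @IVT R (fun t => cut (u (s0, t))) t1 t2 c le
      (continuous_subspaceT (cphi s0)) ltac:(by rewrite ge_min le_max (le_trans lo c14) (le_trans c34 hi) orbT).
    by exists t0 => //; move: t0i; rewrite in_itv /= => /andP[x1 x2]; rewrite (le_trans t10 x1) (le_trans x2 t21).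
  have [t0 t0i E0] := @IVT R (fun t => cut (u (s0, t))) t2 t1 c le
    (continuous_subspaceT (cphi s0)) ltac:(by rewrite ge_min le_max (le_trans lo c14) (le_trans c34 hi) orbT).
  by exists t0 => //; move: t0i; rewrite in_itv /= => /andP[x1 x2]; rewrite (le_trans t20 x1) (le_trans x2 t11).
have cp : core N h (u (s0, t0)) by apply: cut_core; rewrite ct0.
have [i [di lp]] := core_pack cp.
set y0 := phi i (u (s0, t0)) in lp.
pose rho : R := kap^-1.
pose O0 : set P := u @^-1` [set p | dom i p /\ `|phi i p - y0| < rho].
have B z : O0 z -> ball y0 kap^-1 (phi i (u z)).
  by move=> [dz bz]; rewrite -ball_normE /= distrC.
have bE (y : 'rV[R]_m) : `|y - y0| < rho -> ball y0 kap^-1 y by rewrite -ball_normE /= distrC.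
have B0 : ball y0 kap^-1 y0 by apply: ballxx; rewrite invr_gt0.
have NO z : O0 z -> N° (u z).
  move=> Oz; have [dz _] := Oz; have [p [dp Np] Ep] := lp_sub lp (B z Oz).
  by rewrite -(phiK dz) -Ep phiK.
have rng_b (y : 'rV[R]_m) : ball y0 kap^-1 y -> rng i y.
  by move=> By; have [p [dp Np] <-] := lp_sub lp By; exact: rng_phi.
have c0 := compat_at sy ac co (rng_b _ B0).
(* On a quiet slice [cut] differs from [c] by at least [1/8 - 1/16]; since [cut] is [3 k]-Lipschitz
   in the chart, the point is far from [y0]. *)
have far s t : eI s < cT -> 8^-1 <= `|cut (u (s, 0)) - c| -> O0 (s, t) ->
    t0 - 1 <= t <= t0 + 1 -> 2 * k * rT <= `|(phi i \o u) (s, t) - y0|.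
  move=> cs bs Oz /andP[ta tb]; have [dz _] := Oz.
  have o1 : `|cut (u (s, t)) - cut (u (s, 0))| <= 16^-1 by apply: osc cs (unit_window t01 _); rewrite ta tb.
  have := pack_lip lp (B _ Oz); rewrite /y0 !phiK// ct0 -/y0 => pl.
  have : 16^-1 <= 3 * k * `|phi i (u (s, t)) - y0|.
    apply: le_trans pl.
    have : `|cut (u (s, 0)) - c| <= `|cut (u (s, t)) - cut (u (s, 0))| + `|cut (u (s, t)) - c|.
      rewrite -[X in `|X| <= _](_ : - (cut (u (s, t)) - cut (u (s, 0))) + (cut (u (s, t)) - c) = _); last by ring.
      by apply: le_trans (ler_normD _ _) _; rewrite normrN.
    by move=> cX; exact: (oscillation_left cX o1 bs).
  move=> h16; rewrite -(@ler_pM2l _ (3 * k)) ?mulr_gt0//; apply: le_trans h16.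
  have -> : 3 * k * (2 * k * rT) = 6 * k ^+ 2 * rT by ring.
  have h6 : 6 * k ^+ 2 * rT <= 6 * k ^+ 2 * (96 * k ^+ 4)^-1.
    by rewrite ler_pM2l ?mulr_gt0 ?exprn_gt0// ge_min lexx orbT.
  apply: le_trans h6 _.
  have -> : 6 * k ^+ 2 / (96 * k ^+ 4) = 16^-1 * (k ^+ 2)^-1 by field; exact: lt0r_neq0.
  by rewrite ler_piMr// invf_le1 ?exprn_ege1// exprn_gt0.
have rr : 4 * k * rT <= rho.
  have : rT <= kap^-1 / (4 * k) by rewrite ge_min lexx.
  by rewrite ler_pdivlMr ?mulr_gt0// mulrC.
have Kr : 4 * k ^+ 3 * k * rT <= 8^-1.
  have h6 : 4 * k ^+ 4 * rT <= 4 * k ^+ 4 * (96 * k ^+ 4)^-1.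
    by rewrite ler_pM2l ?mulr_gt0// ge_min lexx orbT.
  rewrite [leLHS](_ : _ = 4 * k ^+ 4 * rT); last by ring.
  apply: le_trans h6 _; have -> : 4 * k ^+ 4 / (96 * k ^+ 4) = 24^-1 by field; exact: lt0r_neq0.
  lra.
have half : rho / 2 < rho by rewrite gtr_pMr ?invr_gt0// invf_lt1// ltr1n.
have O00 : O0 (s0, t0) by split => //; rewrite subrr normr0 invr_gt0.
have clO : closed [set z | O0 z /\ `|(phi i \o u) z - y0| <= rho / 2].
  have -> : [set z | O0 z /\ `|(phi i \o u) z - y0| <= rho / 2] =
     u @^-1` [set p | dom i p /\ `|phi i p - y0| <= rho / 2].
    apply/seteqP; split => z /=; first by move=> [[dz _] bz].
    by move=> [dz bz]; split => //; split => //; exact: le_lt_trans bz half.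
  apply: (@preimage_closed _ _ u); first by move=> z _; have [cu _] := su; exact: cu.
  apply: (chart_cball_closed Mh half) => y; exact: rng_b.
have smO : smooth O0 (phi i \o u).
  by apply: smooth_sub (smap_smooth i su) => z [].
have EdE z : O0 z -> bil (g i y0) ('D_es (phi i \o u) z) ('D_es (phi i \o u) z) <= k ^+ 4 * e z.
  move=> Oz; have [dz _] := Oz.
  rewrite -(nrm_sqr (c_bsym c0) (c_psd c0)).
  have n1 : nrm (g i y0) ('D_es (phi i \o u) z) <= k ^+ 2 * q z.
    apply: le_trans (lp_up lp _ B0) _; rewrite expr2 -mulrA ler_pM2l//.
    exact: (es_le lp dz (B _ Oz)).
  have -> : k ^+ 4 * e z = (k ^+ 2 * q z) ^+ 2 by rewrite exprMn sqr_sqrtr// -exprM.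
  by rewrite ler_sqr ?nnegrE ?nrm_ge0// mulr_ge0 ?exprn_ge0 ?sqrtr_ge0// ltW.
have cEd : continuous (fun z => k ^+ 4 * e z).
  by move=> z; apply: cvgM; [exact: cvg_cst|exact: ce].
have := @local_energy R m k k rT eps rho (g i y0) (J i y0) (J i) (Xh i) y0 O0 (phi i \o u) (s0, t0)
  (fun z => k ^+ 4 * e z) k1 (ltW k0) r0 eps0 epsr rr Kr (c_bsym c0) (c_psd c0)
  (fun v => lp_up lp v B0) (fun v => lp_lo lp v B0) (c_iso c0) (c_skew c0) (c_JJv c0) erefl.
move=> /(_ (fun y By => c_JJ (compat_at sy ac co (rng_b y (bE y By))))).
move=> /(_ (fun y v By => lp_JL lp v (bE y By) B0) (fun y By => lp_XL lp (bE y By) B0) (lp_X lp B0)).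
move=> /(_ (preim_open su (chart_ball_open i y0 rho)) smO (fun z Oz => Oz.2) clO O00 erefl).
move=> /(_ (fun z Oz => floer_chart (NO z Oz) Oz.1) cEd).
move=> /(_ (fun z => mulr_ge0 (ltW k4) (e0 z)) EdE s1 s2) /=.
have [s12 s21] := slices_around l0 s1a s1b s2a s2b.
move=> /(_ s12) LE.
have : rT ^+ 2 <= 320 * I1 s1 s2 (fun s => I1 (t0 - 1) (t0 + 1) (fun t => k ^+ 4 * e (s, t) + rT ^+ 2)).
  apply: LE => s t Oz tt st; case: st => E1; rewrite E1 in Oz *.
    exact: (far _ _ c1 b1 Oz tt).
  exact: (far _ _ c2 b2 Oz tt).
have eper s t : e (s, t + 1) = e (s, t).
  have := q_per s t => qq.
  transitivity (Num.sqrt (e (s, t + 1)) ^+ 2); first by rewrite sqr_sqrtr.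
  transitivity (Num.sqrt (e (s, t)) ^+ 2); last by rewrite sqr_sqrtr.
  exact: (congr1 (fun x => x ^+ 2) qq).
have Iin s : I1 (t0 - 1) (t0 + 1) (fun t => k ^+ 4 * e (s, t) + rT ^+ 2) = 2 * k ^+ 4 * eI s + 2 * rT ^+ 2.
  have cs := @slice1_continuous R e s ce.
  have ck : continuous (fun t => k ^+ 4 * e (s, t)) by exact: (@slice1_continuous R _ s cEd).
  rewrite I1D//; last by move=> x; exact: cvg_cst.
  have tm : t0 - 1 <= t0 by rewrite gerBl ler01.
  have tp : t0 <= t0 + 1 by rewrite lerDl ler01.
  rewrite I1Z// (I1_cst _ (le_trans tm tp)).
  rewrite (@I1_cat _ (t0 - 1) t0 (t0 + 1))//; last by rewrite tm tp.
  rewrite (I1_periodic _ cs (eper s)) -{2}(subrK 1 t0) (I1_periodic _ cs (eper s)).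
  by rewrite -/(eI s); ring.
rewrite (@I1_ext _ s1 s2 _ _ (fun s _ => Iin s)) I1D; last 2 first.
- by move=> x; apply: cvgM; [exact: cvg_cst|exact: ceI].
- by move=> x; exact: cvg_cst.
have le12 : s1 <= s2 by case/andP: s12 => /ltW a /ltW; exact: le_trans.
rewrite I1Z// (I1_cst _ le12).
have EI := energy_I1 s1 s2 HE.
have : 2 * k ^+ 4 * I1 s1 s2 eI <= 2 * k ^+ 4 * E by rewrite ler_pM2l// mulr_gt0.
have : 2 * rT ^+ 2 * (s2 - s1) <= 2 * rT ^+ 2 * (4 * lT).
  by rewrite (ler_pM2l (mulr_gt0 (ltr0Sn _ 1) (exprn_gt0 2 rT_gt0))).
have : E < rT ^+ 2 / (1280 * k ^+ 4) by apply: lt_le_trans EC _; rewrite ge_min lexx orbT.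
have k40 : 0 < 1280 * k ^+ 4 by apply: mulr_gt0; [rewrite ltr0n|exact: k4].
rewrite (ltr_pdivlMr _ _ k40); exact: no_cross_aux lE.
Qed.

Let cphi s : continuous (fun t => cut (u (s, t))).
Proof.
have cc : continuous (cut \o u).
  move=> z; apply: differentiable_continuous.
  exact: C1_dif cut_C1 z.
exact: (@slice1_continuous R (cut \o u) s cc).
Qed.

Lemma bav_cst s (a : R) : (forall t, 0 <= t <= 1 -> cut (u (s, t)) = a) -> bav s = a.
Proof.
by move=> E; rewrite /bav (I1_ext E) I1_cst// subr0 mulr1.
Qed.

Lemma bav_low s (a : R) : bav s < a -> exists t, cut (u (s, t)) <= a.
Proof.
move=> lt; apply: contrapT => Hn; move: lt; rewrite ltNge => /negP; apply.
have := @I1_le R 0 1 (fun=> a) (fun t => cut (u (s, t))) (@cst_continuous _ _ a) (@cphi s).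
rewrite I1_cst// subr0 mulr1; apply => t _; rewrite leNgt; apply/negP => lt; apply: Hn.
by exists t; exact: ltW.
Qed.

Lemma bav_high s (a : R) : a < bav s -> exists t, a <= cut (u (s, t)).
Proof.
move=> lt; apply: contrapT => Hn; move: lt; rewrite ltNge => /negP; apply.
have := @I1_le R 0 1 (fun t => cut (u (s, t))) (fun=> a) (@cphi s) (@cst_continuous _ _ a).
rewrite I1_cst// subr0 mulr1; apply => t _; rewrite leNgt; apply/negP => lt; apply: Hn.
by exists t; exact: ltW.
Qed.

(** The second entry keeps the drift [C1B * E] of the mean below 1/4; adding 1 keeps the denominator
    positive, since [C1B] is only known to be nonnegative. *)
Definition energy_gap : R := Num.min (C2T) (4^-1 / (C1B + 1)).

Lemma energy_gap_gt0 : 0 < energy_gap.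
Proof.
rewrite lt_min C2T_gt0//= divr_gt0 ?invr_gt0//.
have := C1B_ge0; lra.
Qed.

Context (E : R).
Hypotheses (HE : (energy omega J u <= E%:E)%E) (Egap : E < energy_gap).

Let small_drift : C1B * E < 4^-1.
Proof.
have c0 := C1B_ge0; move: Egap; rewrite lt_min => /andP[_].
rewrite ltr_pdivlMr; last by rewrite ltr_wpDl.
move: c0; move: (C1B) => c c0; have [E0|E0] := leP 0 E; first by rewrite mulrDr mulr1 mulrC; lra.
have : c * E <= 0 by rewrite mulr_ge0_le0// ltW.
lra.
Qed.

Let drift s1 s2 : s1 <= s2 -> bav s2 - bav s1 < 4^-1.
Proof.
move=> s12; apply: le_lt_trans small_drift.
exact: bav_le.
Qed.

Let no_jump s t1 t2 : cut (u (s, t1)) <= 4^-1 -> 3 / 4 <= cut (u (s, t2)) -> False.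
Proof.
apply: (no_cross HE).
by move: Egap; rewrite lt_min => /andP[].
Qed.

(** The mean is 0 on the slice [s1], hence below 1/4 on [s2]. That slice then has a point with
    [cut <= 1/4] besides one with [cut = 1], which [no_cross] forbids. *)
Lemma no_exit s1 s2 t : s1 <= s2 -> (forall t, 0 <= t <= 1 -> V (u (s1, t))) ->
  ~ (~` (closure V `|` N)) (u (s2, t)).
Proof.
move=> s12 Hs1 out; have b1 : bav s1 = 0 by apply: bav_cst => t' /Hs1 Vt; exact: (cutV Vt).
have [|t' lo] := @bav_low s2 4^-1; first by have := drift s12; rewrite b1 subr0.
by apply: (no_jump lo (t2 := t)); rewrite cut_out//; lra.
Qed.

Lemma no_entry s1 s2 t : s1 <= s2 -> (forall t, 0 <= t <= 1 -> (~` (closure V `|` N)) (u (s2, t))) ->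
  ~ V (u (s1, t)).
Proof.
move=> s12 Hs2 Vt; have b2 : bav s2 = 1 by apply: bav_cst => t' /Hs2 Ht; exact: cut_out.
have [|t' hi] := @bav_high s1 (3 / 4); first by have := drift s12; rewrite b2; lra.
by apply: (no_jump (t1 := t) _ hi); rewrite (cutV Vt).
Qed.

End Bounds.
End Traj.

(** * Periodic orbits *)

Section Slices.
Context {R : realType} {V V' : normedModType R}.
Implicit Types (Phi : V * V' -> R) (y v : V) (c : V') (U : set (V * V')).

Lemma D_slice Phi y c v : 'D_v (fun y => Phi (y, c)) y = 'D_((v, 0) : V * V') Phi (y, c).
Proof.
rewrite /derive; apply: (congr1 (fun k : R -> R => lim (k h @[h --> (0 : R)^']))).
apply/funext => h /=.
have -> : h *: ((v, 0) : V * V') + (y, c) = (h *: v + y, c); last by [].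
have -> : h *: ((v, 0) : V * V') = (h *: v, h *: 0) by [].
have -> : (h *: v, h *: 0) + (y, c) = ((h *: v + y, h *: 0 + c) : V * V') by [].
by rewrite scaler0 add0r.
Qed.

Lemma slice_line_cont y c : {for y, continuous (fun y : V => (y, c) : V * V')}.
Proof.
by apply: (@cvg_pair _ _ _ (nbhs y) (nbhs y) (nbhs c)); [exact: cvg_id|exact: cvg_cst].
Qed.

Lemma dif_slice Phi y c : differentiable Phi (y, c) -> differentiable (fun y => Phi (y, c)) y.
Proof.
move=> dP.
have dl : differentiable (fun y : V => (y, c) : V * V') y.
  by apply: differentiable_pair; [exact: ex_diff|exact: differentiable_cst].
exact: (differentiable_comp dl dP).
Qed.

Lemma smooth_slice U Phi c : smooth U Phi -> smooth [set y | U (y, c)] (fun y => Phi (y, c)).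
Proof.
move=> H k; move: (H k); elim: k Phi {H} => [|k IH] Phi [cP HP]; split => //=.
- move=> y Uy; apply: (@continuous_comp _ _ _ (fun y : V => (y, c) : V * V') Phi); first exact: slice_line_cont.
  exact: cP.
- move=> y Uy; apply: (@continuous_comp _ _ _ (fun y : V => (y, c) : V * V') Phi); first exact: slice_line_cont.
  exact: cP.
- have [dP DP] := HP; split; first by move=> y Uy; apply: dif_slice; exact: dP.
  move=> v; have -> : 'D_v (fun y => Phi (y, c)) = (fun y => 'D_((v, 0) : V * V') Phi (y, c)).
    by apply/funext => y; exact: D_slice.
  exact: IH _ (DP _).
Qed.

End Slices.

Section Barrier.
Context {R : realType}.

(** At a maximum [M] with [g M > 0] the mean value theorem gives [g M <= C (b - a) g M], which is
    less than [g M]. *)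
Lemma barrier_right (g dg : R -> R) (a b C : R) : a <= b -> 0 <= C -> C * (b - a) < 1 -> g a <= 0 ->
  (forall t, a <= t <= b -> is_derive t 1 g (dg t) /\ `|dg t| <= C * pos (g t)) ->
  forall t, a <= t <= b -> g t <= 0.
Proof.
move=> ab C0 Cab ga H t tab; rewrite leNgt; apply/negP => gt0.
have cg : {within `[a, b], continuous g}.
  apply: continuous_in_subspaceT => x; rewrite inE /= in_itv /= => xab.
  have [d _] := H x xab; apply/differentiable_continuous/derivable1_diffP; exact: ex_derive.
have [M Mab Mmax] := EVT_max ab cg.
rewrite in_itv /= in Mab; have [aM Mb] := andP Mab.
have gM : 0 < g M by apply: lt_le_trans gt0 _; apply: Mmax; rewrite in_itv.
have [|x /andP[ax xM] E] := @MVT_all R g dg a M aM.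
  by move=> x /andP[ax xM]; have [] := H x ltac:(by rewrite ax (le_trans xM Mb)).
have xab : a <= x <= b by rewrite ax (le_trans xM Mb).
have [_ dx] := H x xab.
have px : pos (g x) <= g M.
  by rewrite ge_max (ltW gM) /=; apply: Mmax; rewrite in_itv.
have h1 : g M - g a <= C * g M * (b - a).
  rewrite E; apply: le_trans (ler_norm _) _; rewrite normrM (ger0_norm (_ : 0 <= M - a)) ?subr_ge0//.
  apply: ler_pM => //; [by rewrite subr_ge0| |by rewrite lerD2r].
  by apply: le_trans dx _; rewrite ler_wpM2l.
have h2 : C * g M * (b - a) < g M.
  by rewrite mulrAC -[ltRHS]mul1r ltr_pM2r.
by have := lt_le_trans gM; lra.
Qed.

Lemma barrier (g dg : R -> R) (t0 tau C : R) : 0 <= tau -> 0 <= C -> C * tau < 1 -> g t0 <= 0 ->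
  (forall t, t0 - tau <= t <= t0 + tau -> is_derive t 1 g (dg t) /\ `|dg t| <= C * pos (g t)) ->
  forall t, t0 - tau <= t <= t0 + tau -> g t <= 0.
Proof.
move=> tau0 C0 Ct g0 H t /andP[ta tb]; have [le|/ltW le] := leP t0 t.
  apply: (@barrier_right g dg t0 (t0 + tau) C) => //; [by rewrite lerDl|by rewrite addrAC subrr add0r| |by rewrite le].
  by move=> x /andP[x1 x2]; apply: H; rewrite x2 andbT (le_trans _ x1)// gerBl.
have := @barrier_right (fun x => g (- x)) (fun x => - dg (- x)) (- t0) (- t0 + tau) C.
move=> /(_ ltac:(by rewrite lerDl) C0 ltac:(by rewrite addrAC subrr add0r) ltac:(by rewrite opprK)).
move=> /(_ _ (- t)); rewrite opprK; apply; last by lra.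
move=> x xx; have [|d1 d2] := H (- x); first by lra.
split; last by rewrite normrN.
have dN : is_derive x 1 (fun x : R => - x) (-1 : R).
  by have := is_deriveN (is_derive_id x (1 : R)).
by have := @is_derive1_comp _ g (fun x => - x) x _ _ d1 dN; rewrite mulrN1.
Qed.

Lemma small_step (V : normedModType R) (w : V) (e tau : R) : 0 < e -> 0 < tau ->
  exists t : R, [/\ 0 < t, t <= tau & t * `|w| < e].
Proof.
move=> e0 tau0; exists (Num.min tau (e / (2 * (`|w| + 1)))).
have w1 : 0 < `|w| + 1 by rewrite ltr_wpDl.
split; [by rewrite lt_min tau0 divr_gt0// mulr_gt0|by rewrite ge_min lexx|].
apply: (@le_lt_trans _ _ (e / (2 * (`|w| + 1)) * `|w|)).
  by rewrite ler_wpM2r// ge_min lexx orbT.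
rewrite mulrAC ltr_pdivrMr ?mulr_gt0// ltr_pM2l//; have := normr_ge0 w; lra.
Qed.

Lemma R_clopen (T : set R) : T !=set0 -> open T -> closed T -> T = setT.
Proof.
move=> T0 oT cT; have cR : connected [set: R].
  by apply/connected_intervalP => x y _ _ z _.
apply: cR => //; [exists T|exists T] => //; by rewrite setTI.
Qed.

End Barrier.

(** * Structure of the region along its frontier *)

Section Sides.
Context {R : realType} {m : nat} {M : topologicalType} (A : smooth_atlas R m M).
Notation dom := (@dom R m M A).
Notation phi := (@phi R m M A).
Notation psi := (@psi R m M A).
Context (N : set M) (cN : closed N).

(** Along a segment without frontier points, being in [N] and being in its interior agree, so [stay]
    applies with the two sets. *)
Lemma seg_const i (y v : 'rV[R]_m) : (forall t : R, 0 <= t <= 1 -> rng i (y + t *: v) /\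
   (N° (psi i (y + t *: v)) \/ ~ N (psi i (y + t *: v)))) -> N (psi i y) -> N (psi i (y + v)).
Proof.
move=> H Ny; have e0 : psi i (y + (0 : R) *: v) = psi i y by rewrite scale0r addr0.
have e1 : psi i (y + (1 : R) *: v) = psi i (y + v) by rewrite scale1r.
have N0 : N° (psi i (y + (0 : R) *: v)).
  by have [|_ [//|]] := H 0; [rewrite lexx ler01|rewrite e0].
rewrite -e1; apply: interior_subset.
apply: (@stay R M (fun t : R => psi i (y + t *: v)) N° N 0 1) => //.
- move=> t t01; apply: (@continuous_comp _ _ _ (fun t : R => y + t *: v) (psi i)); last first.
    by apply: psi_continuous; have [] := H t t01.
  by apply: cvgD; [exact: cvg_cst|apply: cvgZl; exact: cvg_id].
- exact: open_interior.
- exact: interior_subset.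
- by move=> c c01 Hc; have [_ [//|nN]] := H c c01; exfalso; apply: nN; apply: Hc; case/andP: c01 => -> _ /=.
- by rewrite ler01 lexx.
Qed.

End Sides.

Section SideStructure.
Context {R : realType} {m : nat} {M : topologicalType} (A : smooth_atlas R m M).
Notation dom := (@dom R m M A).
Notation phi := (@phi R m M A).
Notation psi := (@psi R m M A).
Hypotheses (Mc : compact [set: M]) (Mh : hausdorff_space M).
Context (V N : set M) (h : M -> R).
Hypotheses (oV : open V) (tub : tubular_neighborhood A V N)
  (sh : smooth_on_subset (smooth_fun A) N h) (nc : no_critical_points_on A N h)
  (h0 : forall x, bdry V x -> h x = 0) (h1 : forall x, bdry (closure V `|` N) x -> h x = 1).
Implicit Types (y z w : 'rV[R]_m).

Let cN : closed N. Proof. exact: (N_closed Mc Mh tub). Qed.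

Lemma bdry_level p : N p -> ~ N° p -> h p = 0 \/ h p = 1.
Proof.
move=> Np nN; have [b|nb] := pselect (bdry V p); first by left; exact: h0.
have [b|nb'] := pselect (bdry (Vhat V N) p); first by right; exact: h1.
by exfalso; apply: nN; exact: (in_int tub Np nb nb').
Qed.

(** The direction [w] is the coordinate gradient at [p] of a local extension of [h]; it is nonzero
    since [p] is not critical, and on a small ball the derivative along [w] keeps half of its
    value. *)
Lemma extension_chart p : N p -> exists i f w (eta rho : R), [/\ dom i p, 0 < eta, 0 < rho,
  ball (phi i p) rho `<=` rng i &
  [/\ smooth (ball (phi i p) rho) f, forall y, ball (phi i p) rho y -> N (psi i y) -> f y = h (psi i y),
   forall y, ball (phi i p) rho y -> eta <= 'D_w f y &
   forall y, ball (phi i p) rho y -> grd f y != 0]].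
Proof.
move=> Np; have [W [F [oW Wp sF E]]] := sh Np.
have [i di] := dom_cover A p; pose f := F \o psi i; pose y0 := phi i p.
pose U := phi i @` (dom i `&` W); have oU : open U by exact: open_img.
have Uy : U y0 by exists p.
have g0 : grd f y0 != 0.
  apply/eqP => g0; apply: (nc Np oW Wp sF E).
  exact: critical_chart oW Wp sF di g0.
pose w : 'rV[R]_m := grd f y0.
have df y : U y -> differentiable f y by exact: smooth_dif (sF i).
have Dw0 : 0 < 'D_w f y0.
  rewrite (D_grd _ (df _ Uy)) row_dot -/w.
  have [k wk] : exists k, w 0 k != 0.
    apply: contrapT => Hn; move/eqP: g0; apply; apply/rowP => k; rewrite [RHS]mxE.
    by apply/eqP; apply: contrapT => /negP nk; apply: Hn; exists k.
  rewrite (bigD1 k)//= ltr_pwDl// -?expr2 ?exprn_even_gt0//.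
  by apply: sumr_ge0 => j _; rewrite -expr2 sqr_ge0.
have cD : {for y0, continuous ('D_w f)} by exact: smooth_cont (smooth_D w (sF i)) Uy.
have e0 : 0 < 'D_w f y0 / 2 by rewrite divr_gt0.
move/cvgrPdist_lt : (cD) => /(_ _ e0) H1.
have /nbhs_ballP[rho /= rho0 Hr] : nbhs y0 [set y | `|'D_w f y0 - 'D_w f y| < 'D_w f y0 / 2 /\ U y].
  by apply: filterS2 H1 (open_nbhs_nbhs (conj oU Uy)).
have Deta y : ball y0 rho y -> 'D_w f y0 / 2 <= 'D_w f y.
  by move=> /Hr[/= + _]; rewrite ltr_norml => /andP[_ a]; lra.
exists i, f, w, ('D_w f y0 / 2), rho; split => //.
  by move=> y /Hr[_ [q [dq _] <-]]; exact: rng_phi.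
split => //.
- by apply: smooth_sub (sF i) => y /Hr[].
- by move=> y /Hr[_ /psi_in[_ Wy _]] Ny; exact: E.
- move=> y By; apply/eqP => g0'; have := Deta y By.
  have [_ Uy'] := Hr _ By; rewrite (D_grd _ (df _ Uy')) g0' trmx0 mulmx0 mxE; lra.
Qed.

Section Local.
Context (i : chart A) (f : 'rV[R]_m -> R) (w y0 : 'rV[R]_m) (eta rho c : R).
Hypotheses (eta0 : 0 < eta) (rho0 : 0 < rho) (Br : ball y0 rho `<=` rng i)
  (df : forall y, ball y0 rho y -> differentiable f y)
  (Dw : forall y, ball y0 rho y -> eta <= 'D_w f y).

Lemma slope (s t : R) y : s = 1 \/ s = -1 -> 0 <= t -> ball y0 rho y -> ball y0 rho (y - (s * t) *: w) ->
  s * f (y - (s * t) *: w) <= s * f y - eta * t.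
Proof.
move=> s1 t0 By By'.
have inb (a : R) : 0 <= a <= 1 -> ball y0 rho (y + a *: (- ((s * t) *: w))).
  move=> a01; have -> : - ((s * t) *: w) = y - (s * t) *: w - y by rewrite addrAC subrr add0r.
  exact: ball_line.
have [|a a01 E] := @MVT_line R _ f y (- ((s * t) *: w)) 1 ler01.
  by move=> a a01; apply: diff_derivable; apply: df; exact: inb.
move: E; rewrite scale1r mulr1.
have dfa := df (inb a a01).
have -> : 'D_(- ((s * t) *: w)) f (y + a *: (- ((s * t) *: w))) = - (s * t) * 'D_w f (y + a *: (- ((s * t) *: w))).
  by move: (y + a *: _) dfa => z dz; rewrite -scaleNr; exact: (deriveZr (- (s * t)) w dz).
have := Dw (inb a a01); move: ('D_w f _) => d eta_d E.
have -> : f (y - (s * t) *: w) = f y - s * t * d by lra.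
have : eta * t <= d * t by rewrite ler_wpM2r.
have s2 : s * s = 1 by case: s1 => ->; ring.
rewrite mulrBr !mulrA s2 mul1r [t * d]mulrC; lra.
Qed.

Context (r1 tau : R).
Hypotheses (r10 : 0 < r1) (tau0 : 0 < tau) (r1rho : r1 <= rho / 2) (tw : tau * `|w| <= rho / 2)
  (fosc : forall y, ball y0 r1 y -> `|f y - c| < eta * tau)
  (lev : forall y, ball y0 rho y -> N (psi i y) -> ~ N° (psi i y) -> f y = c).

Let inb (s t : R) y : s = 1 \/ s = -1 -> 0 <= t <= tau -> ball y0 r1 y -> ball y0 rho (y - (s * t) *: w).
Proof.
move=> s1 /andP[t0 tt]; rewrite -!ball_normE /= => yr.
have -> : y0 - (y - (s * t) *: w) = (y0 - y) + (s * t) *: w by rewrite opprB addrCA addrC.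
apply: le_lt_trans (ler_normD _ _) _; rewrite normrZ normrM (ger0_norm t0).
have -> : `|s| = 1 by case: s1 => ->; rewrite ?normrN normr1.
rewrite mul1r; have : t * `|w| <= tau * `|w| by rewrite ler_wpM2r.
by move: tw r1rho => *; lra.
Qed.

Let sub1 y : ball y0 r1 y -> ball y0 rho y.
Proof. by apply: le_ball; move: r1rho rho0 => *; lra. Qed.

Let noc y : ball y0 rho y -> f y != c -> rng i y /\ (N° (psi i y) \/ ~ N (psi i y)).
Proof.
move=> By fc; split; first exact: Br.
have [Ny|] := pselect (N (psi i y)); last by right.
left; apply: contrapT => nN; move/eqP: fc; apply; exact: lev.
Qed.

(** One side of a level set in a ball need not be convex, so the two points are joined by three
    segments: away from the level along [- s w], a translation, and back. The middle one misses the
    level because the descent [eta tau] exceeds the oscillation of [f] on the small ball. *)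
Lemma same_side (s : R) y y' : s = 1 \/ s = -1 -> ball y0 r1 y -> ball y0 r1 y' ->
  s * (f y - c) < 0 -> s * (f y' - c) < 0 -> N (psi i y) -> N (psi i y').
Proof.
move=> s1 By By' fy fy' Ny.
have s2 : s * s = 1 by case: s1 => ->; ring.
have down z (t : R) : ball y0 r1 z -> 0 <= t <= tau -> s * (f (z - (s * t) *: w) - c) <= s * (f z - c) - eta * t.
  move=> Bz tt; have [t0 _] := andP tt.
  have := slope s1 t0 (sub1 Bz) (inb s1 tt Bz); rewrite !mulrBr; lra.
have neq z : s * (f z - c) < 0 -> f z != c.
  by move=> H; apply/eqP => E; move: H; rewrite E subrr mulr0 ltxx.
have N1 : N (psi i (y + (- ((s * tau) *: w)))).
  apply: seg_const Ny => // t /andP[t0 t1].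
  have -> : y + t *: - ((s * tau) *: w) = y - (s * (t * tau)) *: w.
    by rewrite scalerN scalerA mulrCA.
  have tt : 0 <= t * tau <= tau by rewrite mulr_ge0 ?(ltW tau0)//= ler_piMl// ltW.
  apply: noc; first exact: inb.
  apply: neq; apply: le_lt_trans (down y _ By tt) _.
  have : 0 <= eta * (t * tau) by rewrite !mulr_ge0// ltW.
  lra.
have N2 : N (psi i (y' - (s * tau) *: w)).
  have -> : y' - (s * tau) *: w = (y - (s * tau) *: w) + (y' - y) by rewrite [RHS]addrC subrKA.
  apply: seg_const N1 => // t /andP[t0 t1].
  have -> : y - (s * tau) *: w + t *: (y' - y) = (y + t *: (y' - y)) - (s * tau) *: w by rewrite addrAC.
  have Bz : ball y0 r1 (y + t *: (y' - y)).
    by apply: ball_line => //; rewrite t0 t1.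
  have tt : 0 <= tau <= tau by rewrite lexx (ltW tau0).
  apply: noc; first exact: inb.
  apply: neq; apply: le_lt_trans (down _ _ Bz tt) _.
  have := fosc Bz; rewrite ltr_norml => /andP[a b].
  by case: s1 => ->; lra.
have -> : y' = (y' - (s * tau) *: w) + (s * tau) *: w by rewrite subrK.
apply: seg_const N2 => // t /andP[t0 t1].
have -> : y' - (s * tau) *: w + t *: ((s * tau) *: w) = y' - (s * ((1 - t) * tau)) *: w.
  by apply/rowP => j; rewrite !mxE; ring.
have tt : 0 <= (1 - t) * tau <= tau.
  by rewrite mulr_ge0 ?subr_ge0 ?(ltW tau0)//= ler_piMl ?(ltW tau0)// gerBl.
apply: noc; first exact: inb.
apply: neq; apply: le_lt_trans (down y' _ By' tt) _.
have : 0 <= eta * ((1 - t) * tau) by rewrite !mulr_ge0 ?subr_ge0// ltW.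
lra.
Qed.

(** A point of the level is a limit of points of the given side, reached along [- s w], and [N] is
    closed. *)
Lemma side_limit (s : R) y : s = 1 \/ s = -1 -> ball y0 r1 y -> f y = c ->
  (forall z, ball y0 r1 z -> s * (f z - c) < 0 -> N (psi i z)) -> N (psi i y).
Proof.
move=> s1 By fc H; apply: contrapT => nN.
have oN : open (~` N) by rewrite openC.
have cy : {for y, continuous (psi i)} by apply: psi_continuous; apply: Br; exact: sub1.
have n1 : nbhs y (psi i @^-1` (~` N)) by apply: cy; exact: open_nbhs_nbhs.
have n2 : nbhs y (ball y0 r1) by apply: open_nbhs_nbhs; split => //; exact: ball_open.
have /nbhs_ballP[e /= e0 He] : nbhs y ((psi i @^-1` (~` N)) `&` ball y0 r1) by exact: filterI.
have [t [t0 tt te]] := small_step w e0 tau0.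
have [|Nz Bz] := He (y - (s * t) *: w).
  rewrite -ball_normE /= opprB addrCA subrr addr0 normrZ normrM (gtr0_norm t0).
  by have -> : `|s| = 1; [case: s1 => ->; rewrite ?normrN normr1|rewrite mul1r].
apply: Nz; apply: H => //.
have tt' : 0 <= t <= tau by rewrite (ltW t0).
have := slope s1 (ltW t0) (sub1 By) (inb s1 tt' By); rewrite fc mulrBr.
have : 0 < eta * t by exact: mulr_gt0.
lra.
Qed.

End Local.

(** Frontier points of [N] lie on the levels 0 and 1, so near [p] each side of the level [h p] is
    entirely in [N] or entirely outside. Both sides in [N] would make [p] interior. If neither were,
    [h] would be constant on [N] near [p], and its constant extension would be critical at [p]. *)
Lemma side_structure p : N p -> ~ N° p -> exists i f w (eta rho s : R), [/\ dom i p, 0 < eta, 0 < rho,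
  ball (phi i p) rho `<=` rng i &
  [/\ smooth (ball (phi i p) rho) f, forall y, ball (phi i p) rho y -> N (psi i y) -> f y = h (psi i y),
   forall y, ball (phi i p) rho y -> eta <= 'D_w f y,
   s = 1 \/ s = -1 &
   forall y, ball (phi i p) rho y -> (N (psi i y) <-> s * (f y - h p) <= 0)]].
Proof.
move=> Np nN; have [i [f [w [eta [rho [di eta0 rho0 Br [sf fh Dw _]]]]]]] := extension_chart Np.
set y0 := phi i p in Br sf fh Dw *; pose c := h p.
have By0 : ball y0 rho y0 by exact: ballxx.
have fc : f y0 = c by rewrite fh//= /y0 phiK.
have df y : ball y0 rho y -> differentiable f y by exact: smooth_dif.
have cf : {for y0, continuous f} by exact: smooth_cont sf By0.
(* An oscillation below 1/2 separates the levels 0 and 1: all frontier points in this ball have the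
   level of [p]. *)
have h2 : (0 : R) < 2^-1 by [].
move/cvgrPdist_lt : (cf) => /(_ _ h2) H1.
have /nbhs_ballP[rho' /= rho'0 Hr'] : nbhs y0 [set y | `|f y0 - f y| < 2^-1 /\ ball y0 rho y].
  apply: filterS2 H1 (open_nbhs_nbhs (conj (ball_open y0 rho) By0)) => // y; by split.
pose tau : R := rho' / (2 * (`|w| + 1)).
have w1 : 0 < `|w| + 1 by rewrite ltr_wpDl.
have tau0 : 0 < tau by rewrite divr_gt0// mulr_gt0.
have tw : tau * `|w| <= rho' / 2.
  rewrite /tau invfM mulrA mulrAC ler_pdivrMr// ler_pM2l ?divr_gt0//; lra.
have et0 : 0 < eta * tau by exact: mulr_gt0.
move/cvgrPdist_lt : (cf) => /(_ _ et0) H2.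
have /nbhs_ballP[r' /= r'0 Hr] : nbhs y0 [set y | `|f y0 - f y| < eta * tau] by exact: H2.
pose r1 := Num.min r' (rho' / 2).
have r10 : 0 < r1 by rewrite lt_min r'0 divr_gt0.
have r1rho : r1 <= rho' / 2 by rewrite ge_min lexx orbT.
have B' y : ball y0 rho' y -> ball y0 rho y by move=> /Hr'[].
have B1 y : ball y0 r1 y -> ball y0 rho' y by apply: le_ball; lra.
have fosc y : ball y0 r1 y -> `|f y - c| < eta * tau.
  move=> By; have : ball y0 r' y by apply: le_ball By; rewrite ge_min lexx.
  by move=> /Hr /=; rewrite fc distrC.
have lev y : ball y0 rho' y -> N (psi i y) -> ~ N° (psi i y) -> f y = c.
  move=> By Ny nNy; have [/= + By'] := Hr' y By; rewrite fc fh//.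
  have cc := bdry_level Np nN; have hc := bdry_level Ny nNy.
  rewrite /c; case: cc => ->; case: hc => -> //; rewrite ?subr0 ?sub0r ?normrN normr1; lra.
have same := @same_side i f w y0 eta rho' c eta0 rho'0 (fun y By => Br _ (B' y By)) (fun y By => df y (B' y By)) (fun y By => Dw y (B' y By))
   r1 tau tau0 r1rho tw fosc lev.
have limit := @side_limit i f w y0 eta rho' c eta0 rho'0 (fun y By => Br _ (B' y By)) (fun y By => df y (B' y By)) (fun y By => Dw y (B' y By))
   r1 tau tau0 r1rho tw.
pose S (s : R) := exists y, [/\ ball y0 r1 y, s * (f y - c) < 0 & N (psi i y)].
have all (s : R) : s = 1 \/ s = -1 -> S s -> forall z, ball y0 r1 z -> s * (f z - c) < 0 -> N (psi i z).
  by move=> s1 [y [By fy Ny]] z Bz fz; exact: (same s y z).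
have le (s : R) : s = 1 \/ s = -1 -> S s -> forall z, ball y0 r1 z -> s * (f z - c) <= 0 -> N (psi i z).
  move=> s1 Ss z Bz; rewrite le_eqVlt => /predU1P[E|]; last exact: all.
  apply: (limit s) => //; last exact: all.
  apply/eqP; rewrite -subr_eq0; case: s1 E => ->; rewrite ?mul1r ?mulN1r; first by move=> ->.
  by move/eqP; rewrite oppr_eq0.
have p1 : (1 : R) = 1 \/ (1 : R) = -1 by left.
have m1 : (-1 : R) = 1 \/ (-1 : R) = -1 by right.
have one (s : R) : s = 1 \/ s = -1 -> S s -> ~ S (- s) -> exists i f w (eta rho s : R),
  [/\ dom i p, 0 < eta, 0 < rho, ball (phi i p) rho `<=` rng i &
  [/\ smooth (ball (phi i p) rho) f, forall y, ball (phi i p) rho y -> N (psi i y) -> f y = h (psi i y),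
   forall y, ball (phi i p) rho y -> eta <= 'D_w f y,
   s = 1 \/ s = -1 &
   forall y, ball (phi i p) rho y -> (N (psi i y) <-> s * (f y - h p) <= 0)]].
  move=> s1 Ss nS; exists i, f, w, eta, r1, s; split => //.
    by move=> y /B1/B'; exact: Br.
  split => //.
  - by apply: smooth_sub sf => y /B1/B'.
  - by move=> y /B1/B'; exact: fh.
  - by move=> y /B1/B'; exact: Dw.
  move=> y By; split; last exact: le.
  move=> Ny; rewrite leNgt; apply/negP => gt; apply: nS; exists y; split => //.
  by rewrite mulNr oppr_lt0.
have [S1|nS1] := pselect (S 1); have [S2|nS2] := pselect (S (-1)).
- exfalso; apply: nN; rewrite /interior.
  have oB : nbhs p [set q | dom i q /\ `|phi i q - y0| < r1].
    apply: open_nbhs_nbhs; split; first exact: chart_ball_open.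
    by split => //; rewrite subrr normr0.
  apply: filterS oB => q [dq Bq].
  have Bq' : ball y0 r1 (phi i q) by rewrite -ball_normE /= distrC.
  rewrite -(phiK dq); have [fl|fg] := leP (f (phi i q)) c.
    by apply: (le 1) => //; rewrite mul1r subr_le0.
  by apply: (le (-1)) => //; rewrite mulN1r oppr_le0 subr_ge0 ltW.
- exact: (one 1).
- by apply: (one (-1)) => //; rewrite opprK.
exfalso; pose W := [set q | dom i q /\ `|phi i q - y0| < r1].
have oW : open W by exact: chart_ball_open.
have Wp : W p by split => //; rewrite subrr normr0.
have sW : smooth_fun A W (fun=> c).
  by move=> j; apply: smooth_cst; exact: open_img.
apply: (nc Np oW Wp sW); last first.
  by move=> j dj v; rewrite (_ : (fun=> c) \o psi j = fun=> c)// derive_cst.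
move=> q [dq Bq] Nq.
have Bq' : ball y0 r1 (phi i q) by rewrite -ball_normE /= distrC.
have E : f (phi i q) = h q by rewrite fh ?phiK//; exact: B' (B1 _ Bq').
rewrite -E; have [lt|gt|//] := ltgtP (f (phi i q)) c.
- by exfalso; apply: nS1; exists (phi i q); rewrite mul1r subr_lt0 phiK.
- by exfalso; apply: nS2; exists (phi i q); rewrite mulN1r oppr_lt0 subr_gt0 phiK.
Qed.

End SideStructure.

Section Aux.
Context {R : realType}.

Lemma near_bounded (T : topologicalType) (F : T -> R) z : {for z, continuous F} ->
  \forall y \near z, `|F y| <= `|F z| + 1.
Proof.
move/cvgrPdist_lt => /(_ 1 ltr01); apply: filterS => y.
move=> H; have := ler_normB (F z) (F z - F y); rewrite opprB addrC subrK; lra.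
Qed.

Lemma near_all (T : topologicalType) (m : nat) (P : 'I_m -> T -> Prop) (z : T) :
  (forall k, \forall y \near z, P k y) -> \forall y \near z, forall k, P k y.
Proof. exact: filter_forall. Qed.

Lemma derive_sub_scale (V : normedModType R) (f g : V -> R) (k : R) v x :
  differentiable f x -> differentiable g x ->
  'D_v (fun z => f z - k * g z) x = 'D_v f x - k * 'D_v g x.
Proof.
move=> df dg.
have H1 : derivable f x v by exact: diff_derivable.
have H2 : derivable (k *: g) x v by apply: derivableZ; exact: diff_derivable.
by apply: (etrans (deriveB H1 H2)); rewrite (deriveZ k (diff_derivable _)).
Qed.

Lemma smooth_grd (m : nat) (U : set 'rV[R]_m) f : smooth U f -> msmooth U (grd f).
Proof.
move=> sf i k; rewrite (_ : (fun x => _) = pd k f); first exact: smooth_D.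
by apply/funext => y; rewrite mxE.
Qed.

Lemma curve_comp (m : nat) (f : 'rV[R]_m -> R) (X : R -> 'rV[R]_m) (t : R) :
  differentiable X t -> differentiable f (X t) ->
  is_derive t 1 (fun t => f (X t)) ('D_('D_1 X t) f (X t)).
Proof.
move=> dX df; apply: DeriveDef; last by have := chain (1 : R) dX df.
by apply: diff_derivable; exact: (differentiable_comp dX df).
Qed.

End Aux.

Section Orbits.
Context {R : realType} {m : nat} {M : topologicalType} (A : smooth_atlas R m M).
Notation dom := (@dom R m M A).
Notation phi := (@phi R m M A).
Notation psi := (@psi R m M A).
Hypotheses (Mc : compact [set: M]) (Mh : hausdorff_space M).
Context (V N : set M) (h : M -> R).
Hypotheses (oV : open V) (tub : tubular_neighborhood A V N)
  (sh : smooth_on_subset (smooth_fun A) N h) (nc : no_critical_points_on A N h)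
  (h0 : forall x, bdry V x -> h x = 0) (h1 : forall x, bdry (closure V `|` N) x -> h x = 1).
Implicit Types (y z w : 'rV[R]_m).

Let cN : closed N. Proof. exact: (N_closed Mc Mh tub). Qed.

Lemma near_chart i q (S : set 'rV[R]_m) : dom i q -> nbhs (phi i q) S -> nbhs q (dom i `&` phi i @^-1` S).
Proof.
move=> dq nS; apply: filterI; first by apply: open_nbhs_nbhs; split => //; exact: dom_open.
exact: (phi_continuous dq).
Qed.

(** At a frontier point a small move along [- s w] enters the side that belongs to the interior. The
    density transports identities between differentials from the interior of [N] to its frontier. *)
Lemma N_dense p W : N p -> open W -> W p -> exists2 q, W q & N° q.
Proof.
move=> Np oW Wp; have [|nN] := pselect (N° p); first by exists p.
have [i [f [w [eta [rho [s [di eta0 rho0 Br [sf fh Dw s1 side]]]]]]]] :=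
  side_structure Mc Mh tub sh nc h0 h1 Np nN.
set y0 := phi i p in Br sf fh Dw side.
have By0 : ball y0 rho y0 by exact: ballxx.
have df y : ball y0 rho y -> differentiable f y by exact: smooth_dif.
have fc : f y0 = h p by rewrite fh//= /y0 phiK.
have n1 : nbhs y0 (psi i @^-1` W).
  by apply: (psi_continuous (Br _ By0)); rewrite /y0 phiK//; exact: open_nbhs_nbhs.
have /nbhs_ballP[e /= e0 He] : nbhs y0 ((psi i @^-1` W) `&` ball y0 rho).
  by apply: filterI => //; apply: open_nbhs_nbhs; split => //; exact: ball_open.
have [t [t0 _ te]] := small_step w e0 ltr01.
have [|Wz Bz] := He (y0 - (s * t) *: w).
  rewrite -ball_normE /= opprB addrCA subrr addr0 normrZ normrM (gtr0_norm t0).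
  by have -> : `|s| = 1; [case: s1 => ->; rewrite ?normrN normr1|rewrite mul1r].
set z := y0 - _ in Wz Bz.
have fz : s * f z < s * h p.
  have := slope df Dw s1 (ltW t0) By0 Bz; rewrite -/z fc.
  have : 0 < eta * t by exact: mulr_gt0.
  lra.
exists (psi i z) => //; rewrite /interior.
have [q [dq _] Eq] : (phi i @` (dom i `&` setT)) z by have [q dq <-] := Br _ Bz; exists q.
have Ez : psi i z = q by rewrite -Eq phiK.
have cz : {for z, continuous f} by exact: smooth_cont sf Bz.
have cs : {for z, continuous (fun y => s * f y)} by apply: cont_mul => //; exact: cst_continuous.
have n2 : nbhs z [set y | s * f y < s * h p].
  by apply: (cs [set r : R | r < s * h p]); apply: open_nbhs_nbhs; split; [exact: open_lt|].
have n3 : nbhs z (ball y0 rho) by apply: open_nbhs_nbhs; split => //; exact: ball_open.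
have n4 : nbhs z ([set y | s * f y < s * h p] `&` ball y0 rho) by exact: filterI.
rewrite -Eq in n4; rewrite Ez; apply: filterS (near_chart dq n4) => q' [dq' [/= fq Bq]].
by rewrite -(phiK dq'); apply/(side _ Bq); rewrite mulrBr; lra.
Qed.

Context (omega J : tensor A).
Hypotheses (sy : symplectic_form omega) (ac : almost_complex J) (co : compatible omega J).

Section Orbit.
Context (eps s1 : R) (H : M -> R -> R -> R) (beta : R -> R -> R) (x : R -> M).
Hypotheses (eps0 : 0 < eps) (hH : homotopy A H)
  (HN : forall x t s, N x -> H x t s = eps * h x + beta s t)
  (ox : periodic_orbit omega (fun p t => H p t s1) x).

Let K i (t : R) y : R := H (psi i y) t s1.
Let Ph i (z : 'rV[R]_m * (R * R)) : R := H (psi i z.1) z.2.1 z.2.2.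

Let sP i : smooth [set z : 'rV[R]_m * (R * R) | rng i z.1] (Ph i).
Proof. by case: hH. Qed.

Let sK i t : smooth (rng i) (K i t).
Proof. exact: (smooth_slice (t, s1) (@sP i)). Qed.

Let sx : smooth_map A [set: R] x. Proof. by case: ox. Qed.

(** The formula for [H] is given on [N] only. It yields the identity of differentials in the
    interior, and continuity together with [N_dense] extends it to the frontier. *)
Lemma grd_N i f U t v y : open U -> U `<=` rng i -> smooth U f ->
  (forall y, U y -> N (psi i y) -> f y = h (psi i y)) -> U y -> N (psi i y) ->
  'D_v (K i t) y = eps * 'D_v f y.
Proof.
move=> oU Ur sf fh Uy Ny.
pose E y : R := 'D_v (K i t) y - eps * 'D_v f y.
have E0 z : U z -> N° (psi i z) -> E z = 0.
  move=> Uz Nz; have [q dq Eq] := Ur _ Uz.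
  pose O := U `&` (phi i @` (dom i `&` N°)).
  have oO : open O by apply: openI => //; apply: open_img; exact: open_interior.
  have Oz : O z by split => //; exists q => //; split => //; rewrite -(phiK dq) Eq.
  have KE y' : O y' -> K i t y' = eps * f y' + beta s1 t.
    move=> [Uy' /psi_in[_ Ny' _]]; have Ny'' := interior_subset Ny'.
    by rewrite /K HN// fh.
  have dfz : differentiable f z by exact: smooth_dif sf Uz.
  rewrite /E (derive_near v oO Oz KE).
  have -> : (fun w : 'rV[R]_m => eps * f w + beta s1 t) = (fun w => cst (beta s1 t) w - (- eps) * f w).
    by apply/funext => w; rewrite /= mulNr opprK addrC.
  rewrite derive_sub_scale//.
  by rewrite derive_cst mulNr opprK add0r subrr.
have cE : {for y, continuous E}.
  apply: cont_add; first by apply: (smooth_cont (smooth_D v (@sK i t))); exact: Ur.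
  rewrite (_ : (fun z => - (eps * _)) = fun z => (- eps) * 'D_v f z); last first.
    by apply/funext => z; rewrite mulNr.
  by apply: cont_mul; [exact: cst_continuous|exact: smooth_cont (smooth_D v sf) Uy].
apply/eqP; rewrite -subr_eq0; apply: contrapT => /negP En.
have n1 : nbhs y [set z | E z != 0].
  by apply: (cE [set r : R | r != 0]); apply: open_nbhs_nbhs; split; [exact: open_neq|exact: En].
have n2 : nbhs y ([set z | E z != 0] `&` U) by apply: filterI => //; exact: open_nbhs_nbhs.
have [q dq Eq] := Ur _ Uy.
have Pq : psi i y = q by rewrite -Eq phiK.
have n3 : nbhs q (phi i @^-1` ([set z | E z != 0] `&` U) `&` dom i).
  apply: filterI; last by apply: open_nbhs_nbhs; split => //; exact: dom_open.
  by apply: (phi_continuous dq); rewrite Eq.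
move: n3; rewrite nbhsE => -[W [oW Wq] HW].
rewrite Pq in Ny; have [q' Wq' Nq'] := N_dense Ny oW Wq.
have [[/= /eqP + Uq'] dq'] := HW _ Wq'; apply.
by apply: E0 => //; rewrite phiK.
Qed.

Lemma orbit_chart i t : dom i (x t) ->
  'D_1 (phi i \o x) t = hamX (J i (phi i (x t))) (gJ omega J i (phi i (x t))) (grd (K i t) (phi i (x t))).
Proof.
move=> dx; have [_ _ ->//] := ox; apply: (ham_vecE sy ac co dx).
exact: smooth_dif (@sK i t) (rng_phi dx).
Qed.

(* d(K_t - eps f) vanishes on N, hence is at most a multiple of the distance to N along w. *)
Lemma side_bound i f w (y0 : 'rV[R]_m) (eta rho s c : R) t0 : 0 < eta -> 0 < rho -> ball y0 rho `<=` rng i ->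
  smooth (ball y0 rho) f -> (forall y, ball y0 rho y -> N (psi i y) -> f y = h (psi i y)) ->
  (forall y, ball y0 rho y -> eta <= 'D_w f y) -> s = 1 \/ s = -1 ->
  (forall y, ball y0 rho y -> (N (psi i y) <-> s * (f y - c) <= 0)) -> f y0 = c ->
  exists r tau L : R, [/\ 0 < r, 0 < tau, 0 <= L, r <= rho &
    forall y t k, ball y0 r y -> `|t - t0| < tau -> `|pd k (K i t) y - eps * pd k f y| <= L * pos (s * (f y - c))].
Proof.
move=> eta0 rho0 Br sf fh Dw ss side fc.
have By0 : ball y0 rho y0 by exact: ballxx.
pose F1 (k : 'I_m) (z : 'rV[R]_m * (R * R)) : R := 'D_((w, 0) : 'rV[R]_m * (R * R)) ('D_(('e_k : 'rV[R]_m, 0) : 'rV[R]_m * (R * R)) (Ph i)) z.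
pose F2 (k : 'I_m) (z : 'rV[R]_m) : R := 'D_w (pd k f) z.
pose z0 : 'rV[R]_m * (R * R) := (y0, (t0, s1)).
have c1 k : {for z0, continuous (F1 k)}.
  by apply: (smooth_cont (smooth_D _ (smooth_D _ (@sP i)))); exact: Br.
have c2 k : {for y0, continuous (F2 k)}.
  by apply: (smooth_cont (smooth_D _ (smooth_D _ sf))).
pose B1 : R := \sum_k (`|F1 k z0| + 1); pose B2 : R := \sum_k (`|F2 k y0| + 1).
have B10 : 0 <= B1 by apply: sumr_ge0 => j _; rewrite addr_ge0.
have B20 : 0 <= B2 by apply: sumr_ge0 => j _; rewrite addr_ge0.
have n1 := near_all (fun k => near_bounded (c1 k)).
have n2 := near_all (fun k => near_bounded (c2 k)).
move/nbhs_ballP : n1 => [e1 /= e10 H1]; move/nbhs_ballP : n2 => [e2 /= e20 H2].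
have {}H1 (z : 'rV[R]_m * (R * R)) k : ball z0 e1 z -> `|F1 k z| <= B1.
  move=> /H1 /= /(_ k) /le_trans; apply.
  by rewrite /B1 (bigD1 k)//= lerDl; apply: sumr_ge0 => j _; rewrite addr_ge0.
have {}H2 z k : ball y0 e2 z -> `|F2 k z| <= B2.
  move=> /H2 /= /(_ k) /le_trans; apply.
  by rewrite /B2 (bigD1 k)//= lerDl; apply: sumr_ge0 => j _; rewrite addr_ge0.
pose r0 : R := Num.min rho (Num.min e1 e2).
have r00 : 0 < r0 by rewrite !lt_min rho0 e10.
have r0rho : r0 <= rho by rewrite ge_min lexx.
have r0e1 : r0 <= e1 by rewrite !ge_min lexx orbT.
have r0e2 : r0 <= e2 by rewrite !ge_min lexx !orbT.
have [tau1 [tau10 _ tw]] := small_step w (divr_gt0 r00 (ltr0Sn _ 1)) ltr01.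
have et0 : 0 < eta * tau1 by exact: mulr_gt0.
have cf : {for y0, continuous f} by exact: smooth_cont sf By0.
move/cvgrPdist_lt : (cf) => /(_ _ et0) H3.
have /nbhs_ballP[e3 /= e30 Hr] : nbhs y0 [set y | `|f y0 - f y| < eta * tau1] by exact: H3.
pose r := Num.min (r0 / 2) e3.
have r_gt0 : 0 < r by rewrite lt_min divr_gt0.
have rr0 : r <= r0 / 2 by rewrite ge_min lexx.
have re3 : r <= e3 by rewrite ge_min lexx orbT.
exists r, e1, ((B1 + eps * B2) / eta); split => //.
- exact: (divr_ge0 (addr_ge0 B10 (mulr_ge0 (ltW eps0) B20)) (ltW eta0)).
- lra.
move=> y t k By tt; set G := pos _.
have G0 : 0 <= G by rewrite le_max lexx.
have s_1 : `|s| = 1 by case: ss => ->; rewrite ?normrN normr1.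
have By3 : `|f y - c| < eta * tau1.
  have : ball y0 e3 y by exact: le_ball By.
  by move=> /Hr /=; rewrite fc distrC.
have Glt : G < eta * tau1.
  rewrite gt_max et0 /=; apply: le_lt_trans (ler_norm _) _; by rewrite normrM s_1 mul1r.
(* After parameter [g] along [- s w] the function [f] has moved by at least [G], so the endpoint is
   in [N], where the differentials agree. *)
pose g := G / eta; have g0 : 0 <= g by rewrite divr_ge0// ltW.
have gt : g < tau1 by rewrite ltr_pdivrMr// mulrC.
have Byr : ball y0 r0 y by apply: le_ball By; lra.
have By' : ball y0 r0 (y - (s * g) *: w).
  move: By; rewrite -!ball_normE /= => yr.
  have -> : y0 - (y - (s * g) *: w) = (y0 - y) + (s * g) *: w by rewrite opprB addrCA addrC.
  apply: le_lt_trans (ler_normD _ _) _; rewrite normrZ normrM (ger0_norm g0) s_1 mul1r.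
  have : g * `|w| <= tau1 * `|w| by rewrite ler_wpM2r// ltW.
  move: tw yr rr0; move: (`|y0 - y|) (g * _) (tau1 * _) => a b c'; lra.
have inr a : 0 <= a <= 1 -> ball y0 r0 (y + a *: (- ((s * g) *: w))).
  move=> a01; have -> : - ((s * g) *: w) = y - (s * g) *: w - y by rewrite addrAC subrr add0r.
  exact: ball_line.
have sub z : ball y0 r0 z -> ball y0 rho z by exact: le_ball.
pose E z : R := pd k (K i t) z - eps * pd k f z.
have dK z : ball y0 r0 z -> differentiable (pd k (K i t)) z.
  by move=> Bz; apply: (smooth_dif (smooth_D _ (@sK i t))); exact/Br/sub.
have df z : ball y0 r0 z -> differentiable (pd k f) z.
  by move=> Bz; apply: (smooth_dif (smooth_D _ sf)); exact/sub.
have dE z : ball y0 r0 z -> differentiable E z.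
  move=> Bz; apply: differentiableB; first exact: dK.
  by apply: differentiableM; [exact: differentiable_cst|exact: df].
have Ey' : E (y - (s * g) *: w) = 0.
  apply/eqP; rewrite subr_eq0; apply/eqP.
  have dfz z : ball y0 rho z -> differentiable f z by exact: smooth_dif.
  apply: (grd_N t _ (ball_open y0 rho) Br sf fh (sub _ By')).
  apply/(side _ (sub _ By')).
  have := slope dfz Dw ss g0 (sub _ Byr) (sub _ By').
  have -> : eta * g = G by rewrite /g mulrC divfK// gt_eqF.
  have : s * (f y - c) <= G by rewrite le_max lexx orbT.
  rewrite !mulrBr; move: (s * f _) (s * f _) (s * c) => a b c'; lra.
have DE z : ball y0 r0 z -> ball z0 e1 (z, (t, s1)) -> `|'D_w E z| <= B1 + eps * B2.
  move=> Bz B1z.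
  have -> : 'D_w E z = 'D_w (pd k (K i t)) z - eps * 'D_w (pd k f) z.
    by apply: derive_sub_scale; [exact: dK|exact: df].
  have -> : 'D_w (pd k (K i t)) z = F1 k (z, (t, s1)).
    have -> : pd k (K i t) = (fun z => 'D_(('e_k : 'rV[R]_m, 0) : 'rV[R]_m * (R * R)) (Ph i) (z, (t, s1))).
      by apply/funext => z'; exact: (D_slice (Ph i) z' (t, s1)).
    rewrite /F1; exact: (D_slice ('D_(('e_k : 'rV[R]_m, 0) : 'rV[R]_m * (R * R)) (Ph i)) z (t, s1) w).
  apply: le_trans (ler_normB _ _) _; apply: lerD; first exact: H1.
  rewrite normrM (gtr0_norm eps0); exact: (ler_wpM2l (ltW eps0) (H2 _ _ (le_ball r0e2 Bz))).
have [|a a01 ME] := @MVT_line R _ E y (- ((s * g) *: w)) 1 ler01.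
  by move=> a a01; apply: diff_derivable; apply: dE; exact: inr.
move: ME; rewrite scale1r Ey' sub0r mulr1.
have Bz := inr a a01; have dz := dE _ Bz.
have tz : ball z0 e1 (y + a *: (- ((s * g) *: w)), (t, s1)).
  split; first by apply: le_ball Bz.
  by split => /=; [rewrite -ball_normE /= distrC|exact: ballxx].
have := DE _ Bz tz; move: (y + a *: _) dz => z dz Dle.
have -> : 'D_(- ((s * g) *: w)) E z = - (s * g) * 'D_w E z.
  by rewrite -scaleNr; exact: (deriveZr (- (s * g)) w dz).
move=> /eqP; rewrite mulNr eqr_opp => /eqP; rewrite -/(E y) => ->.
rewrite normrM (normrM s g) s_1 mul1r (ger0_norm g0).
have -> : (B1 + eps * B2) / eta * G = g * (B1 + eps * B2) by rewrite /g [LHS]mulrAC -mulrA mulrC.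
by rewrite ler_wpM2l.
Qed.

Lemma orbit_cont t : {for t, continuous x}.
Proof. by case: sx => cx _; exact: cx. Qed.

Lemma orbit_near t S : nbhs (x t) S -> nbhs t (x @^-1` S).
Proof. exact: orbit_cont. Qed.

(** At a frontier point [N] is locally a sublevel set of [s * (f - c)]. Along the orbit this
    function has derivative at most [C] times its positive part, by [side_bound], so [barrier] keeps
    it nonpositive for times close to [t0], before and after. *)
Lemma orbit_open t0 : N (x t0) -> \forall t \near t0, N (x t).
Proof.
move=> Nx; have [Ni|nN] := pselect (N° (x t0)).
  have : nbhs t0 (x @^-1` N°) by apply: orbit_cont; apply: open_nbhs_nbhs; split; [exact: open_interior|].
  by apply: filterS => t; exact: interior_subset.
have [i [f [w [eta [rho [s [di eta0 rho0 Br [sf fh Dw ss side]]]]]]]] :=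
  side_structure Mc Mh tub sh nc h0 h1 Nx nN.
set y0 := phi i (x t0) in Br sf fh Dw side; set c := h (x t0) in side.
have By0 : ball y0 rho y0 by exact: ballxx.
have fc : f y0 = c by rewrite fh//= /y0 phiK.
have [r [tau [L [r_gt0 tau0 L0 rrho HB]]]] := side_bound t0 eta0 rho0 Br sf fh Dw ss side fc.
(* For a covector [e], the product of [e] with [P y] is the derivative of [f] along the Hamiltonian
   vector of [e]. *)
pose P y := (invmx (gJ omega J i y) *m J i y) *m (grd f y)^T.
have cP k : {for y0, continuous (fun y => P y k 0)}.
  suff sP' : msmooth (ball y0 rho) P by exact: smooth_cont (sP' k 0) By0.
  have oB : open (ball y0 rho) by exact: ball_open.
  apply: msmooth_mul => //; last by apply: msmooth_tr; exact: smooth_grd.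
  apply: msmooth_mul => //; last first.
    by apply: smooth_msmooth => //; case: ac => _ + _; move=> /(_ i); exact: smooth_sub.
  apply: msmooth_inv => //.
    by move=> y /Br ry; exact: c_Gunit (compat_at sy ac co ry).
  by move=> k' l; exact: smooth_sub Br (g_smooth sy ac i k' l).
pose b : R := \sum_k (`|P y0 k 0| + 1).
have b0 : 0 <= b by apply: sumr_ge0 => j _; rewrite addr_ge0.
have n1 : \forall y \near y0, forall k, `|P y k 0| <= `|P y0 k 0| + 1.
  by apply: (@near_all _ _ (fun k y => `|P y k 0| <= `|P y0 k 0| + 1) y0) => k; exact: near_bounded (cP k).
have n2 : nbhs y0 (ball y0 r) by exact: nbhsx_ballx.
have n3 : nbhs y0 ([set y | forall k, `|P y k 0| <= `|P y0 k 0| + 1] `&` ball y0 r) by exact: filterI.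
have n4 := near_chart di n3.
have /nbhs_ballP[d /= d0 Hd] := orbit_near n4.
pose C : R := L * b; have C0 : 0 <= C by exact: mulr_ge0.
pose T : R := Num.min (tau / 2) (Num.min (d / 2) (2 * (C + 1))^-1).
have C1 : 0 < 2 * (C + 1) by rewrite mulr_gt0// ltr_wpDl.
have T0 : 0 < T by rewrite !lt_min !divr_gt0//= invr_gt0.
have Ttau : T <= tau / 2 by rewrite ge_min lexx.
have Td : T <= d / 2 by rewrite !ge_min lexx orbT.
have TC : C * T < 1.
  have : C * T <= C * (2 * (C + 1))^-1 by rewrite ler_wpM2l// !ge_min lexx !orbT.
  move=> /le_lt_trans; apply; rewrite ltr_pdivrMr//; lra.
pose X := phi i \o x.
have near t : t0 - T <= t <= t0 + T -> [/\ dom i (x t), forall k, `|P (X t) k 0| <= `|P y0 k 0| + 1,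
    ball y0 r (X t) & `|t - t0| < tau].
  move=> /andP[t1 t2].
  have tt : `|t - t0| <= T by rewrite ler_distl t1 t2.
  have [|dx [Px Bx]] := Hd t.
    by rewrite -ball_normE /= distrC; apply: le_lt_trans tt _; apply: le_lt_trans Td _; lra.
  by split => //; apply: le_lt_trans tt _; apply: le_lt_trans Ttau _; lra.
have sub y : ball y0 r y -> ball y0 rho y by exact: le_ball.
pose g t : R := s * (f (X t) - c).
pose dg t : R := s * 'D_('D_1 X t) f (X t).
have bar := @barrier R g dg t0 T C (ltW T0) C0 TC.
have gN t : t0 - T <= t <= t0 + T -> g t <= 0.
  apply: bar; first by rewrite /g /X /= -/y0 fc subrr mulr0.
  move=> t' tt; have [dx Px Bx ttau] := near _ tt.
  have dfx : differentiable f (X t') by exact: smooth_dif sf (sub _ Bx).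
  split.
    have := der_sub (curve_comp (smap_dif sx dx) dfx) (is_derive_cst c t' (1 : R)).
    by rewrite subr0; exact: der_scale.
  rewrite /dg (D_grd _ dfx) normrM; have -> : `|s| = 1 by case: ss => ->; rewrite ?normrN normr1.
  rewrite mul1r (orbit_chart dx) -/(X t').
  have cm := compat_at sy ac co (rng_phi dx).
  set G := gJ _ _ _ _ in cm *; set Jy := J i _ in cm *.
  set e := grd (K i t') _; pose e' := e - eps *: grd f (X t').
  (* The multiple [eps d f] can be subtracted from the covector because [d f] vanishes on its own
     Hamiltonian vector; the remaining [e'] is what [side_bound] estimates. *)
  have -> : hamX Jy G e *m (grd f (X t'))^T = e' *m P (X t').
    rewrite /P -/G -/Jy mulmxA /e' !mulmxBl -!scalemxAl.
    have := hamX_d cm (grd f (X t')); rewrite /hamX -!mulmxA => ->.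
    by rewrite scaler0 subr0.
  rewrite mxE; apply: le_trans (ler_norm_sum _ _ _) _.
  apply: (@le_trans _ _ (\sum_k L * pos (g t') * (`|P y0 k 0| + 1))).
    apply: ler_sum => k _; rewrite normrM; apply: ler_pM => //.
    rewrite /e' /e !mxE; exact: HB.
  by rewrite -mulr_sumr /C -/b mulrAC.
have : \forall t \near t0, t0 - T <= t <= t0 + T.
  apply/nbhs_ballP; exists T => //= t; rewrite -ball_normE /= distrC ltr_distl => /andP[a1 a2].
  by rewrite !ltW.
apply: filterS => t tt; have [dx _ Bx _] := near _ tt.
rewrite -(phiK dx); apply/(side _ (sub _ Bx)); exact: gN.
Qed.

Lemma orbit_N t0 t : N (x t0) -> N (x t).
Proof.
move=> N0; pose T := [set t | N (x t)].
suff E : T = setT by have : setT t by []; rewrite -E.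
apply: R_clopen; first by exists t0.
- by rewrite openE => t1 /orbit_open.
- have -> : T = x @^-1` N by [].
  by apply: preimage_closed => // t1 _; exact: orbit_cont.
Qed.

Lemma orbit_chart_N i f U t : open U -> U `<=` rng i -> smooth U f ->
  (forall y, U y -> N (psi i y) -> f y = h (psi i y)) -> dom i (x t) -> U (phi i (x t)) -> N (x t) ->
  'D_1 (phi i \o x) t = eps *: hamX (J i (phi i (x t))) (gJ omega J i (phi i (x t))) (grd f (phi i (x t))).
Proof.
move=> oU Ur sf fh dx Ux Nx; rewrite orbit_chart//.
have -> : grd (K i t) (phi i (x t)) = eps *: grd f (phi i (x t)).
  by apply/rowP => k; rewrite !mxE; apply: (grd_N t _ oU Ur sf fh Ux); rewrite phiK.
by rewrite /hamX -!scalemxAl.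
Qed.

End Orbit.

Lemma hamX_msmooth i U f : open U -> U `<=` rng i -> smooth U f ->
  msmooth U (fun y => hamX (J i y) (gJ omega J i y) (grd f y)).
Proof.
move=> oU Ur sf; apply: msmooth_mul => //; last first.
  by apply: smooth_msmooth => //; case: ac => _ + _; move=> /(_ i); exact: smooth_sub.
apply: msmooth_mul => //; first exact: smooth_grd.
apply: msmooth_inv => //.
  by move=> y /Ur ry; exact: c_Gunit (compat_at sy ac co ry).
by move=> k' l; exact: smooth_sub Ur (g_smooth sy ac i k' l).
Qed.

(* Inside N the orbit moves along eps X_h, which has a nonzero coordinate: for small eps it
   stays in the chart for a unit time and that coordinate is strictly monotone. *)
Lemma no_orbit_near p : N p -> \forall p' \near p & e \near (0 : R)^'+,
  N p' -> forall (s1 : R) H (beta : R -> R -> R) x, homotopy A H ->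
  (forall x t s, N x -> H x t s = e * h x + beta s t) ->
  periodic_orbit omega (fun p t => H p t s1) x -> x 0 <> p'.
Proof.
move=> Np.
have [i [f [w [eta [rho [di eta0 rho0 Br [sf fh Dw gf]]]]]]] := extension_chart sh nc Np.
set y0 := phi i p in Br sf fh Dw gf.
have By0 : ball y0 rho y0 by exact: ballxx.
have oB : open (ball y0 rho) by exact: ball_open.
pose F y := hamX (J i y) (gJ omega J i y) (grd f y).
have sF : msmooth (ball y0 rho) F by exact: hamX_msmooth.
have cF k : {for y0, continuous (fun y => F y 0 k)} by exact: smooth_cont (sF 0 k) By0.
have cm := compat_at sy ac co (Br _ By0).
(* By nondegeneracy a vanishing Hamiltonian vector would force the differential of [f] to vanish at
   [y0]. *)
have [k Fk] : exists k, F y0 0 k != 0.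
  apply: contrapT => Hn; move/eqP: (gf _ By0); apply.
  have F0 : F y0 = 0.
    apply/rowP => k; rewrite [RHS]mxE; apply/eqP; apply: contrapT => /negP nk.
    by apply: Hn; exists k.
  have := hamXO cm (grd f y0); rewrite -/(F y0) F0 mul0mx => /eqP.
  by rewrite eq_sym oppr_eq0 => /eqP.
have n1 : \forall y \near y0, F y 0 k != 0.
  by apply: (cF k [set r : R | r != 0]); apply: open_nbhs_nbhs; split; [exact: open_neq|].
have n2 := near_all (fun k => near_bounded (cF k)).
pose B : R := \sum_k (`|F y0 0 k| + 1).
have B0 : 0 <= B by apply: sumr_ge0 => j _; rewrite addr_ge0.
have /nbhs_ballP[r1 /= r10 Hr] : nbhs y0 [set y | F y 0 k != 0 /\ forall k, `|F y 0 k| <= `|F y0 0 k| + 1].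
  by apply: filterS2 n1 n2.
pose r : R := Num.min r1 rho; have r0 : 0 < r by rewrite lt_min r10.
have rr1 : r <= r1 by rewrite ge_min lexx.
have rrho : r <= rho by rewrite ge_min lexx orbT.
have Fne y : ball y0 r y -> F y 0 k != 0.
  by move=> By; have [] := Hr y (le_ball rr1 By).
have FB y j : ball y0 r y -> `|F y 0 j| <= B.
  move=> By; have [_ /(_ j)/le_trans] := Hr y (le_ball rr1 By); apply.
  by rewrite /B (bigD1 j)//= lerDl; apply: sumr_ge0 => l _; rewrite addr_ge0.
have nW : nbhs p [set q | dom i q /\ `|phi i q - y0| < r / 3].
  apply: open_nbhs_nbhs; split; first exact: chart_ball_open.
  by split => //; rewrite subrr normr0 divr_gt0.
(* The speed is at most [e * B] in each coordinate, so an orbit that starts within [r / 3] stays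
   within [2 r / 3] for a unit of time. *)
have ne : \forall e \near (0 : R)^'+, 0 < e /\ e * B < r / 3.
  near=> e; split; first by near: e; exact: nbhs_right_gt.
  apply: (@le_lt_trans _ _ (e * (B + 1))); first by rewrite ler_wpM2l ?lerDl//; near: e; exact: nbhs_right_ge.
  rewrite -ltr_pdivlMr ?ltr_wpDl//; near: e; apply: nbhs_right_lt.
  by rewrite !divr_gt0 ?ltr_wpDl.
exists ([set q | dom i q /\ `|phi i q - y0| < r / 3], [set e | 0 < e /\ e * B < r / 3]); first by split.
move=> [p' e] [/= [dp' Bp'] [e0 eB]] Np' s1 H beta x hH HN ox x0.
have Nx t : N (x t) by apply: (orbit_N e0 hH HN ox (t0 := 0)); rewrite x0.
have sx : smooth_map A [set: R] x by case: ox.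
pose X := phi i \o x.
have sB y : ball y0 r y -> ball y0 rho y by exact: le_ball.
have in_ball t : dom i (x t) -> `|X t - y0| < r -> ball y0 r (X t).
  by move=> _; rewrite -ball_normE /= distrC.
have DX t : dom i (x t) -> `|X t - y0| < r -> 'D_1 X t = e *: F (X t).
  move=> dx Bx; exact: (orbit_chart_N hH HN ox oB Br sf fh dx (sB _ (in_ball _ dx Bx)) (Nx t)).
have entry t j : dom i (x t) -> `|X t - y0| < r -> is_derive t 1 (fun t => X t 0 j) (e * F (X t) 0 j).
  move=> dx Bx; have dX := smap_dif sx dx.
  have -> : e * F (X t) 0 j = 'D_1 (fun t => X t 0 j) t.
    by have := D_entry (1 : R) dX j; rewrite -/X DX// mxE.
  by apply: DeriveDef => //; apply: diff_derivable; exact: dif_entry dX j.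
have stay01 c : 0 <= c <= 1 -> dom i (x c) /\ `|X c - y0| < 2 * (r / 3).
  move=> c01; pose U := [set q | dom i q /\ `|phi i q - y0| < 2 * (r / 3)].
  pose C := [set q | dom i q /\ `|phi i q - y0| <= 2 * (r / 3)].
  apply: (@stay R M x U C 0 1 _ _ _ _ ler01 _ _ c c01).
  - by move=> t _; case: sx => cx _; exact: cx.
  - exact: chart_ball_open.
  - apply: (@chart_cball_closed R m M A Mh i y0 _ r); first lra.
    by move=> y /sB; exact: Br.
  - by move=> q [dq Bq]; split => //; exact: ltW.
  - split; [rewrite x0//|rewrite x0]; lra.
  move=> d /andP[d0 d1] HC.
  have inr t : 0 <= t <= d -> dom i (x t) /\ `|X t - y0| < r.
    by move=> td; have [dx Bx] := HC t td; split => //; apply: le_lt_trans Bx _; lra.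
  have dd : 0 <= d <= d by rewrite d0 lexx.
  have [dxd Bxd] := inr d dd; split => //.
  have : `|X d - X 0| <= e * B.
    rewrite [leLHS]mx_normrE; apply/bigmax_leP; split; first by rewrite mulr_ge0// ltW.
    move=> [a b] _ /=; rewrite ord1 !mxE.
    have [|z zd ->] := @MVT_all R (fun t => X t 0 b) (fun t => e * F (X t) 0 b) 0 d d0.
      by move=> z /inr[dz Bz]; exact: entry.
    have [dz Bz] := inr z zd.
    rewrite subr0 !normrM (gtr0_norm e0) (ger0_norm d0) -mulrA ler_wpM2l ?(ltW e0)//.
    rewrite -[leRHS]mulr1; apply: ler_pM => //; exact/FB/in_ball.
  have := ler_distD (X 0) (X d) y0.
  have : `|X 0 - y0| < r / 3 by rewrite /X /= x0.
  rewrite -/(X d); move: (`|X 0 - y0|) (`|X d - y0|) (`|X d - X 0|) => a b c'; lra.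
have inr t : 0 <= t <= 1 -> dom i (x t) /\ `|X t - y0| < r.
  by move=> /stay01[dx Bx]; split => //; apply: lt_trans Bx _; lra.
have [|z z01 E] := @MVT_all R (fun t => X t 0 k) (fun t => e * F (X t) 0 k) 0 1 ler01.
  by move=> z /inr[dz Bz]; exact: entry.
have per : X 1 = X 0 by case: ox => _ + _; move=> /(_ 0); rewrite add0r /X /= => ->.
have [dz Bz] := inr z z01.
move: E; rewrite per subrr subr0 mulr1 => /esym/eqP; rewrite mulf_eq0 gt_eqF//=.
by apply/negP; exact/Fne/in_ball.
Unshelve. all: by end_near.
Qed.

(** Compactness of [N] along the filter of small positive [eps] makes the local exclusion uniform.
    An orbit that meets [N] at some time is in [N] at time 0 by [orbit_N], so excluding starting
    points suffices. *)
Lemma no_orbit : exists2 e1 : R, 0 < e1 & forall (e s1 : R) H (beta : R -> R -> R) x, 0 < e < e1 -> homotopy A H ->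
  (forall x t s, N x -> H x t s = e * h x + beta s t) ->
  periodic_orbit omega (fun p t => H p t s1) x -> forall t, ~ N (x t).
Proof.
have cN' : compact N by exact: (N_compact Mc tub).
have /compact_near_coveringP cov := cN'.
have FF : Filter (0 : R)^'+ by exact: _.
have := cov R (0 : R)^'+ (fun e p' => N p' -> forall (s1 : R) H (beta : R -> R -> R) x, homotopy A H ->
  (forall x t s, N x -> H x t s = e * h x + beta s t) ->
  periodic_orbit omega (fun p t => H p t s1) x -> x 0 <> p') FF no_orbit_near.
move=> /nbhs_ballP[e1 /= e10 He].
exists (e1 : R) => // e s1 H beta x /andP[e0 ee] hH HN ox t Nx.
have N0 := orbit_N e0 hH HN ox 0 Nx.
by apply: (He e _ e0 _ N0 N0 s1 H beta x hH HN ox erefl); rewrite -ball_normE /= sub0r normrN gtr0_norm.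
Qed.

End Orbits.

(** * Ends of a trajectory *)

Section Ends.
Context {R : realType} {m : nat} {M : topologicalType} (A : smooth_atlas R m M).
Notation phi := (@phi R m M A).
Notation psi := (@psi R m M A).
Context (H : M -> R -> R -> R).
Hypothesis hH : homotopy A H.

Lemma homotopy_const x t (a b s : R) : a <= s <= b -> (forall s', a <= s' <= b -> derive1 (H x t) s' = 0) ->
  H x t a = H x t s.
Proof.
move=> /andP[as_ sb] D0; have [_ sP _] := hH.
have [i dx] := dom_cover A x.
pose Ph (z : 'rV[R]_m * (R * R)) : R := H (psi i z.1) z.2.1 z.2.2.
have dH s' : derivable (H x t) s' 1.
  apply: diff_derivable.
  have -> : H x t = Ph \o (fun s' : R => (phi i x, (t, s'))).
    by apply/funext => s''; rewrite /Ph /= phiK.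
  have dP : differentiable Ph (phi i x, (t, s')) by apply: (smooth_dif (sP i)); exact: rng_phi.
  apply: differentiable_comp; last exact: dP.
  apply: differentiable_pair; first exact: differentiable_cst.
  by apply: differentiable_pair; [exact: differentiable_cst|exact: ex_diff].
have [|z zz] := @MVT_all R (H x t) (fun=> 0) a s as_.
  move=> z /andP[az zs]; apply: DeriveDef => //; rewrite -derive1E; apply: D0.
  by rewrite az (le_trans zs sb).
by rewrite mul0r => /eqP; rewrite subr_eq0 => /eqP.
Qed.

(** Both ends are values of [H] at finite times, so the form [eps h + beta] on [N] is inherited
    without passing to a limit. *)
Lemma homotopy_ends : exists s1 s2 : R, Hminus H = (fun x t => H x t s1) /\ Hplus H = (fun x t => H x t s2).
Proof.
have [_ _ [R0 R00 HR]] := hH; exists (- (R0 + 1)), (R0 + 1); split.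
  apply/funext => x; apply/funext => t; apply: cvg_lim => //; apply: cvg_near_cst.
  near=> s; have sR : s < - (R0 + 1) by near: s; apply: nbhs_ninfty_lt; exact: num_real.
  apply: (@homotopy_const x t s (- (R0 + 1))); first by rewrite (ltW sR) lexx.
  move=> s' /andP[_ s1]; apply: HR; rewrite ltr0_norm; lra.
apply/funext => x; apply/funext => t; apply: cvg_lim => //; apply: cvg_near_cst.
near=> s; have sR : R0 + 1 < s by near: s; apply: nbhs_pinfty_gt; exact: num_real.
apply/esym; apply: (@homotopy_const x t (R0 + 1) s); first by rewrite (ltW sR) lexx.
move=> s' /andP[s1 _]; apply: HR; rewrite gtr0_norm; lra.
Unshelve. all: by end_near.
Qed.

(** Away from [N] the manifold is the disjoint union of the open sets [V] and the complement of
    [Vhat], and the line is connected. *)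
Lemma orbit_side (Mc : compact [set: M]) (Mh : hausdorff_space M) V N (x : R -> M) : open V ->
  tubular_neighborhood A V N ->
  continuous x -> (forall t, ~ N (x t)) -> (forall t, V (x t)) \/ (forall t, (~` (closure V `|` N)) (x t)).
Proof.
move=> oV tub cx nN; pose T := x @^-1` V.
have oT : open T by apply: open_comp => // t _; exact: cx.
have TC : ~` T = x @^-1` (~` Vhat V N).
  apply/seteqP; split => t /=.
    by move=> nV /(Vhat_split tub)[//|]; exact: nN.
  by move=> nV Vt; apply: nV; left; exact: subset_closure.
have cT : closed T.
  rewrite -[T]setCK closedC TC; apply: open_comp; first by move=> t _; exact: cx.
  by rewrite openC; exact: (Vhat_closed Mc Mh tub).
have [[t0 Tt0]|T0] := pselect (T !=set0).
  left => t; have : setT t by []; by rewrite -(R_clopen (ex_intro _ t0 Tt0) oT cT).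
right => t; have : (~` T) t by move=> Tt; apply: T0; exists t.
by rewrite TC.
Qed.

Lemma limit_side (F : set_system R) (FF : ProperFilter F) (u : R * R -> M) (x : R -> M) (O : set M) :
  {compact-open, (fun s t => u (s, t)) @ F --> x} -> open O -> (forall t, O (x t)) ->
  \forall s \near F, forall t, 0 <= t <= 1 -> O (u (s, t)).
Proof.
move=> cv oO Ox.
have /compact_open_cvgP : {compact-open, (fun s t => u (s, t)) @ F --> x} := cv.
move=> /(_ _ O (@segment_compact R 0 1) oO) H1.
have : [set x t | t in `[0, 1]] `<=` O by move=> _ [t _ <-].
move=> /H1 H2; have H3 : \forall s \near F, [set u (s, t) | t in `[0, 1]] `<=` O by exact: H2.
by apply: (filterS _ H3) => s Hs t t01; apply: Hs; exists t => //; rewrite /= in_itv.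
Qed.

End Ends.

(** Neither [omega], [J] nor [V] occurs: [core] and [good] involve [N], [h] and the metric, and
    [chart_const] speaks of all chart data. A value selected by this property is thus a function of
    [N], the metric and [h]. *)
Definition gap_constant (R : realType) (m : nat) (M : topologicalType) (A : smooth_atlas R m M)
    (N : set M) (g : tensor A) (h : M -> R) (c : R) : Prop :=
  exists kap k : R, [/\ 1 <= kap, 1 <= k, @chart_const R m kap k,
    forall p, core N h p -> good N h g kap p & c = energy_gap kap k].

Theorem theorem2 (R : realType) (n : nat) (M : topologicalType)
    (A : smooth_atlas R n.*2 M)
    (M_compact : compact [set: M]) (M_hausdorff : hausdorff_space M) :
  exists C : set M -> tensor A -> (M -> R) -> R,
  forall (omega J : tensor A),
    symplectic_form omega -> almost_complex J -> compatible omega J ->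
    regular J ->
  forall (V N : set M) (h : M -> R),
    open V -> smooth_boundary A V -> tubular_neighborhood A V N ->
    smooth_on_subset (smooth_fun A) N h -> no_critical_points_on A N h ->
    (forall x, bdry V x -> h x = 0) ->
    (forall x, bdry (closure V `|` N) x -> h x = 1) ->
  0 < C N (gJ omega J) h /\
  exists2 eps0 : R, 0 < eps0 &
  forall (eps : R) (H : M -> R -> R -> R),
    0 < eps < eps0 ->
    homotopy A H ->
    (exists2 beta : R -> R -> R,
       (forall s t, beta s (t + 1) = beta s t) &
       forall x t s, N x -> H x t s = eps * h x + beta s t) ->
  forall (u : R * R -> M) (xm xp : R -> M),
    floer_trajectory omega J H u xm xp ->
    (exists z, V (u z)) ->
    (exists z, (~` (closure V `|` N)) (u z)) ->
    ((forall t, (~` (closure V `|` N)) (xm t)) /\ (forall t, V (xp t)))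
    \/ ((C N (gJ omega J) h)%:E <= energy omega J u)%E.
Proof.
(* Any value with the property will do; existence, shown below for each admissible [omega] and [J],
   keeps the default 1 from being selected. *)
exists (fun N g h => xget 1 (gap_constant N g h)).
move=> omega J sy ac co _ V N h oV _ tub sh nc h0 h1.
have [kap0 kap01 gk0] := good_unif sy ac co sh nc (core_compact M_compact M_hausdorff tub sh)
  (core_int M_compact M_hausdorff oV tub sh h0 h1).
have [k0 k01 kE0] := @chart_bounds R n.*2 kap0 kap01.
have : gap_constant N (gJ omega J) h (energy_gap kap0 k0) by exists kap0, k0.
move=> /(xgetI 1); set C := xget 1 _ => -[kap [k [kap1 k1 kE gk CE]]].
split; first by rewrite CE; exact: energy_gap_gt0.
have [e1 e10 no] := no_orbit M_compact M_hausdorff tub sh nc h0 h1 sy ac co.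
(* [e1] excludes orbits through [N], [dl1] serves the drift of the mean and [rT] the crossing
   estimate. *)
exists (Num.min e1 (Num.min (dl1 kap k) (rT kap k))).
  by rewrite lt_min e10 lt_min (dl1_gt0 kap1 k1) (rT_gt0 kap1 k1).
move=> eps H /andP[eps0]; rewrite lt_min => /andP[ee1]; rewrite lt_min => /andP[edl erT] hH [beta _ HN].
move=> u xm xp [[su per] fl _ [om op] [lm lp]] [[sV tV] uV] [[sW tW] uW].
have [le|ltC] := leP C%:E (energy omega J u); [by right|left].
(* The estimates of the trajectory take a real upper bound of the energy; the case of the value
   [-oo] is answered by a real number below [C]. *)
have [E HE EC] : exists2 E : R, (energy omega J u <= E%:E)%E & E < energy_gap kap k.
  rewrite -CE; case: (energy omega J u) ltC => [r| |].
  - by rewrite lte_fin => rC; exists r.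
  - by [].
  - by move=> _; exists (C - 1); rewrite ?leNye// ltrBlDr ltrDl.
have [s1 [s2 [Em Ep]]] := homotopy_ends hH.
rewrite Em in om; rewrite Ep in op.
have e_lt : 0 < eps < e1 by rewrite eps0.
have nm := no eps s1 H beta xm e_lt hH HN om.
have np := no eps s2 H beta xp e_lt hH HN op.
have cm : continuous xm by case: om => -[cx _] _ _ t; exact: cx.
have cp : continuous xp by case: op => -[cx _] _ _ t; exact: cx.
have oW : open (~` Vhat V N) by rewrite openC; exact: (Vhat_closed M_compact M_hausdorff tub).
split.
  have [xV|//] := orbit_side M_compact M_hausdorff oV tub cm nm.
  have [S [_ HS]] := limit_side _ lm oV xV.
  (* The slice at [a] lies entirely in [V] and does not come after the slice that meets the
     complement of [Vhat], as [no_exit] requires. *)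
  exfalso; pose a := Num.min sW (S - 1).
  have aS : a < S by rewrite gt_min ltrBlDr ltrDl ltr01 orbT.
  have aW : a <= sW by rewrite ge_min lexx.
  exact: (no_exit M_compact M_hausdorff sy ac co oV tub sh nc h0 h1 HN su per fl kap1 k1 kE gk
    eps0 edl (ltW erT) HE EC aW (HS a aS) uW).
have [//|xW] := orbit_side M_compact M_hausdorff oV tub cp np.
have [S [_ HS]] := limit_side _ lp oW xW.
exfalso; pose a := Num.max sV (S + 1).
have aS : S < a by rewrite lt_max ltrDl ltr01 orbT.
have aV : sV <= a by rewrite le_max lexx.
exact: (no_entry M_compact M_hausdorff sy ac co oV tub sh nc h0 h1 HN su per fl kap1 k1 kE gk
  eps0 edl (ltW erT) HE EC aV (HS a aS) uV).
Qed.
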